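(* Let $K$ be a field. Let $L_K:\mathcal{G}^w\to\mathcal{A}_K$ be the weighted Leavitt path algebra functor, $V:\mathcal{A}_K\to\mathcal{M}^{ab}$ the $V$-monoid functor, and $M:\mathcal{G}^w\to\mathcal{M}^{ab}$ the functor defined by generators and relations in the context. Then the functors $V\circ L_K$ and $M$ are naturally isomorphic: $V\circ L_K\cong M$. Moreover, if $(E,w)$ is a finite weighted graph, then the ring $L_K(E,w)$ is left and right hereditary.
   Context: $\mathbb{N}$ denotes the positive integers. Directed graphs: a directed graph is a quadruple $E=(E^0,E^1,s,r)$ with sets $E^0$ (vertices), $E^1$ (edges) and maps $s,r:E^1\to E^0$ (source, range). It is row-finite if $s^{-1}(v)$ is finite for every $v\in E^0$, and finite if $E^0$ and $E^1$ are finite. Weighted graphs: a weighted graph $(E,w)$ is a directed graph $E$ with a map $w:E^1\to\mathbb{N}$; it is called finite if $E$ is finite. All weighted graphs are assumed row-finite. For $v\in E^0$ put $w(v):=\max\{w(e)\mid e\in s^{-1}(v)\}$, with $\max\emptyset=0$. Category $\mathcal{G}^w$: objects are all (row-finite) weighted graphs; morphisms are complete weighted graph homomorphisms, i.e. pairs $\phi=(\phi^0,\phi^1):(E,w)\to(E',w')$ of injective maps $\phi^0:E^0\to E'^0$, $\phi^1:E^1\to E'^1$ with $s'(\phi^1(e))=\phi^0(s(e))$, $r'(\phi^1(e))=\phi^0(r(e))$, $w'(\phi^1(e))=w(e)$ for all $e\in E^1$, such that for every $v\in E^0$ with $s^{-1}(v)\neq\emptyset$, $\phi^1$ restricts to a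 bijection $s^{-1}(v)\to s'^{-1}(\phi^0(v))$. $\mathcal{A}_K$ is the category of associative (not necessarily unital) $K$-algebras with $K$-algebra homomorphisms; $\mathcal{M}^{ab}$ is the category of abelian monoids. Functor $L_K$: the weighted Leavitt path algebra $L_K(E,w)$ is the associative $K$-algebra presented by generators $E^0\cup\{e_i,e_i^*\mid e\in E^1,1\le i\le w(e)\}$ and relations (i) $uv=\delta_{uv}u$ for $u,v\in E^0$; (ii) $s(e)e_i=e_i=e_ir(e)$ and $r(e)e_i^*=e_i^*=e_i^*s(e)$ for $e\in E^1$, $1\le i\le w(e)$; (iii) $\sum_{e\in s^{-1}(v)}e_ie_j^*=\delta_{ij}v$ for $v\in E^0$, $1\le i,j\le w(v)$; (iv) $\sum_{1\le i\le w(v)}e_i^*f_i=\delta_{ef}r(e)$ for $v\in E^0$, $e,f\in s^{-1}(v)$; where in (iii), (iv) one sets $e_i=e_i^*=0$ whenever $i>w(e)$. On morphisms, $L_K(\phi)$ is the unique $K$-algebra homomorphism with $v\mapsto\phi^0(v)$, $e_i\mapsto(\phi^1(e))_i$, $e_i^*\mapsto(\phi^1(e))_i^*$. Functor $V$: for an associative $K$-algebra $A$, let $\mathbb{M}_\infty(A)$ be the directed union of the matrix rings $\mathbb{M}_n(A)$, $n\in\mathbb{N}$, along $x\mapsto\begin{pmatrix}x&0\\0&0\end{pmatrix}$. For idempotents $e,f\in\mathbb{M}_\infty(A)$ write $e\sim f$ iff there are $x,y\in\mathbb{M}_\infty(A)$ with $e=xy$, $f=yx$. $V(A)$ is the set of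 $\sim$-classes of idempotents, with addition $[e]+[f]=\left[\begin{pmatrix}e&0\\0&f\end{pmatrix}\right]$. $V$ acts on algebra homomorphisms by applying them entrywise. (For unital $A$, $V(A)$ is isomorphic to the monoid of isomorphism classes of finitely generated projective right $A$-modules under $\oplus$.) Functor $M$: for a weighted graph $(E,w)$ and $v\in E^0$ write $w(s^{-1}(v))=\{w_1(v),\dots,w_{k_v}(v)\}$ with $k_v\ge 0$ and $w_1(v)<\dots<w_{k_v}(v)$ (so $k_v$ is the number of different weights of edges in $s^{-1}(v)$), and $w_0(v):=0$. $M(E,w)$ is the abelian monoid presented by generators $\{v,q_1^v,\dots,q_{k_v-1}^v\mid v\in E^0\}$ and relations $$q^v_{i-1}+(w_i(v)-w_{i-1}(v))v=q_i^v+\sum_{e\in s^{-1}(v),\,w(e)=w_i(v)}r(e)\qquad(v\in E^0,\ 1\le i\le k_v),$$ where $q_0^v=q_{k_v}^v=0$. On morphisms, $M(\phi)$ is the unique monoid homomorphism with $[v]\mapsto[\phi^0(v)]$ and $[q_i^v]\mapsto[q_i^{\phi^0(v)}]$ for $v\in E^0$, $1\le i\le k_v-1$. *)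

(* Defs.v *)
From HB Require Import structures.
From mathcomp Require Import all_boot all_order all_algebra finmap.
From mathcomp Require Import all_classical.

Set Implicit Arguments.
Unset Strict Implicit.
Unset Printing Implicit Defensive.

Import GRing.Theory.
Local Open Scope classical_set_scope.
Local Open Scope ring_scope.
Local Open Scope quotient_scope.

Record category := Category {
  ob :> Type;
  hom : ob -> ob -> Type;
  idc : forall X, hom X X;
  compc : forall X Y Z, hom Y Z -> hom X Y -> hom X Z;
  compc1 : forall X Y (f : hom X Y), compc f (idc X) = f;
  comp1c : forall X Y (f : hom X Y), compc (idc Y) f = f;
  compcA : forall X Y Z T (h : hom Z T) (g : hom Y Z) (f : hom X Y),
    compc h (compc g f) = compc (compc h g) f }.
Arguments hom {c} _ _.
Arguments idc {c} _.
Arguments compc {c X Y Z} _ _.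

Record functor (C D : category) := Functor {
  fob :> C -> D;
  fmor : forall X Y, hom X Y -> hom (fob X) (fob Y);
  fmor1 : forall X, fmor (idc X) = idc (fob X);
  fmorM : forall X Y Z (g : hom Y Z) (f : hom X Y),
    fmor (compc g f) = compc (fmor g) (fmor f) }.
Arguments fmor {C D} _ {X Y} _.

Section CompFunctor.
Variables (C D D' : category) (G : functor D D') (F : functor C D).
Lemma comp_functor1 X : fmor G (fmor F (idc X)) = idc (G (F X)).
Proof. by rewrite !fmor1. Qed.
Lemma comp_functorM X Y Z (g : hom Y Z) (f : hom X Y) :
  fmor G (fmor F (compc g f)) =
  compc (fmor G (fmor F g)) (fmor G (fmor F f)).
Proof. by rewrite !fmorM. Qed.
Definition comp_functor : functor C D' :=
  @Functor C D' (fun X => G (F X)) (fun X Y f => fmor G (fmor F f))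
    comp_functor1 comp_functorM.
End CompFunctor.

Definition isomorphism (C : category) (X Y : C) (f : hom X Y) : Prop :=
  exists g : hom Y X, compc g f = idc X /\ compc f g = idc Y.

Definition nat_isomorphic (C D : category) (F G : functor C D) : Prop :=
  exists eta : forall X : C, hom (F X) (G X),
    (forall X, isomorphism (eta X)) /\
    (forall X Y (f : hom X Y),
       compc (fmor G f) (eta X) = compc (eta Y) (fmor F f)).

Lemma additive_ext (U V : nmodType) (f g : {additive U -> V}) :
  f =1 g -> f = g.
Proof.
case: f g => [f [[f1]]] [g [[g1]]] /= /funext fg.
by case: _ / fg in g1 *; rewrite (Prop_irrelevance f1 g1).
Qed.

Lemma linear_ext (K : pzRingType) (U V : lmodType K) (f g : {linear U -> V}) :
  f =1 g -> f = g.
Proof.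
case: f g => [f [[f1] [f2]]] [g [[g1] [g2]]] /= /funext fg.
case: _ / fg in g1 g2 *.
by rewrite (Prop_irrelevance f1 g1) (Prop_irrelevance f2 g2).
Qed.

Definition id_add (U : nmodType) : {additive U -> U} := idfun.
Definition comp_add (U V W : nmodType) (g : {additive V -> W})
  (f : {additive U -> V}) : {additive U -> W} := g \o f.

Definition AbMon : category.
Proof.
refine (@Category nmodType (fun U V => {additive U -> V}) id_add comp_add
  _ _ _).
- by move=> U V f; apply: additive_ext.
- by move=> U V f; apply: additive_ext.
- by move=> U V W T h g f; apply: additive_ext.
Defined.

HB.mixin Record Lmodule_isNUAlgebra (K : comPzRingType) A
    of GRing.Lmodule K A := {
  nmul : A -> A -> A;
  nmulA : associative nmul;
  nmulDl : left_distributive nmul +%R;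
  nmulDr : right_distributive nmul +%R;
  nmulZl : forall (a : K) x y, nmul (a *: x) y = a *: nmul x y;
  nmulZr : forall (a : K) x y, nmul x (a *: y) = a *: nmul x y
}.
#[short(type="nuAlgType")]
HB.structure Definition NUAlgebra (K : comPzRingType) :=
  {A of Lmodule_isNUAlgebra K A & GRing.Lmodule K A}.

Notation "x ** y" := (nmul x y) (at level 40, left associativity) : ring_scope.

Section NUAlgebraTheory.
Variables (K : comPzRingType) (A : nuAlgType K).
Implicit Types x y : A.

Lemma nmul0l x : 0 ** x = 0.
Proof. by apply: (addIr (0 ** x)); rewrite -nmulDl !add0r. Qed.
Lemma nmul0r x : x ** 0 = 0.
Proof. by apply: (addIr (x ** 0)); rewrite -nmulDr !add0r. Qed.
Lemma nmul_suml I (r : seq I) (P : pred I) (F : I -> A) y :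
  (\sum_(i <- r | P i) F i) ** y = \sum_(i <- r | P i) (F i ** y).
Proof.
by apply: (big_morph (fun x => x ** y)) => [? ?|]; rewrite ?nmulDl ?nmul0l.
Qed.
Lemma nmul_sumr I (r : seq I) (P : pred I) (F : I -> A) y :
  y ** (\sum_(i <- r | P i) F i) = \sum_(i <- r | P i) (y ** F i).
Proof.
by apply: (big_morph (fun x => y ** x)) => [? ?|]; rewrite ?nmulDr ?nmul0r.
Qed.
End NUAlgebraTheory.

Record nuHom (K : comPzRingType) (A B : nuAlgType K) := NUHom {
  nuhom :> {linear A -> B};
  nuhomM : {morph nuhom : x y / x ** y} }.

Lemma nuHom_ext (K : comPzRingType) (A B : nuAlgType K) (f g : nuHom A B) :
  f =1 g -> f = g.
Proof.
case: f g => [f f1] [g g1] /= /linear_ext fg.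
by case: _ / fg in g1 *; rewrite (Prop_irrelevance f1 g1).
Qed.

Section NUCategory.
Variable K : comPzRingType.
Definition id_lin (A : lmodType K) : {linear A -> A} := idfun.
Definition comp_lin (A B C : lmodType K) (g : {linear B -> C})
  (f : {linear A -> B}) : {linear A -> C} := g \o f.
Definition id_nu (A : nuAlgType K) : nuHom A A :=
  @NUHom K A A (id_lin A) (fun _ _ => erefl).
Lemma comp_nuM (A B C : nuAlgType K) (g : nuHom B C) (f : nuHom A B) :
  {morph comp_lin g f : x y / x ** y}.
Proof. by move=> x y; rewrite /= !nuhomM. Qed.
Definition comp_nu (A B C : nuAlgType K) (g : nuHom B C) (f : nuHom A B) :
  nuHom A C := NUHom (comp_nuM g f).

Definition NUAlg : category.
Proof.
refine (@Category (nuAlgType K) (@nuHom K) id_nu comp_nu _ _ _).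
- by move=> A B f; apply: nuHom_ext.
- by move=> A B f; apply: nuHom_ext.
- by move=> A B C D h g f; apply: nuHom_ext.
Defined.
End NUCategory.

Inductive monTerm (X : Type) :=
  | MGen of X
  | MZero
  | MAdd of monTerm X & monTerm X.
Arguments MZero {X}.
HB.instance Definition _ X := gen_eqMixin (monTerm X).
HB.instance Definition _ X := gen_choiceMixin (monTerm X).

Inductive monCongr (X : Type) (r : monTerm X -> monTerm X -> Prop) :
    monTerm X -> monTerm X -> Prop :=
  | MC_rel t u of r t u : monCongr r t u
  | MC_refl t : monCongr r t t
  | MC_sym t u of monCongr r t u : monCongr r u t
  | MC_trans t u v of monCongr r t u & monCongr r u v : monCongr r t v
  | MC_add t t' u u' of monCongr r t t' & monCongr r u u' :
      monCongr r (MAdd t u) (MAdd t' u')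
  | MC_addA t u v : monCongr r (MAdd t (MAdd u v)) (MAdd (MAdd t u) v)
  | MC_addC t u : monCongr r (MAdd t u) (MAdd u t)
  | MC_add0 t : monCongr r (MAdd MZero t) t.

Section PresentedMonoid.
Variables (X : Type) (r : monTerm X -> monTerm X -> Prop).

Definition monCongrb (t u : monTerm X) : bool := `[< monCongr r t u >].
Lemma monCongrb_refl : reflexive monCongrb.
Proof. by move=> t; apply/asboolP; apply: MC_refl. Qed.
Lemma monCongrb_sym : ssrbool.symmetric monCongrb.
Proof. by move=> t u; apply: asbool_equiv_eq; split; apply: MC_sym. Qed.
Lemma monCongrb_trans : ssrbool.transitive monCongrb.
Proof.
by move=> u t v /asboolP tu /asboolP uv; apply/asboolP; apply: MC_trans uv.
Qed.
Canonical monCongr_equiv :=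
  EquivRel monCongrb monCongrb_refl monCongrb_sym monCongrb_trans.

Definition presMon := {eq_quot monCongr_equiv}.
HB.instance Definition _ := Choice.on presMon.

Definition monpi (t : monTerm X) : presMon := \pi_({eq_quot monCongr_equiv}) t.
Definition monrepr (x : presMon) : monTerm X := repr (x : {eq_quot _}).

Lemma monreprK x : monpi (monrepr x) = x.
Proof. exact: reprK. Qed.
Lemma monpiP t u : monpi t = monpi u <-> monCongr r t u.
Proof.
split=> [/eqmodP/asboolP//|tu]; apply/eqmodP; exact/asboolP.
Qed.
Lemma monpi_surj x : exists t, x = monpi t.
Proof. by exists (monrepr x); rewrite monreprK. Qed.

Definition monadd (x y : presMon) : presMon :=
  monpi (MAdd (monrepr x) (monrepr y)).
Lemma monaddE t u : monadd (monpi t) (monpi u) = monpi (MAdd t u).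
Proof. by apply/monpiP; apply: MC_add; apply/monpiP; rewrite monreprK. Qed.

Lemma monaddA : associative monadd.
Proof.
move=> x y z; have [t ->] := monpi_surj x; have [u ->] := monpi_surj y.
have [v ->] := monpi_surj z.
by rewrite !monaddE; apply/monpiP; apply: MC_addA.
Qed.
Lemma monaddC : commutative monadd.
Proof.
move=> x y; have [t ->] := monpi_surj x; have [u ->] := monpi_surj y.
by rewrite !monaddE; apply/monpiP; apply: MC_addC.
Qed.
Lemma monadd0 : left_id (monpi MZero) monadd.
Proof.
move=> x; have [t ->] := monpi_surj x.
by rewrite !monaddE; apply/monpiP; apply: MC_add0.
Qed.
HB.instance Definition _ := GRing.isNmodule.Build presMon
  monaddA monaddC monadd0.

Definition mongen (x : X) : presMon := monpi (MGen x).

Lemma monpiD t u : monpi (MAdd t u) = monpi t + monpi u.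
Proof. by rewrite -monaddE. Qed.
Lemma monpi0 : monpi MZero = 0. Proof. by []. Qed.

Lemma presMon_ext (N : nmodType) (f g : {additive presMon -> N}) :
  (forall x, f (mongen x) = g (mongen x)) -> f = g.
Proof.
move=> fg; apply: additive_ext => x; have [t ->] := monpi_surj x.
elim: t => [y||t IHt u IHu]; first exact: fg.
- by rewrite monpi0 !raddf0.
- by rewrite monpiD !raddfD IHt IHu.
Qed.

Fixpoint moneval (N : nmodType) (f : X -> N) (t : monTerm X) : N :=
  match t with
  | MGen x => f x
  | MZero => 0
  | MAdd t u => moneval f t + moneval f u
  end.

Section Lift.
Variables (N : nmodType) (f : X -> N).
Hypothesis fr : forall t u, r t u -> moneval f t = moneval f u.

Lemma moneval_congr t u : monCongr r t u -> moneval f t = moneval f u.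
Proof.
elim=> {t u} //=.
- by move=> t u v _ -> _ ->.
- by move=> t t' u u' _ -> _ ->.
- by move=> t u v; rewrite addrA.
- by move=> t u; rewrite addrC.
- by move=> t; rewrite add0r.
Qed.

Definition monlift_fun (x : presMon) : N := moneval f (monrepr x).
Lemma monlift_pi t : monlift_fun (monpi t) = moneval f t.
Proof. by apply: moneval_congr; apply/monpiP; rewrite monreprK. Qed.
Lemma monlift_is_nmod : nmod_morphism monlift_fun.
Proof.
split=> [|x y]; first by rewrite -monpi0 monlift_pi.
have [t ->] := monpi_surj x; have [u ->] := monpi_surj y.
by rewrite -monpiD !monlift_pi.
Qed.
HB.instance Definition _ :=
  GRing.isNmodMorphism.Build presMon N monlift_fun monlift_is_nmod.
Definition monlift : {additive presMon -> N} := monlift_fun.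
Lemma monlift_gen x : monlift (mongen x) = f x.
Proof. exact: monlift_pi. Qed.
End Lift.
End PresentedMonoid.

Inductive algTerm (K X : Type) :=
  | AGen of X
  | AZero
  | AAdd of algTerm K X & algTerm K X
  | AScale of K & algTerm K X
  | AMul of algTerm K X & algTerm K X.
Arguments AGen {K X} _.
Arguments AZero {K X}.
HB.instance Definition _ K X := gen_eqMixin (algTerm K X).
HB.instance Definition _ K X := gen_choiceMixin (algTerm K X).

Inductive algCongr (K : comPzRingType) (X : Type)
    (r : algTerm K X -> algTerm K X -> Prop) :
    algTerm K X -> algTerm K X -> Prop :=
  | AC_rel t u of r t u : algCongr r t u
  | AC_refl t : algCongr r t t
  | AC_sym t u of algCongr r t u : algCongr r u t
  | AC_trans t u v of algCongr r t u & algCongr r u v : algCongr r t v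
  | AC_add t t' u u' of algCongr r t t' & algCongr r u u' :
      algCongr r (AAdd t u) (AAdd t' u')
  | AC_scale a t t' of algCongr r t t' :
      algCongr r (AScale a t) (AScale a t')
  | AC_mul t t' u u' of algCongr r t t' & algCongr r u u' :
      algCongr r (AMul t u) (AMul t' u')
  | AC_addA t u v : algCongr r (AAdd t (AAdd u v)) (AAdd (AAdd t u) v)
  | AC_addC t u : algCongr r (AAdd t u) (AAdd u t)
  | AC_add0 t : algCongr r (AAdd AZero t) t
  | AC_addN t : algCongr r (AAdd (AScale (-1) t) t) AZero
  | AC_scaleA a b t : algCongr r (AScale a (AScale b t)) (AScale (a * b) t)
  | AC_scale1 t : algCongr r (AScale 1 t) t
  | AC_scaleDr a t u :
      algCongr r (AScale a (AAdd t u)) (AAdd (AScale a t) (AScale a u))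
  | AC_scaleDl a b t :
      algCongr r (AScale (a + b) t) (AAdd (AScale a t) (AScale b t))
  | AC_mulA t u v : algCongr r (AMul t (AMul u v)) (AMul (AMul t u) v)
  | AC_mulDl t u v : algCongr r (AMul (AAdd t u) v) (AAdd (AMul t v) (AMul u v))
  | AC_mulDr t u v : algCongr r (AMul t (AAdd u v)) (AAdd (AMul t u) (AMul t v))
  | AC_mulZl a t u : algCongr r (AMul (AScale a t) u) (AScale a (AMul t u))
  | AC_mulZr a t u : algCongr r (AMul t (AScale a u)) (AScale a (AMul t u)).

Section PresentedAlgebra.
Variables (K : comPzRingType) (X : Type).
Variable r : algTerm K X -> algTerm K X -> Prop.

Definition algCongrb (t u : algTerm K X) : bool := `[< algCongr r t u >].
Lemma algCongrb_refl : reflexive algCongrb.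
Proof. by move=> t; apply/asboolP; apply: AC_refl. Qed.
Lemma algCongrb_sym : ssrbool.symmetric algCongrb.
Proof. by move=> t u; apply: asbool_equiv_eq; split; apply: AC_sym. Qed.
Lemma algCongrb_trans : ssrbool.transitive algCongrb.
Proof.
by move=> u t v /asboolP tu /asboolP uv; apply/asboolP; apply: AC_trans uv.
Qed.
Canonical algCongr_equiv :=
  EquivRel algCongrb algCongrb_refl algCongrb_sym algCongrb_trans.

Definition presAlg := {eq_quot algCongr_equiv}.
HB.instance Definition _ := Choice.on presAlg.

Definition algpi (t : algTerm K X) : presAlg := \pi_({eq_quot algCongr_equiv}) t.
Definition algrepr (x : presAlg) : algTerm K X := repr (x : {eq_quot _}).

Lemma algreprK x : algpi (algrepr x) = x.
Proof. exact: reprK. Qed.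
Lemma algpiP t u : algpi t = algpi u <-> algCongr r t u.
Proof.
split=> [/eqmodP/asboolP//|tu]; apply/eqmodP; exact/asboolP.
Qed.
Lemma algpi_surj x : exists t, x = algpi t.
Proof. by exists (algrepr x); rewrite algreprK. Qed.

Definition algadd (x y : presAlg) : presAlg :=
  algpi (AAdd (algrepr x) (algrepr y)).
Definition algmul (x y : presAlg) : presAlg :=
  algpi (AMul (algrepr x) (algrepr y)).
Definition algscale (a : K) (x : presAlg) : presAlg :=
  algpi (AScale a (algrepr x)).

Lemma algaddE t u : algadd (algpi t) (algpi u) = algpi (AAdd t u).
Proof. by apply/algpiP; apply: AC_add; apply/algpiP; rewrite algreprK. Qed.
Lemma algmulE t u : algmul (algpi t) (algpi u) = algpi (AMul t u).
Proof. by apply/algpiP; apply: AC_mul; apply/algpiP; rewrite algreprK. Qed.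
Lemma algscaleE a t : algscale a (algpi t) = algpi (AScale a t).
Proof. by apply/algpiP; apply: AC_scale; apply/algpiP; rewrite algreprK. Qed.

Lemma algaddA : associative algadd.
Proof.
move=> x y z; have [t ->] := algpi_surj x; have [u ->] := algpi_surj y.
have [v ->] := algpi_surj z.
by rewrite !algaddE; apply/algpiP; apply: AC_addA.
Qed.
Lemma algaddC : commutative algadd.
Proof.
move=> x y; have [t ->] := algpi_surj x; have [u ->] := algpi_surj y.
by rewrite !algaddE; apply/algpiP; apply: AC_addC.
Qed.
Lemma algadd0 : left_id (algpi AZero) algadd.
Proof.
move=> x; have [t ->] := algpi_surj x.
by rewrite !algaddE; apply/algpiP; apply: AC_add0.
Qed.
Lemma algaddN : left_inverse (algpi AZero) (algscale (-1)) algadd.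
Proof.
move=> x; have [t ->] := algpi_surj x.
by rewrite algscaleE algaddE; apply/algpiP; apply: AC_addN.
Qed.
HB.instance Definition _ := GRing.isZmodule.Build presAlg
  algaddA algaddC algadd0 algaddN.

Lemma algpiD t u : algpi (AAdd t u) = algpi t + algpi u.
Proof. by rewrite -algaddE. Qed.
Lemma algpi0 : algpi AZero = 0. Proof. by []. Qed.

Lemma algscaleA a b x : algscale a (algscale b x) = algscale (a * b) x.
Proof.
have [t ->] := algpi_surj x.
by rewrite !algscaleE; apply/algpiP; apply: AC_scaleA.
Qed.
Lemma algscale1 : left_id 1 algscale.
Proof.
move=> x; have [t ->] := algpi_surj x.
by rewrite algscaleE; apply/algpiP; apply: AC_scale1.
Qed.
Lemma algscaleDr : right_distributive algscale +%R.
Proof.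
move=> a x y; have [t ->] := algpi_surj x; have [u ->] := algpi_surj y.
by rewrite -algpiD !algscaleE -algpiD; apply/algpiP; apply: AC_scaleDr.
Qed.
Lemma algscaleDl x : {morph algscale^~ x : a b / a + b}.
Proof.
move=> a b /=; have [t ->] := algpi_surj x.
by rewrite !algscaleE -algpiD; apply/algpiP; apply: AC_scaleDl.
Qed.
HB.instance Definition _ := GRing.Zmodule_isLmodule.Build K presAlg
  algscaleA algscale1 algscaleDr algscaleDl.

Lemma algpiZ a t : algpi (AScale a t) = a *: algpi t.
Proof. by rewrite -algscaleE. Qed.

Lemma algmulA : associative algmul.
Proof.
move=> x y z; have [t ->] := algpi_surj x; have [u ->] := algpi_surj y.
have [v ->] := algpi_surj z.
by rewrite !algmulE; apply/algpiP; apply: AC_mulA.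
Qed.
Lemma algmulDl : left_distributive algmul +%R.
Proof.
move=> x y z; have [t ->] := algpi_surj x; have [u ->] := algpi_surj y.
have [v ->] := algpi_surj z.
by rewrite -algpiD !algmulE -algpiD; apply/algpiP; apply: AC_mulDl.
Qed.
Lemma algmulDr : right_distributive algmul +%R.
Proof.
move=> x y z; have [t ->] := algpi_surj x; have [u ->] := algpi_surj y.
have [v ->] := algpi_surj z.
by rewrite -algpiD !algmulE -algpiD; apply/algpiP; apply: AC_mulDr.
Qed.
Lemma algmulZl (a : K) x y : algmul (a *: x) y = a *: algmul x y.
Proof.
have [t ->] := algpi_surj x; have [u ->] := algpi_surj y.
by rewrite -algpiZ !algmulE -algpiZ; apply/algpiP; apply: AC_mulZl.
Qed.
Lemma algmulZr (a : K) x y : algmul x (a *: y) = a *: algmul x y.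
Proof.
have [t ->] := algpi_surj x; have [u ->] := algpi_surj y.
by rewrite -algpiZ !algmulE -algpiZ; apply/algpiP; apply: AC_mulZr.
Qed.
HB.instance Definition _ := Lmodule_isNUAlgebra.Build K presAlg
  algmulA algmulDl algmulDr algmulZl algmulZr.

Lemma algpiM t u : algpi (AMul t u) = algpi t ** algpi u.
Proof. by rewrite -algmulE. Qed.

Definition alggen (x : X) : presAlg := algpi (AGen x).

Lemma presAlg_ext (B : nuAlgType K) (f g : nuHom presAlg B) :
  (forall x, f (alggen x) = g (alggen x)) -> f = g.
Proof.
move=> fg; apply: nuHom_ext => x; have [t ->] := algpi_surj x.
elim: t => [y||t IHt u IHu|a t IHt|t IHt u IHu]; first exact: fg.
- by rewrite algpi0 !raddf0.
- by rewrite algpiD !raddfD /= IHt IHu.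
- by rewrite algpiZ !linearZ /= IHt.
- by rewrite algpiM !nuhomM IHt IHu.
Qed.

Fixpoint algeval (B : nuAlgType K) (f : X -> B) (t : algTerm K X) : B :=
  match t with
  | AGen x => f x
  | AZero => 0
  | AAdd t u => algeval f t + algeval f u
  | AScale a t => a *: algeval f t
  | AMul t u => algeval f t ** algeval f u
  end.

Section Lift.
Variables (B : nuAlgType K) (f : X -> B).
Hypothesis fr : forall t u, r t u -> algeval f t = algeval f u.

Lemma algeval_congr t u : algCongr r t u -> algeval f t = algeval f u.
Proof.
elim=> {t u} //=.
- by move=> t u v _ -> _ ->.
- by move=> t t' u u' _ -> _ ->.
- by move=> a t t' _ ->.
- by move=> t t' u u' _ -> _ ->.
- by move=> t u v; rewrite addrA.
- by move=> t u; rewrite addrC.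
- by move=> t; rewrite add0r.
- by move=> t; rewrite scaleN1r addNr.
- by move=> a b t; rewrite scalerA.
- by move=> t; rewrite scale1r.
- by move=> a t u; rewrite scalerDr.
- by move=> a b t; rewrite scalerDl.
- by move=> t u v; rewrite nmulA.
- by move=> t u v; rewrite nmulDl.
- by move=> t u v; rewrite nmulDr.
- by move=> a t u; rewrite nmulZl.
- by move=> a t u; rewrite nmulZr.
Qed.

Definition alglift_fun (x : presAlg) : B := algeval f (algrepr x).
Lemma alglift_pi t : alglift_fun (algpi t) = algeval f t.
Proof. by apply: algeval_congr; apply/algpiP; rewrite algreprK. Qed.
Lemma alglift_is_linear : linear alglift_fun.
Proof.
move=> a x y; have [t ->] := algpi_surj x; have [u ->] := algpi_surj y.
by rewrite -algpiZ -algpiD !alglift_pi.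
Qed.
HB.instance Definition _ :=
  GRing.isLinear.Build K presAlg B *:%R alglift_fun alglift_is_linear.
Lemma alglift_isM : {morph (alglift_fun : {linear presAlg -> B}) : x y / x ** y}.
Proof.
move=> x y; have [t ->] := algpi_surj x; have [u ->] := algpi_surj y.
by rewrite -algpiM /= !alglift_pi.
Qed.
Definition alglift : nuHom presAlg B := NUHom alglift_isM.
Lemma alglift_gen x : alglift (alggen x) = f x.
Proof. exact: alglift_pi. Qed.
End Lift.
End PresentedAlgebra.

Section MatInf.
Variables (K : comPzRingType) (A : nuAlgType K).

(* [x] has all its nonzero entries in the upper left [m] x [n] corner. *)
Definition corner (m n : nat) (x : nat -> nat -> A) : Prop :=
  forall i j, (m <= i)%N || (n <= j)%N -> x i j = 0.

Lemma corner_widen m n m' n' x :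
  (m <= m')%N -> (n <= n')%N -> corner m n x -> corner m' n' x.
Proof.
move=> mm nn cx i j /orP[h|h]; apply: cx.
  by rewrite (leq_trans mm h).
by rewrite (leq_trans nn h) orbT.
Qed.

Definition finsupp_mx : {pred nat -> nat -> A} :=
  [pred x | `[< exists n, corner n n x >]].

Lemma finsupp_mx_submod : submod_closed finsupp_mx.
Proof.
split=> [|a x y]; rewrite !inE.
  by exists 0%N.
move=> [m cx] [n cy]; exists (maxn m n) => i j h.
have -> : (a *: x + y) i j = a *: x i j + y i j by [].
rewrite (corner_widen _ _ cx h) ?leq_maxl// scaler0 add0r.
by rewrite (corner_widen _ _ cy h) ?leq_maxr.
Qed.
HB.instance Definition _ :=
  GRing.isSubmodClosed.Build K _ finsupp_mx finsupp_mx_submod.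

(* The directed union of the matrix algebras of size [n] over [A]: a matrix
   of size [n] is identified with its extension by zero to a
   [nat] x [nat] matrix. *)
Record matInf := MatInf { matval :> nat -> nat -> A;
  _ : matval \in finsupp_mx }.
HB.instance Definition _ := [isSub for matval].
HB.instance Definition _ := [Choice of matInf by <:].
HB.instance Definition _ := [SubChoice_isSubLmodule of matInf by <:].

Lemma matInf_ext (x y : matInf) : (forall i j, x i j = y i j) -> x = y.
Proof. by move=> xy; apply: val_inj; apply/funext => i; apply/funext. Qed.

Lemma matInf_corner (x : matInf) : exists n, corner n n x.
Proof. by have := valP x; rewrite inE. Qed.

Lemma matD (x y : matInf) i j : (x + y) i j = x i j + y i j.
Proof. by []. Qed.
Lemma mat0 i j : (0 : matInf) i j = 0. Proof. by []. Qed.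
Lemma matZ a (x : matInf) i j : (a *: x) i j = a *: x i j.
Proof. by []. Qed.

(* The sum has finite support, so [\sum_(k \in setT)] is its actual value. *)
Definition matmul_fun (x y : nat -> nat -> A) (i j : nat) : A :=
  \sum_(k \in [set: nat]) (x i k ** y k j).

Lemma matmul_funEl n m x y : corner m n x ->
  forall i j, matmul_fun x y i j = \sum_(k < n) (x i k ** y k j).
Proof.
move=> cx i j; rewrite (fsbig_ord _ n (fun k => x i k ** y k j)).
apply/esym/fsbig_widen => // k [_ /= /negP].
by rewrite -leqNgt => nk; rewrite cx ?nk ?orbT ?nmul0l.
Qed.
Lemma matmul_funEr n p x y : corner n p y ->
  forall i j, matmul_fun x y i j = \sum_(k < n) (x i k ** y k j).
Proof.
move=> cy i j; rewrite (fsbig_ord _ n (fun k => x i k ** y k j)).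
apply/esym/fsbig_widen => // k [_ /= /negP].
by rewrite -leqNgt => nk; rewrite cy ?nk ?nmul0r.
Qed.

Lemma matmul_corner m n p x y :
  corner m n x -> corner n p y -> corner m p (matmul_fun x y).
Proof.
move=> cx cy i j ij; rewrite (matmul_funEl _ cx) big1// => k _.
by case/orP: ij => h; [rewrite cx ?h// nmul0l|rewrite (cy k) ?h ?orbT// nmul0r].
Qed.

Lemma matmul_finsupp (x y : matInf) : matmul_fun x y \in finsupp_mx.
Proof.
have [m cx] := matInf_corner x; have [n cy] := matInf_corner y.
rewrite inE; exists (maxn m n); apply: (@matmul_corner _ (maxn m n)).
  by apply: corner_widen cx; rewrite leq_maxl.
by apply: corner_widen cy; rewrite leq_maxr.
Qed.
Definition matmul (x y : matInf) : matInf := MatInf (matmul_finsupp x y).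

Lemma matmulEl n m (x y : matInf) : corner m n x ->
  forall i j, matmul x y i j = \sum_(k < n) (x i k ** y k j).
Proof. exact: matmul_funEl. Qed.
Lemma matmulEr n p (x y : matInf) : corner n p y ->
  forall i j, matmul x y i j = \sum_(k < n) (x i k ** y k j).
Proof. exact: matmul_funEr. Qed.

Lemma matmulA : associative matmul.
Proof.
move=> x y z; apply: matInf_ext => i j.
have [m cx] := matInf_corner x; have [n cz] := matInf_corner z.
rewrite (matmulEl _ cx) (matmulEr _ cz).
transitivity (\sum_(k < m) \sum_(l < n) (x i k ** y k l ** z l j)).
  apply: eq_bigr => k _; rewrite (matmulEr _ cz) nmul_sumr.
  by apply: eq_bigr => l _; rewrite nmulA.
rewrite exchange_big; apply: eq_bigr => l _ /=.
by rewrite (matmul_funEl _ cx) nmul_suml.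
Qed.
Lemma matmulDl : left_distributive matmul +%R.
Proof.
move=> x y z; apply: matInf_ext => i j; have [n cz] := matInf_corner z.
rewrite matD !(matmulEr _ cz) -big_split.
by apply: eq_bigr => k _; rewrite matD nmulDl.
Qed.
Lemma matmulDr : right_distributive matmul +%R.
Proof.
move=> z x y; apply: matInf_ext => i j; have [n cz] := matInf_corner z.
rewrite matD !(matmulEl _ cz) -big_split.
by apply: eq_bigr => k _; rewrite matD nmulDr.
Qed.
Lemma matmulZl a x y : matmul (a *: x) y = a *: matmul x y.
Proof.
apply: matInf_ext => i j; have [n cy] := matInf_corner y.
rewrite matZ !(matmulEr _ cy) scaler_sumr.
by apply: eq_bigr => k _; rewrite matZ nmulZl.
Qed.
Lemma matmulZr a x y : matmul x (a *: y) = a *: matmul x y.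
Proof.
apply: matInf_ext => i j; have [n cx] := matInf_corner x.
rewrite matZ !(matmulEl _ cx) scaler_sumr.
by apply: eq_bigr => k _; rewrite matZ nmulZr.
Qed.
HB.instance Definition _ := Lmodule_isNUAlgebra.Build K matInf
  matmulA matmulDl matmulDr matmulZl matmulZr.

Lemma matMEl n m (x y : matInf) : corner m n x ->
  forall i j, (x ** y) i j = \sum_(k < n) (x i k ** y k j).
Proof. exact: matmul_funEl. Qed.
Lemma matMEr n p (x y : matInf) : corner n p y ->
  forall i j, (x ** y) i j = \sum_(k < n) (x i k ** y k j).
Proof. exact: matmul_funEr. Qed.

(* The block diagonal matrix with blocks [x] of size [n] and [y]. *)
Definition blockdiag_fun (n : nat) (x y : nat -> nat -> A) (i j : nat) : A :=
  if (i < n)%N && (j < n)%N then x i j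
  else if (n <= i)%N && (n <= j)%N then y (i - n)%N (j - n)%N
  else 0.

Lemma blockdiag_finsupp n (x y : matInf) : blockdiag_fun n x y \in finsupp_mx.
Proof.
have [m cy] := matInf_corner y.
rewrite inE; exists (n + m)%N => i j h; rewrite /blockdiag_fun.
have /negbTE -> : ~~ ((i < n)%N && (j < n)%N).
  rewrite negb_and -!leqNgt; apply/orP; case/orP: h => h; [left|right];
  exact: leq_trans (leq_addr _ _) h.
case: ifP => // /andP[ni nj]; apply: cy.
by rewrite !leq_subRL ?ni ?nj.
Qed.
Definition blockdiag n (x y : matInf) : matInf :=
  MatInf (blockdiag_finsupp n x y).

Record idem := Idem { idemval :> matInf; idemP : idemval ** idemval == idemval }.
HB.instance Definition _ := [isSub for idemval].
HB.instance Definition _ := [Choice of idem by <:].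

Definition mvn (e f : matInf) : Prop :=
  exists x y : matInf, e = x ** y /\ f = y ** x.

Lemma mvn_refl (e : matInf) : e ** e = e -> mvn e e.
Proof. by move=> ee; exists e, e; rewrite ee. Qed.
Lemma mvn_sym (e f : matInf) : mvn e f -> mvn f e.
Proof. by move=> [x [y [-> ->]]]; exists y, x. Qed.
Lemma mvn_trans (e f g : matInf) : e ** e = e -> g ** g = g ->
  mvn e f -> mvn f g -> mvn e g.
Proof.
move=> ee gg [x [y [exy fyx]]] [u [v [fuv gvu]]].
exists (x ** u), (v ** y); split.
  rewrite nmulA -(nmulA x) -fuv fyx -[LHS]ee exy.
  by rewrite !nmulA.
rewrite nmulA -(nmulA v) -fyx fuv -[LHS]gg gvu.
by rewrite !nmulA.
Qed.

Lemma mvn_norm (e f : matInf) : e ** e = e -> f ** f = f -> mvn e f ->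
  exists x y, [/\ e = x ** y, f = y ** x, e ** x = x, x ** f = x
                & f ** y = y /\ y ** e = y].
Proof.
move=> ee ff [x [y [exy fyx]]].
have ex : e ** x = x ** f by rewrite exy fyx nmulA.
have fy : f ** y = y ** e by rewrite exy fyx nmulA.
exists (e ** x), (f ** y); split.
- by rewrite fy nmulA -(nmulA e) -exy !ee.
- by rewrite ex nmulA -(nmulA f) -fyx !ff.
- by rewrite nmulA ee.
- by rewrite ex -nmulA ff.
- by rewrite nmulA ff; split=> //; rewrite fy -nmulA ee.
Qed.

Lemma orth_idem (e f : matInf) : e ** e = e -> f ** f = f ->
  e ** f = 0 -> f ** e = 0 -> (e + f) ** (e + f) = e + f.
Proof.
by move=> ee ff ef fe; rewrite nmulDl !nmulDr ee ff ef fe addr0 add0r.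
Qed.

Lemma mvn_orth (e e' f f' : matInf) :
  e ** e = e -> f ** f = f -> e' ** e' = e' -> f' ** f' = f' ->
  e ** f = 0 -> f ** e = 0 -> e' ** f' = 0 -> f' ** e' = 0 ->
  mvn e e' -> mvn f f' -> mvn (e + f) (e' + f').
Proof.
move=> ee ff ee' ff' ef fe ef' fe'.
move=> /(mvn_norm ee ee')[x [y [exy eyx ex xe [ey ye]]]].
move=> /(mvn_norm ff ff')[z [w [fzw fwz fz zf [fw wf]]]].
exists (x + z), (y + w); rewrite !(nmulDl, nmulDr) -exy -fzw -eyx -fwz.
have -> : x ** w = 0 by rewrite -xe -fw nmulA -(nmulA x) ef' nmul0r nmul0l.
have -> : z ** y = 0 by rewrite -zf -ey nmulA -(nmulA z) fe' nmul0r nmul0l.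
have -> : y ** z = 0 by rewrite -ye -fz nmulA -(nmulA y) ef nmul0r nmul0l.
have -> : w ** x = 0 by rewrite -wf -ex nmulA -(nmulA w) fe nmul0r nmul0l.
by rewrite !addr0 !add0r.
Qed.

Lemma zero_idem : (0 : matInf) ** 0 = 0. Proof. exact: nmul0l. Qed.

Definition rowshift_fun n (x : nat -> nat -> A) (i j : nat) : A :=
  if (n <= i)%N then x (i - n)%N j else 0.
Definition colshift_fun n (x : nat -> nat -> A) (i j : nat) : A :=
  if (n <= j)%N then x i (j - n)%N else 0.

Lemma rowshift_finsupp n (x : matInf) : rowshift_fun n x \in finsupp_mx.
Proof.
have [m cx] := matInf_corner x.
rewrite inE; exists (n + m)%N => i j h; rewrite /rowshift_fun.
case: leqP => // ni; apply: cx; rewrite leq_subRL//.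
by case/orP: h => [->//|h]; rewrite (leq_trans (leq_addl _ _) h) orbT.
Qed.
Lemma colshift_finsupp n (x : matInf) : colshift_fun n x \in finsupp_mx.
Proof.
have [m cx] := matInf_corner x.
rewrite inE; exists (n + m)%N => i j h; rewrite /colshift_fun.
case: leqP => // ni; apply: cx; rewrite leq_subRL//.
by case/orP: h => [h|->]; rewrite ?orbT// (leq_trans (leq_addl _ _) h).
Qed.
Definition rowshift n (x : matInf) := MatInf (rowshift_finsupp n x).
Definition colshift n (x : matInf) := MatInf (colshift_finsupp n x).

Lemma rowshiftM n (x y : matInf) : rowshift n x ** y = rowshift n (x ** y).
Proof.
apply: matInf_ext => i j; have [m cy] := matInf_corner y.
rewrite (matMEr _ cy) /= /rowshift_fun.
case: ifP => ni; first by rewrite (matmul_funEr _ cy).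
by rewrite big1// => k _; rewrite nmul0l.
Qed.
Lemma colshiftM n (x y : matInf) : x ** colshift n y = colshift n (x ** y).
Proof.
apply: matInf_ext => i j; have [m cx] := matInf_corner x.
rewrite (matMEl _ cx) /= /colshift_fun.
case: ifP => ni; first by rewrite (matmul_funEl _ cx).
by rewrite big1// => k _; rewrite nmul0r.
Qed.
Lemma colrowshift n (x y : matInf) : colshift n x ** rowshift n y = x ** y.
Proof.
apply: matInf_ext => i j; have [m cx] := matInf_corner x.
have cx' : corner m (n + m) (colshift n x).
  move=> k l h; rewrite /= /colshift_fun; case: leqP => // nl.
  by apply: cx; rewrite leq_subRL.
rewrite (matMEl _ cx') (matMEl _ cx) big_split_ord /= big1.
  rewrite add0r; apply: eq_bigr => k _.
  by rewrite /colshift_fun /rowshift_fun /= leq_addr addKn.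
by move=> k _; rewrite /colshift_fun /= leqNgt ltn_ord nmul0l.
Qed.
Definition shift n (x : matInf) := rowshift n (colshift n x).

Lemma shift_idem n (x : matInf) : x ** x = x -> shift n x ** shift n x = shift n x.
Proof. by move=> xx; rewrite /shift rowshiftM colrowshift colshiftM xx. Qed.
Lemma shift_mvn n (x : matInf) : x ** x = x -> mvn (shift n x) x.
Proof.
move=> xx; exists (rowshift n x), (colshift n x).
by rewrite colrowshift rowshiftM colshiftM xx.
Qed.
Lemma corner_shift n (x y : matInf) : corner n n x -> x ** shift n y = 0.
Proof.
move=> cx; apply: matInf_ext => i j; rewrite (matMEl _ cx) big1// => k _.
by rewrite /= /rowshift_fun leqNgt ltn_ord nmul0r.
Qed.
Lemma shift_corner n (x y : matInf) : corner n n x -> shift n y ** x = 0.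
Proof.
move=> cx; apply: matInf_ext => i j; rewrite (matMEr _ cx) big1// => k _.
rewrite /= /rowshift_fun /colshift_fun /=.
by rewrite [(n <= k)%N]leqNgt ltn_ord; case: ifP => _; rewrite nmul0l.
Qed.
Lemma blockdiagE n (x y : matInf) : corner n n x ->
  blockdiag n x y = x + shift n y.
Proof.
move=> cx; apply: matInf_ext => i j; rewrite matD /= /blockdiag_fun.
rewrite /rowshift_fun /= /colshift_fun.
case: (ltnP i n) => ni; case: (ltnP j n) => nj /=; rewrite ?addr0//.
- by rewrite cx ?nj ?orbT.
- by rewrite cx ?ni.
- by rewrite cx ?ni// add0r.
Qed.
Lemma blockdiag_idem n (e f : matInf) : corner n n e ->
  e ** e = e -> f ** f = f -> blockdiag n e f ** blockdiag n e f = blockdiag n e f.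
Proof.
move=> ce ee ff; rewrite blockdiagE//; apply: orth_idem => //.
- exact: shift_idem.
- exact: corner_shift.
- exact: shift_corner.
Qed.

(* A size of [x]; the class of [blockdiag n x y] does not depend on the
   choice of the size [n] of [x], by [blockdiag_mvn]. *)
Definition matsize (x : matInf) : nat := projT1 (cid (matInf_corner x)).
Lemma matsizeP (x : matInf) : corner (matsize x) (matsize x) x.
Proof. by rewrite /matsize; case: cid. Qed.

Lemma idemE (e : idem) : idemval e ** idemval e = idemval e.
Proof. exact/eqP/idemP. Qed.

Lemma blockdiag_mvn n (e f e' f' : matInf) : corner n n e ->
  e ** e = e -> f ** f = f -> e' ** e' = e' -> f' ** f' = f' ->
  e' ** f' = 0 -> f' ** e' = 0 -> mvn e e' -> mvn f f' ->
  mvn (blockdiag n e f) (e' + f').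
Proof.
move=> ce ee ff ee' ff' ef' fe' eqe eqf; rewrite blockdiagE//.
apply: mvn_orth => //.
- exact: shift_idem.
- exact: corner_shift.
- exact: shift_corner.
- apply: (mvn_trans _ _ (shift_mvn n ff) eqf) => //; exact: shift_idem.
Qed.

Definition mvnb (e f : idem) : bool := `[< mvn e f >].
Lemma mvnb_refl : reflexive mvnb.
Proof. by move=> e; apply/asboolP; apply: mvn_refl; apply: idemE. Qed.
Lemma mvnb_sym : ssrbool.symmetric mvnb.
Proof. by move=> e f; apply: asbool_equiv_eq; split; apply: mvn_sym. Qed.
Lemma mvnb_trans : ssrbool.transitive mvnb.
Proof.
move=> f e g /asboolP ef /asboolP fg; apply/asboolP.
by apply: mvn_trans ef fg; apply: idemE.
Qed.
Canonical mvn_equiv := EquivRel mvnb mvnb_refl mvnb_sym mvnb_trans.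

Definition Vmon := {eq_quot mvn_equiv}.
HB.instance Definition _ := Choice.on Vmon.

Definition Vpi (e : idem) : Vmon := \pi_({eq_quot mvn_equiv}) e.
Definition Vrepr (a : Vmon) : idem := repr (a : {eq_quot _}).
Lemma VreprK a : Vpi (Vrepr a) = a.
Proof. exact: reprK. Qed.
Lemma VpiP e f : Vpi e = Vpi f <-> mvn e f.
Proof.
split=> [/eqmodP/asboolP//|ef]; apply/eqmodP; exact/asboolP.
Qed.
Lemma Vpi_surj a : exists e, a = Vpi e.
Proof. by exists (Vrepr a); rewrite VreprK. Qed.

Definition idem0 : idem := @Idem 0 (introT eqP zero_idem).
Definition idemD (e f : idem) : idem :=
  @Idem (blockdiag (matsize e) e f)
    (introT eqP (blockdiag_idem (@matsizeP e) (idemE e) (idemE f))).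
Definition Vadd (a b : Vmon) : Vmon := Vpi (idemD (Vrepr a) (Vrepr b)).

Lemma VaddE (e f g : idem) (e' f' : matInf) :
  e' ** e' = e' -> f' ** f' = f' -> e' ** f' = 0 -> f' ** e' = 0 ->
  mvn e e' -> mvn f f' -> idemval g = e' + f' ->
  Vadd (Vpi e) (Vpi f) = Vpi g.
Proof.
move=> ee' ff' ef' fe' eqe eqf gE; apply/VpiP; rewrite gE.
apply: blockdiag_mvn => //; rewrite ?idemE//.
- exact: matsizeP.
- by apply: (mvn_trans _ _ _ eqe); rewrite ?idemE//; apply/VpiP; rewrite VreprK.
- by apply: (mvn_trans _ _ _ eqf); rewrite ?idemE//; apply/VpiP; rewrite VreprK.
Qed.

Lemma VaddD (e f : idem) n : corner n n (idemval e) ->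
  Vadd (Vpi e) (Vpi f) = Vpi (idemD e f) /\
  exists g : idem, idemval g = blockdiag n e f /\
    Vadd (Vpi e) (Vpi f) = Vpi g.
Proof.
have H m : corner m m e -> forall g : idem, idemval g = blockdiag m e f ->
    Vadd (Vpi e) (Vpi f) = Vpi g.
  move=> ce g gE; apply: (@VaddE _ _ _ e (shift m f)); rewrite ?idemE//.
  - by apply: shift_idem; rewrite idemE.
  - exact: corner_shift.
  - exact: shift_corner.
  - by apply: mvn_refl; rewrite idemE.
  - by apply: mvn_sym; apply: shift_mvn; rewrite idemE.
  - by rewrite gE blockdiagE.
move=> ce; split; first by apply: (H (matsize e)) => //; apply: matsizeP.
exists (@Idem (blockdiag n e f)
  (introT eqP (blockdiag_idem ce (idemE e) (idemE f)))).
by split=> //; apply: (H n).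
Qed.

Lemma VaddC : commutative Vadd.
Proof.
move=> a b; have [e ->] := Vpi_surj a; have [f ->] := Vpi_surj b.
have ce := @matsizeP e.
rewrite [LHS](VaddD f ce).1; apply/esym.
apply: (@VaddE _ _ _ (shift (matsize e) f) e); rewrite ?idemE//.
- by apply: shift_idem; rewrite idemE.
- exact: shift_corner.
- exact: corner_shift.
- by apply: mvn_sym; apply: shift_mvn; rewrite idemE.
- by apply: mvn_refl; rewrite idemE.
- by rewrite /= blockdiagE// addrC.
Qed.

Lemma Vadd0 : left_id (Vpi idem0) Vadd.
Proof.
move=> a; have [e ->] := Vpi_surj a.
apply: (@VaddE _ _ _ 0 e); rewrite ?idemE ?nmul0l ?nmul0r ?add0r//.
- by apply: mvn_refl; rewrite nmul0l.
- by apply: mvn_refl; rewrite idemE.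
Qed.

Lemma VaddA : associative Vadd.
Proof.
move=> a b c; have [e ->] := Vpi_surj a; have [f ->] := Vpi_surj b.
have [g ->] := Vpi_surj c.
have ce := @matsizeP e; have cf := @matsizeP f.
rewrite (VaddD f ce).1 (VaddD g cf).1.
set h := idemD f g; set k := idemD e f.
pose m := maxn (matsize k) (matsize e).
have ck : corner m m k by apply: corner_widen (@matsizeP k); rewrite leq_maxl.
have cem : corner m m e by apply: corner_widen ce; rewrite leq_maxr.
pose f1 := shift (matsize e) f; pose g1 := shift m g.
have kE : idemval k = idemval e + f1 by rewrite /= blockdiagE.
have ef : idemval e ** f1 = 0 by apply: corner_shift.
have fe : f1 ** idemval e = 0 by apply: shift_corner.
have eg : idemval e ** g1 = 0 by apply: corner_shift.
have ge : g1 ** idemval e = 0 by apply: shift_corner.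
have ff : f1 ** f1 = f1 by apply: shift_idem; rewrite idemE.
have gg : g1 ** g1 = g1 by apply: shift_idem; rewrite idemE.
have kg : idemval k ** g1 = 0 by apply: corner_shift.
have gk : g1 ** idemval k = 0 by apply: shift_corner.
have fg : f1 ** g1 = 0 by rewrite -[RHS]kg kE nmulDl eg add0r.
have gf : g1 ** f1 = 0 by rewrite -[RHS]gk kE nmulDr ge add0r.
have [_ [s [sE ->]]] := VaddD g ck.
have fm : mvn f f1 by apply: mvn_sym; apply: shift_mvn; rewrite idemE.
have gm : mvn g g1 by apply: mvn_sym; apply: shift_mvn; rewrite idemE.
apply: (@VaddE _ _ _ e (f1 + g1)).
- by rewrite idemE.
- exact: orth_idem.
- by rewrite nmulDr ef eg addr0.
- by rewrite nmulDl fe ge addr0.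
- by apply: mvn_refl; rewrite idemE.
- by apply: blockdiag_mvn => //; rewrite ?idemE.
- by rewrite sE blockdiagE// kE addrA.
Qed.

HB.instance Definition _ := GRing.isNmodule.Build Vmon VaddA VaddC Vadd0.
End MatInf.

Section VFunctor.
Variable K : comPzRingType.

Section Map.
Variables (A B : nuAlgType K) (f : nuHom A B).

Lemma map_matInf_finsupp (x : matInf A) :
  (fun i j => f (x i j)) \in @finsupp_mx K B.
Proof.
have [n cx] := matInf_corner x; rewrite inE; exists n => i j h.
by rewrite cx// raddf0.
Qed.
Definition map_matInf (x : matInf A) : matInf B := MatInf (map_matInf_finsupp x).

Lemma map_matInf_corner m n (x : matInf A) :
  corner m n x -> corner m n (map_matInf x).
Proof. by move=> cx i j h; rewrite /= cx// raddf0. Qed.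
Lemma map_matInfM : {morph map_matInf : x y / x ** y}.
Proof.
move=> x y; apply: matInf_ext => i j; have [n cx] := matInf_corner x.
have cx' := map_matInf_corner cx.
rewrite (matMEl _ cx') /= (matmul_funEl _ cx) raddf_sum.
by apply: eq_bigr => k _; apply: nuhomM.
Qed.
Lemma map_matInf_blockdiag n (x y : matInf A) :
  map_matInf (blockdiag n x y) = blockdiag n (map_matInf x) (map_matInf y).
Proof.
apply: matInf_ext => i j; rewrite /= /blockdiag_fun /=.
by case: ifP => // _; case: ifP => // _; rewrite raddf0.
Qed.
Lemma map_idemP (e : idem A) : map_matInf e ** map_matInf e == map_matInf e.
Proof. by rewrite -map_matInfM idemE. Qed.
Definition map_idem (e : idem A) : idem B := Idem (map_idemP e).

Definition Vmap_fun (a : Vmon A) : Vmon B := Vpi (map_idem (Vrepr a)).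
Lemma Vmap_pi e : Vmap_fun (Vpi e) = Vpi (map_idem e).
Proof.
apply/VpiP; have /VpiP[x [y [exy eyx]]] := VreprK (Vpi e).
by exists (map_matInf x), (map_matInf y); rewrite -!map_matInfM -exy -eyx.
Qed.
Lemma Vmap_is_nmod : nmod_morphism Vmap_fun.
Proof.
split=> [|a b].
  rewrite [0 in LHS](_ : _ = Vpi (idem0 A))// Vmap_pi; congr Vpi.
  by apply: val_inj; apply: matInf_ext => i j /=; rewrite raddf0.
have [d ->] := Vpi_surj a; have [e ->] := Vpi_surj b.
have cd := @matsizeP _ _ d.
rewrite [Vpi d + _ in LHS](VaddD e cd).1 !Vmap_pi.
have [_ [g [gE gD]]] := VaddD (e := map_idem d) (map_idem e) (map_matInf_corner cd).
rewrite [RHS]gD; congr Vpi; apply: val_inj.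
by rewrite /= gE -map_matInf_blockdiag.
Qed.
HB.instance Definition _ :=
  GRing.isNmodMorphism.Build (Vmon A) (Vmon B) Vmap_fun Vmap_is_nmod.
Definition Vmap : {additive Vmon A -> Vmon B} := Vmap_fun.
End Map.

Definition Vfunctor : functor (NUAlg K) AbMon.
Proof.
refine (@Functor (NUAlg K) AbMon (fun A => Vmon A) Vmap _ _).
- move=> A; apply: additive_ext => a; have [e ->] := Vpi_surj a.
  rewrite /= Vmap_pi; congr Vpi; apply: val_inj; exact: matInf_ext.
- move=> A B C g f; apply: additive_ext => a; have [e ->] := Vpi_surj a.
  rewrite /= !Vmap_pi; congr Vpi; apply: val_inj; exact: matInf_ext.
Defined.
End VFunctor.

(* Requiring choiceType carriers loses no generality: by the axiom of choice,
   every type carries such a structure. *)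
Record wgraph := WGraph {
  vertex : choiceType;
  edge : choiceType;
  src : edge -> vertex;
  rng : edge -> vertex;
  wt : edge -> nat;
  wt_gt0 : forall e, (0 < wt e)%N;
  row_finite : forall v, finite_set [set e | src e = v] }.

Definition finite_wgraph (E : wgraph) : Prop :=
  finite_set [set: vertex E] /\ finite_set [set: edge E].

Record complete_hom (E F : wgraph) := WHom {
  hv : vertex E -> vertex F;
  he : edge E -> edge F;
  hv_inj : injective hv;
  he_inj : injective he;
  he_src : forall e, src (he e) = hv (src e);
  he_rng : forall e, rng (he e) = hv (rng e);
  he_wt : forall e, wt (he e) = wt e;
  he_complete : forall v, [set e | src e = v] !=set0 ->
    set_bij [set e | src e = v] [set e | src e = hv v] he }.

Lemma whom_ext (E F : wgraph) (f g : complete_hom E F) :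
  hv f =1 hv g -> he f =1 he g -> f = g.
Proof.
case: f => f0 f1 a1 a2 a3 a4 a5 a6; case: g => g0 g1 b1 b2 b3 b4 b5 b6 /=.
move=> /funext fg0 /funext fg1.
case: _ / fg0 in b1 b2 b3 b4 b5 b6 *; case: _ / fg1 in b1 b2 b3 b4 b5 b6 *.
by congr WHom; exact: Prop_irrelevance.
Qed.

Definition id_whom (E : wgraph) : complete_hom E E.
Proof.
refine (@WHom E E id id _ _ _ _ _ _) => //.
by move=> v _; split=> // e he; exists e.
Defined.

Definition comp_whom (E F G : wgraph) (g : complete_hom F G) (f : complete_hom E F) :
  complete_hom E G.
Proof.
refine (@WHom E G (hv g \o hv f) (he g \o he f) _ _ _ _ _ _).
- exact: inj_comp (@hv_inj _ _ g) (@hv_inj _ _ f).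
- exact: inj_comp (@he_inj _ _ g) (@he_inj _ _ f).
- by move=> e /=; rewrite !he_src.
- by move=> e /=; rewrite !he_rng.
- by move=> e /=; rewrite !he_wt.
move=> v v0; have [ff fi fs] := he_complete f v0.
have v1 : [set e | src e = hv f v] !=set0.
  by case: v0 => e ev; exists (he f e); apply: ff.
have [gf gi gs] := he_complete g v1.
split.
- by move=> e /ff /gf.
- by move=> e e' _ _ /he_inj /he_inj.
- by move=> e /gs [e' /fs [e'' ev <-] <-]; exists e''.
Defined.

Definition WGraphs : category.
Proof.
refine (@Category wgraph complete_hom id_whom comp_whom _ _ _).
- by move=> E F f; apply: whom_ext.
- by move=> E F f; apply: whom_ext.
- by move=> E F G H h g f; apply: whom_ext.
Defined.

Section WGraphTheory.
Variable E : wgraph.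
Implicit Types v : vertex E.

Definition out v : {fset edge E} := fset_set [set e | src e = v].

Lemma in_out v e : (e \in out v) = (src e == v).
Proof.
rewrite in_fset_set; last exact: row_finite.
by apply/idP/eqP; rewrite inE.
Qed.

Definition vwt v : nat := \max_(e <- out v) wt e.

(* The sorted list w_1(v) < ... < w_k(v) of the distinct weights of the edges
   emitted by [v]; [wti v i] is w_i(v) for 0 <= i <= k, with w_0(v) = 0. *)
Definition wts v : seq nat := sort leq (undup [seq wt e | e <- out v]).
Definition nwts v : nat := size (wts v).
Definition wti v (i : nat) : nat := nth 0%N (0%N :: wts v) i.

Lemma vwt_ge v e : src e = v -> (wt e <= vwt v)%N.
Proof.
move=> ev; apply: (@leq_bigmax_seq _ _ xpredT) => //.
by rewrite in_out ev.
Qed.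
End WGraphTheory.

Section WHomTheory.
Variables (E F : wgraph) (f : complete_hom E F).

Lemma out_hom v : out v != fset0 ->
  perm_eq (out (hv f v)) [seq he f e | e <- out v].
Proof.
move=> /fset0Pn[e0]; rewrite in_out => /eqP e0v.
have v0 : [set e | src e = v] !=set0 by exists e0.
have [ff fi fs] := he_complete f v0.
apply: uniq_perm; first exact: fset_uniq.
  by rewrite map_inj_uniq ?fset_uniq//; apply: he_inj.
move=> e; rewrite in_out; apply/eqP/mapP => [/fs[e' /= ev <-]|[e' + ->]].
  by exists e'; rewrite ?in_out ?ev.
by rewrite in_out => /eqP; apply: ff.
Qed.

Lemma wt_hom v : out v != fset0 ->
  perm_eq [seq wt e | e <- out (hv f v)] [seq wt e | e <- out v].
Proof.
move=> v0; rewrite (perm_trans (perm_map _ (out_hom v0)))//.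
by rewrite -map_comp (eq_map (@he_wt _ _ f)).
Qed.
Lemma vwt_hom v : out v != fset0 -> vwt (hv f v) = vwt v.
Proof.
by move=> /wt_hom p; rewrite /vwt -(big_map (@wt F) xpredT id) (perm_big _ p) big_map.
Qed.
Lemma wts_hom v : out v != fset0 -> wts (hv f v) = wts v.
Proof.
move=> /wt_hom p; apply/perm_sortP.
- exact: leq_total.
- exact: leq_trans.
- exact: anti_leq.
- exact: perm_undup (perm_mem p).
Qed.

Lemma out_vwt (v : vertex E) i : (i < vwt v)%N -> out v != fset0.
Proof.
by move=> h; apply/eqP => v0; move: h; rewrite /vwt v0 big_seq_fset0.
Qed.
Lemma out_nwts (v : vertex E) i : (0 < i <= nwts v)%N -> out v != fset0.
Proof.
move=> h; apply/eqP => v0; move: h.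
by rewrite /nwts /wts v0 size_sort /=; case: i.
Qed.
End WHomTheory.

(* Edge generators are indexed from 0: for [i : 'I_(wt e)], [LEdge i] and
   [LGhost i] stand for the generators e_{i+1} and e_{i+1}^*. *)
Inductive LGen (E : wgraph) :=
  | LVertex of vertex E
  | LEdge (e : edge E) of 'I_(wt e)
  | LGhost (e : edge E) of 'I_(wt e).
Arguments LEdge {E} e _.
Arguments LGhost {E} e _.

Section WeightedLPA.
Variables (K : fieldType) (E : wgraph).
Local Notation term := (algTerm K (LGen E)).

Definition tvertex (v : vertex E) : term := AGen (LVertex v).
(* The conventions e_{i+1} = e_{i+1}^* = 0 for i + 1 > w(e) are built in. *)
Definition tedge (e : edge E) (i : nat) : term :=
  if insub i is Some j then AGen (LEdge e j) else AZero.
Definition tghost (e : edge E) (i : nat) : term :=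
  if insub i is Some j then AGen (LGhost e j) else AZero.

Inductive LRel : term -> term -> Prop :=
  | LR_vertex (u v : vertex E) :
      LRel (AMul (tvertex u) (tvertex v)) (if u == v then tvertex u else AZero)
  | LR_srcE e (i : 'I_(wt e)) :
      LRel (AMul (tvertex (src e)) (tedge e i)) (tedge e i)
  | LR_rngE e (i : 'I_(wt e)) :
      LRel (AMul (tedge e i) (tvertex (rng e))) (tedge e i)
  | LR_rngG e (i : 'I_(wt e)) :
      LRel (AMul (tvertex (rng e)) (tghost e i)) (tghost e i)
  | LR_srcG e (i : 'I_(wt e)) :
      LRel (AMul (tghost e i) (tvertex (src e))) (tghost e i)
  | LR_sum v (i j : 'I_(vwt v)) :
      LRel (\big[@AAdd K _/AZero]_(e <- out v) AMul (tedge e i) (tghost e j))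
           (if i == j then tvertex v else AZero)
  | LR_dual v e f of src e = v & src f = v :
      LRel (\big[@AAdd K _/AZero]_(i < vwt v) AMul (tghost e i) (tedge f i))
           (if e == f then tvertex (rng e) else AZero).

Definition wLPA := presAlg LRel.
HB.instance Definition _ := NUAlgebra.on wLPA.

Lemma algeval_sum (B : nuAlgType K) (g : LGen E -> B) I (s : seq I)
    (F : I -> term) :
  algeval g (\big[@AAdd K _/AZero]_(i <- s) F i) =
  \sum_(i <- s) algeval g (F i).
Proof. exact: (big_morph (algeval g)). Qed.
End WeightedLPA.

Section WLPAFunctor.
Variable K : fieldType.

Section Map.
Variables (E F : wgraph) (f : complete_hom E F).

Definition Lmap_gen (x : LGen E) : wLPA K F :=
  match x with
  | LVertex v => algpi (@LRel K F) (tvertex K (hv f v))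
  | LEdge e i => algpi (@LRel K F) (tedge K (he f e) i)
  | LGhost e i => algpi (@LRel K F) (tghost K (he f e) i)
  end.

Lemma Lmap_edge e i :
  algeval Lmap_gen (tedge K e i) = algpi (@LRel K F) (tedge K (he f e) i).
Proof.
rewrite {1}/tedge; case: insubP => [j _ <-//|]; rewrite -leqNgt => h.
by rewrite /tedge insubN// -leqNgt he_wt.
Qed.
Lemma Lmap_ghost e i :
  algeval Lmap_gen (tghost K e i) = algpi (@LRel K F) (tghost K (he f e) i).
Proof.
rewrite {1}/tghost; case: insubP => [j _ <-//|]; rewrite -leqNgt => h.
by rewrite /tghost insubN// -leqNgt he_wt.
Qed.

Lemma algpi_sum (E' : wgraph) I (s : seq I) (G : I -> algTerm K (LGen E')) :
  algpi (@LRel K E') (\big[@AAdd K _/AZero]_(i <- s) G i) =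
  \sum_(i <- s) algpi (@LRel K E') (G i).
Proof. by apply: big_morph => [t u|]; rewrite ?algpiD. Qed.

Lemma Lmap_rel t u : LRel t u -> algeval Lmap_gen t = algeval Lmap_gen u.
Proof.
have R t' u' : @LRel K F t' u' -> algpi (@LRel K F) t' = algpi (@LRel K F) u'.
  by move=> h; apply/algpiP; apply: AC_rel.
case=> {t u}.
- move=> u v /=; rewrite -algpiM (R _ _ (LR_vertex _ _ _)).
  by rewrite (inj_eq (@hv_inj _ _ f)); case: ifP.
- move=> e i; rewrite [LHS]/= Lmap_edge -algpiM -he_src.
  by have := LR_srcE K (cast_ord (esym (he_wt f e)) i) => /R.
- move=> e i; rewrite [LHS]/= Lmap_edge -algpiM -he_rng.
  by have := LR_rngE K (cast_ord (esym (he_wt f e)) i) => /R.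
- move=> e i; rewrite [LHS]/= Lmap_ghost -algpiM -he_rng.
  by have := LR_rngG K (cast_ord (esym (he_wt f e)) i) => /R.
- move=> e i; rewrite [LHS]/= Lmap_ghost -algpiM -he_src.
  by have := LR_srcG K (cast_ord (esym (he_wt f e)) i) => /R.
- move=> v i j; have v0 := out_vwt (ltn_ord i).
  have wv := vwt_hom f v0.
  have := R _ _ (LR_sum K (cast_ord (esym wv) i) (cast_ord (esym wv) j)).
  rewrite algpi_sum (perm_big _ (out_hom f v0)) big_map /= => S.
  rewrite algeval_sum (eq_bigr (fun e => algpi (@LRel K F)
    (AMul (tedge K (he f e) i) (tghost K (he f e) j)))); last first.
    by move=> e _ /=; rewrite Lmap_edge Lmap_ghost algpiM.
  by rewrite S (inj_eq (@cast_ord_inj _ _ _)); case: ifP.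
- move=> v e g ev gv; have v0 : out v != fset0.
    by apply/fset0Pn; exists e; rewrite in_out ev.
  have h : src (he f e) = hv f v by rewrite he_src ev.
  have h' : src (he f g) = hv f v by rewrite he_src gv.
  have := R _ _ (LR_dual K h h').
  rewrite algpi_sum vwt_hom// => S.
  rewrite algeval_sum (eq_bigr (fun i : 'I_(vwt v) => algpi (@LRel K F)
    (AMul (tghost K (he f e) i) (tedge K (he f g) i)))); last first.
    by move=> i _ /=; rewrite Lmap_edge Lmap_ghost algpiM.
  by rewrite S (inj_eq (@he_inj _ _ f)) he_rng; case: ifP.
Qed.

Definition Lmap : nuHom (wLPA K E) (wLPA K F) := alglift Lmap_rel.
End Map.

Definition Lfunctor : functor WGraphs (NUAlg K).
Proof.
refine (@Functor WGraphs (NUAlg K) (fun E => wLPA K E) Lmap _ _).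
- move=> E; apply: presAlg_ext => x; rewrite alglift_gen /=.
  by case: x => [v|e i|e i] //=; rewrite /tedge /tghost valK.
- move=> E F G g f; apply: presAlg_ext => x; rewrite [LHS]alglift_gen.
  change (Lmap_gen (comp_whom g f) x =
    alglift_fun (Lmap_gen g) (alglift (@Lmap_rel _ _ f) (alggen _ x))).
  rewrite alglift_gen.
  case: x => [v|e i|e i] /=; rewrite [RHS](alglift_pi (@Lmap_rel _ _ g)) //.
    by rewrite Lmap_edge.
  by rewrite Lmap_ghost.
Defined.
End WLPAFunctor.

(* For [i : 'I_(nwts v).-1], [MQ v i] stands for the generator q_{i+1}^v. *)
Inductive MGens (E : wgraph) :=
  | MVertex of vertex E
  | MQ (v : vertex E) of 'I_(nwts v).-1.
Arguments MQ {E} v _.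

Section WMonoid.
Variable E : wgraph.
Local Notation term := (monTerm (MGens E)).

Definition mvertex (v : vertex E) : term := MGen (MVertex v).
(* q_i^v, with q_0^v = q_k^v = 0 for k = nwts v. *)
Definition mq (v : vertex E) (i : nat) : term :=
  if i is i'.+1 then
    if insub i' is Some j then MGen (MQ v j) else MZero
  else MZero.

Inductive MRel : term -> term -> Prop :=
  | MR_rel v i of (0 < i <= nwts v)%N :
      MRel (MAdd (mq v i.-1)
                 (iter (wti v i - wti v i.-1) (MAdd (mvertex v)) MZero))
           (MAdd (mq v i)
                 (\big[@MAdd _/MZero]_(e <- out v | wt e == wti v i)
                    mvertex (rng e))).

Definition wmon := presMon MRel.
HB.instance Definition _ := GRing.Nmodule.on wmon.
End WMonoid.

Section WMonoidFunctor.

Section Map.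
Variables (E F : wgraph) (f : complete_hom E F).

Definition Mmap_gen (x : MGens E) : wmon F :=
  match x with
  | MVertex v => monpi (@MRel F) (mvertex (hv f v))
  | MQ v i => monpi (@MRel F) (mq (hv f v) i.+1)
  end.

Lemma Mmap_q v i : out v != fset0 ->
  moneval Mmap_gen (mq v i) = monpi (@MRel F) (mq (hv f v) i).
Proof.
move=> v0; case: i => //= i; case: insubP => [j _ <-//|h].
by rewrite insubN// /nwts wts_hom.
Qed.

Lemma moneval_sum (X : Type) (N : nmodType) (g : X -> N) I (s : seq I)
    (P : pred I) (G : I -> monTerm X) :
  moneval g (\big[@MAdd _/MZero]_(i <- s | P i) G i) =
  \sum_(i <- s | P i) moneval g (G i).
Proof. exact: (big_morph (moneval g)). Qed.
Lemma moneval_iter (X : Type) (N : nmodType) (g : X -> N) n t :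
  moneval g (iter n (MAdd t) MZero) = moneval g t *+ n.
Proof. by elim: n => //= n ->; rewrite mulrS. Qed.
Lemma monpiE (X : Type) (r : monTerm X -> monTerm X -> Prop) t :
  monpi r t = moneval (mongen r) t.
Proof. by elim: t => //= t <- u <-; rewrite monpiD. Qed.

Lemma Mmap_rel t u : MRel t u -> moneval Mmap_gen t = moneval Mmap_gen u.
Proof.
case=> {t u} v i hi; have v0 := out_nwts hi.
have hi' : (0 < i <= nwts (hv f v))%N by rewrite /nwts wts_hom.
have /monpiP := MC_rel (MR_rel hi').
rewrite !monpiD /wti wts_hom// => S.
rewrite /= !Mmap_q// moneval_iter moneval_sum.
move: S; rewrite [X in _ + X = _]monpiE [X in _ = _ + X]monpiE.
rewrite moneval_iter moneval_sum -big_filter.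
have p := perm_filter (fun e => wt e == nth 0%N (0%N :: wts v) i)
  (out_hom f v0).
rewrite (perm_big _ p) filter_map big_map big_filter => S.
rewrite S; congr (_ + _); apply: eq_big => [e|e _] /=.
  by rewrite he_wt.
by rewrite he_rng.
Qed.

Definition Mmap : {additive wmon E -> wmon F} := monlift Mmap_rel.
End Map.

Definition Mfunctor : functor WGraphs AbMon.
Proof.
refine (@Functor WGraphs AbMon wmon Mmap _ _).
- move=> E; apply: presMon_ext => x; rewrite monlift_gen /=.
  by case: x => [v|v i] //=; rewrite valK.
- move=> E F G g f; apply: presMon_ext => x; rewrite [LHS]monlift_gen.
  change (Mmap_gen (comp_whom g f) x =
    monlift_fun (Mmap_gen g) (monlift (@Mmap_rel _ _ f) (mongen _ x))).
  rewrite monlift_gen.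
  case: x => [v|v i]; rewrite [RHS](monlift_pi (@Mmap_rel _ _ g)) //.
  rewrite Mmap_q//.
  have h : (0 < i.+1 <= nwts v)%N.
    by have := ltn_ord i; case: (nwts v) i => [|n] i //= /leqW.
  apply/fset0Pn; have /fset0Pn[e] := out_nwts h; rewrite in_out => /eqP ev.
  by exists (he f e); rewrite in_out he_src ev.
Defined.
End WMonoidFunctor.

(* A not necessarily unital algebra with a two-sided identity, as a ring. *)
Section UnitalRing.
Variables (K : comPzRingType) (A : nuAlgType K) (u : A).
Hypothesis hu : left_id u nmul /\ right_id u nmul.
Definition unital_ring of left_id u nmul /\ right_id u nmul : Type := A.
HB.instance Definition _ := GRing.Zmodule.on (unital_ring hu).
HB.instance Definition _ := GRing.Zmodule_isPzRing.Build (unital_ring hu)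
  (@nmulA K A) hu.1 hu.2 (@nmulDl K A) (@nmulDr K A).
End UnitalRing.

Definition projective (R : pzRingType) (P : lmodType R) : Prop :=
  forall (M N : lmodType R) (g : {linear M -> N}) (f : {linear P -> N}),
    (forall y, exists x, g x = y) ->
    exists h : {linear P -> M}, forall x, g (h x) = f x.

Record left_ideal (R : pzRingType) (I : submodClosed R^o) :=
  LeftIdeal { ideal_val : R^o; _ : ideal_val \in I }.
HB.instance Definition _ (R : pzRingType) (I : submodClosed R^o) :=
  [isSub for @ideal_val R I].
HB.instance Definition _ (R : pzRingType) (I : submodClosed R^o) :=
  [Choice of left_ideal I by <:].
HB.instance Definition _ (R : pzRingType) (I : submodClosed R^o) :=
  [SubChoice_isSubLmodule of left_ideal I by <:].

Definition left_hereditary (R : pzRingType) : Prop :=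
  forall I : submodClosed R^o, projective (left_ideal I).

(* Right modules over [R] are left modules over the converse ring. *)
Definition right_hereditary (R : pzRingType) : Prop := left_hereditary R^c.

Section FiniteWLPA.
Variables (K : fieldType) (E : wgraph) (finE : finite_wgraph E).

Definition wLPA_one : wLPA K E :=
  \sum_(v <- fset_set [set: vertex E]) algpi (@LRel K E) (tvertex K v).

Lemma wLPA_oneP : left_id wLPA_one nmul /\ right_id wLPA_one nmul.
Proof.
have R t u : @LRel K E t u -> algpi (@LRel K E) t = algpi (@LRel K E) u.
  by move=> h; apply/algpiP; apply: AC_rel.
have inV v : v \in fset_set [set: vertex E].
  by rewrite in_fset_set ?inE//; exact: finE.1.
have vv u v : algpi (@LRel K E) (tvertex K u) ** algpi (@LRel K E) (tvertex K v)
    = if u == v then algpi (@LRel K E) (tvertex K v) else 0.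
  by rewrite -algpiM (R _ _ (LR_vertex K u v)); case: eqP => [->|].
have onev v : wLPA_one ** algpi (@LRel K E) (tvertex K v) =
    algpi (@LRel K E) (tvertex K v).
  rewrite nmul_suml (eq_bigr _ (fun u _ => vv u v)) -big_mkcond /=.
  by rewrite -big_filter filter_pred1_uniq ?fset_uniq// big_seq1.
have vone v : algpi (@LRel K E) (tvertex K v) ** wLPA_one =
    algpi (@LRel K E) (tvertex K v).
  rewrite nmul_sumr (eq_bigr _ (fun u _ => vv v u)) -big_mkcond /=.
  rewrite -big_filter (eq_filter (_ : _ =1 pred1 v)).
    by rewrite filter_pred1_uniq ?fset_uniq// big_seq1.
  by move=> u; rewrite /= eq_sym.
split=> x; have [t ->] := algpi_surj x.
  elim: t => [[v|e i|e i]||t IHt u IHu|a t IHt|t IHt u IHu].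
  - exact: onev.
  - have := R _ _ (LR_srcE K i); rewrite /tedge valK algpiM => <-.
    by rewrite nmulA onev.
  - have := R _ _ (LR_rngG K i); rewrite /tghost valK algpiM => <-.
    by rewrite nmulA onev.
  - exact: nmul0r.
  - by rewrite algpiD nmulDr IHt IHu.
  - by rewrite algpiZ nmulZr IHt.
  - by rewrite algpiM nmulA IHt.
elim: t => [[v|e i|e i]||t IHt u IHu|a t IHt|t IHt u IHu].
- exact: vone.
- have := R _ _ (LR_rngE K i); rewrite /tedge valK algpiM => <-.
  by rewrite -nmulA vone.
- have := R _ _ (LR_srcG K i); rewrite /tghost valK algpiM => <-.
  by rewrite -nmulA vone.
- exact: nmul0l.
- by rewrite algpiD nmulDl IHt IHu.
- by rewrite algpiZ nmulZl IHt.
- by rewrite algpiM -nmulA IHu.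
Qed.

Definition wLPA_ring : pzRingType := unital_ring wLPA_oneP.
End FiniteWLPA.

(* Main.v *)
(* The Leavitt algebra L = L_K(E, w) is a full corner of an algebra A whose
   vertices are the generators v and q_i^v of M: for each relation of M, A has a
   pair of mutually inverse rectangular matrices X_t between the projections of
   its two sides. In L, q_i^v corresponds to the complement, in w_i(v) copies of
   v, of the projections e e^* for the edges e of weight at most w_i(v).

   V(A) is computed by hand. A has a basis of words, and an idempotent matrix
   [e] over A is presented by a finite dimensional graded space Z of its row
   module, with the relations x_i = \sum_j X_ij x_j holding inside Z as only
   relations. One shrinks Z in steps: cutting by a functional which vanishes on
   the relations splits off a summand u A, cutting by a family of functionals
   which sees a single side of a single relation replaces one generating system
   by an isomorphic one. Coefficients at words of maximal length always provide
   such a step, so e is a sum of vertices; the steps are confluent, so the total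
   of the vertices split off is well defined modulo the relations of M.

   For heredity, a K-linear lift s of f : I -> N along g : M -> N has a defect
   l s(x) - s(l x), a derivation of L with values in Hom_K(I, ker g). It extends
   to Hom_K(L, ker g) since the defining relations of L, X X^* = 1 and X^* X = 1
   with prescribed zeros, can be deformed to first order; evaluating the
   extension at 1 corrects s into an L-linear lift. *)
From HB Require Import structures.
Require Import Defs.
From mathcomp Require Import all_boot all_order all_algebra finmap.
From mathcomp Require Import all_classical.

Set Implicit Arguments.
Unset Strict Implicit.
Unset Printing Implicit Defensive.

Import GRing.Theory.
Local Open Scope classical_set_scope.
Local Open Scope ring_scope.

(** * Linear endomorphisms and matrix units *)

(** In L the matrix X = (e_i) of a vertex has prescribed zero entries, so X X^* = 1 and X^* X = 1
    offer no evident monomial normal form. In A each relation says that two full rectangular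
    matrices of letters are inverse. Eliminating one middle label per product leaves overlaps that
    resolve, and an explicit action on functions of words shows the remaining words to be
    independent. A coefficient at a word of maximal length is nonzero on a relation x_i = \sum_j
    X_ij x_j only if the word starts with a letter of that relation: otherwise some component of the
    other side would contain a longer word. This is why such a coefficient either vanishes on all
    relations or belongs to a family seeing one side of one relation. The relations of M enter at a
    single point, where two families see opposite sides of the same relation: one order of cutting
    splits off the vertices of one side, the other order those of the other side. For heredity,
    inverting X + d to first order gives X^* - X^* d X^*, which need not have the zeros prescribed
    for X^*. Changing d by a term X b X repairs this, and a comparison of weights shows that the
    zeros of X survive. *)

Section LinearEndo.
Variables (K : comPzRingType) (V : lmodType K).

Definition is_lin : {pred V -> V} := [pred f | `[< linear f >]].

Lemma is_lin_submod : submod_closed is_lin.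
Proof.
split=> [|a f g]; rewrite !inE.
  by move=> b x y; have E z : (0 : V -> V) z = 0 by [];
    rewrite !E scaler0 addr0.
move=> lf lg b x y; have E z : (a *: f + g) z = a *: f z + g z by [].
by rewrite !E lf lg !scalerDr !scalerA mulrC addrACA.
Qed.
HB.instance Definition _ :=
  GRing.isSubmodClosed.Build K _ is_lin is_lin_submod.

Record lendo := Lendo { lendo_val :> V -> V; _ : lendo_val \in is_lin }.
HB.instance Definition _ := [isSub for lendo_val].
HB.instance Definition _ := [Choice of lendo by <:].
HB.instance Definition _ := [SubChoice_isSubLmodule of lendo by <:].

Lemma lendo_ext (f g : lendo) : (forall x, f x = g x) -> f = g.
Proof. by move=> fg; apply: val_inj; apply/funext. Qed.
Lemma lendo_lin (f : lendo) : linear f.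
Proof. by have := valP f; rewrite inE. Qed.
Lemma lendoD (f g : lendo) x : (f + g) x = f x + g x. Proof. by []. Qed.
Lemma lendoZ a (f : lendo) x : (a *: f) x = a *: f x. Proof. by []. Qed.
Lemma lendo0 x : (0 : lendo) x = 0. Proof. by []. Qed.
Lemma lendo_sum J (r : seq J) (P : pred J) (F : J -> lendo) x :
  (\sum_(i <- r | P i) F i) x = \sum_(i <- r | P i) F i x.
Proof. by apply: (big_morph (fun f : lendo => f x)). Qed.
Lemma lendo_r0 (f : lendo) : f 0 = 0.
Proof.
have /eqP := lendo_lin f 1 0 0; rewrite !scale1r addr0 -[X in X == _]addr0.
by rewrite eq_sym => /eqP/addrI.
Qed.
Lemma lendo_rD (f : lendo) x y : f (x + y) = f x + f y.
Proof. by have := lendo_lin f 1 x y; rewrite !scale1r. Qed.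
Lemma lendo_rZ (f : lendo) a x : f (a *: x) = a *: f x.
Proof. by have := lendo_lin f a x 0; rewrite !addr0 lendo_r0 addr0. Qed.
Lemma lendo_rN (f : lendo) x : f (- x) = - f x.
Proof. by rewrite -!scaleN1r lendo_rZ. Qed.
Lemma lendo_rB (f : lendo) x y : f (x - y) = f x - f y.
Proof. by rewrite lendo_rD lendo_rN. Qed.
Lemma lendo_rsum (f : lendo) J (r : seq J) (P : pred J) (F : J -> V) :
  f (\sum_(i <- r | P i) F i) = \sum_(i <- r | P i) f (F i).
Proof. exact: (big_morph f (lendo_rD f) (lendo_r0 f)). Qed.

Lemma lcomp_lin (f g : lendo) : f \o g \in is_lin.
Proof. by rewrite inE => a x y /=; rewrite !lendo_lin. Qed.
Definition lcomp (f g : lendo) : lendo := Lendo (lcomp_lin f g).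
Lemma lcompA : associative lcomp.
Proof. by move=> f g h; apply: lendo_ext. Qed.
Lemma lcompDl : left_distributive lcomp +%R.
Proof. by move=> f g h; apply: lendo_ext. Qed.
Lemma lcompDr : right_distributive lcomp +%R.
Proof. by move=> f g h; apply: lendo_ext => x; apply: lendo_rD. Qed.
Lemma lcompZl a f g : lcomp (a *: f) g = a *: lcomp f g.
Proof. exact: lendo_ext. Qed.
Lemma lcompZr a f g : lcomp f (a *: g) = a *: lcomp f g.
Proof. by apply: lendo_ext => x; apply: lendo_rZ. Qed.
HB.instance Definition _ := Lmodule_isNUAlgebra.Build K lendo
  lcompA lcompDl lcompDr lcompZl lcompZr.

Lemma lendoM (f g : lendo) x : (f ** g) x = f (g x). Proof. by []. Qed.
End LinearEndo.

Section NUAlgExtra.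
Variables (K : comPzRingType) (A : nuAlgType K).
Implicit Types x y z : A.
Lemma nmulNl x y : (- x) ** y = - (x ** y).
Proof. by rewrite -scaleN1r nmulZl scaleN1r. Qed.
Lemma nmulNr x y : x ** (- y) = - (x ** y).
Proof. by rewrite -scaleN1r nmulZr scaleN1r. Qed.
Lemma nmulBl x y z : (x - y) ** z = x ** z - y ** z.
Proof. by rewrite nmulDl nmulNl. Qed.
Lemma nmulBr x y z : z ** (x - y) = z ** x - z ** y.
Proof. by rewrite nmulDr nmulNr. Qed.
End NUAlgExtra.

Section MatrixUnits.
Variables (K : comPzRingType) (A : nuAlgType K).

Lemma munit_finsupp p q (x : A) :
  (fun i j => if (i == p) && (j == q) then x else 0) \in @finsupp_mx K A.
Proof.
rewrite inE; exists (maxn p q).+1 => i j.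
case: eqP => [->|//]; case: eqP => [->|//] /=.
by rewrite !gtn_max !ltnn andbF.
Qed.
Definition munit p q x : matInf A := MatInf (munit_finsupp p q x).

Lemma munitE p q x i j :
  munit p q x i j = if (i == p) && (j == q) then x else 0.
Proof. by []. Qed.
Lemma munit00E x : munit 0 0 x 0%N 0%N = x. Proof. by []. Qed.

Lemma munit_is_linear p q : linear (munit p q).
Proof.
move=> a x y; apply: matInf_ext => i j; rewrite matD matZ !munitE.
by case: ifP => _ //; rewrite scaler0 addr0.
Qed.
HB.instance Definition _ p q :=
  GRing.isLinear.Build K A (matInf A) *:%R (munit p q) (munit_is_linear p q).

Lemma munit_corner p q x m n : (p < m)%N -> (q < n)%N ->
  corner m n (munit p q x).
Proof.
move=> pm qn i j h; rewrite munitE; case: eqP => [ip|//];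
  case: eqP => [jq|//] /=.
by move: h; rewrite ip jq leqNgt pm leqNgt qn.
Qed.

Lemma munitM p q x p' q' y :
  munit p q x ** munit p' q' y = if q == p' then munit p q' (x ** y) else 0.
Proof.
apply: matInf_ext => i j.
have c : corner p.+1 (maxn q p').+1 (munit p q x).
  by apply: munit_corner; rewrite ?ltnS ?leq_maxl.
rewrite (matMEl _ c) (eq_bigr (fun k : 'I_(maxn q p').+1 =>
   if (k : nat) == q then (if (i == p) then x else 0) **
     (if ((q == p')) && (j == q') then y else 0) else 0)); last first.
  by move=> k _; rewrite !munitE; case: (eqVneq (k : nat) q) => [->|_];
    rewrite ?andbT ?andbF ?nmul0l.
rewrite -big_mkcond /= (big_ord1_eq _ (fun k : nat =>
  (if (i == p) then x else 0) **
     (if ((q == p')) && (j == q') then y else 0))).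
rewrite ltnS leq_maxl; case: (q == p'); last by rewrite mat0 nmul0r.
rewrite munitE; case: (i == p); last by rewrite nmul0l.
by case: (j == q'); rewrite ?nmul0r.
Qed.
Lemma munit00M x y : munit 0 0 x ** munit 0 0 y = munit 0 0 (x ** y).
Proof. by rewrite munitM. Qed.

Lemma mat_sum J (r : seq J) (P : pred J) (F : J -> matInf A) i j :
  (\sum_(k <- r | P k) F k) i j = \sum_(k <- r | P k) F k i j.
Proof. by apply: (big_morph (fun f : matInf A => f i j)). Qed.

Lemma mat_munits m n (x : matInf A) : corner m n x ->
  x = \sum_(i < m) \sum_(j < n) munit i j (x i j).
Proof.
move=> cx; apply: matInf_ext => k l; rewrite mat_sum.
rewrite (eq_bigr (fun i : 'I_m => if (i : nat) == k then
   (if (l < n)%N then x i l else 0) else 0)); last first.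
  move=> i _; rewrite mat_sum; case: eqP => [ik|/eqP ik]; last first.
    by rewrite big1// => j _; rewrite munitE eq_sym (negbTE ik).
  rewrite (eq_bigr (fun j : 'I_n => if (j : nat) == l then x i j else 0)).
    by rewrite -big_mkcond /= (big_ord1_eq _ (fun j : nat => x i j)).
  by move=> j _; rewrite munitE ik eqxx eq_sym.
rewrite -big_mkcond /= (big_ord1_eq _ (fun i : nat =>
  if (l < n)%N then x i l else 0)).
case: ltnP => km; last by rewrite cx ?km.
by case: ltnP => ln //; rewrite cx ?ln ?orbT.
Qed.

Lemma munit_mulE i p (x : A) (m : matInf A) k j :
  (munit i p x ** m) k j = if k == i then x ** m p j else 0.
Proof.
have c : corner i.+1 p.+1 (munit i p x) by exact: munit_corner.
rewrite (matMEl _ c) (eq_bigr (fun l : 'I_p.+1 => if (l : nat) == p then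
   (if k == i then x ** m p j else 0) else 0)); last first.
  move=> l _; rewrite munitE; case: (eqVneq (l : nat) p) => [->|_].
    by rewrite andbT; case: ifP; rewrite ?nmul0l.
  by rewrite andbF nmul0l.
rewrite -big_mkcond /=.
by rewrite (big_ord1_eq _ (fun _ : nat => if k == i then x ** m p j else 0))
  ltnSn.
Qed.
Lemma mul_munitE q j (x : A) (m : matInf A) k l :
  (m ** munit q j x) k l = if l == j then m k q ** x else 0.
Proof.
have c : corner q.+1 j.+1 (munit q j x) by exact: munit_corner.
rewrite (matMEr _ c) (eq_bigr (fun p : 'I_q.+1 => if (p : nat) == q then
   (if l == j then m k q ** x else 0) else 0)); last first.
  move=> p _; rewrite munitE; case: (eqVneq (p : nat) q) => [->|_].
    by case: (l == j); rewrite //= nmul0r.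
  by rewrite nmul0r.
rewrite -big_mkcond /=.
by rewrite (big_ord1_eq _ (fun _ : nat => if l == j then m k q ** x else 0))
  ltnSn.
Qed.
End MatrixUnits.

Section MvnTools.
Variables (K : comPzRingType) (A : nuAlgType K).
Implicit Types e f : matInf A.

Lemma VpiD (e f g : idem A) : idemval e ** idemval f = 0 ->
  idemval f ** idemval e = 0 -> idemval g = idemval e + idemval f ->
  Vpi g = Vpi e + Vpi f.
Proof.
move=> ef fe gE; apply/esym; apply: (@VaddE _ _ e f g e f) => //;
  by rewrite ?idemE//; apply: mvn_refl; rewrite idemE.
Qed.

Definition mkidem e (h : e ** e = e) : idem A := @Idem K A e (introT eqP h).

Lemma Vpi_eq0 (e : idem A) : idemval e = 0 -> Vpi e = 0.
Proof.
move=> e0; rewrite [RHS](_ : _ = Vpi (idem0 A))//; congr Vpi.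
by apply: val_inj; rewrite /= e0.
Qed.
End MvnTools.

(** * Local units from orthogonal idempotents *)

Section LocalUnits.
Variables (K : comPzRingType) (B : nuAlgType K) (U : eqType) (eV : U -> B).
Hypothesis eVV : forall u u', eV u ** eV u' = if u == u' then eV u else 0.
Definition vone (s : seq U) : B := \sum_(u <- s) eV u.
Lemma voneV (s : seq U) u : uniq s ->
  vone s ** eV u = if u \in s then eV u else 0.
Proof.
move=> us; rewrite nmul_suml (eq_bigr (fun u' => if u' == u then eV u else 0)).
  rewrite -big_mkcond -big_filter; case: ifP => us'.
    by rewrite filter_pred1_uniq// big_seq1.
  rewrite big1_seq// => v /andP[_]; rewrite mem_filter => /andP[/eqP->].
  by rewrite us'.
by move=> u' _; rewrite eVV; case: eqP => [->|].
Qed.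
Lemma Vvone (s : seq U) u : uniq s ->
  eV u ** vone s = if u \in s then eV u else 0.
Proof.
move=> us; rewrite nmul_sumr (eq_bigr (fun u' => if u' == u then eV u else 0)).
  rewrite -big_mkcond -big_filter; case: ifP => us'.
    by rewrite filter_pred1_uniq// big_seq1.
  rewrite big1_seq// => v /andP[_]; rewrite mem_filter => /andP[/eqP->].
  by rewrite us'.
by move=> u' _; rewrite eVV eq_sym.
Qed.
Lemma voneM (s s' : seq U) : uniq s -> uniq s' -> {subset s <= s'} ->
  vone s' ** vone s = vone s /\ vone s ** vone s' = vone s.
Proof.
move=> us us' ss'; split.
  by rewrite nmul_sumr; apply: eq_big_seq => u hu; rewrite voneV// ss'.
by rewrite nmul_suml; apply: eq_big_seq => u hu; rewrite Vvone// ss'.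
Qed.

Definition has_unit x := exists s, [/\ uniq s,
  vone s ** x = x & x ** vone s = x].
Lemma has_unit_widen s s' x : uniq s -> uniq s' -> {subset s <= s'} ->
  vone s ** x = x -> x ** vone s = x -> vone s' ** x = x /\ x ** vone s' = x.
Proof.
move=> us us' ss' sx xs; have [h1 h2] := voneM us us' ss'; split.
  by rewrite -sx nmulA h1.
by rewrite -xs -nmulA h2.
Qed.
Lemma has_unit2 x y : has_unit x -> has_unit y -> exists s, [/\ uniq s,
  vone s ** x = x /\ x ** vone s = x & vone s ** y = y /\ y ** vone s = y].
Proof.
move=> [s [us sx xs]] [s' [us' sy ys]]; exists (undup (s ++ s')).
have uss : uniq (undup (s ++ s')) by apply: undup_uniq.
split=> //; [apply: has_unit_widen us uss _ sx xs|apply: has_unit_widen us' uss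
  _ sy ys].
  by move=> u hu; rewrite mem_undup mem_cat hu.
by move=> u hu; rewrite mem_undup mem_cat hu orbT.
Qed.
Lemma has_unit_gen u u' x : eV u ** x = x -> x ** eV u' = x -> has_unit x.
Proof.
move=> ux xu; exists (undup [:: u; u']).
have us : uniq (undup [:: u; u']) by apply: undup_uniq.
split=> //.
  by rewrite -{1}ux nmulA voneV// mem_undup inE eqxx ux.
by rewrite -{1}xu -nmulA Vvone// mem_undup !inE eqxx orbT xu.
Qed.
Lemma has_unit0 : has_unit 0.
Proof. by exists [::]; rewrite nmul0l nmul0r. Qed.
Lemma has_unitD x y : has_unit x -> has_unit y -> has_unit (x + y).
Proof.
move=> hx hy; have [s [us [sx xs] [sy ys]]] := has_unit2 hx hy.
by exists s; rewrite nmulDl nmulDr sx xs sy ys.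
Qed.
Lemma has_unitZ a x : has_unit x -> has_unit (a *: x).
Proof. by move=> [s [us sx xs]]; exists s; rewrite nmulZl nmulZr sx xs. Qed.
Lemma has_unitM x y : has_unit x -> has_unit y -> has_unit (x ** y).
Proof.
move=> hx hy; have [s [us [sx xs] [sy ys]]] := has_unit2 hx hy.
by exists s; rewrite nmulA sx -nmulA ys.
Qed.
End LocalUnits.

Section MapMatInf.
Variables (K : comPzRingType) (A B : nuAlgType K) (f : nuHom A B).
Implicit Types M N : matInf A.

Lemma map_matInfE M i j : map_matInf f M i j = f (M i j). Proof. by []. Qed.
Lemma map_matInfD M N : map_matInf f (M + N) = map_matInf f M + map_matInf f N.
Proof. by apply: matInf_ext => i j; rewrite map_matInfE !matD !map_matInfE
  raddfD. Qed.
Lemma map_matInf0 : map_matInf f 0 = 0.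
Proof. by apply: matInf_ext => i j; rewrite map_matInfE !mat0 raddf0. Qed.
Lemma map_matInfB M N : map_matInf f (M - N) = map_matInf f M - map_matInf f N.
Proof. by apply/eqP; rewrite eq_sym subr_eq -map_matInfD subrK. Qed.
Lemma map_matInf_sum J (r : seq J) (P : pred J) (F : J -> matInf A) :
  map_matInf f (\sum_(j <- r | P j) F j) = \sum_(j <- r |
    P j) map_matInf f (F j).
Proof. exact: (big_morph _ map_matInfD map_matInf0). Qed.
Lemma map_munit i j x : map_matInf f (munit i j x) = munit i j (f x).
Proof.
apply: matInf_ext => k l; rewrite map_matInfE !munitE.
by case: ifP => // _; rewrite raddf0.
Qed.
End MapMatInf.

(** * The algebra of a system of inverse matrices *)

(* For a type t, [bsd t true] and [bsd t false] label two families of vertices;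
   the algebra [balg] makes their direct sums isomorphic, by the inverse
   matrices [bX t true] and [bX t false]. *)
Record bsys := BSys {
  bvert : choiceType;
  btype : choiceType;
  blab : choiceType;
  bsd : btype -> bool -> seq blab;
  bvx : btype -> bool -> blab -> bvert;
  bsd_uniq : forall t d, uniq (bsd t d);
  bsd_ne : forall t d i, i \in bsd t d -> exists j, j \in bsd t (~~ d) }.

Section BAlgebra.
Variables (K : fieldType) (S : bsys).
Local Notation U := (bvert S).
Local Notation T := (btype S).
Local Notation I := (blab S).
Local Notation sd := (@bsd S).
Local Notation vx := (@bvx S).

Inductive BGen := BVertex of U | BLetter (t : T) (d : bool) (i j : I).
Local Notation term := (algTerm K BGen).
Definition tV u : term := AGen (BVertex u).
Definition tX t d i j : term := AGen (BLetter t d i j).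

Inductive BRel : term -> term -> Prop :=
  | BR_vertex u u' : BRel (AMul (tV u) (tV u')) (if u == u' then tV u else
    AZero)
  | BR_src t d i j : BRel (AMul (tV (vx t d i)) (tX t d i j)) (tX t d i j)
  | BR_rng t d i j : BRel (AMul (tX t d i j) (tV (vx t (~~ d) j))) (tX t d i j)
  | BR_bad t d i j of ~~ ((i \in sd t d) && (j \in sd t (~~ d))) :
      BRel (tX t d i j) AZero
  | BR_inv t d i i' of i \in sd t d & i' \in sd t d :
      BRel (\big[@AAdd K _/AZero]_(j <- sd t (~~ d))
              AMul (tX t d i j) (tX t (~~ d) j i'))
           (if i == i' then tV (vx t d i) else AZero).

Definition balg := presAlg BRel.
HB.instance Definition _ := NUAlgebra.on balg.

Definition bV u : balg := algpi BRel (tV u).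
Definition bX t d i j : balg := algpi BRel (tX t d i j).

Lemma balgR t u : BRel t u -> algpi BRel t = algpi BRel u.
Proof. by move=> h; apply/algpiP; apply: AC_rel. Qed.
Lemma bVV u u' : bV u ** bV u' = if u == u' then bV u else 0.
Proof. by rewrite -algpiM (balgR (BR_vertex _ _)); case: eqP. Qed.
Lemma bVid u : bV u ** bV u = bV u.
Proof. by rewrite bVV eqxx. Qed.
Lemma bVX t d i j : bV (vx t d i) ** bX t d i j = bX t d i j.
Proof. by rewrite -algpiM (balgR (BR_src _ _ _ _)). Qed.
Lemma bXV t d i j : bX t d i j ** bV (vx t (~~ d) j) = bX t d i j.
Proof. by rewrite -algpiM (balgR (BR_rng _ _ _ _)). Qed.
Lemma bX_bad t d i j : ~~ ((i \in sd t d) && (j \in sd t (~~ d))) ->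
  bX t d i j = 0.
Proof. by move=> h; rewrite /bX (balgR (BR_bad h)). Qed.
Lemma bXX t d i i' : i \in sd t d -> i' \in sd t d ->
  \sum_(j <- sd t (~~ d)) bX t d i j ** bX t (~~ d) j i' =
  if i == i' then bV (vx t d i) else 0.
Proof.
move=> hi hi'; transitivity (algpi BRel (\big[@AAdd K _/AZero]_(j <- sd t (~~
  d))
              AMul (tX t d i j) (tX t (~~ d) j i'))).
  by rewrite (big_morph (algpi BRel) (algpiD BRel) (algpi0 BRel));
    apply: eq_bigr => j _; rewrite algpiM.
by rewrite (balgR (BR_inv hi hi')); case: ifP.
Qed.

Section BLift.
Variables (B : nuAlgType K) (eV : U -> B) (eX : T -> bool -> I -> I -> B).
Hypothesis eVV : forall u u', eV u ** eV u' = if u == u' then eV u else 0.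
Hypothesis eVX : forall t d i j, eV (vx t d i) ** eX t d i j = eX t d i j.
Hypothesis eXV : forall t d i j, eX t d i j ** eV (vx t (~~ d) j) = eX t d i j.
Hypothesis eX_bad : forall t d i j,
  ~~ ((i \in sd t d) && (j \in sd t (~~ d))) -> eX t d i j = 0.
Hypothesis eXX : forall t d i i', i \in sd t d -> i' \in sd t d ->
  \sum_(j <- sd t (~~ d)) eX t d i j ** eX t (~~ d) j i' =
  if i == i' then eV (vx t d i) else 0.

Definition bgen (x : BGen) : B :=
  match x with BVertex u => eV u | BLetter t d i j => eX t d i j end.
Lemma bgen_rel t u : BRel t u -> algeval bgen t = algeval bgen u.
Proof.
case=> {t u}.
- by move=> u u' /=; rewrite eVV; case: eqP.
- by move=> t d i j /=; rewrite eVX.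
- by move=> t d i j /=; rewrite eXV.
- by move=> t d i j h /=; rewrite eX_bad.
- move=> t d i i' hi hi'; rewrite (big_morph (algeval bgen)
    (id1 := 0) (op1 := +%R))//= eXX//; by case: ifP.
Qed.
Definition blift : nuHom balg B := alglift bgen_rel.
Lemma blift_V u : blift (bV u) = eV u. Proof. exact: alglift_gen. Qed.
Lemma blift_X t d i j : blift (bX t d i j) = eX t d i j.
Proof. exact: alglift_gen. Qed.
End BLift.

Lemma balg_ind (P : balg -> Prop) :
  (forall u, P (bV u)) -> (forall t d i j, P (bX t d i j)) -> P 0 ->
  (forall x y, P x -> P y -> P (x + y)) -> (forall a x, P x -> P (a *: x)) ->
  (forall x y, P x -> P y -> P (x ** y)) -> forall x, P x.
Proof.
move=> PV PX P0 PD PZ PM x; have [t ->] := algpi_surj x.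
elim: t => [[u|t d i j]||t IHt u IHu|a t IHt|t IHt u IHu].
- exact: PV.
- exact: PX.
- exact: P0.
- by rewrite algpiD; apply: PD.
- by rewrite algpiZ; apply: PZ.
- by rewrite algpiM; apply: PM.
Qed.

Definition bone (s : seq U) : balg := vone bV s.
Definition boneM := voneM bVV.

Lemma local_unit x : exists s, [/\ uniq s, bone s ** x = x & x ** bone s = x].
Proof.
rewrite -/(has_unit bV x); elim/balg_ind: x.
- by move=> u; apply: (has_unit_gen bVV); apply: bVid.
- by move=> t d i j; apply: (has_unit_gen bVV); [apply: bVX|apply: bXV].
- exact: has_unit0.
- by move=> x y; apply: (has_unitD bVV).
- by move=> a x; apply: has_unitZ.
- by move=> x y; apply: (has_unitM bVV).
Qed.

(** * Words and their normal form *)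

Definition letter := (T * bool * I * I)%type.
Definition word := seq letter.
Definition vend (b : U) (w : word) : U :=
  if w is (t, d, i, _) :: _ then vx t d i else b.
(* [i] is the distinguished label of the side [d] of [t]. *)
Definition isb t d (i : I) : bool := i == head i (sd t d).
Definition whd t d (i : I) (w : word) : option (I * word) :=
  if w is (t', d', i', j) :: w' then
    if [&& t' == t, d' == d & i' == i] then Some (j, w') else None
  else None.
(* The letter [(t, d, i, j)] may precede [w]: using the relation BR_inv one
   eliminates the products in which the middle label is distinguished. *)
Definition junc t d (j : I) (w : word) : bool :=
  ~~ (isb t (~~ d) j && whd t (~~ d) j w).
Definition okl t d (i j : I) := (i \in sd t d) && (j \in sd t (~~ d)).
Fixpoint valid (b : U) (w : word) : bool :=
  if w is (t, d, i, j) :: w' then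
    [&& okl t d i j, vx t (~~ d) j == vend b w', junc t d j w' & valid b w']
  else true.

Lemma validE b t d i j w : valid b ((t, d, i, j) :: w) =
  [&& okl t d i j, vx t (~~ d) j == vend b w, junc t d j w & valid b w].
Proof. by []. Qed.

Lemma whdP t d i w : (exists j w', w = (t, d, i,
  j) :: w' /\ whd t d i w = Some (j, w'))
  \/ whd t d i w = None.
Proof.
case: w => [|[[[t' d'] i'] j] w]; first by right.
rewrite /=; case: ifP => [/and3P[/eqP-> /eqP-> /eqP->]|_]; last by right.
by left; exists j, w.
Qed.
Lemma whd_cons t d i j w : whd t d i ((t, d, i, j) :: w) = Some (j, w).
Proof. by rewrite /= !eqxx. Qed.

Lemma isb_inj t d i j : i \in sd t d -> j \in sd t d -> isb t d i ->
  isb t d j -> i = j.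
Proof. by rewrite /isb; case: (sd t d) => //= k s _ _ /eqP-> /eqP. Qed.
(** This is what [bsd_ne] is for: every product of two letters of one type must have a distinguished
    middle label that can be eliminated. *)
Lemma isb_ex t d i : i \in sd t d -> exists2 j,
  j \in sd t (~~ d) & isb t (~~ d) j.
Proof.
move=> /bsd_ne[j]; rewrite /isb; case: (sd t (~~ d)) => //= k s _.
by exists k => //; rewrite inE eqxx.
Qed.
Lemma big_isb t d (V : nmodType) (F : I -> V) j0 :
  j0 \in sd t d -> isb t d j0 ->
  \sum_(j <- sd t d) (if isb t d j then F j else 0) = F j0.
Proof.
move=> hj0 bj0; rewrite (bigD1_seq j0) ?bsd_uniq//= bj0 big1_seq ?addr0// => j.
case/andP => jj0 hj; case: ifP => // bj; case/eqP: jj0.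
exact: (isb_inj (t := t) (d := d)).
Qed.
Lemma big_eqb t d (V : nmodType) (F : I -> V) j0 :
  j0 \in sd t d ->
  \sum_(j <- sd t d) (if j == j0 then F j else 0) = F j0.
Proof.
move=> hj0; rewrite (bigD1_seq j0) ?bsd_uniq//= eqxx big1 ?addr0// => j.
by move=> /negbTE ->.
Qed.

Section Operators.
Variable b : U.
Local Notation F := (word -> K^o).

(** The operators act on all functions of words, finitely supported or not. This is harmless, since
    each of them computes a value from finitely many values of its argument. *)
Definition opV_fun u (f : F) : F := fun w => if valid b w && (vend b w == u)
  then f w else 0.
(* The left action on the words from b, in coordinates: a letter is prepended,
   unless the middle label is distinguished, in which case BR_inv is used. *)
Definition cpart t d j (f : F) j' w' : K^o :=
  (if j == j' then f w' else 0) -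
  (if isb t (~~ d) j then
     (if whd t (~~ d) j' w' is Some (i', w'') then f ((t, ~~ d, j,
       i') :: w'') else 0)
   else 0).
(** Three contributions to the coefficient at w: the prepended letter; the products with other
    middle labels, subtracted when j is distinguished; and, in the last summand, the unit term of
    [BR_inv], which cancels two letters. *)
Definition opX_fun t d i j (f : F) : F := fun w =>
  if [&& okl t d i j, valid b w & vend b w == vx t d i] then
    (if whd t d i w is Some (j', w') then cpart t d j f j' w' else 0) +
    (if isb t (~~ d) j && junc t (~~ d) i w then f ((t, ~~ d, j,
      i) :: w) else 0)
  else 0.

Lemma opV_lin u : opV_fun u \in @is_lin K F.
Proof.
rewrite inE => a f g; apply/funext => w.
have E (h h' : F) z : (a *: h + h') z = a *: h z + h' z by [].
by rewrite E /opV_fun; case: ifP => _ //; rewrite scaler0 addr0.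
Qed.
Lemma opX_lin t d i j : opX_fun t d i j \in @is_lin K F.
Proof.
rewrite inE => a f g; apply/funext => w.
have E (h h' : F) z : (a *: h + h') z = a *: h z + h' z by [].
rewrite E /opX_fun; case: ifP => _; last by rewrite scaler0 addr0.
rewrite scalerDr addrACA; congr (_ + _).
  case: whd => [[j' w']|]; last by rewrite scaler0 addr0.
  rewrite /cpart scalerBr addrACA -opprD; congr (_ - _).
    by case: ifP => _; rewrite ?scaler0 ?addr0.
  by case: ifP => _; [case: whd => [[]|]|]; rewrite ?scaler0 ?addr0.
by case: ifP => _; rewrite ?scaler0 ?addr0.
Qed.
Definition opV u : lendo F := Lendo (opV_lin u).
Definition opX t d i j : lendo F := Lendo (opX_lin t d i j).

Lemma opVV u u' : opV u ** opV u' = if u == u' then opV u else 0.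
Proof.
apply: lendo_ext => f; apply/funext => w; rewrite lendoM /= /opV_fun.
case: (eqVneq u u') => [<-|ne] /=; first by rewrite /opV_fun;
  case: (valid b w && _).
case: ifP => // /andP[_ /eqP->]; by rewrite (negbTE ne) andbF.
Qed.
Lemma opVX t d i j : opV (vx t d i) ** opX t d i j = opX t d i j.
Proof.
apply: lendo_ext => f; apply/funext => w; rewrite lendoM /= /opV_fun /opX_fun.
by case: (valid b w); case: (vend b w == _); rewrite ?andbF.
Qed.

Lemma opXV t d i j : opX t d i j ** opV (vx t (~~ d) j) = opX t d i j.
Proof.
apply: lendo_ext => f; apply/funext => w; rewrite lendoM /= /opX_fun.
case: ifP => // /and3P[ok vw ew].
have ok' : okl t (~~ d) j i by move: ok; rewrite /okl negbK andbC.
congr (_ + _).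
  case: (whdP t d i w) => [[j' [w' [wE ->]]]|->//].
  have : valid b ((t, d, i, j') :: w') by rewrite -wE.
  rewrite validE => /and4P[okj' ej' ju vw'].
  rewrite /cpart; congr (_ - _).
    by case: eqP => // ->; rewrite /opV_fun vw' eq_sym ej'.
  case: ifP => // bj.
  case: (whdP t (~~ d) j' w') => [[i' [w'' [wE' ->]]]|->//].
  rewrite /opV_fun [vend _ _]/= eqxx andbT ifT// validE.
  move: vw'; rewrite wE' validE => /and4P[ok1 -> -> ->].
  by rewrite andbT; move: ok1 ok'; rewrite /okl => /andP[_ ->] /andP[->].
case: ifP => // /andP[bj ju].
rewrite /opV_fun [vend _ _]/= eqxx andbT ifT// validE.
by rewrite ok' negbK eq_sym ew ju vw.
Qed.

Lemma opX_bad t d i j : ~~ ((i \in sd t d) && (j \in sd t (~~ d))) ->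
  opX t d i j = 0.
Proof.
move=> h; apply: lendo_ext => f; apply/funext => w; rewrite /= /opX_fun /okl.
by rewrite (negbTE h).
Qed.

(** The resolution of overlaps: rewriting a product of three letters at either end gives the same
    result. In the sum over j only the label [j1] carried by w and the distinguished label [j0]
    contribute. *)
Lemma opXX t d i i' : i \in sd t d -> i' \in sd t d ->
  \sum_(j <- sd t (~~ d)) opX t d i j ** opX t (~~ d) j i' =
  if i == i' then opV (vx t d i) else 0.
Proof.
move=> hi hi'; apply: lendo_ext => f; apply/funext => w.
have sumE (r : seq I) (G : I -> lendo F) :
    (\sum_(j <- r) G j) f w = \sum_(j <- r) (G j f w).
  by rewrite lendo_sum; apply: (big_morph (fun h : F => h w)).
rewrite sumE.
have [j0 hj0 bj0] := isb_ex hi.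
case: (boolP (valid b w && (vend b w == vx t d i))) => [vw|nvw]; last first.
  rewrite big1 => [|j _].
    by case: ifP => _ //=; rewrite /opV_fun (negbTE nvw).
  by rewrite lendoM /= /opX_fun (negbTE nvw) andbF.
have -> : (if i == i' then opV (vx t d i) else 0) f w = if i == i' then f w else
  0.
  by case: ifP => _ //=; rewrite /opV_fun vw.
case/andP: vw => vw ew.
pose g j : F := opX t (~~ d) j i' f.
have okb j k : j \in sd t (~~ d) -> k \in sd t d -> okl t (~~ d) j k.
  by move=> hj hk; rewrite /okl negbK hj.
rewrite (eq_big_seq (fun j =>
  (if whd t d i w is Some (j1, w') then if j == j1 then g j w' else 0 else 0) +
  (if isb t (~~ d) j then
    (if junc t (~~ d) i w then g j ((t, ~~ d, j, i) :: w) else 0) -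
    (if whd t d i w is Some (j1, w') then
       if whd t (~~ d) j1 w' is Some (i1, w'') then g j ((t, ~~ d, j,
         i1) :: w'') else 0
     else 0) else 0))); last first.
  move=> j hj; rewrite [LHS](_ : _ = opX_fun t d i j (g j) w)//.
  rewrite /opX_fun [okl _ _ _ _]/okl hi hj vw ew !andTb.
  case: whd => [[j1 w']|]; last first.
    by rewrite !add0r; case: (isb t _ j) => //=; rewrite subr0.
  rewrite /cpart -addrA; congr (_ + _); case: (isb t _ j) => /=;
    last by rewrite oppr0 addr0.
  by rewrite addrC.
rewrite big_split /= (big_isb _ hj0 bj0).
(* the value of the inner operator on a word starting with the distinguished
   label *)
have gE k w1 : k \in sd t d -> valid b ((t, ~~ d, j0, k) :: w1) ->
    g j0 ((t, ~~ d, j0, k) :: w1) = cpart t (~~ d) i' f k w1.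
  move=> hk v1.
  rewrite [LHS](_ : _ = opX_fun t (~~ d) j0 i' f ((t, ~~ d, j0, k) :: w1))//.
  rewrite /opX_fun okb// v1 [vend _ _]/= eqxx whd_cons !andbT.
  have -> : junc t (~~ ~~ d) j0 ((t, ~~ d, j0, k) :: w1) = false.
    by rewrite /junc negbK bj0 whd_cons.
  by rewrite andbF addr0.
case: (whdP t d i w) => [[j1 [w' [wE whE]]]|whE]; rewrite whE; last first.
  have jw : junc t (~~ d) i w by rewrite /junc negbK whE andbF.
  rewrite jw subr0 big1// add0r gE//; last first.
    by rewrite validE okb// negbK eq_sym ew jw vw.
  by rewrite /cpart negbK whE eq_sym; case: (isb t d i'); rewrite subr0.
have vwE : valid b ((t, d, i, j1) :: w') by rewrite -wE.
move: (vwE); rewrite validE => /and4P[/andP[_ hj1] ej1 ju vw'].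
rewrite (big_eqb (fun j => g j w') hj1).
(* If i is not distinguished, the term of i' in [third] cancels [first]. If it is, [third] is 0 and
   [first] alone gives f w, exactly for i' = i. *)
have third : (if junc t (~~ d) i w then g j0 ((t, ~~ d, j0, i) :: w) else 0) =
    if isb t d i then 0 else
    (if i == i' then f w else 0) - (if isb t d i' then f ((t, d, i',
      j1) :: w') else 0).
  have -> : junc t (~~ d) i w = ~~ isb t d i by rewrite /junc negbK whE andbT.
  case: (boolP (isb t d i)) => //= nb; rewrite gE//.
    by rewrite /cpart negbK whE eq_sym.
  by rewrite validE okb// negbK eq_sym ew vw andbT /junc negbK (negbTE nb).
have first : g j1 w' - (if whd t (~~ d) j1 w' is Some (i1, w'') then
     g j0 ((t, ~~ d, j0, i1) :: w'') else 0) =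
     if isb t d i' then f ((t, d, i', j1) :: w') else 0.
  rewrite [g j1 w'](_ : _ = opX_fun t (~~ d) j1 i' f w')//.
  rewrite /opX_fun okb// vw' eq_sym ej1 !andbT negbK.
  have ju' : junc t d j1 w' by [].
  case: (whdP t (~~ d) j1 w') => [[i1 [w'' [wE' whE']]]|whE']; rewrite whE'.
    have : valid b ((t, ~~ d, j1, i1) :: w'') by rewrite -wE'.
    rewrite validE negbK => /and4P[/andP[_]]; rewrite negbK => hi1 e1 j1' v1.
    rewrite gE ?hi1 //; last by rewrite validE okb// negbK e1 j1' v1.
    by rewrite ju' andbT addrAC subrr add0r.
  by rewrite add0r subr0 ju' andbT.
rewrite third addrA addrAC first.
case: (boolP (isb t d i)) => bi; last first.
  by rewrite addrCA subrr addr0.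
rewrite addr0; case: (eqVneq i i') => [<-|ne]; first by rewrite bi wE.
by case: ifP => // bi'; case/eqP: ne; apply: (isb_inj (t := t) (d := d)).
Qed.

Definition bact : nuHom balg (lendo F) := blift opVV opVX opXV opX_bad opXX.
End Operators.
End BAlgebra.

(** * The basis of words and its coefficients *)

Section Words.
Variables (K : fieldType) (S : bsys).
Local Notation U := (bvert S).
Local Notation vx := (@bvx S).
Local Notation A := (balg K S).
Local Notation W := (word S).
Local Notation F := (W -> K^o).
Local Notation bV := (@bV K S).
Local Notation bX := (@bX K S).

Definition delta (w : W) : F := fun w' => if w' == w then 1 else 0.

Fixpoint wval (b : U) (w : W) : A :=
  if w is (t, d, i, j) :: w' then bX t d i j ** wval b w' else bV b.

Lemma wval_cons b t d i j w :
  wval b ((t, d, i, j) :: w) = bX t d i j ** wval b w.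
Proof. by []. Qed.
Lemma wval_nil b : wval b [::] = bV b. Proof. by []. Qed.
Lemma Vwval b w : bV (vend b w) ** wval b w = wval b w.
Proof. by case: w => [|[[[t d] i] j] w] /=; rewrite ?bVid// nmulA bVX. Qed.
Lemma wvalV b w : wval b w ** bV b = wval b w.
Proof. by elim: w => [|[[[t d] i] j] w IH] /=; rewrite ?bVid// -nmulA IH. Qed.
Lemma Vwval_neq b w u : u != vend b w -> bV u ** wval b w = 0.
Proof. by move=> /negbTE ne; rewrite -Vwval nmulA bVV ne nmul0l. Qed.

(** [delta [::]] stands for the empty word at b, so x applied to it lists the coefficients of x at
    the words ending in b. *)
Definition cf b (w : W) (x : A) : K := (bact K b x) (delta [::]) w.

Lemma cf_is_linear b w : linear (cf b w : A -> K^o).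
Proof. by move=> a x y; rewrite /cf linearP. Qed.
HB.instance Definition _ b w :=
  GRing.isLinear.Build K A K^o *:%R (cf b w) (cf_is_linear b w).

Lemma cf0 b w : cf b w 0 = 0.
Proof. exact: (raddf0 (cf b w)). Qed.
Lemma cfZ b w a x : cf b w (a *: x) = a * cf b w x.
Proof. by have := cf_is_linear b w a x 0; rewrite cf0 !addr0. Qed.
Lemma cf_sum b w J (r : seq J) (P : pred J) (G : J -> A) :
  cf b w (\sum_(j <- r | P j) G j) = \sum_(j <- r | P j) cf b w (G j).
Proof. exact: (raddf_sum (cf b w)). Qed.

Lemma bact_V b u : bact K b (bV u) = opV K b u.
Proof. exact: blift_V. Qed.
Lemma bact_X b t d i j : bact K b (bX t d i j) = opX K b t d i j.
Proof. exact: blift_X. Qed.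
Lemma bactX b t d i j f w : bact K b (bX t d i j) f w = opX_fun b t d i j f w.
Proof. by rewrite bact_X. Qed.

Lemma cfX b w t d i j x : cf b w (bX t d i j ** x) =
  opX_fun b t d i j (fun w' => cf b w' x) w.
Proof. by rewrite /cf nuhomM lendoM bactX. Qed.

Lemma opX_delta b t d i j w' : valid b ((t, d, i, j) :: w') ->
  opX_fun b t d i j (delta w') = delta ((t, d, i, j) :: w').
Proof.
move=> v; apply/funext => w; rewrite /opX_fun.
move: (v); rewrite validE => /and4P[ok e ju v']; rewrite ok andTb.
case: ifP => [/andP[vw ew]|nc]; last first.
  rewrite /delta; case: eqP => // wE; move: nc.
  by rewrite wE v /= eqxx.
have Z i0 w0 : isb t (~~ d) j -> delta w' ((t, ~~ d, j, i0) :: w0) = 0.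
  move=> bj; rewrite /delta; case: eqP => // E; move: ju.
  by rewrite -E /junc bj whd_cons.
rewrite [X in _ + X](_ : _ = 0) ?addr0; last by case: ifP => // /andP[bj _];
  apply: Z.
case: (whdP t d i w) => [[j1 [w1 [wE ->]]]|wN]; last first.
  by rewrite wN /delta; case: eqP => // wE; move: wN; rewrite wE whd_cons.
rewrite /cpart [X in _ - X](_ : _ = 0) ?subr0; last first.
  by case: ifP => // bj; case: whd => // -[i0 w0]; apply: Z.
rewrite wE /delta eqseq_cons; case: (eqVneq j j1) => [->|ne];
  first by rewrite eqxx.
by rewrite !xpair_eqE !eqxx /= eq_sym (negbTE ne).
Qed.

Lemma opV_delta0 b u : opV_fun b u (delta [::]) = if b == u then delta [::] else
  0 :> F.
Proof.
apply/funext => w; rewrite /opV_fun /delta; case: (eqVneq w [::]) => [->|wn] /=.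
  by case: ifP.
by rewrite if_same; case: ifP => //= _; rewrite (negbTE wn).
Qed.

Lemma bact_wval b b' w : valid b w ->
  bact K b' (wval b w) (delta [::]) = if b' == b then delta w else 0.
Proof.
case: (eqVneq b' b) => [->|ne].
  elim: w => [_|[[[t d] i] j] w IH v].
    by rewrite wval_nil bact_V; have := opV_delta0 b b; rewrite eqxx.
  rewrite wval_cons nuhomM lendoM IH ?bact_X; last by move: v;
    rewrite validE => /and4P[].
  exact: opX_delta.
move=> _; elim: w => [|[[[t d] i] j] w IH].
  by rewrite wval_nil bact_V; have := opV_delta0 b' b; rewrite (negbTE ne).
by rewrite wval_cons nuhomM lendoM IH lendo_r0.
Qed.

Lemma cf_wval b b' w w' : valid b w ->
  cf b' w' (wval b w) = if (b' == b) && (w' == w) then 1 else 0.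
Proof. by move=> v; rewrite /cf bact_wval//; case: (b' == b). Qed.

Definition inspan (x : A) : Prop := exists s : seq (K * (U * W)),
  all (fun p => valid p.2.1 p.2.2) s /\
  x = \sum_(p <- s) p.1 *: wval p.2.1 p.2.2.

Lemma inspan0 : inspan 0.
Proof. by exists [::]; rewrite big_nil. Qed.
Lemma inspanD x y : inspan x -> inspan y -> inspan (x + y).
Proof.
move=> [s [vs ->]] [s' [vs' ->]]; exists (s ++ s').
by rewrite all_cat vs vs' big_cat.
Qed.
Lemma inspanZ a x : inspan x -> inspan (a *: x).
Proof.
move=> [s [vs ->]]; exists [seq (a * p.1, p.2) | p <- s].
rewrite all_map; split=> //; rewrite big_map scaler_sumr.
by apply: eq_bigr => p _; rewrite scalerA.
Qed.
Lemma inspan_sum J (r : seq J) (P : pred J) (G : J -> A) :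
  (forall j, P j -> inspan (G j)) -> inspan (\sum_(j <- r | P j) G j).
Proof. by move=> h; apply: (big_ind inspan inspan0 inspanD). Qed.
Lemma inspan_sum_seq (J : eqType) (r : seq J) (P : pred J) (G : J -> A) :
  (forall j, j \in r -> P j -> inspan (G j)) -> inspan (\sum_(j <- r |
    P j) G j).
Proof.
by move=> h; rewrite big_seq_cond; apply: inspan_sum => j /andP[]; apply: h.
Qed.
Lemma inspanN x : inspan x -> inspan (- x).
Proof. by rewrite -scaleN1r; apply: inspanZ. Qed.
Lemma inspan_w b w : valid b w -> inspan (wval b w).
Proof. by move=> v; exists [:: (1, (b, w))]; rewrite /= v big_seq1 scale1r. Qed.

(** Only a forbidden junction is not immediately a word or 0. There [BR_inv] gives a unit, which
    leaves a shorter word, minus products whose middle label is not distinguished and which are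
    therefore legal. *)
Lemma inspanX_w t d i j b w : valid b w -> inspan (bX t d i j ** wval b w).
Proof.
move=> v; case: (boolP (okl t d i j)) => [ok|nok]; last first.
  by rewrite bX_bad// nmul0l; apply: inspan0.
case: (eqVneq (vx t (~~ d) j) (vend b w)) => [e|ne]; last first.
  by rewrite -bXV -nmulA Vwval_neq// nmul0r; apply: inspan0.
case: (boolP (junc t d j w)) => [ju|]; first by apply: (@inspan_w b ((t, d, i,
  j) :: w));
  rewrite validE ok e eqxx ju.
rewrite /junc negbK => /andP[bj].
case: (whdP t (~~ d) j w) => [[i' [w3 [wE _]]] _|-> //].
move: v; rewrite wE validE negbK => /and4P[/andP[hj]];
  rewrite negbK => hi' e' ju v3.
have /andP[hi _] := ok.
have := bXX K hi hi'; rewrite (bigD1_seq j) ?bsd_uniq//= =>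
  /(canRL (addrK _)) E.
rewrite nmulA E nmulBl nmul_suml; apply: inspanD.
  case: eqP => [->|_]; last by rewrite nmul0l; apply: inspan0.
  rewrite (eqP e') Vwval; exact: inspan_w.
apply: inspanN; apply: inspan_sum_seq => k hk kj; rewrite -nmulA.
apply: (@inspan_w b ((t, d, i, k) :: (t, ~~ d, k, i') :: w3)).
have nbk : isb t (~~ d) k = false.
  by apply/negP => bk; case/eqP: kj; apply: (isb_inj (t := t) (d := ~~ d)).
by rewrite !validE /okl hi hk /= !negbK hi' eqxx e' ju v3 /junc nbk.
Qed.
Lemma inspanX t d i j x : inspan x -> inspan (bX t d i j ** x).
Proof.
move=> [s [/allP vs ->]]; rewrite nmul_sumr.
apply: inspan_sum_seq => p /vs vp _; rewrite nmulZr; apply: inspanZ.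
exact: inspanX_w.
Qed.
Lemma inspanV u x : inspan x -> inspan (bV u ** x).
Proof.
move=> [s [/allP vs ->]]; rewrite nmul_sumr.
apply: inspan_sum_seq => p /vs vp _; rewrite nmulZr; apply: inspanZ.
case: (eqVneq u (vend p.2.1 p.2.2)) => [->|ne].
  by rewrite Vwval; apply: inspan_w.
by rewrite Vwval_neq//; apply: inspan0.
Qed.

Lemma inspanP x : inspan x.
Proof.
(* A right local unit is a sum of empty words, so it suffices that left multiplication by x
   preserves the span. *)
have [s [_ _ <-]] := local_unit x; rewrite /bone /vone.
have : inspan (\sum_(u <- s) bV u).
  by apply: inspan_sum => u _; apply: (@inspan_w u [::]).
elim/balg_ind: x (\sum_(u <- s) bV u) => {s}.
- by move=> u y; apply: inspanV.
- by move=> t d i j y; apply: inspanX.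
- by move=> y _; rewrite nmul0l; apply: inspan0.
- by move=> x x' hx hx' y hy; rewrite nmulDl; apply: inspanD;
    [apply: hx|apply: hx'].
- by move=> a x hx y hy; rewrite nmulZl; apply: inspanZ; apply: hx.
- by move=> x x' hx hx' y hy; rewrite -nmulA; apply: hx; apply: hx'.
Qed.

(** An expansion s may repeat a word; [r] groups equal words, and the coefficient at each of them is
    the corresponding sum, which vanishes. *)
Lemma cf_faithful x : (forall b w, cf b w x = 0) -> x = 0.
Proof.
have [s [/allP vs xE]] := inspanP x; move=> cx.
pose r := undup [seq p.2 | p <- s].
have cE p : p \in r -> \sum_(q <- s) (if p == q.2 then q.1 else 0) = 0.
  move=> pr; rewrite -[RHS](cx p.1 p.2) xE cf_sum.
  apply: eq_big_seq => q qs; rewrite cfZ cf_wval ?vs//.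
  case: q qs => c [b w] qs /=; rewrite [p in LHS]surjective_pairing xpair_eqE.
  by case: ifP => _; [exact/esym/mulr1|exact/esym/mulr0].
rewrite xE (eq_big_seq (fun q => \sum_(p <- r) (if p == q.2 then q.1 else 0) *:
  wval p.1 p.2)).
  rewrite exchange_big /= big1_seq// => p /andP[_ pr].
  by rewrite -scaler_suml cE// scale0r.
move=> q qs /=; rewrite (bigD1_seq q.2) ?undup_uniq//=; last first.
  by rewrite mem_undup map_f.
by rewrite eqxx big1 ?addr0// => p /negbTE ->; rewrite scale0r.
Qed.

Lemma cf_bounded x : exists n, forall b w, (n < size w)%N -> cf b w x = 0.
Proof.
have [s [/allP vs ->]] := inspanP x.
exists (\max_(p <- s) size p.2.2) => b w nw.
rewrite cf_sum big1_seq// => p /andP[_ ps].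
rewrite cfZ cf_wval ?vs//; case: eqP => [_|_]; last exact: mulr0.
case: eqP => [wE|_]; last exact: mulr0.
move: nw; rewrite ltnNge wE.
by rewrite (@leq_bigmax_seq _ _ xpredT (fun p : K * (U * W) => size p.2.2)).
Qed.

Lemma bV_neq0 u : bV u != 0.
Proof.
apply/eqP => u0; have := @cf_wval u u [::] [::] isT.
by rewrite !eqxx /= u0 cf0 => /esym/eqP; rewrite oner_eq0.
Qed.
End Words.

(** * Reduction of presentations *)

Section Machine.
Variables (K : fieldType) (S : bsys).
Local Notation U := (bvert S).
Local Notation T := (btype S).
Local Notation I := (blab S).
Local Notation sd := (@bsd S).
Local Notation vx := (@bvx S).
Variable MM : nuAlgType K.
Variables (eps : U -> MM) (X : T -> bool -> I -> I -> MM).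
Hypothesis epsM : forall u u', eps u ** eps u' = if u == u' then eps u else 0.
Hypothesis epsX : forall t d i j, eps (vx t d i) ** X t d i j = X t d i j.
Hypothesis Xeps : forall t d i j, X t d i j ** eps (vx t (~~ d) j) = X t d i j.
Hypothesis XX : forall t d i i', i \in sd t d -> i' \in sd t d ->
  \sum_(j <- sd t (~~ d)) X t d i j ** X t (~~ d) j i' =
  if i == i' then eps (vx t d i) else 0.

Local Notation func := ({linear MM -> K^o}).
Definition gsp := U -> MM -> Prop.
Implicit Types (Z : gsp).

Lemma funcP (l : func) a x y : l (a *: x + y) = a * l x + l y.
Proof. exact: (linearP l). Qed.
Lemma funcZ (l : func) a x : l (a *: x) = a * l x.
Proof. by have := funcP l a x 0; rewrite !raddf0 !addr0. Qed.

Lemma func0 (l : func) : l 0 = 0. Proof. exact: raddf0. Qed.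
Lemma funcB (l : func) x y : l (x - y) = l x - l y. Proof. exact: raddfB. Qed.
Lemma func_sum (l : func) J (r : seq J) (P : pred J) (G : J -> MM) :
  l (\sum_(j <- r | P j) G j) = \sum_(j <- r | P j) l (G j).
Proof. exact: raddf_sum. Qed.

Lemma gsp_ext Z Z' : (forall u m, Z u m <-> Z' u m) -> Z = Z'.
Proof.
by move=> h; apply/funext => u; apply/funext => m; apply/propext; apply: h.
Qed.

Definition subsp Z := forall u, [/\ forall m, Z u m -> eps u ** m = m, Z u 0
  & forall a x y, Z u x -> Z u y -> Z u (a *: x + y)].
Definition rel Z t (x : bool -> I -> MM) :=
  (forall d i, i \in sd t d -> Z (vx t d i) (x d i)) /\
  (forall d i, i \in sd t d ->
     x d i = \sum_(j <- sd t (~~ d)) X t d i j ** x (~~ d) j).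
(* A functional is free if it vanishes on all components of the relations inside
   Z. A sheet is a family of functionals, indexed by the side d of t, vanishing
   on all components other than those of that side, where it takes a common
   value; it is active if that value is not always 0. *)
Definition supp u (l : func) := forall m, l (eps u ** m) = l m.
Definition free Z (l : func) :=
  forall t x, rel Z t x -> forall d i, i \in sd t d -> l (x d i) = 0.
Definition nonzero Z (l : func) := exists u m, Z u m /\ l m != 0.
Definition cut Z (l : func) : gsp := fun u m => Z u m /\ l m = 0.
Definition cuts (J : eqType) Z (s : seq J) (l : J -> func) : gsp :=
  fun u m => Z u m /\ forall i, i \in s -> l i m = 0.
Definition sheet Z t d (l : I -> func) :=
  [/\ forall i, i \in sd t d -> supp (vx t d i) (l i),
      forall t' x, rel Z t' x -> forall d' i j, i \in sd t' d' ->
        j \in sd t d ->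
        (t', d', i) != (t, d, j) -> l j (x d' i) = 0
    & forall x, rel Z t x -> forall i j, i \in sd t d -> j \in sd t d ->
        l i (x d i) = l j (x d j)].
Definition active Z t d (l : I -> func) :=
  exists x i, [/\ rel Z t x, i \in sd t d & l i (x d i) != 0].

Section Subspaces.
Variable Z : gsp.
Hypothesis sZ : subsp Z.
Lemma sp_eps u m : Z u m -> eps u ** m = m. Proof. by have [h _ _] := sZ u;
  apply: h. Qed.
Lemma sp0 u : Z u 0. Proof. by have [_ h _] := sZ u. Qed.
Lemma sp_lin u a x y : Z u x -> Z u y -> Z u (a *: x + y).
Proof. by have [_ _ h] := sZ u; apply: h. Qed.
Lemma spZ u a x : Z u x -> Z u (a *: x).
Proof. by move=> h; rewrite -[a *: x]addr0; apply: sp_lin => //; apply: sp0.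
  Qed.
Lemma spD u x y : Z u x -> Z u y -> Z u (x + y).
Proof. by move=> hx hy; rewrite -[x]scale1r; apply: sp_lin. Qed.
Lemma spB u x y : Z u x -> Z u y -> Z u (x - y).
Proof. by move=> hx hy; apply: spD => //; rewrite -scaleN1r; apply: spZ. Qed.
Lemma sp_sum u (J : eqType) (r : seq J) (P : pred J) (G : J -> MM) :
  (forall j, j \in r -> P j -> Z u (G j)) -> Z u (\sum_(j <- r | P j) G j).
Proof.
move=> h; rewrite big_seq_cond; apply: (big_ind (Z u)).
- exact: sp0.
- by move=> x y; apply: spD.
- by move=> j /andP[]; apply: h.
Qed.
Lemma supp_neq u u' l m : supp u l -> Z u' m -> u != u' -> l m = 0.
Proof.
move=> sl zm /negbTE ne.
by rewrite -sl -(sp_eps zm) nmulA epsM ne nmul0l func0.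
Qed.
Lemma supp_eq u u' l m : supp u l -> Z u' m -> l m != 0 -> u = u'.
Proof.
by move=> sl zm nz; apply/eqP; apply: contraNT nz => /(supp_neq sl zm)->.
Qed.
Lemma cut_subsp l : subsp (cut Z l).
Proof.
move=> u; split=> [m [/sp_eps]//||a x y [zx lx] [zy ly]].
  by split; [apply: sp0|rewrite func0].
by split; [apply: sp_lin|rewrite funcP lx ly mulr0 addr0].
Qed.
Lemma cuts_subsp (J : eqType) (s : seq J) l : subsp (cuts Z s l).
Proof.
move=> u; split=> [m [/sp_eps]//||a x y [zx lx] [zy ly]].
  by split; [apply: sp0|move=> i _; rewrite func0].
by split; [apply: sp_lin|move=> i hi; rewrite funcP lx// ly// mulr0 addr0].
Qed.

Lemma rel_lin t a x y : rel Z t x -> rel Z t y ->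
  rel Z t (fun d i => a *: x d i + y d i).
Proof.
move=> [zx ex] [zy ey]; split=> d i hi; first by apply: sp_lin;
  [apply: zx|apply: zy].
rewrite [in LHS]ex// [in LHS]ey// scaler_sumr -big_split;
  apply: eq_bigr => j _ /=.
by rewrite nmulDr nmulZr.
Qed.
End Subspaces.

(** The equations of one side suffice: multiplying them by the inverse matrix gives those of the
    other side. *)
Lemma relI Z t d x : (forall u m, Z u m -> eps u ** m = m) ->
  (forall d' i, i \in sd t d' -> Z (vx t d' i) (x d' i)) ->
  (forall i, i \in sd t d -> x d i = \sum_(j <- sd t (~~ d)) X t d i j ** x (~~
    d) j) ->
  rel Z t x.
Proof.
move=> sZ zx ex; split=> // d' i; have [-> hi|ne] := eqVneq d' d;
  first exact: ex.
have -> : d' = ~~ d by case: (d) (d') ne => [] [].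
rewrite negbK => hi.
rewrite (eq_big_seq (fun j => \sum_(k <- sd t (~~ d)) (X t (~~ d) i j ** X t d j
  k) ** x (~~ d) k)).
  rewrite exchange_big /= (bigD1_seq i) ?bsd_uniq//= -nmul_suml.
  have := XX hi hi; rewrite negbK eqxx => ->.
  rewrite sZ; last exact: zx.
  rewrite big1_seq ?addr0// => k /andP[ki hk]; rewrite -nmul_suml.
  by have := XX hi hk; rewrite negbK eq_sym (negbTE ki) => ->; rewrite nmul0l.
move=> j hj; rewrite ex// nmul_sumr; apply: eq_bigr => k _.
by rewrite nmulA.
Qed.

Lemma rel_sub Z Z' t x : (forall u m, Z u m -> Z' u m) -> rel Z t x ->
  rel Z' t x.
Proof. by move=> ZZ [zx ex]; split=> // d i hi; apply: ZZ; apply: zx. Qed.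
Lemma cuts_sub (J : eqType) Z (s : seq J) l u m : cuts Z s l u m -> Z u m.
  Proof. by case. Qed.
Lemma rel_cut Z l t x : free Z l -> rel Z t x -> rel (cut Z l) t x.
Proof.
move=> fl rx; have [zx ex] := rx; split=> // d i hi; split; first exact: zx.
exact: (fl _ _ rx).
Qed.
Lemma free_sub Z Z' l : (forall u m, Z' u m -> Z u m) -> free Z l -> free Z' l.
Proof. by move=> ZZ fl t x /(rel_sub ZZ); apply: fl. Qed.
Lemma sheet_sub Z Z' t d l : (forall u m, Z' u m -> Z u m) -> sheet Z t d l ->
  sheet Z' t d l.
Proof.
move=> ZZ [sl nl gl]; split=> //.
  by move=> t' x /(rel_sub ZZ); apply: nl.
by move=> x /(rel_sub ZZ); apply: gl.
Qed.
Lemma rel_cuts Z t d l t' x : sheet Z t d l -> rel Z t' x ->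
  (t' = t -> forall i, i \in sd t d -> l i (x d i) = 0) ->
    rel (cuts Z (sd t d) l) t' x.
Proof.
move=> [_ nl gl] rx lx; have [zx ex] := rx; split=> // d' i hi; split;
  first exact: zx.
move=> j hj; have [[tt dd ij]|ne] := eqVneq (t', d', i) (t, d, j);
  last exact: nl rx _ _ _ _ _ ne.
by rewrite dd ij; apply: lx.
Qed.
Lemma cuts_cons (J : eqType) Z (i : J) s l : cuts Z (i :: s) l = cuts (cut Z (l
  i)) s l.
Proof.
apply: gsp_ext => u m; split=> [[zm h]|[[zm h1] h2]].
  by split; [split=> //; apply: h; rewrite inE eqxx|move=> j hj; apply: h;
    rewrite inE hj orbT].
by split=> // j; rewrite inE => /orP[/eqP->|/h2].
Qed.
Lemma cut_cutC Z l l' : cut (cut Z l) l' = cut (cut Z l') l.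
Proof. by apply: gsp_ext => u m; rewrite /cut; split=> [[[? ?] ?]|[[? ?] ?]].
  Qed.
Lemma cut_cutsC (J : eqType) Z l (s : seq J) l' : cut (cuts Z s l') l = cuts
  (cut Z l) s l'.
Proof. by apply: gsp_ext => u m; rewrite /cut /cuts;
  split=> [[[? ?] ?]|[[? ?] ?]]. Qed.
Lemma cuts_cutsC (J J' : eqType) Z (s : seq J) l (s' : seq J') l' : cuts (cuts Z
  s l) s' l' = cuts (cuts Z s' l') s l.
Proof. by apply: gsp_ext => u m; rewrite /cut /cuts;
  split=> [[[? ?] ?]|[[? ?] ?]]. Qed.

(* Z has total dimension at most n. *)
Fixpoint dimle n Z : Prop := if n is n'.+1 then
    forall u l, supp u l -> nonzero Z l -> dimle n' (cut Z l)
  else forall u m, Z u m -> m = 0.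

Lemma dimle_sub n Z Z' : (forall u m, Z' u m -> Z u m) -> dimle n Z ->
  dimle n Z'.
Proof.
elim: n Z Z' => [|n IH] Z Z' ZZ /= h; first by move=> u m /ZZ; apply: h.
move=> u l sl [u' [m [zm nz]]]; apply: (IH (cut Z l)).
  by move=> v y [/ZZ].
by apply: (h u) => //; exists u', m; split=> //; apply: ZZ.
Qed.
Lemma dimleS n Z : dimle n Z -> dimle n.+1 Z.
Proof.
elim: n Z => [|n IH] Z h.
  by move=> u l _ [u' [m [/h ->]]]; rewrite func0 eqxx.
by move=> u l sl nz; apply: IH; apply: (h u).
Qed.
Lemma dimle_cuts n Z t d l i : dimle n.+1 Z -> supp (vx t d i) (l i) ->
  i \in sd t d ->
  nonzero Z (l i) -> dimle n (cuts Z (sd t d) l).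
Proof.
move=> dZ sl hi nz; apply: (@dimle_sub _ (cut Z (l i)));
  last exact: (dZ (vx t d i)).
by move=> u m [zm h]; split=> //; apply: h.
Qed.
Lemma active_nz Z t d l : active Z t d l -> exists2 i,
  i \in sd t d & nonzero Z (l i).
Proof.
by move=> [x [i [[zx _] hi nz]]]; exists i => //; exists (vx t d i), (x d i);
  split=> //; apply: zx.
Qed.

(** A graded span: a generator of degree other than u may enter only with coefficient 0. *)
Fixpoint spn (s : seq (U * MM)) : gsp := fun u m =>
  if s is p :: s' then exists a, (a = 0 \/ p.1 = u) /\ spn s' u (m - a *: p.2)
  else m = 0.
Definition typed (s : seq (U * MM)) := forall p, p \in s ->
  eps p.1 ** p.2 = p.2.

Lemma spn_subsp s : typed s -> subsp (spn s).
Proof.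
elim: s => [|p s IH] ts u /=; first by split=> [m ->||a x y -> ->];
  rewrite ?nmul0r ?scaler0 ?addr0.
have [e0 s0 sl] : [/\ forall m, spn s u m -> eps u ** m = m, spn s u 0
    & forall a x y, spn s u x -> spn s u y -> spn s u (a *: x + y)].
  by apply: IH => q qs; apply: ts; rewrite inE qs orbT.
have ep : eps p.1 ** p.2 = p.2 by apply: ts; rewrite inE eqxx.
split.
- move=> m [a [ha hm]]; rewrite -[m](subrK (a *: p.2)) nmulDr e0//.
  by case: ha => [->|<-]; rewrite ?scale0r ?nmul0r// nmulZr ep.
- by exists 0; split; [left|rewrite scale0r subr0].
- move=> a x y [b [hb hx]] [c [hc hy]]; exists (a * b + c); split.
    by case: hb => [->|]; [case: hc => [->|]; [left;
      rewrite mulr0 addr0|right]|right].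
  rewrite (_ : _ - _ = a *: (x - b *: p.2) + (y - c *: p.2)); first exact: sl.
  by rewrite scalerBr scalerA scalerDl opprD addrACA.
Qed.
Lemma spn_mem s u m : typed s -> (u, m) \in s -> spn s u m.
Proof.
elim: s => // p s IH ts; have tss : typed s by move=> q qs; apply: ts;
  rewrite inE qs orbT.
rewrite inE => /orP[/eqP<-|h] /=.
  exists 1; split; [by right|rewrite scale1r subrr];
    exact: sp0 (spn_subsp tss) u.
by exists 0; split; [left|rewrite scale0r subr0; apply: IH].
Qed.
(** Elimination of one generator: if l vanishes on the span of the tail, p is dropped; otherwise a
    vector z of that span with l z nonzero corrects p into the kernel of l, and the tail is
    shortened by induction. *)
Lemma spn_cut s u0 l : typed s -> supp u0 l -> nonzero (spn s) l ->
  exists s', [/\ (size s').+1 = size s, typed s'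
    & forall u m, cut (spn s) l u m -> spn s' u m].
Proof.
move=> + sl; elim: s => [_ [u [m [/= -> ]]]|p s IH ts nz];
  first by rewrite func0 eqxx.
have tss : typed s by move=> q qs; apply: ts; rewrite inE qs orbT.
have ep : eps p.1 ** p.2 = p.2 by apply: ts; rewrite inE eqxx.
have [nzs|zs] := pselect (nonzero (spn s) l); last first.
  have l0 u m : spn s u m -> l m = 0.
    by move=> h; apply/eqP; apply: contrapT => /negP ne; apply: zs; exists u, m.
  have lp : l p.2 != 0.
    case: nz => u [m [[a [_ /l0]]]]; rewrite funcB funcZ => /subr0_eq -> .
    by apply: contraNneq => ->; rewrite mulr0.
  exists s; split=> // u m [[a [_ hm]] lm].
  have := l0 _ _ hm; rewrite funcB lm funcZ sub0r => /eqP.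
  rewrite oppr_eq0 mulf_eq0 (negbTE lp) orbF => /eqP a0.
  by move: hm; rewrite a0 scale0r subr0.
have [s' [ss' ts' cs']] := IH tss nzs.
have [u1 [z [hz lz]]] := nzs.
have u01 : u0 = u1 by apply: (supp_eq (spn_subsp tss) sl hz lz).
pose r := l p.2 / l z.
have hr : r = 0 \/ p.1 = u1.
  case: (eqVneq p.1 u1) => [|ne]; first by right.
  left; rewrite /r -[p.2]ep -sl nmulA epsM u01 eq_sym (negbTE ne) nmul0l func0.
  by rewrite mul0r.
exists ((p.1, p.2 - r *: z) :: s'); split=> [/=|q|u m [[a [ha hm]] lm]].
- by rewrite ss'.
- rewrite inE => /orP[/eqP->|]; last exact: ts'.
  rewrite /= nmulBr ep nmulZr; congr (_ - _).
  by case: hr => [->|->]; rewrite ?scale0r// (sp_eps (spn_subsp tss) hz).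
- exists a; split=> //=; apply: cs'.
  have -> : m - a *: (p.2 - r *: z) = (a * r) *: z + (m - a *: p.2).
    by rewrite scalerBr opprB scalerA addrCA.
  split; last first.
    rewrite funcP funcB lm funcZ sub0r /r.
    by rewrite mulrA mulfVK// subrr.
  have [ssp0 sspl] : spn s u 0 /\ (forall a x y, spn s u x -> spn s u y ->
    spn s u (a *: x + y)).
    by have [] := spn_subsp tss u.
  case: ha => [a0|pu]; first by rewrite {1}a0 mul0r scale0r add0r.
  case: hr => [->|pu1]; first by rewrite mulr0 scale0r add0r.
  by apply: sspl => //; rewrite -pu pu1.
Qed.
Lemma spn_dimle s Z : typed s -> (forall u m, Z u m -> spn s u m) ->
  dimle (size s) Z.
Proof.
move: {2}(size s) (erefl (size s)) => n; elim: n s Z => [|n IH] s Z sn ts hZ;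
  rewrite sn.
  by case: s sn ts hZ => // _ _ hZ u m /hZ.
move=> u l sl [u' [m [zm nz]]].
have nzs : nonzero (spn s) l by exists u', m; split=> //; apply: hZ.
have [s' [ss' ts' cs']] := spn_cut ts sl nzs.
have sn' : size s' = n by apply/succn_inj; rewrite ss'.
rewrite -sn'; apply: IH => // v y [/hZ hy ly].
by apply: cs'.
Qed.

(** * Reduction steps and their confluence *)

Section Reduction.
Variables (Mn : nmodType) (gam : U -> Mn).
Hypothesis gamE : forall t, \sum_(i <- sd t true) gam (vx t true i) =
  \sum_(i <- sd t false) gam (vx t false i).

(** [Step1] splits off a summand, recorded by its class; [Step2] only replaces generators, so it
    contributes 0. *)
Inductive step Z : gsp -> Mn -> Prop :=
| Step1 u l of supp u l & free Z l & nonzero Z l : step Z (cut Z l) (gam u)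
| Step2 t d l of sheet Z t d l & active Z t d l : step Z (cuts Z (sd t d) l) 0.

Inductive red : gsp -> Mn -> Prop :=
| Red0 Z of (forall u m, Z u m -> m = 0) : red Z 0
| RedS Z Z1 d c of step Z Z1 d & red Z1 c : red Z (d + c).

Lemma step_dim n Z Z1 d : dimle n.+1 Z -> step Z Z1 d -> dimle n Z1.
Proof.
move=> dZ; case=> {Z1 d} [u l sl _|t d l [sl _ _] /active_nz[i hi nz]].
  exact: dZ sl.
by apply: (dimle_cuts dZ (sl _ hi)).
Qed.
Lemma step_subsp Z Z1 d : subsp Z -> step Z Z1 d -> subsp Z1.
Proof.
by move=> sZ; case=> {Z1 d} *; [apply: cut_subsp|apply: cuts_subsp].
Qed.
Lemma step_nz Z Z1 d : step Z Z1 d -> ~ (forall u m, Z u m -> m = 0).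
Proof.
case=> {Z1 d} [u l _ _|t d l _ /active_nz[i hi]] [v [m [zm /eqP nz]]] h;
  by apply: nz; rewrite (h _ _ zm) func0.
Qed.

(** An exchange argument in place of a dimension count: a multiple of m' moves m into the kernel of
    l' without changing l m, because l m' = 0. *)
Lemma cut_nz Z u l u' l' : subsp Z -> supp u l -> supp u' l' ->
  nonzero Z l -> nonzero (cut Z l) l' -> nonzero (cut Z l') l.
Proof.
move=> sZ sl sl' [v [m [zm nz]]] [v' [m' [[zm' lm'] nz']]].
have uv := supp_eq sZ sl zm nz; have uv' := supp_eq sZ sl' zm' nz'.
case: (eqVneq v v') => [vv|ne]; last first.
  exists v, m; split=> //; split=> //; apply: (supp_neq sZ sl' zm).
  by rewrite uv' eq_sym.
exists v, (- (l' m / l' m') *: m' + m); split;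
  last by rewrite funcP lm' mulr0 add0r.
split; first by apply: sp_lin => //; rewrite vv.
by rewrite funcP mulNr divfK// addNr.
Qed.

(* A free functional is not killed by a sheet, which involves relations only. *)
Lemma free_cuts_nz Z t d mu u l : subsp Z -> sheet Z t d mu ->
  active Z t d mu ->
  supp u l -> free Z l -> nonzero Z l -> nonzero (cuts Z (sd t d) mu) l.
Proof.
move=> sZ [smu nmu gmu] [x [i0 [rx hi0 nz0]]] sl fl [v [m [zm nz]]].
have [zx ex] := rx.
pose g := mu i0 (x d i0).
exists v, (m - \sum_(i <- sd t d) (mu i m / g) *: x d i); split; last first.
  rewrite funcB func_sum big1_seq ?subr0// => i /andP[_ hi].
  by rewrite funcZ (fl _ _ rx)// mulr0.
split.
  apply: spB => //; apply: sp_sum => // i hi _.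
  case: (eqVneq (vx t d i) v) => [<-|ne]; first by apply: spZ => //; apply: zx.
  by rewrite (supp_neq sZ (smu _ hi) zm ne) mul0r scale0r; apply: sp0.
move=> j hj; rewrite funcB func_sum (bigD1_seq j) ?bsd_uniq//= big1_seq ?addr0.
  by rewrite funcZ (gmu _ rx j i0)// -/g divfK// subrr.
move=> i /andP[ij hi]; rewrite funcZ (nmu _ _ rx) ?mulr0//.
by rewrite xpair_eqE (negbTE ij) andbF.
Qed.

Lemma step1_sub Z u l l' : subsp Z -> supp u l -> free Z l ->
  nonzero (cut Z l') l ->
  step (cut Z l') (cut (cut Z l') l) (gam u).
Proof.
by move=> sZ sl fl nz; apply: Step1 => //; apply: free_sub fl => v m [].
Qed.

(** The dual family y keeps each functional nonzero on the common kernel of the preceding ones, so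
    they can be cut one after the other. *)
Lemma chain_up (J : eqType) Z (v : J -> U) (l : J ->
  func) y (s : seq J) c0 : subsp Z -> uniq s ->
  (forall i, i \in s -> supp (v i) (l i)) ->
  (forall i, i \in s -> free Z (l i)) ->
  (forall i, i \in s -> exists u, Z u (y i)) ->
  (forall i j, i \in s -> j \in s -> (l i (y j) == 0) = (i != j)) ->
  red (cuts Z s l) c0 -> red Z (\sum_(i <- s) gam (v i) + c0).
Proof.
elim: s Z => [|i s IH] Z sZ us sl fl zy ly.
  rewrite (_ : cuts Z [::] l = Z) ?big_nil ?add0r//.
  by apply: gsp_ext => u m; split=> [[]|].
have hi : i \in i :: s by rewrite inE eqxx.
have hj j : j \in s -> j \in i :: s by rewrite inE orbC => ->.
rewrite cuts_cons big_cons -addrA => R; move: us => /= /andP[nis us].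
apply: (RedS (Z1 := cut Z (l i))).
  apply: Step1; [exact: sl|exact: fl|].
  have [u hu] := zy _ hi; exists u, (y i); split=> //.
  by rewrite ly// eqxx.
apply: IH => //.
- exact: cut_subsp.
- by move=> j /hj; apply: sl.
- by move=> j /hj /fl; apply: free_sub => w m [].
- move=> j js; have [u hu] := zy _ (hj _ js); exists u; split=> //.
  by apply/eqP; rewrite (ly _ _ hi (hj _ js)); apply: contraNneq nis => ->.
- by move=> k j /hj hk /hj; apply: ly.
Qed.

Section Confluence.
Variable n : nat.
Hypothesis IHn : forall Z c Z1 d, dimle n Z -> subsp Z -> red Z c ->
  step Z Z1 d ->
  exists c1, red Z1 c1 /\ c = d + c1.

(** The converse of [chain_up]: a reduction of Z can be made to start with this chain. It requires
    dimension at most n, where [IHn] gives confluence. *)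
Lemma chain_down (J : eqType) Z (v : J -> U) (l : J ->
  func) y (s : seq J) c : dimle n Z -> subsp Z -> uniq s ->
  (forall i, i \in s -> supp (v i) (l i)) ->
  (forall i, i \in s -> free Z (l i)) ->
  (forall i, i \in s -> exists u, Z u (y i)) ->
  (forall i j, i \in s -> j \in s -> (l i (y j) == 0) = (i != j)) ->
  red Z c ->
  exists c0, red (cuts Z s l) c0 /\ c = \sum_(i <- s) gam (v i) + c0.
Proof.
elim: s Z c => [|i s IH] Z c dZ sZ us sl fl zy ly R.
  exists c; rewrite (_ : cuts Z [::] l = Z) ?big_nil ?add0r//.
  by apply: gsp_ext => u m; split=> [[]|].
have hi : i \in i :: s by rewrite inE eqxx.
have hj j : j \in s -> j \in i :: s by rewrite inE orbC => ->.
move: us => /= /andP[nis us].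
have st : step Z (cut Z (l i)) (gam (v i)).
  apply: Step1; [exact: sl|exact: fl|].
  have [u hu] := zy _ hi; exists u, (y i); split=> //.
  by rewrite ly// eqxx.
have [c1 [R1 ->]] := IHn dZ sZ R st.
have [c0 [R0 ->]] : exists c0, red (cuts (cut Z (l i)) s l) c0 /\
    c1 = \sum_(i <- s) gam (v i) + c0.
  apply: IH => //.
  - by apply: dimle_sub dZ => u m [].
  - exact: cut_subsp.
  - by move=> j /hj; apply: sl.
  - by move=> j /hj /fl; apply: free_sub => w m [].
  - move=> j js; have [u hu] := zy _ (hj _ js); exists u; split=> //.
    by apply/eqP; rewrite (ly _ _ hi (hj _ js)); apply: contraNneq nis => ->.
  - by move=> k j /hj hk /hj; apply: ly.
by exists c0; rewrite cuts_cons big_cons addrA.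
Qed.

Variable Z : gsp.
Hypothesis (dZ : dimle n.+1 Z) (sZ : subsp Z).

(** The two cuts commute if l' stays nonzero on the kernel of l. Otherwise, by exchange, both
    functionals have the same kernel in Z, hence also the same degree. *)
Lemma confl11 u l u' l' c2 : supp u l -> free Z l -> nonzero Z l ->
  supp u' l' -> free Z l' -> nonzero Z l' -> red (cut Z l') c2 ->
  exists c1, red (cut Z l) c1 /\ gam u' + c2 = gam u + c1.
Proof.
move=> sl fl nl sl' fl' nl' R2.
have [nz1|z1] := pselect (nonzero (cut Z l) l').
  have nz2 := cut_nz sZ sl sl' nl nz1.
  have dZ2 : dimle n (cut Z l') by apply: (dZ sl').
  have [c3 [R3 ->]] := IHn dZ2 (cut_subsp sZ l') R2 (step1_sub sZ sl fl nz2).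
  exists (gam u' + c3); split; last by rewrite addrCA.
  by apply: RedS (step1_sub sZ sl' fl' nz1) _; rewrite cut_cutC.
have z2 : ~ nonzero (cut Z l') l by move/(cut_nz sZ sl' sl nl').
have E : cut Z l = cut Z l'.
  have H (k k' : func) : ~ nonzero (cut Z k) k' -> forall v m, cut Z k v m ->
    cut Z k' v m.
    move=> nk v m zm; split; first by case: zm.
    by apply/eqP; apply: contrapT => /negP ne; apply: nk; exists v, m.
  by apply: gsp_ext => v m; split; apply: H.
have uu : u = u'.
  have [v [m [zm nz]]] := nl; have uv := supp_eq sZ sl zm nz.
  apply: contrapT => ne; apply: z2; exists v, m; split=> //; split=> //.
  by apply: (supp_neq sZ sl' zm); rewrite -uv; apply/eqP => h; apply: ne.
by exists c2; rewrite E uu.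
Qed.

(** On relations a sheet amounts to a single functional, its common value. If that of mu vanishes
    wherever that of l does, the two are proportional. *)
Lemma confl_g t d d' l mu x0 i0 : sheet Z t d l -> sheet Z t d' mu ->
  rel Z t x0 -> i0 \in sd t d -> l i0 (x0 d i0) != 0 ->
  (forall x, rel Z t x -> (forall i, i \in sd t d -> l i (x d i) = 0) ->
     forall j, j \in sd t d' -> mu j (x d' j) = 0) ->
  forall x, rel Z t x -> forall i j, i \in sd t d -> j \in sd t d' ->
    mu j (x d' j) = (mu j (x0 d' j) / l i0 (x0 d i0)) * l i (x d i).
Proof.
move=> [sl nl gl] _ rx0 hi0 nz0 hB x rx i j hi hj.
pose a := l i (x d i) / l i0 (x0 d i0).
have ra := rel_lin sZ (- a) rx0 rx.
have E : mu j (- a *: x0 d' j + x d' j) = 0.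
  apply: (hB _ ra) => // k hk; rewrite funcP (gl _ rx0 k i0)// (gl _ rx k i)//.
  by rewrite mulNr /a divfK// addNr.
move/eqP: E; rewrite funcP addrC addr_eq0 => /eqP ->.
by rewrite mulNr opprK /a mulrC mulrCA mulrC.
Qed.

Lemma sheet_act Z' t d l x i : (forall u m, Z' u m -> Z u m) -> sheet Z t d l ->
  rel Z' t x -> i \in sd t d -> l i (x d i) != 0 ->
  step Z' (cuts Z' (sd t d) l) 0.
Proof.
move=> ZZ sh rx hi nz; apply: Step2; first exact: sheet_sub sh.
by exists x, i.
Qed.

(** On relations mu = k l, so all differences [mu i - k l i] are free. If they vanish on Z, the cuts
    coincide; otherwise one of them, nu, is cut as well, and the two sheets are compared on its
    kernel, which has smaller dimension. *)
Lemma confl22_same t d l mu c2 : sheet Z t d l -> active Z t d l ->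
  sheet Z t d mu -> active Z t d mu ->
  (forall x, rel Z t x -> (forall i, i \in sd t d -> l i (x d i) = 0) ->
     forall j, j \in sd t d -> mu j (x d j) = 0) ->
  red (cuts Z (sd t d) mu) c2 -> red (cuts Z (sd t d) l) c2.
Proof.
move=> shl acl shm acm hB R2; have [x0 [i0 [rx0 hi0 nz0]]] := acl.
have gE := confl_g shl shm rx0 hi0 nz0 hB.
have [sl nl gl] := shl; have [sm nm gm] := shm.
pose k := mu i0 (x0 d i0) / l i0 (x0 d i0).
have muE x i : rel Z t x -> i \in sd t d -> mu i (x d i) = k * l i (x d i).
  move=> rx hi; rewrite (gE x rx i i)// /k; congr (_ / _ * _).
  exact: gm.
have k0 : k != 0.
  have [x [i [rx hi nz]]] := acm; apply: contraNneq nz => k0.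
  by rewrite muE// k0 mul0r.
have [[i [hi nzi]]|allz] := pselect (exists i, i \in sd t d /\
    nonzero Z (mu i \- (k \*: l i))); last first.
  rewrite (_ : cuts Z (sd t d) l = cuts Z (sd t d) mu)//.
  have E i u m : i \in sd t d -> Z u m -> mu i m = k * l i m.
    move=> hi zm; apply/eqP; rewrite -subr_eq0; apply: contrapT => /negP ne.
    by apply: allz; exists i; split=> //; exists u, m.
  apply: gsp_ext => u m; split=> -[zm h]; split=> // i hi.
    by rewrite (E _ u)// h// mulr0.
  by have /eqP := h _ hi; rewrite (E _ u)// mulf_eq0 (negbTE k0) => /eqP.
pose nu : func := mu i \- (k \*: l i).
have snu : supp (vx t d i) nu by move=> m; rewrite /= (sm i hi) (sl i hi).
have fnu : free Z nu.
  move=> t' x rx d' j hj /=; have [E|ne] := eqVneq (t', d', j) (t, d, i).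
    case: E rx hj => -> -> -> rx _.
    by rewrite muE// subrr.
  by rewrite (nm _ _ rx)// (nl _ _ rx)// scaler0 subrr.
have st2 : step (cuts Z (sd t d) mu) (cut (cuts Z (sd t d) mu) nu) (gam (vx t d
  i)).
  apply: Step1 => //; last exact: free_cuts_nz.
  by apply: free_sub fnu => v m [].
have [im him nzm] := active_nz acm.
have dZ2 : dimle n (cuts Z (sd t d) mu) by apply: dimle_cuts nzm => //;
  apply: sm.
have [c0 [R0 ->]] := IHn dZ2 (cuts_subsp sZ _ _) R2 st2.
have dY : dimle n (cut Z nu) by apply: dZ snu _.
have RY : red (cut Z nu) (0 + c0).
  apply: RedS; last by move: R0; rewrite cut_cutsC; apply.
  have [x [j [rx hj nz]]] := acm.
  by apply: sheet_act shm (rel_cut fnu rx) hj nz => v m [].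
have stY : step (cut Z nu) (cuts (cut Z nu) (sd t d) l) 0.
  have [x [j [rx hj nz]]] := acl.
  by apply: sheet_act shl (rel_cut fnu rx) hj nz => v m [].
have [c3 [R3]] := IHn dY (cut_subsp sZ _) RY stY.
rewrite !add0r => ->; apply: (RedS (Z1 := cut (cuts Z (sd t d) l) nu)).
  apply: Step1 => //; last exact: free_cuts_nz.
  by apply: free_sub fnu => v m [].
by rewrite cut_cutsC.
Qed.

Lemma gam_side t d : \sum_(i <- sd t d) gam (vx t d i) =
  \sum_(i <- sd t (~~ d)) gam (vx t (~~ d) i).
Proof. by case: d => /=; rewrite gamE. Qed.

(** The place where [gamE] is needed. On the kernel of mu no relation of type t is seen by l any
    more, so the l i become a chain of free functionals splitting off side d; likewise the mu j on
    the kernel of l, with side ~~ d. Both chains end in the same space. *)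
Lemma confl22_opp t d l mu c2 : sheet Z t d l -> active Z t d l ->
  sheet Z t (~~ d) mu -> active Z t (~~ d) mu ->
  (forall x, rel Z t x -> (forall i, i \in sd t d -> l i (x d i) = 0) ->
     forall j, j \in sd t (~~ d) -> mu j (x (~~ d) j) = 0) ->
  red (cuts Z (sd t (~~ d)) mu) c2 -> red (cuts Z (sd t d) l) c2.
Proof.
move=> shl acl shm acm hB R2; have [x0 [i0 [rx0 hi0 nz0]]] := acl.
have gE := confl_g shl shm rx0 hi0 nz0 hB.
have [sl nl gl] := shl; have [sm nm gm] := shm.
have nzm j : j \in sd t (~~ d) -> mu j (x0 (~~ d) j) != 0.
  move=> hj; have [x [j' [rx hj' nz]]] := acm; apply: contraNneq nz => E.
  by rewrite (gm _ rx j' j)// (gE x rx i0 j)// E mul0r mul0r.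
have nzl i : i \in sd t d -> l i (x0 d i) != 0.
  by move=> hi; rewrite (gl _ rx0 i i0).
have hC x : rel Z t x -> (forall j, j \in sd t (~~ d) ->
  mu j (x (~~ d) j) = 0) ->
    forall i, i \in sd t d -> l i (x d i) = 0.
  move=> rx h i hi; have [x1 [j [_ hj _]]] := acm.
  have /esym/eqP := gE x rx i j hi hj; rewrite h// mulf_eq0 => /orP[|/eqP//].
  by rewrite mulf_eq0 (negbTE (nzm _ hj)) invr_eq0 (negbTE nz0).
have nd d1 (i j : I) t' : (t', ~~ d1, i) != (t', d1, j).
  by rewrite !xpair_eqE; case: d1; rewrite andbF.
have nd' d1 (i j : I) t' : (t', d1, i) != (t', ~~ d1, j).
  by rewrite !xpair_eqE; case: d1; rewrite andbF.
have [zx0 _] := rx0.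
have [im him nzim] := active_nz acm; have [il hil nzil] := active_nz acl.
have dZ2 : dimle n (cuts Z (sd t (~~ d)) mu) by apply: dimle_cuts nzim => //;
  apply: sm.
have [c0 [R0 ->]] : exists c0, red (cuts (cuts Z (sd t (~~ d)) mu) (sd t d) l)
  c0 /\
    c2 = \sum_(i <- sd t d) gam (vx t d i) + c0.
  apply: (chain_down (v := vx t d) (y := x0 d)) => //.
  - exact: cuts_subsp.
  - exact: bsd_uniq.
  - move=> i hi t' x rx d' j hj; have rZ := rel_sub (@cuts_sub _ Z _ _) rx.
    have [E|ne] := eqVneq (t', d', j) (t, d, i); last exact: (nl _ _ rZ).
    case: E rx rZ hj => -> -> -> rx rZ _; apply: hC => // k hk.
    have [zx _] := rx; have [_] := zx _ _ hk; exact.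
  - move=> i hi; exists (vx t d i); split; first exact: zx0.
    by move=> j hj; apply: (nm _ _ rx0).
  - move=> i j hi hj; case: (eqVneq i j) => [->|ne]; first by apply/negbTE/nzl.
    by rewrite (nl _ _ rx0) ?eqxx// !xpair_eqE !eqxx /= eq_sym.
rewrite gam_side; apply: (chain_up (v := vx t (~~ d)) (y := x0 (~~ d)) (l :=
  mu)).
- exact: cuts_subsp.
- exact: bsd_uniq.
- exact: sm.
- move=> i hi t' x rx d' j hj; have rZ := rel_sub (@cuts_sub _ Z _ _) rx.
  have [E|ne] := eqVneq (t', d', j) (t, ~~ d, i); last exact: (nm _ _ rZ).
  case: E rx rZ hj => -> -> -> rx rZ _; apply: hB => // k hk.
  have [zx _] := rx; have [_] := zx _ _ hk; exact.
- move=> i hi; exists (vx t (~~ d) i); split; first exact: zx0.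
  by move=> j hj; apply: (nl _ _ rx0).
- move=> i j hi hj; case: (eqVneq i j) => [->|ne]; first by apply/negbTE/nzm.
  by rewrite (nm _ _ rx0) ?eqxx// !xpair_eqE !eqxx /= eq_sym.
- by rewrite cuts_cutsC.
Qed.

(** If the types differ, or some relation x is seen by mu and not by l, each sheet stays active
    after the other cut and the cuts commute. In the latter case subtracting a multiple of x from x0
    gives a relation seen by l only. Otherwise the values are proportional. *)
Lemma confl22 t d l t' d' mu c2 : sheet Z t d l -> active Z t d l ->
  sheet Z t' d' mu -> active Z t' d' mu ->
  red (cuts Z (sd t' d') mu) c2 -> red (cuts Z (sd t d) l) c2.
Proof.
move=> shl acl shm acm R2; have [sl nl gl] := shl; have [sm nm gm] := shm.
have [x0 [i0 [rx0 hi0 nz0]]] := acl.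
have [y0 [j0 [ry0 hj0 nzj0]]] := acm.
have [im him nzim] := active_nz acm.
have dZ2 : dimle n (cuts Z (sd t' d') mu) by apply: dimle_cuts nzim => //;
  apply: sm.
have done x y i j : rel (cuts Z (sd t d) l) t' y -> j \in sd t' d' ->
    mu j (y d' j) != 0 -> rel (cuts Z (sd t' d') mu) t x -> i \in sd t d ->
    l i (x d i) != 0 -> red (cuts Z (sd t d) l) c2.
  move=> ry hj nzj rx hi nzi.
  have st2 := sheet_act (@cuts_sub _ Z _ _) shl rx hi nzi.
  have st1 := sheet_act (@cuts_sub _ Z _ _) shm ry hj nzj.
  have [c3 [R3 ->]] := IHn dZ2 (cuts_subsp sZ _ _) R2 st2.
  by apply: RedS st1 _; rewrite cuts_cutsC.
have [tt|ne] := eqVneq t t'; last first.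
  apply: (done x0 y0 i0 j0) => //.
    by apply: rel_cuts => // tt; case/eqP: ne.
  by apply: rel_cuts => // tt; case/eqP: ne.
case: t' / tt in shm acm sm nm gm ry0 hj0 nzj0 R2 done him nzim dZ2 *.
have [[x [rx lx [j hj nzj]]]|hB] := pselect (exists x, [/\ rel Z t x,
    forall i, i \in sd t d -> l i (x d i) = 0
    & exists2 j, j \in sd t d' & mu j (x d' j) != 0]).
  pose a := mu j (x0 d' j) / mu j (x d' j).
  have rxa := rel_lin sZ (- a) rx rx0.
  apply: (done _ x i0 j _ hj nzj _ hi0).
  - exact: rel_cuts.
  - apply: (rel_cuts shm rxa) => _ i hi; rewrite funcP.
    rewrite (gm _ rx i j)// (gm _ rx0 i j)//.
    by rewrite mulNr /a divfK// addNr.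
  - by rewrite funcP lx// mulr0 add0r.
have {}hB x : rel Z t x -> (forall i, i \in sd t d -> l i (x d i) = 0) ->
     forall j, j \in sd t d' -> mu j (x d' j) = 0.
  move=> rx lx j hj; apply/eqP; apply: contrapT => /negP ne.
  by apply: hB; exists x; split=> //; exists j.
have [dd|ne] := eqVneq d' d.
  by rewrite dd in shm acm hB R2; apply: confl22_same hB R2.
have dd : d' = ~~ d by case: (d) (d') ne => [] [].
by rewrite dd in shm acm hB R2; apply: confl22_opp hB R2.
Qed.
End Confluence.

Lemma confluence n Z c Z1 d : dimle n Z -> subsp Z -> red Z c -> step Z Z1 d ->
  exists c1, red Z1 c1 /\ c = d + c1.
Proof.
elim: n Z c Z1 d => [|n IH] Z c Z1 d dZ sZ R st.
  by have := step_nz st dZ.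
case: R dZ sZ st => {Z c} [Z z0 _ _ /step_nz//|Z Z2 d2 c st2 R2 dZ sZ st].
case: st => {Z1 d} [u l sl fl nl|t d l shl acl].
  case: st2 R2 => {Z2 d2} [u' l' sl' fl' nl'|t d mu shm acm] R2.
    exact: (confl11 IH dZ).
  have st : step (cuts Z (sd t d) mu) (cut (cuts Z (sd t d) mu) l) (gam u).
    apply: Step1 => //; last exact: free_cuts_nz.
    by apply: free_sub fl => v m [].
  have dZ2 : dimle n (cuts Z (sd t d) mu).
    have [im him nzim] := active_nz acm; have [sm _ _] := shm.
    by apply: dimle_cuts nzim => //; apply: sm.
  have [c3 [R3 ->]] := IH _ _ _ _ dZ2 (cuts_subsp sZ _ _) R2 st.
  exists (0 + c3); split; last by rewrite !add0r.
  apply: RedS; last by move: R3; rewrite cut_cutsC; apply.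
  have [x [j [rx hj nz]]] := acm.
  by apply: (sheet_act _ shm (rel_cut fl rx) hj nz) => v m [].
case: st2 R2 => {Z2 d2} [u l' sl' fl' nl'|t' d' mu shm acm] R2; last first.
  exists c; split; last by rewrite !add0r.
  exact: (confl22 IH dZ sZ shl acl shm acm).
have dZ2 : dimle n (cut Z l') by apply: (dZ _ _ sl').
have st : step (cut Z l') (cuts (cut Z l') (sd t d) l) 0.
  have [x [j [rx hj nz]]] := acl.
  by apply: (sheet_act _ shl (rel_cut fl' rx) hj nz) => v m [].
have [c3 [R3 ->]] := IH _ _ _ _ dZ2 (cut_subsp sZ _) R2 st.
exists (gam u + c3); split; last by rewrite !add0r.
apply: (RedS (Z1 := cut (cuts Z (sd t d) l) l')).
  apply: Step1 => //; last exact: free_cuts_nz.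
  by apply: free_sub fl' => v m [].
by rewrite cut_cutsC.
Qed.

Lemma red_unique n Z c c' : dimle n Z -> subsp Z -> red Z c -> red Z c' ->
  c = c'.
Proof.
move=> dZ sZ R R'; elim: R' n dZ sZ c R => {Z c'} [Z z0|Z Z1 d c' st R' IH] n dZ
  sZ c R.
  by case: R z0 {dZ sZ} => // {}Z Z1 d c1 /step_nz.
have [c1 [R1 ->]] := confluence dZ sZ R st.
congr (_ + _); apply: (IH n) => //; last exact: step_subsp st.
by case: n dZ => [/step_nz|n /(step_dim)]; [move/(_ _ _ st)|move/(_ _ _
  st)/dimleS].
Qed.
End Reduction.

(** * Effect of a reduction step on the presented module *)

Section Presentation.
(** The values on Z of a would-be homomorphism from [MM ** e]; such a homomorphism is a right
    multiplication. *)
Definition hcompat Z (h : U -> MM -> MM) :=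
  [/\ forall u a x y, Z u x -> Z u y -> h u (a *: x + y) = a *: h u x + h u y,
      forall u x, Z u x -> eps u ** h u x = h u x
    & forall t x, rel Z t x -> forall d i, i \in sd t d ->
        h (vx t d i) (x d i) =
        \sum_(j <- sd t (~~ d)) X t d i j ** h (vx t (~~ d) j) (x (~~ d) j)].
(* [Z] generates the module [MM ** e], with the internal relations of [Z] as
   only relations. *)
Definition pres Z e :=
  [/\ forall u z, Z u z -> z ** e = z,
      forall H, (forall u z, Z u z -> z ** H = 0) -> e ** H = 0
    & forall h, hcompat Z h -> exists H, forall u z, Z u z -> z ** H = h u z].

Lemma pres_trivial Z e : pres Z e -> e ** e = e ->
  (forall u m, Z u m -> m = 0) -> e = 0.
Proof.
move=> [_ gen _] ee z0; rewrite -ee; apply: gen => u z /z0 ->.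
exact: nmul0l.
Qed.

Section OnZ.
Variables (Z : gsp) (e : MM).
Hypothesis (sZ : subsp Z) (pZ : pres Z e).

Section Hlin.
Variable h : U -> MM -> MM.
Variable Y : gsp.
Hypothesis (sY : subsp Y).
Hypothesis hl : forall u a x y, Y u x -> Y u y ->
  h u (a *: x + y) = a *: h u x + h u y.
Lemma hlin0 u : h u 0 = 0.
Proof.
have := hl 1 (sp0 sY u) (sp0 sY u); rewrite !scale1r addr0 -[X in X = _]addr0.
by move=> /addrI.
Qed.
End Hlin.

(** Normalise a relation x so that l i is 1 on [x d i]. The [x d i] complement the cut and are
    expressed by the other side of x, which lies in the cut: these generators can be eliminated, and
    x is the only relation lost. *)
Lemma pres_sheet t d l : sheet Z t d l -> active Z t d l ->
  pres (cuts Z (sd t d) l) e.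
Proof.
move=> sh [x1 [i0 [rx1 hi0 nz0]]]; have [sl nl gl] := sh.
have [ze gen ext_hom] := pZ.
pose x d' i := (l i0 (x1 d i0))^-1 *: x1 d' i.
have rx : rel Z t x.
  have := rel_lin sZ ((l i0 (x1 d i0))^-1 - 1) rx1 rx1.
  rewrite (_ : (fun d' i => _ *: x1 d' i + x1 d' i) = x)//; apply/funext => d';
    apply/funext => i.
  by rewrite scalerBl scale1r subrK.
have lx i : i \in sd t d -> l i (x d i) = 1.
  by move=> hi; rewrite funcZ (gl _ rx1 i i0)// mulVf.
clearbody x.
have [zx ex] := rx.
have lne i j : i \in sd t d -> j \in sd t d -> i != j -> l i (x d j) = 0.
  by move=> hi hj ne; rewrite (nl _ _ rx)// !xpair_eqE !eqxx /= eq_sym.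
pose p z := z - \sum_(i <- sd t d) l i z *: x d i.
have pcut u z : Z u z -> cuts Z (sd t d) l u (p z).
  move=> zz; split.
    apply: spB => //; apply: sp_sum => // i hi _.
    case: (eqVneq (vx t d i) u) => [<-|ne]; first by apply: spZ => //;
      apply: zx.
    by rewrite (supp_neq sZ (sl _ hi) zz ne) scale0r; apply: sp0.
  move=> j hj; rewrite funcB func_sum (bigD1_seq j) ?bsd_uniq//= big1_seq
    ?addr0.
    by rewrite funcZ lx// mulr1 subrr.
  by move=> i /andP[ij hi]; rewrite funcZ lne ?mulr0// eq_sym.
have pid u z : cuts Z (sd t d) l u z -> p z = z.
  by move=> [_ h]; rewrite /p big1_seq ?subr0// => i /andP[_ /h ->];
    rewrite scale0r.
have zxc j : j \in sd t (~~ d) -> cuts Z (sd t d) l (vx t (~~ d) j) (x (~~ d)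
  j).
  move=> hj; split; first exact: zx.
  by move=> i hi; apply: (nl _ _ rx) => //; rewrite !xpair_eqE; case: (d);
    rewrite andbF.
split.
- by move=> u z [/ze].
- move=> H hH; apply: gen => u z zz.
  rewrite -[z](subrK (\sum_(i <- sd t d) l i z *: x d i)) nmulDl (hH u);
    last exact: pcut.
  rewrite add0r nmul_suml big1_seq// => i /andP[_ hi].
  rewrite nmulZl ex// nmul_suml big1_seq ?scaler0// => j /andP[_ hj].
  by rewrite -nmulA (hH _ _ (zxc _ hj)) nmul0r.
move=> h [hl ht hc]; have sc := cuts_subsp sZ (sd t d) l.
pose Y i := \sum_(j <- sd t (~~ d)) X t d i j ** h (vx t (~~ d) j) (x (~~ d) j).
(* Extend h from the cut to Z: the relation x forces the value [Y i] on [x d i]. *)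
pose h' u z := h u (p z) + \sum_(i <- sd t d) l i z *: Y i.
have h'0 t' y d' i : rel Z t' y -> i \in sd t' d' -> (t', d') != (t, d) ->
    h' (vx t' d' i) (y d' i) = h (vx t' d' i) (y d' i) /\ cuts Z (sd t d) l (vx
      t' d' i) (y d' i).
  move=> ry hi ne.
  have c : cuts Z (sd t d) l (vx t' d' i) (y d' i).
    split; first by have [zy _] := ry; apply: zy.
    move=> j hj; apply: (nl _ _ ry) => //; apply: contraNneq ne => -[-> -> _].
    by [].
  split=> //; rewrite /h' (pid _ _ c) big1_seq ?addr0// => j /andP[_ hj].
  by have [_ ->] := c; rewrite ?scale0r.
have hc' : hcompat Z h'.
  split.
  - move=> u a y z zy zz; rewrite /h' (_ : p (a *: y + z) = a *: p y + p z);
      last first.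
      rewrite /p scalerBr addrACA -opprD; congr (_ - _).
      rewrite scaler_sumr -big_split; apply: eq_bigr => i _ /=.
      by rewrite funcP scalerDl scalerA.
    rewrite hl; try exact: pcut.
    rewrite scalerDr addrACA; congr (_ + _).
    rewrite scaler_sumr -big_split; apply: eq_bigr => i _ /=.
    by rewrite funcP scalerDl scalerA.
  - move=> u z zz; rewrite /h' nmulDr ht; last exact: pcut.
    congr (_ + _); rewrite nmul_sumr; apply: eq_big_seq => i hi.
    case: (eqVneq (vx t d i) u) => [<-|ne]; last first.
      by rewrite (supp_neq sZ (sl _ hi) zz ne) scale0r nmul0r.
    rewrite nmulZr /Y nmul_sumr; congr (_ *: _); apply: eq_bigr => j _.
    by rewrite nmulA epsX.
  move=> t' y ry.
  (* Phrasing the claim as a relation lets [relI] reduce the case of type t to the side d. *)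
  suff R : rel (fun u m => exists z, Z u z /\ m = h' u z) t'
      (fun d' i => h' (vx t' d' i) (y d' i)).
    by have [_ r] := R.
  have [zy ey] := ry.
  have sW : forall u m, (exists z, Z u z /\ m = h' u z) -> eps u ** m = m.
    move=> u _ [z [zz ->]]; rewrite /h' nmulDr ht; last exact: pcut.
    congr (_ + _); rewrite nmul_sumr; apply: eq_big_seq => i hi.
    case: (eqVneq (vx t d i) u) => [<-|ne]; last first.
      by rewrite (supp_neq sZ (sl _ hi) zz ne) scale0r nmul0r.
    rewrite nmulZr /Y nmul_sumr; congr (_ *: _); apply: eq_bigr => j _.
    by rewrite nmulA epsX.
  have mem d' i : i \in sd t' d' -> exists z, Z (vx t' d' i) z /\
      h' (vx t' d' i) (y d' i) = h' (vx t' d' i) z.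
    by move=> hi; exists (y d' i); split=> //; apply: zy.
  have [tt|ne] := eqVneq t' t; last first.
    have E d' : (t', d') != (t, d) by rewrite xpair_eqE (negbTE ne).
    split=> // d' i hi; rewrite (h'0 _ _ _ _ ry hi (E _)).1.
    have ryc : rel (cuts Z (sd t d) l) t' y.
      by split=> // d1 i1 hi1; apply: (h'0 _ _ _ _ ry hi1 (E _)).2.
    rewrite (hc _ _ ryc)//; apply: eq_big_seq => j hj.
    by rewrite (h'0 _ _ _ _ ry hj (E _)).1.
  rewrite {t'}tt in y ry zy ey mem *.
  apply: (@relI _ t d) => // i hi.
  have ne : (t, ~~ d) != (t, d) by rewrite xpair_eqE; case: (d); rewrite andbF.
  pose g := l i (y d i).
  (* Subtracting g times x moves the relation y into the cut, where h is compatible. *)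
  have rz := rel_lin sZ (- g) rx ry.
  have rzc : rel (cuts Z (sd t d) l) t (fun d' i' => - g *: x d' i' + y d' i').
    apply: (rel_cuts sh rz) => _ k hk.
    by rewrite funcP lx// mulr1 (gl _ ry k i)// addNr.
  have piE : p (y d i) = - g *: x d i + y d i.
    rewrite /p (bigD1_seq i) ?bsd_uniq//= big1_seq ?addr0;
      first by rewrite addrC scaleNr.
    move=> k /andP[ki hk]; rewrite (nl _ _ ry) ?scale0r//.
    by rewrite !xpair_eqE !eqxx /= eq_sym.
  have SE : \sum_(k <- sd t d) l k (y d i) *: Y k = g *: Y i.
    rewrite (bigD1_seq i) ?bsd_uniq//= big1_seq ?addr0// => k /andP[ki hk].
    by rewrite (nl _ _ ry) ?scale0r// !xpair_eqE !eqxx /= eq_sym.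
  rewrite [in LHS]/h' piE (hc _ _ rzc)// SE /Y scaler_sumr -big_split;
    apply: eq_big_seq => j hj /=.
  have [-> cy] := h'0 _ _ _ _ ry hj ne.
  rewrite hl//; last exact: zxc.
  by rewrite nmulDr nmulZr scaleNr addrAC addNr add0r.
have [H hH] := ext_hom _ hc'; exists H => u z zc; have [zz _] := zc.
rewrite (hH u)// /h' (pid _ _ zc) big1_seq ?addr0// => i /andP[_ hi].
by have [_ ->] := zc; rewrite ?scale0r.
Qed.
End OnZ.

(** No relation constrains a free l, so z |-> l z *: eps u extends to a homomorphism H onto the
    module of u. It is split by z0 with l z0 = 1, and pi is the complementary projection. *)
Lemma pres_free Z e u l : subsp Z -> pres Z e -> e ** e = e ->
  supp u l -> free Z l -> nonzero Z l ->
  exists pi z0 H, [/\ pres (cut Z l) pi, pi ** pi = pi,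
    pi ** e = pi /\ e ** pi = pi,
    e - pi = H ** z0 & z0 ** H = eps u].
Proof.
move=> sZ pZ ee sl fl [v [m [zm nz]]]; have [ze gen ext_hom] := pZ.
have uv := supp_eq sZ sl zm nz; rewrite -uv in zm => {v uv}.
pose z0 := (l m)^-1 *: m.
have zz0 : Z u z0 by apply: spZ.
have lz0 : l z0 = 1 by rewrite funcZ mulVf.
clearbody z0.
have lne v z : Z v z -> v != u -> l z = 0.
  by move=> zz ne; apply: (supp_neq sZ sl zz); rewrite eq_sym.
have eqMM (H H' : MM) : e ** H = H -> e ** H' = H' ->
    (forall v z, Z v z -> z ** H = z ** H') -> H = H'.
  move=> eH eH' hh; apply/eqP; rewrite -subr_eq0 -eH -eH' -nmulBr; apply/eqP.
  by apply: gen => v z zz; rewrite nmulBr (hh v)// subrr.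
have norm (H : MM) h : (forall v z, Z v z -> z ** H = h v z) ->
    forall v z, Z v z -> z ** (e ** H) = h v z.
  by move=> hH v z zz; rewrite nmulA (ze _ _ zz) (hH v).
have [H1 hH1] : exists H, forall v z, Z v z -> z ** H = z - l z *: z0.
  apply: (ext_hom (fun _ z => z - l z *: z0)); split.
  - move=> v a x y zx zy; rewrite funcP scalerBr addrACA -opprD scalerDl
      scalerA.
    by [].
  - move=> v z zz; rewrite nmulBr (sp_eps sZ zz); congr (_ - _).
    case: (eqVneq v u) => [->|ne]; last by rewrite (lne v z)// !scale0r nmul0r.
    by rewrite nmulZr (sp_eps sZ zz0).
  - move=> t x rx d i hi; have [zx ex] := rx.
    rewrite (fl _ _ rx)// scale0r subr0 ex//; apply: eq_big_seq => j hj.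
    by rewrite (fl _ _ rx)// scale0r subr0.
have [H2 hH2] : exists H, forall v z, Z v z -> z ** H = l z *: eps u.
  apply: (ext_hom (fun _ z => l z *: eps u)); split.
  - by move=> v a x y zx zy; rewrite funcP scalerDl scalerA.
  - move=> v z zz; case: (eqVneq v u) => [->|ne]; last first.
      by rewrite (lne v z)// scale0r nmul0r.
    by rewrite nmulZr epsM eqxx.
  - move=> t x rx d i hi; rewrite (fl _ _ rx)// scale0r big1_seq// =>
      j /andP[_ hj].
    by rewrite (fl _ _ rx)// scale0r nmul0r.
pose pi := e ** H1; pose H := e ** H2.
have zpi : forall v z, Z v z -> z ** pi = z - l z *: z0 := norm H1 _ hH1.
have zH : forall v z, Z v z -> z ** H = l z *: eps u := norm H2 _ hH2.
have epi : e ** pi = pi by rewrite /pi nmulA ee.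
have eH : e ** H = H by rewrite /H nmulA ee.
clearbody pi H.
have z0pi : z0 ** pi = 0 by rewrite (zpi u)// lz0 scale1r subrr.
have pie : pi ** e = pi.
  apply: eqMM; rewrite ?nmulA ?epi// => v z zz.
  by rewrite nmulA (zpi v)// nmulBl nmulZl (ze _ _ zz) (ze _ _ zz0).
have pipi : pi ** pi = pi.
  apply: eqMM; rewrite ?nmulA ?epi// => v z zz.
  by rewrite nmulA !(zpi v z)// nmulBl nmulZl z0pi scaler0 subr0 (zpi v z).
exists pi, z0, H; split=> //; last by rewrite (zH u)// lz0 scale1r.
  split.
  - by move=> v z [zz lz]; rewrite (zpi v)// lz scale0r subr0.
  - move=> G hG; rewrite -epi -nmulA; apply: gen => v z zz.
    rewrite nmulA (zpi v)//; apply: (hG v); split;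
      last by rewrite funcB funcZ lz0 mulr1 subrr.
    apply: spB => //; case: (eqVneq v u) => [->|ne]; first exact: spZ.
    by rewrite (lne v z)// scale0r; apply: sp0.
  - move=> h [hl ht hc].
    have pc v z : Z v z -> cut Z l v (z - l z *: z0).
      move=> zz; split; last by rewrite funcB funcZ lz0 mulr1 subrr.
      apply: spB => //; case: (eqVneq v u) => [->|ne]; first exact: spZ.
      by rewrite (lne v z)// scale0r; apply: sp0.
    have [G hG] : exists G, forall v z, Z v z -> z ** G = h v (z - l z *: z0).
      apply: (ext_hom (fun v z => h v (z - l z *: z0))); split.
      - move=> v a x y zx zy; rewrite -hl; try exact: pc.
        by rewrite funcP scalerBr addrACA -opprD scalerDl scalerA.
      - by move=> v z zz; apply: ht; apply: pc.
      - move=> t x rx d i hi; rewrite (fl _ _ rx)// scale0r subr0.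
        rewrite (hc _ _ (rel_cut fl rx))//; apply: eq_big_seq => j hj.
        by rewrite (fl _ _ rx)// scale0r subr0.
    by exists G => v z [zz lz]; rewrite (hG v)// lz scale0r subr0.
have EE : e ** (e - pi) = e - pi by rewrite nmulBr ee epi.
apply: eqMM => //; first by rewrite nmulA eH.
move=> v z zz; rewrite nmulBr (ze _ _ zz) (zpi v)// opprB addrCA subrr addr0.
rewrite nmulA (zH v)// nmulZl; congr (_ *: _); apply/esym.
exact: sp_eps zz0.
Qed.

(** A free functional comes from a homomorphism, and a homomorphism vanishing on generators is 0. *)
Lemma pres_free_gen Z e u l (G : MM -> Prop) : subsp Z -> pres Z e ->
  eps u != 0 ->
  supp u l -> free Z l -> (forall g, G g -> l g = 0) ->
  (forall g, G g -> exists v, Z v g) ->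
  (forall H, (forall g, G g -> g ** H = 0) -> e ** H = 0) -> ~ nonzero Z l.
Proof.
move=> sZ [ze gen ext_hom] u0 sl fl lG GZ genG [w [m [zm /eqP nz]]]; apply: nz.
have [H hH] : exists H, forall v z, Z v z -> z ** H = l z *: eps u.
  apply: (ext_hom (fun _ z => l z *: eps u)); split.
  - by move=> v a x y zx zy; rewrite funcP scalerDl scalerA.
  - move=> v z zz; case: (eqVneq u v) => [->|ne]; last first.
      by rewrite (supp_neq sZ sl zz ne) scale0r nmul0r.
    by rewrite nmulZr epsM eqxx.
  - move=> t x rx d i hi; rewrite (fl _ _ rx)// scale0r big1_seq// =>
      j /andP[_ hj].
    by rewrite (fl _ _ rx)// scale0r nmul0r.
have eH : e ** H = 0.
  by apply: genG => g Gg; have [v zv] := GZ _ Gg; rewrite (hH v)// lG// scale0r.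
have := hH _ _ zm; rewrite -{1}(ze _ _ zm) -nmulA eH nmul0r.
by move/esym/eqP; rewrite scaler_eq0 (negbTE u0) orbF => /eqP.
Qed.
End Presentation.
End Machine.

(** * Coefficient functionals on row vectors over A *)

Section Concrete.
Variables (K : fieldType) (S : bsys).
Local Notation U := (bvert S).
Local Notation sd := (@bsd S).
Local Notation vx := (@bvx S).
Local Notation A := (balg K S).
Local Notation bV := (@bV K S).
Local Notation bX := (@bX K S).
Local Notation MM := (matInf A).
Local Notation func := ({linear MM -> K^o}).

(** Row vectors are encoded as matrices supported in row 0, so that A acts on them from position (0,
    0). *)
Definition mV (u : U) : MM := munit 0 0 (bV u).
Definition mX t d i j : MM := munit 0 0 (bX t d i j).
Local Notation subsp := (subsp mV).
Local Notation rel := (rel mX).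
Local Notation supp := (supp mV).
Local Notation free := (free mX).
Local Notation sheet := (sheet mV mX).
Local Notation active := (active mX).
Local Notation gsp := (gsp S MM).
Implicit Type Z : gsp.

Lemma mVM u u' : mV u ** mV u' = if u == u' then mV u else 0.
Proof. by rewrite /mV munit00M bVV; case: eqP => // _; rewrite linear0. Qed.
Lemma mVX t d i j : mV (vx t d i) ** mX t d i j = mX t d i j.
Proof. by rewrite /mV munit00M bVX. Qed.
Lemma mXX t d i i' : i \in sd t d -> i' \in sd t d ->
  \sum_(j <- sd t (~~ d)) mX t d i j ** mX t (~~ d) j i' =
  if i == i' then mV (vx t d i) else 0.
Proof.
move=> hi hi'; under eq_bigr do rewrite munit00M.
by rewrite -linear_sum bXX//; case: ifP => // _; rewrite linear0.
Qed.
Lemma mV_neq0 u : mV u != 0.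
Proof.
apply: contra_neq (bV_neq0 K u) => /(congr1 (fun m : MM => m 0%N 0%N)).
by rewrite munit00E.
Qed.

(* The functional m |-> coefficient at the word w of entry (0, k) of m x. *)
Definition lcf_fun k b w (x m : MM) : K := cf b w ((m ** x) 0%N k).
Lemma lcf_is_linear k b w x : linear (lcf_fun k b w x : MM -> K^o).
Proof.
move=> a m m'; rewrite /lcf_fun nmulDl nmulZl matD matZ.
exact: cf_is_linear.
Qed.
HB.instance Definition _ k b w x :=
  GRing.isLinear.Build K MM K^o *:%R (lcf_fun k b w x) (lcf_is_linear k b w x).
Definition lcf k b w x : func := lcf_fun k b w x.
Lemma lcfE k b w x m : lcf k b w x m = cf b w ((m ** x) 0%N k).
Proof. by []. Qed.

Lemma cf_supp b w (x : A) : cf b w (bV (vend b w) ** x) = cf b w x.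
Proof.
have [s [/allP vs ->]] := inspanP x; rewrite nmul_sumr !cf_sum.
apply: eq_big_seq => p /vs vp; rewrite nmulZr !cfZ; congr (_ * _).
case: (eqVneq (vend b w) (vend p.2.1 p.2.2)) => [->|ne]; first by rewrite Vwval.
rewrite Vwval_neq// cf0 cf_wval//; case: eqP => //= eb; case: eqP => // ew.
by case/eqP: ne; rewrite eb ew.
Qed.
Lemma mV_mulE u (m : MM) k : (mV u ** m) 0%N k = bV u ** m 0%N k.
Proof. by rewrite munit_mulE. Qed.
Lemma lcf_supp k b w x : supp (vend b w) (lcf k b w x).
Proof. by move=> m; rewrite !lcfE -nmulA mV_mulE cf_supp. Qed.

Definition vanish Z x n := forall u z, Z u z -> forall k b w, (n < size w)%N ->
  lcf k b w x z = 0.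

(** Prepend to w' a letter (t, ~~ d, i, j) with i distinguished. The word is now too long to occur
    in component i of the other side; expanding that component by the relation leaves the
    coefficient at w' in component j and one rewriting term, which must cancel. *)
Lemma rel_top Z x n t xi d j k b w' : subsp Z -> vanish Z x n -> rel Z t xi ->
  j \in sd t d -> size w' = n -> valid b w' ->
  lcf k b w' x (xi d j) = if whd t d j w' is Some (i', w'') then
    lcf k b ((t, d, head j (sd t d), i') :: w'') x (xi d (head j (sd t d))) else
      0.
Proof.
move=> sZ vZ rx hj sw vw; have [zx ex] := rx.
have bh : isb t d (head j (sd t d)).
  by rewrite /isb; case: (sd t d) hj => //= a s _.
have hh : head j (sd t d) \in sd t d.
  by case: (sd t d) hj => //= a s _; rewrite inE eqxx.
case: (eqVneq (vx t d j) (vend b w')) => [ej|nej]; last first.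
  have -> : lcf k b w' x (xi d j) = 0.
    by apply: (supp_neq mVM sZ (lcf_supp k b w' x) (zx _ _ hj)); rewrite eq_sym.
  case: (whdP t d j w') => [[i' [w'' [wE' _]]]|->//].
  by case/eqP: nej; rewrite wE'.
(* If the letter cannot be prepended, j is itself the head label and w' starts with it, so both
   sides of the claim agree. *)
case: (boolP (junc t (~~ d) j w')) => [ju|]; last first.
  rewrite /junc negbK negbK => /andP[bj].
  case: (whdP t d j w') => [[i' [w'' [wE' ->]]] _|->//].
  by rewrite wE' (isb_inj hh hj bh bj).
have [i hi bi] := isb_ex hj.
pose w := (t, ~~ d, i, j) :: w'.
have vwE : valid b w by rewrite /w validE /okl negbK hi hj ej eqxx ju vw.
have := vZ _ _ (zx _ _ hi) k b w; rewrite /= sw ltnSn => /(_ isT).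
rewrite lcfE ex// negbK nmul_suml mat_sum cf_sum.
under eq_bigr => j1 _.
  rewrite -nmulA munit_mulE eqxx cfX /opX_fun.
  rewrite vwE [vend _ _]/= eqxx /w whd_cons !andbT.
  over.
rewrite (eq_big_seq (fun j1 =>
  (if j1 == j then lcf k b w' x (xi d j) else 0) -
  (if isb t d j1 then (if whd t d j w' is Some (i', w'') then
    lcf k b ((t, d, j1, i') :: w'') x (xi d j1) else 0) else 0))); last first.
  move=> j1 hj1; rewrite /okl hi negbK hj1 /cpart !negbK.
  rewrite [X in _ + X](_ : _ = 0) ?addr0; last first.
    case: ifP => // _; apply: (vZ _ _ (zx _ _ hj1)).
    by rewrite /= sw ltnS leqnSn.
  congr (_ - _); first by case: eqP => // ->.
rewrite sumrB (bigD1_seq j) ?bsd_uniq//= eqxx big1;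
  last by move=> i1 /negbTE ->.
rewrite (big_isb _ hh bh) addr0 => /eqP; rewrite subr_eq0 => /eqP -> //.
Qed.

Lemma lcf_valid k b w x : ~~ valid b w -> forall m, lcf k b w x m = 0.
Proof.
move=> nv m; rewrite lcfE; set y := (m ** x) 0%N k.
have [s [/allP vs ->]] := inspanP y; rewrite cf_sum big1_seq// =>
  p /andP[_ /vs vp].
rewrite cfZ cf_wval//; case: eqP => [eb|_] /=; last by rewrite mulr0.
case: eqP => [ew|_]; last by rewrite mulr0.
by case/negP: nv; rewrite eb ew.
Qed.

(* Take a coefficient at a longest word occurring in Z x. *)
Lemma extraction Z x N : subsp Z -> vanish Z x N ->
  (exists k b w, nonzero Z (lcf k b w x)) ->
  exists k b w, [/\ nonzero Z (lcf k b w x), vanish Z x (size w)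
    & free Z (lcf k b w x) \/
      exists t d l, [/\ sheet Z t d l, active Z t d l
        & forall i, i \in sd t d -> exists w',
          size w' = size w /\ l i = lcf k b w' x]].
Proof.
move=> sZ vN ex.
have [k [b [w [nz vw]]]] : exists k b w, nonzero Z (lcf k b w x) /\ vanish Z x
  (size w).
  elim: N vN => [|N IH] vN.
    have [k [b [w nz]]] := ex; exists k, b, w; split=> //.
    move=> u z zz k' b' w' sw; apply: vN zz _ _ _ _.
    exact: leq_ltn_trans sw.
  have [[k [b [w [nz sw]]]]|nex] := pselect (exists k b w,
      nonzero Z (lcf k b w x) /\ size w = N.+1).
    by exists k, b, w; rewrite sw.
  apply: IH => u z zz k b w; rewrite leq_eqVlt => /orP[/eqP sw|];
    last exact: vN zz k b w.
  apply/eqP; apply: contrapT => /negP ne; apply: nex.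
  by exists k, b, w; split=> //; exists u, z.
exists k, b, w; split=> //.
have valw w' : nonzero Z (lcf k b w' x) -> valid b w'.
  by move=> [u [z [_]]]; apply: contraNT => /lcf_valid ->.
have top := fun t xi d j => @rel_top Z x (size w) t xi d j k b _ sZ vw.
case wE: w => [|[[[t d] i] j] w0].
  left=> t xi rx d i hi; rewrite (top _ _ _ _ _ rx hi) ?wE//.
(* Varying the row label of the first letter of w gives the sheet: by [rel_top] all members take on
   a relation the value found at the head label. *)
pose l i' : func := lcf k b ((t, d, i', j) :: w0) x.
have sl i' : size ((t, d, i', j) :: w0) = size w by rewrite wE.
have lsupp i' : supp (vx t d i') (l i') by apply: (@lcf_supp k b ((t, d, i',
  j) :: w0) x).
have vl i' : i' \in sd t d -> valid b ((t, d, i', j) :: w0).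
  move=> hi'; have := valw _ nz; rewrite wE !validE => /and4P[/andP[_ hj] -> ->
    ->].
  by rewrite /okl hi' hj.
have topl t' xi d' i1 j1 : rel Z t' xi -> i1 \in sd t' d' -> j1 \in sd t d ->
    l j1 (xi d' i1) = if (t', d', i1) == (t, d, j1) then
      l (head j1 (sd t d)) (xi d (head j1 (sd t d))) else 0.
  move=> rx hi1 hj1; rewrite [LHS](top _ _ _ _ _ rx hi1 (sl j1) (vl _ hj1)) /=.
  rewrite !xpair_eqE; case: (eqVneq t t') hi1 => [<-|nt] hi1 //=.
  case: (eqVneq d d') hi1 => [<-|nd] hi1 //=.
  by case: (eqVneq j1 i1) => // ->.
have hd j1 j2 : j1 \in sd t d -> head j2 (sd t d) = head j1 (sd t d).
  by case: (sd t d).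
have sh : sheet Z t d l.
  split=> [i' _|t' xi rx d' i1 j1 hi1 hj1 /negbTE ne|xi rx i1 j1 hi1 hj1].
  - exact: lsupp.
  - by rewrite (topl _ _ _ _ _ rx hi1 hj1) ne.
  - by rewrite (topl _ _ _ _ _ rx hi1 hi1) (topl _ _ _ _ _ rx hj1 hj1) !eqxx (hd
      i1).
have [ac|nac] := pselect (active Z t d l).
  right; exists t, d, l; split=> // i' _; by exists ((t, d, i', j) :: w0).
left=> t' xi rx d' i1 hi1.
have hi : i \in sd t d by have := valw _ nz; rewrite wE validE =>
  /and4P[/andP[]].
rewrite -/(l i) (topl _ _ _ _ _ rx hi1 hi); case: eqP => // -[tt dd ii].
rewrite tt in rx; apply/eqP; apply: contrapT => /negP ne; apply: nac.
exists xi, (head i (sd t d)); split=> //.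
by case: (sd t d) hi => //= a s _; rewrite inE eqxx.
Qed.
End Concrete.

(** * Decomposition into vertices *)

Section VA.
Variables (K : fieldType) (S : bsys).
Local Notation U := (bvert S).
Local Notation sd := (@bsd S).
Local Notation vx := (@bvx S).
Local Notation A := (balg K S).
Local Notation bV := (@bV K S).
Local Notation MM := (matInf A).
Local Notation mV := (@mV K S).
Local Notation mX := (@mX K S).
Local Notation subsp := (subsp mV).
Local Notation dimle := (dimle mV).
Local Notation pres := (pres mV mX).
Local Notation gsp := (gsp S MM).
Implicit Type Z : gsp.

Lemma vanish_sub Z Z' x n : (forall u m, Z' u m -> Z u m) -> vanish Z x n ->
  vanish Z' x n.
Proof. by move=> ZZ v u z /ZZ; apply: v. Qed.

Lemma lcf_bounded x (m : MM) :
  exists N, forall k b w, (N < size w)%N -> lcf k b w x m = 0.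
Proof.
have [n cn] := matInf_corner (m ** x).
have [N hN] : {N : nat -> nat & forall k b w, (N k < size w)%N ->
  cf b w ((m ** x) 0%N k) = 0}.
  apply: cid; have /choice[N hN] := fun k => cf_bounded ((m ** x) 0%N k).
  by exists N.
exists (\max_(k < n) N k) => k b w sw; rewrite lcfE.
case: (ltnP k n) => kn; last by rewrite cn ?kn ?orbT// cf0.
apply: hN; apply: leq_ltn_trans sw.
exact: (leq_bigmax (Ordinal kn)).
Qed.
Lemma spn_vanish (s : seq (U * MM)) x : exists N, vanish (@spn K S MM s) x N.
Proof.
elim: s => [|p s [N hN]].
  by exists 0%N => u z -> k b w _; rewrite lcfE nmul0l mat0 cf0.
have [M hM] := lcf_bounded x p.2.
exists (maxn N M) => u z [a [_ hz]] k b w; rewrite gtn_max => /andP[Nw Mw].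
rewrite -[z](subrK (a *: p.2)) addrC funcP (hN _ _ hz)// addr0.
by rewrite hM// mulr0.
Qed.

Lemma row0 u (z : MM) i k : mV u ** z = z -> i != 0%N -> z i k = 0.
Proof. by move=> <- /negbTE i0; rewrite munit_mulE i0. Qed.
Lemma row_faithful u (z x : MM) : mV u ** z = z ->
  (forall k b w, lcf k b w x z = 0) -> z ** x = 0.
Proof.
move=> uz h; apply: matInf_ext => i k; rewrite mat0.
case: (eqVneq i 0%N) => [->|i0]; last first.
  by apply: (@row0 u) => //; rewrite nmulA uz.
by apply: cf_faithful => b w; rewrite -lcfE h.
Qed.

Lemma mVid u : mV u ** mV u = mV u. Proof. by rewrite mVM eqxx. Qed.
Definition vcl u : Vmon A := Vpi (mkidem (mVid u)).

Lemma pres_standard n Z (e : MM) (ee : e ** e = e) : subsp Z -> dimle n Z ->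
  (exists N, vanish Z e N) -> pres Z e ->
  exists us, Vpi (mkidem ee) = \sum_(u <- us) vcl u.
Proof.
elim: n Z e ee => [|n IH] Z e ee sZ dZ [N vN] pZ.
  by exists [::]; rewrite big_nil; apply: Vpi_eq0; apply: (pres_trivial pZ ee).
have [ze gen _] := pZ.
have [ex|nex] := pselect (exists k b w, nonzero Z (lcf k b w e)); last first.
  exists [::]; rewrite big_nil; apply: Vpi_eq0;
    apply: (pres_trivial pZ ee) => u z zz.
  rewrite -(ze _ _ zz); apply: (row_faithful (sp_eps sZ zz)) => k b w.
  apply/eqP; apply: contrapT => /negP ne; apply: nex.
  by exists k, b, w, u, z.
have [k [b [w [nz vw [fr|[t [d [l [sh ac _]]]]]]]]] := extraction sZ vN ex;
  last first.
  have [sl _ _] := sh; have [i hi nzi] := active_nz ac.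
  apply: (IH (cuts Z (sd t d) l)).
  - exact: cuts_subsp.
  - by apply: (dimle_cuts dZ (sl _ hi)).
  - by exists (size w); apply: vanish_sub vw => u m [].
  - exact: (pres_sheet (@mVM K S) (@mVX K S) (@mXX K S) sZ pZ sh ac).
have sl := @lcf_supp _ _ k b w e.
have [pi [z0 [H [pp pipi [pie epi] eH Hu]]]] :=
  pres_free (@mVM K S) sZ pZ ee sl fr nz.
have qq : (e - pi) ** (e - pi) = e - pi.
  by rewrite nmulBl !nmulBr ee pie epi pipi subrr subr0.
have [us hus] : exists us, Vpi (mkidem pipi) = \sum_(u <- us) vcl u.
  apply: (IH (cut Z (lcf k b w e))) => //.
  - exact: cut_subsp.
  - exact: dZ sl nz.
  exists (size w) => u z zz k' b' w' sw; have [zZ _] := zz.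
  have [zpi _ _] := pp; rewrite lcfE (zpi _ _ zz) -(ze _ _ zZ) -lcfE.
  exact: (vw _ _ zZ).
exists (vend b w :: us); rewrite big_cons -hus.
have -> : vcl (vend b w) = Vpi (mkidem qq).
  by apply/VpiP; exists z0, H.
by apply: VpiD; rewrite /= ?nmulBl ?nmulBr ?pie ?epi ?pipi ?subrr ?subrK.
Qed.

Section Diag.
Variable us : seq U.
Variable u0 : U.
Local Notation un k := (nth u0 us k).
Definition drow k : MM := munit 0 k (bV (un k)).
Definition diag n : MM := \sum_(k < n) munit k k (bV (un k)).
Lemma diagS n : diag n.+1 = diag n + munit n n (bV (un n)).
Proof. by rewrite /diag big_ord_recr. Qed.
Lemma diag_munit n : diag n ** munit n n (bV (un n)) = 0 /\
  munit n n (bV (un n)) ** diag n = 0.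
Proof.
rewrite /diag nmul_suml nmul_sumr !big1// => k _; rewrite munitM.
  by rewrite [_ == _]gtn_eqF.
by rewrite [_ == _]ltn_eqF.
Qed.
Lemma munit_idem k u : munit k k (bV u) ** munit k k (bV u) = munit k k (bV u)
  :> MM.
Proof. by rewrite munitM eqxx bVid. Qed.
Lemma diag_idem n : diag n ** diag n = diag n.
Proof.
elim: n => [|n IH]; first by rewrite /diag big_ord0 nmul0l.
have [h1 h2] := diag_munit n.
by rewrite diagS nmulDl !nmulDr IH h1 h2 munit_idem addr0 add0r.
Qed.
Lemma Vdiag n : Vpi (mkidem (diag_idem n)) = \sum_(k < n) vcl (un k).
Proof.
elim: n => [|n IH].
  by rewrite big_ord0; apply: Vpi_eq0; rewrite /= /diag big_ord0.
have [h1 h2] := diag_munit n.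
rewrite big_ord_recr -IH (VpiD (e := mkidem (diag_idem n)) (f :=
  mkidem (munit_idem n (un n)))) //=.
- congr (_ + _); apply/VpiP => /=; exists (munit n 0 (bV (un n))),
    (munit 0 n (bV (un n))).
  by rewrite !munitM !eqxx bVid.
- exact: diagS.
Qed.
Lemma drow_diag k n : (k < n)%N -> drow k ** diag n = drow k.
Proof.
move=> kn; rewrite /diag nmul_sumr (bigD1 (Ordinal kn))//= munitM eqxx bVid big1
  ?addr0//.
by move=> j /eqP jk; rewrite munitM; case: eqP => // kj; case: jk;
  apply: val_inj.
Qed.
Lemma diag_rows n : diag n = \sum_(k < n) munit k 0 (bV (un k)) ** drow k.
Proof. by apply: eq_bigr => k _; rewrite munitM eqxx bVid. Qed.
Lemma mV_drow k : mV (un k) ** drow k = drow k.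
Proof. by rewrite munitM eqxx bVid. Qed.
Lemma lcf_drow k' b w k : (0 < size w)%N -> cf b w (drow k 0%N k') = 0.
Proof.
move=> sw; rewrite munitE eqxx /=; case: ifP => _; last exact: cf0.
rewrite -[bV _](wval_nil) cf_wval//; case: w sw => //= x w _.
by rewrite andbF.
Qed.
End Diag.

Lemma cf_bVr b w (x : A) u : cf b w (x ** bV u) = if b == u then cf b w x else
  0.
Proof.
have [s [/allP vs ->]] := inspanP x; rewrite nmul_suml !cf_sum.
case: (eqVneq b u) => [<-|ne].
  apply: eq_big_seq => p /vs vp; rewrite nmulZl !cfZ; congr (_ * _).
  case: (eqVneq p.2.1 b) => [<-|ne]; first by rewrite wvalV.
  by rewrite -wvalV -nmulA bVV (negbTE ne) nmul0r cf0 wvalV cf_wval// eq_sym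
    (negbTE ne).
rewrite big1_seq// => p /andP[_ /vs vp]; rewrite nmulZl cfZ.
case: (eqVneq p.2.1 u) ne => [<-|ne'] ne; last by rewrite -wvalV -nmulA bVV
  (negbTE ne') nmul0r cf0 mulr0.
by rewrite wvalV cf_wval// (negbTE ne) mulr0.
Qed.

Lemma mul_diagE us u0 n (m : MM) i k :
  (m ** diag us u0 n) i k = if (k < n)%N then m i k ** bV (nth u0 us k) else 0.
Proof.
rewrite /diag nmul_sumr mat_sum.
rewrite (eq_bigr (fun j : 'I_n => if (j : nat) == k then m i j ** bV (nth u0 us
  j) else 0)).
  by rewrite -big_mkcond /= (big_ord1_eq _ (fun j : nat =>
    m i j ** bV (nth u0 us j))).
by move=> j _; rewrite mul_munitE eq_sym; case: eqP => // ->.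
Qed.

Section Standard.
Variables (Mn : nmodType) (gam : U -> Mn).
Hypothesis gamE : forall t, \sum_(i <- sd t true) gam (vx t true i) =
  \sum_(i <- sd t false) gam (vx t false i).
Local Notation red := (red mV mX gam).

(** With only empty words left, their coefficients are free and dual to the rows
    [drow us u0 k ** y], and together they cut Z down to 0. *)
Lemma red_base Z (e x y : MM) us u0 : subsp Z -> vanish Z x 0 -> pres Z e ->
  e = x ** y -> y ** x = diag us u0 (size us) ->
  x ** diag us u0 (size us) = x ->
  (forall k, (k < size us)%N -> Z (nth u0 us k) (drow us u0 k ** y)) ->
  red Z (\sum_(u <- us) gam u).
Proof.
move=> sZ vZ [ze _ _] exy yx xf Zr.
have -> : \sum_(u <- us) gam u = \sum_(k <- iota 0 (size us)) gam (nth u0 us k)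
  + 0.
  by rewrite addr0 (big_nth u0) /index_iota subn0.
apply: (@chain_up _ _ _ _ _ _ _ _ Z (nth u0 us)
  (fun k => lcf k (nth u0 us k) [::] x) (fun k => drow us u0 k ** y)) => //.
- exact: iota_uniq.
- by move=> i _; apply: (@lcf_supp _ _ i (nth u0 us i) [::] x).
- by move=> i _ t xi rx d j hj; rewrite (rel_top _ sZ vZ rx hj).
- by move=> i; rewrite mem_iota /= => hi; exists (nth u0 us i); apply: Zr.
- move=> i j; rewrite !mem_iota /= !add0n => hi hj.
  rewrite lcfE -nmulA yx drow_diag// munitE eqxx andTb.
  case: (eqVneq i j) => [->|_]; last by rewrite cf0 eqxx.
  by rewrite -[bV _](wval_nil) cf_wval// !eqxx /= oner_eq0.
apply: Red0 => u z [zz lz].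
rewrite -(ze _ _ zz) exy nmulA (row_faithful (sp_eps sZ zz)) ?nmul0l// => k b w.
case: w => [|a w]; last exact: (vZ _ _ zz).
rewrite lcfE -xf nmulA mul_diagE; case: ltnP => kn; last by rewrite cf0.
rewrite cf_bVr; case: eqP => // ->; rewrite -lcfE.
by apply: lz; rewrite mem_iota.
Qed.

(** Multiplication by x passes to the coordinates of the diagonal idempotent, where the rows
    [drow us u0 k ** y] involve empty words only. A free coefficient at a nonempty word would vanish
    on these generators, hence on Z; so only steps contributing 0 occur before [red_base]
    applies. *)
Lemma red_standard n Z (e x y : MM) us u0 : subsp Z -> dimle n Z ->
  (exists N, vanish Z x N) -> pres Z e ->
  e = x ** y -> y ** x = diag us u0 (size us) ->
  x ** diag us u0 (size us) = x -> diag us u0 (size us) ** y = y ->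
  (forall k, (k < size us)%N -> Z (nth u0 us k) (drow us u0 k ** y)) ->
  red Z (\sum_(u <- us) gam u).
Proof.
move=> + + + + exy yx xf fy.
elim: n Z => [|n IH] Z sZ dZ [N vN] pZ Zr.
  apply: (red_base sZ _ pZ exy yx xf Zr) => u z /dZ -> k b w _.
  exact: func0.
have [[k0 [b0 [w0 [sw0 nz0]]]]|nex] := pselect (exists k b w,
      (0 < size w)%N /\ nonzero Z (lcf k b w x)); last first.
  apply: (red_base sZ _ pZ exy yx xf Zr) => u z zz k b w sw.
  apply/eqP; apply: contrapT => /negP ne; apply: nex.
  by exists k, b, w; split=> //; exists u, z.
have [|k [b [w [nz vw H]]]] := extraction sZ vN; first by exists k0, b0, w0.
have sw : (0 < size w)%N.
  rewrite lt0n; apply/negP => /eqP sw; rewrite sw in vw.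
  by case: nz0 => [u [z [zz]]]; rewrite (vw _ _ zz)// eqxx.
have rowE k1 b1 w1 j : (j < size us)%N -> size w1 = size w ->
    lcf k1 b1 w1 x (drow us u0 j ** y) = 0.
  move=> hj sw1; rewrite lcfE -nmulA yx drow_diag//.
  by apply: lcf_drow; rewrite sw1.
case: H => [fr|[t [d [l [sh ac lE]]]]].
  case: (@pres_free_gen _ _ _ _ mX (@mVM K S) Z e (vend b w) (lcf k b w x)
    (fun g => exists2 j, (j < size us)%N & g = drow us u0 j ** y)) => //.
  - exact: mV_neq0.
  - exact: lcf_supp.
  - by move=> g [j hj ->]; apply: rowE.
  - by move=> g [j hj ->]; exists (nth u0 us j); apply: Zr.
  - move=> G hG; rewrite exy -nmulA -fy diag_rows !nmul_suml nmul_sumr big1// =>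
      j _.
    by rewrite -!nmulA (nmulA (drow _ _ _)) hG ?nmul0r ?nmul0r//; exists j.
rewrite -[X in red _ X]add0r; apply: RedS; first exact: (Step2 _ sh ac).
have [sl _ _] := sh; have [i hi nzi] := active_nz ac.
apply: IH.
- exact: cuts_subsp.
- by apply: (dimle_cuts dZ (sl _ hi)).
- by exists (size w); apply: vanish_sub vw => u m [].
- exact: (pres_sheet (@mVM K S) (@mVX K S) (@mXX K S) sZ pZ sh ac).
- move=> j hj; split; first exact: Zr.
  by move=> i1 /lE[w' [sw' ->]]; apply: rowE.
Qed.
End Standard.
End VA.

(** * Finite dimensional presentations and the monoid of A *)

Section VA2.
Variables (K : fieldType) (S : bsys).
Local Notation U := (bvert S).
Local Notation sd := (@bsd S).
Local Notation vx := (@bvx S).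
Local Notation A := (balg K S).
Local Notation W := (word S).
Local Notation bV := (@bV K S).
Local Notation MM := (matInf A).
Local Notation mV := (@mV K S).
Local Notation mX := (@mX K S).
Local Notation subsp := (subsp mV).
Local Notation rel := (rel mX).
Local Notation dimle := (dimle mV).
Local Notation pres := (pres mV mX).
Local Notation gsp := (gsp S MM).
Implicit Type Z : gsp.


Local Notation spn := (@spn K S MM).
Local Notation typed := (typed mV).

Lemma spn_ind (Z : gsp) (Q : U -> MM -> Prop) (s : seq (U * MM)) :
  subsp Z -> (forall u, Q u 0) ->
  (forall u a x y, Z u x -> Z u y -> Q u x -> Q u y -> Q u (a *: x + y)) ->
  (forall p, p \in s -> Z p.1 p.2 /\ Q p.1 p.2) ->
  forall u z, spn s u z -> Z u z /\ Q u z.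
Proof.
move=> sZ Q0 Ql; elim: s => [|p s IH] Qs u z /=.
  by move=> ->; split; [apply: sp0|apply: Q0].
move=> [a [ha hz]]; have [|zz qz] := IH _ u _ hz.
  by move=> q qs; apply: Qs; rewrite inE qs orbT.
have [zp qp] : Z p.1 p.2 /\ Q p.1 p.2 by apply: Qs; rewrite inE eqxx.
case: ha => [a0|pu]; first by move: zz qz; rewrite a0 scale0r subr0.
rewrite -[z](subrK (a *: p.2)) addrC -pu; rewrite -pu in zz qz.
by split; [apply: sp_lin|apply: Ql].
Qed.

(** Closed under suffixes and under changing the row label of the first letter: a whole side of
    words (t, d, i', j) :: w' comes with w', so the relation between them holds inside the span. *)
Fixpoint cl (w : W) : seq W := w ::
  (if w is (t, d, i, j) :: w' then [seq (t, d, i', j) :: w' |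
    i' <- sd t d] ++ cl w' else [::]).

Section Init.
Variable e : MM.
Variable n : nat.
Hypothesis cn : corner n n e.
Hypothesis ee : e ** e = e.
(* index of a monomial row: base vertex, column and word *)
Local Notation IX := (U * nat * W)%type.
Definition erow (p : IX) : MM := munit 0 p.1.2 (wval K p.1.1 p.2) ** e.
Definition eelt (p : IX) : U * MM := (vend p.1.1 p.2, erow p).

Lemma eelt_typed (D : seq IX) : typed (map eelt D).
Proof.
move=> p /mapP[q _ ->] /=; rewrite /erow nmulA munitM eqxx Vwval.
by [].
Qed.
Lemma erow_e p : erow p ** e = erow p.
Proof. by rewrite /erow -nmulA ee. Qed.

Variable D : seq IX.
Variable S1 : seq U.
Hypothesis uS1 : uniq S1.
Hypothesis D_valid : forall p, p \in D -> [/\ valid p.1.1 p.2,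
  p.1.1 \in S1 & (p.1.2 < n)%N].
Hypothesis S_e : forall k l, (k < n)%N -> bone K S1 ** e k l = e k l.
Definition Dcl : seq IX := flatten [seq [seq (p.1, w) | w <- cl p.2] |
  p <- D ++ [seq (b, l, [::]) | b <- S1, l <- iota 0 n]].
Definition init_span : gsp := spn (map eelt Dcl).
Lemma init_span_subsp : subsp init_span.
Proof. exact: (spn_subsp (@eelt_typed Dcl)). Qed.

(* rows whose entries are combinations of the words in [D] *)
Definition expr u (y : MM) := exists L : seq (K * IX), (forall q, q \in L ->
  q.2 \in D) /\
  y = \sum_(q <- L) q.1 *: (mV u ** munit 0 q.2.1.2 (wval K q.2.1.1 q.2.2)).

Lemma init_span_D p w : p \in D -> w \in cl p.2 ->
  init_span (vend p.1.1 w) (erow (p.1, w)).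
Proof.
move=> pD wp; apply: (@spn_mem K S MM mV); first exact: eelt_typed.
apply/mapP; exists (p.1, w) => //; apply/flattenP.
exists [seq (p.1, w') | w' <- cl p.2]; last by apply/mapP; exists w.
by apply/mapP; exists p => //; rewrite mem_cat pD.
Qed.
Lemma init_span_S b l : b \in S1 -> (l < n)%N -> init_span b (erow (b, l,
  [::])).
Proof.
move=> bS ln; apply: (@spn_mem K S MM mV); first exact: eelt_typed.
apply/mapP; exists (b, l, [::]) => //; apply/flattenP.
exists [seq ((b, l), w') | w' <- cl [::]]; last by apply/mapP; exists [::].
apply/mapP; exists (b, l, [::]) => //; rewrite mem_cat; apply/orP; right.
by apply/allpairsP; exists (b, l); rewrite mem_iota.
Qed.
Lemma cl_self w : w \in cl w.
Proof. by case: w => [|a w]; rewrite inE eqxx. Qed.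

(** Since y ** e = y, the coefficients expressing y by monomial rows also express it by the monomial
    multiples of the rows of e. *)
Lemma expr_sum u y : expr u y -> y ** e = y -> exists L : seq (K * IX),
  (forall q, q \in L -> q.2 \in D /\ vend q.2.1.1 q.2.2 = u) /\
  y = \sum_(q <- L) q.1 *: erow q.2 /\
  y = \sum_(q <- L) q.1 *: munit 0 q.2.1.2 (wval K q.2.1.1 q.2.2).
Proof.
move=> [L [LD yE]] ye.
pose P := fun q : K * IX => vend q.2.1.1 q.2.2 == u.
have yE' : y = \sum_(q <- [seq q <- L | P q]) q.1 *: munit 0 q.2.1.2 (wval K
  q.2.1.1 q.2.2).
  rewrite yE big_filter [RHS]big_mkcond; apply: eq_bigr => q _.
  rewrite munitM eqxx /P; case: (eqVneq _ u) => [<-|ne]; first by rewrite Vwval.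
  by rewrite Vwval_neq 1?eq_sym// linear0 scaler0.
exists [seq q <- L | P q]; split; last split=> //.
  by move=> q; rewrite mem_filter => /andP[/eqP qu qL]; split=> //; apply: LD.
rewrite -{1}ye yE' nmul_suml; apply: eq_bigr => q _; by rewrite nmulZl.
Qed.
Lemma expr_init_span u y : expr u y -> y ** e = y -> init_span u y.
Proof.
move=> ex ye; have [L [LD [-> _]]] := expr_sum ex ye.
apply: (sp_sum init_span_subsp) => q qL _; apply: (spZ init_span_subsp).
have [qD <-] := LD _ qL; case: q.2 qD => p w qD.
exact: (init_span_D qD (cl_self _)).
Qed.

Hypothesis D_e : forall b k, (k < n)%N -> expr b (erow (b, k, [::])).

Lemma resolve (G : MM) : (forall i j, (n <= i)%N -> G i j = 0) ->
  (forall i j, (i < n)%N -> bone K S1 ** G i j = G i j) ->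
  G = \sum_(k < n) \sum_(b <- S1) munit k 0 (bV b) ** (munit 0 k (bV b) ** G).
Proof.
move=> G0 GS; apply: matInf_ext => i j; rewrite mat_sum.
rewrite (eq_bigr (fun k : 'I_n => if (k : nat) == i then G i j else 0)).
  rewrite -big_mkcond /= (big_ord1_eq _ (fun k : nat => G i j)).
  by case: ltnP => // /G0 ->.
move=> k _; rewrite mat_sum; case: eqP => [ki|/eqP ki]; last first.
  by rewrite big1// => b _; rewrite munit_mulE eq_sym (negbTE ki).
rewrite -[RHS]GS -?ki// nmul_suml; apply: eq_bigr => b _.
by rewrite !munit_mulE !eqxx nmulA bVid.
Qed.

Lemma e_resolve : e = \sum_(k < n) \sum_(b <- S1) munit k 0 (bV b) ** erow (b,
  k : nat, [::]).
Proof.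
apply: resolve => i j h; first by rewrite cn ?h.
exact: S_e.
Qed.

(** H is assembled from the values of h on the rows of e. Letter by letter, the internal relations
    force h of a word times a row to be the word times h of the row; expanding a row of e through
    [D_e] then shows that H agrees with h on the rows. *)
Lemma init_pres : pres init_span e.
Proof.
have se := init_span_subsp.
have eDcl p : p \in map eelt Dcl -> init_span p.1 p.2.
  by case: p => u m pD; apply: (@spn_mem K S MM mV) => //; exact: eelt_typed.
split.
- move=> u z /(@spn_ind init_span (fun _ z => z ** e = z)) [] //.
  + by move=> _; rewrite nmul0l.
  + by move=> _ a x y _ _ hx hy; rewrite nmulDl nmulZl hx hy.
  + by move=> p pD; split; [apply: eDcl|case/mapP: pD => q _ ->; apply: erow_e].
- move=> H hH; rewrite e_resolve nmul_suml big1// => k _.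
  rewrite nmul_suml big1_seq// => b /andP[_ bS].
  by rewrite -nmulA (hH b) ?nmul0r//; apply: init_span_S.
move=> h [hl ht hc].
pose H := \sum_(k < n) \sum_(b <- S1) munit k 0 (bV b) ** h b (erow (b, k : nat,
  [::])).
have h0 := hlin0 se hl.
have c2 b l w : b \in S1 -> (l < n)%N ->
    munit 0 l (wval K b w) ** H = munit 0 0 (wval K b w) ** h b (erow (b, l,
      [::])).
  move=> bS ln; rewrite /H nmul_sumr (bigD1 (Ordinal ln))//= [X in _ + X]big1
    ?addr0.
    rewrite nmul_sumr (bigD1_seq b)//= big1 ?addr0.
      by rewrite nmulA munitM eqxx wvalV.
    move=> b' nb; rewrite nmulA munitM eqxx -wvalV -nmulA bVV eq_sym (negbTE
      nb).
    by rewrite nmul0r linear0 nmul0l.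
  move=> k /eqP kl; rewrite nmul_sumr big1// => b' _; rewrite nmulA munitM.
  case: eqP => [lk|_]; last by rewrite nmul0l.
  by case: kl; apply: val_inj.
have c1 p : p \in D \/ p \in [seq (b, l, [::]) | b <- S1, l <- iota 0 n] ->
    valid p.1.1 p.2 /\ (forall w, w \in cl p.2 ->
      init_span (vend p.1.1 w) (erow (p.1, w))) /\
    p.1.1 \in S1 /\ (p.1.2 < n)%N.
  case=> [pD|/allpairsP[[b l] /= [bS]]].
    by have [? ? ?] := D_valid pD; split=> //; split=> // w; apply: init_span_D.
  rewrite mem_iota => /= ln ->; split=> //; split=> // w;
    rewrite inE => /eqP ->.
  exact: init_span_S.
have c1' b l w : valid b w -> (forall w1, w1 \in cl w ->
  init_span (vend b w1) (erow (b, l, w1))) ->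
    b \in S1 -> (l < n)%N -> forall w1, w1 \in cl w ->
    h (vend b w1) (erow (b, l, w1)) = munit 0 0 (wval K b w1) ** h b (erow (b,
      l, [::])).
  move=> + + bS ln; elim: w => [_ _ w1|[[[t d] i] j] w IH].
    by rewrite inE => /eqP -> /=; rewrite ht//; apply: init_span_S.
  rewrite validE => /and4P[/andP[hi hj] /eqP ej _ vw] hw.
  have hw' w1 : w1 \in cl w -> init_span (vend b w1) (erow (b, l, w1)).
    by move=> h1; apply: hw; rewrite inE mem_cat h1 !orbT.
  have {}IH := IH vw hw'.
  move=> w1; rewrite inE mem_cat => h1.
  have [|[i1 hi1 ->]] : w1 \in cl w \/ exists2 i1, i1 \in sd t d & w1 = (t, d,
    i1, j) :: w.
  - case/or3P: h1 => [/eqP ->|/mapP[i1 ? ->]|]; [by right; exists i|by right;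
      exists i1|by left].
  - exact: IH.
  (* The internal relation used: one side consists of the words with first letter (t, d, i2, j), the
     other of w at label j and 0 at all other labels. *)
  pose xi d' i2 : MM := if d' == d then erow (b, l, (t, d, i2, j) :: w)
     else if i2 == j then erow (b, l, w) else 0.
  have nd : (~~ d == d) = false by case: (d).
  have rx : rel init_span t xi.
    apply: (@relI _ _ _ mV mX (@mXX K S) init_span t d).
    - by move=> u m; apply: sp_eps.
    - move=> d' i2; rewrite /xi; case: eqP => [->|/eqP nd'] hi2.
        apply: (hw ((t, d, i2, j) :: w)); rewrite inE mem_cat; apply/orP; right.
        by apply/orP; left; apply/mapP; exists i2.
      have dd : d' = ~~ d by case: (d) (d') nd' => [] [].
      case: eqP => [->|_]; last exact: (sp0 se).
      by rewrite dd ej; apply: hw'; apply: cl_self.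
    - move=> i2 hi2; rewrite /xi eqxx nd (bigD1_seq j) ?bsd_uniq//= eqxx big1
        ?addr0.
        by rewrite /erow nmulA munitM eqxx.
      by move=> j1 /negbTE ->; rewrite nmul0r.
  have := hc _ _ rx d i1 hi1; rewrite {1}/xi eqxx => ->.
  rewrite (bigD1_seq j) ?bsd_uniq//= /xi nd eqxx big1 ?addr0.
    by rewrite ej IH ?cl_self// nmulA munitM eqxx.
  by move=> j1 /negbTE ->; rewrite h0 nmul0r.
have hsum u (L : seq (K * IX)) : (forall q, q \in L ->
  init_span u (erow q.2)) ->
    h u (\sum_(q <- L) q.1 *: erow q.2) = \sum_(q <- L) q.1 *: h u (erow q.2).
  elim: L => [|q L IH] hL; first by rewrite !big_nil h0.
  have hL' q' : q' \in L -> init_span u (erow q'.2) by move=> q'L; apply: hL;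
    rewrite inE q'L orbT.
  rewrite !big_cons hl ?IH//; first by apply: hL; rewrite inE eqxx.
  by apply: (sp_sum se) => q' q'L _; apply: (spZ se); apply: hL'.
have c3 b k : b \in S1 -> (k < n)%N -> erow (b, k, [::]) ** H = h b (erow (b, k,
  [::])).
  move=> bS kn; have [L [LD [E1 E2]]] := expr_sum (D_e b kn) (erow_e _).
  have hL q : q \in L -> init_span b (erow q.2).
    move=> /LD[]; case: q.2 => p w qD <-; exact: (init_span_D qD (cl_self _)).
  rewrite [in RHS]E1 hsum// [in LHS]E2 nmul_suml; apply: eq_big_seq => q qL.
  have [qD qb] := LD _ qL; rewrite nmulZl; congr (_ *: _).
  have [v [hw [qS qn]]] := c1 _ (or_introl qD).
  rewrite c2// -qb; case: q.2 v hw qS qn {qD qb} => -[b' l] w v hw qS qn.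
  by rewrite (c1' _ _ _ v hw qS qn)// cl_self.
have eH : e ** H = H.
  rewrite {1}e_resolve nmul_suml; apply: eq_bigr => k _; rewrite nmul_suml.
  by apply: eq_big_seq => b bS; rewrite -nmulA c3.
exists H => u z zz; apply: (proj2 (@spn_ind init_span (fun u z =>
  z ** H = h u z) _ se _ _ _ u z zz)).
- by move=> v; rewrite nmul0l h0.
- by move=> v a x y zx zy hx hy; rewrite nmulDl nmulZl hx hy hl.
move=> p pD; split; first exact: eDcl.
case/mapP: pD => q /flattenP[s /mapP[p0 p0D ->] /mapP[w wcl ->]] -> /=.
have [v [hw [bS ln]]] : valid p0.1.1 p0.2 /\ (forall w, w \in cl p0.2 ->
  init_span (vend p0.1.1 w) (erow (p0.1, w))) /\
    p0.1.1 \in S1 /\ (p0.1.2 < n)%N by apply: c1; apply/orP; rewrite -mem_cat.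
rewrite {1}/erow -nmulA eH c2//=.
by case: p0 {p0D} wcl v hw bS ln => -[b l] w0 wcl v hw bS ln;
  rewrite (c1' _ _ _ v hw bS ln).
Qed.
End Init.

Definition expand (a : A) : seq (K * (U * W)) := projT1 (cid (inspanP a)).
Lemma expandP a : all (fun p => valid p.2.1 p.2.2) (expand a) /\
  a = \sum_(p <- expand a) p.1 *: wval K p.2.1 p.2.2.
Proof. by rewrite /expand; case: cid. Qed.

Lemma row_entries u n (y : MM) : mV u ** y = y -> (forall i j, (n <= j)%N ->
  y i j = 0) ->
  y = \sum_(l < n) munit 0 l (y 0%N l).
Proof.
move=> uy cy; apply: matInf_ext => i j; rewrite mat_sum.
case: (eqVneq i 0%N) => [->|i0]; last first.
  rewrite (row0 j uy i0) big1// => l _; by rewrite munitE (negbTE i0).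
rewrite (eq_bigr (fun l : 'I_n => if (l : nat) == j then y 0%N j else 0)).
  by rewrite -big_mkcond /= (big_ord1_eq _ (fun l : nat => y 0%N j));
    case: ltnP => // /cy ->.
by move=> l _; rewrite munitE eqxx eq_sym; case: eqP => // ->.
Qed.

Lemma corner_mulr n m (x y : MM) : corner m n y -> forall i j, (n <= j)%N ->
  (x ** y) i j = 0.
Proof.
move=> cy i j nj; rewrite (matMEr _ cy) big1// => k _.
by rewrite cy ?nj ?orbT// nmul0r.
Qed.

(** D collects the words in the entries of e and of ys, S1 their base points and local units.
    Prescribing rows ys allows two decompositions of one idempotent to be compared in a single Z. *)
Lemma init_exists (e : MM) (ys : seq (U * MM)) : e ** e = e -> typed ys ->
  (forall p, p \in ys -> p.2 ** e = p.2) ->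
  exists n Z, [/\ subsp Z, dimle n Z, forall x, exists N, vanish Z x N, pres Z e
    & forall p, p \in ys -> Z p.1 p.2].
Proof.
move=> ee ty ye; have [n cn] := matInf_corner e.
pose entries : seq (A * nat) := [seq ((p : U * MM).2 0%N l, l) | p <- ys,
  l <- iota 0 n] ++
  [seq (e k l, l) | k <- iota 0 n, l <- iota 0 n].
pose D := flatten [seq [seq (q.2.1, c.2, q.2.2) | q <- expand c.1] |
  c <- entries].
pose lu a := projT1 (cid (@local_unit K S a)).
pose S1 := undup (flatten [seq lu c.1 | c <- entries] ++ [seq p.1.1 | p <- D]).
have entP c : c \in entries -> (c.2 < n)%N.
  rewrite mem_cat => /orP[] /allpairsP[[p l] /= [_ + ->]]; by rewrite mem_iota.
have DP c q : c \in entries -> q \in expand c.1 -> (q.2.1, c.2, q.2.2) \in D.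
  move=> col_entry qc; apply/flattenP; exists [seq (q.2.1, c.2, q.2.2) |
    q <- expand c.1].
    by apply/mapP; exists c.
  by apply/mapP; exists q.
have D_valid p : p \in D -> [/\ valid p.1.1 p.2, p.1.1 \in S1 & (p.1.2 < n)%N].
  move=> pD; split.
  - move: pD => /flattenP[_ /mapP[c _ ->] /mapP[q qc ->]] /=.
    by have [/allP h _] := expandP c.1; apply: h.
  - by rewrite mem_undup mem_cat (map_f (fun p => p.1.1) pD) orbT.
  - by move: pD => /flattenP[_ /mapP[c /entP ? ->] /mapP[q qc ->]].
have S_e k l : (k < n)%N -> bone K S1 ** e k l = e k l.
  move=> kn; case: (ltnP l n) => ln; last by rewrite cn ?ln ?orbT// nmul0r.
  have col_entry : (e k l, l) \in entries.
    by rewrite mem_cat; apply/orP; right; apply/allpairsP; exists (k, l);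
      rewrite !mem_iota.
  have : [/\ uniq (lu (e k l)), bone K (lu (e k l)) ** e k l = e k l
      & e k l ** bone K (lu (e k l)) = e k l] by rewrite /lu; case: cid.
  move=> [us se _]; have sub : {subset lu (e k l) <= S1}.
    move=> u hu; rewrite mem_undup mem_cat; apply/orP; left.
    by apply/flattenP; exists (lu (e k l)) => //; apply/mapP; exists (e k l, l).
  have [h _] := boneM K us (undup_uniq _) sub.
  by rewrite -{1}se nmulA h se.
have exprP u (y : MM) (a : nat -> A) : (forall l, (l < n)%N -> (a l,
  l) \in entries) ->
    y = \sum_(l < n) mV u ** munit 0 l (a l) -> expr D u y.
  move=> ha ->.
  exists (flatten [seq [seq (q.1, (q.2.1, l, q.2.2)) | q <- expand (a l)] |
    l <- iota 0 n]).
  split=> [q /flattenP[_ /mapP[l ln ->] /mapP[q' hq ->]] /=|].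
    by move: ln; rewrite mem_iota => /= ln; apply: (DP (a l, l)) => //;
      apply: ha.
  rewrite big_flatten big_map -(big_mkord xpredT (fun l =>
    mV u ** munit 0 l (a l))).
  rewrite /index_iota subn0; apply: eq_bigr => l _.
  have [_ {1}->] := expandP (a l); rewrite big_map linear_sum nmul_sumr.
  by apply: eq_bigr => q _; rewrite linearZ nmulZr.
have D_e b k : (k < n)%N -> expr D b (erow e (b, k, [::])).
  move=> kn; apply: (exprP _ _ (fun l => e k l)) => [l ln|].
    by rewrite mem_cat; apply/orP; right; apply/allpairsP; exists (k, l);
      rewrite !mem_iota.
  rewrite [LHS](@row_entries b n).
  - by apply: eq_bigr => l _; rewrite munitM eqxx munit_mulE eqxx.
  - by rewrite /erow nmulA munitM eqxx bVid.
  - exact: corner_mulr cn.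
pose Z := init_span e n D S1; exists (size (map (eelt e) (Dcl n D S1))), Z.
have sZ : subsp Z by apply: init_span_subsp.
split=> //.
- by apply: (spn_dimle (@mVM K S)) => //; apply: eelt_typed.
- by move=> x; apply: spn_vanish.
- by apply: init_pres => //; apply: undup_uniq.
move=> [u y] yD /=; have ey : y ** e = y := ye _ yD.
have uy : mV u ** y = y := ty _ yD.
apply: expr_init_span => //.
apply: (exprP _ _ (fun l => y 0%N l)) => [l ln|].
  rewrite mem_cat; apply/orP; left; apply/allpairsP; exists ((u, y), l).
  by rewrite mem_iota.
rewrite [LHS](@row_entries u n)//.
  apply: eq_bigr => l _; rewrite munitM eqxx; congr munit.
  by rewrite -{1}uy munit_mulE eqxx.
by rewrite -ey; apply: corner_mulr cn.
Qed.

Theorem V_balg_gen (a : Vmon A) : exists us, a = \sum_(u <- us) @vcl K S u.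
Proof.
have [e ->] := Vpi_surj a; have ee := idemE e.
have [//|//|n [Z [sZ dZ vZ pZ _]]] := @init_exists e [::] ee.
have [us hus] := pres_standard ee sZ dZ (vZ _) pZ.
by exists us; rewrite -hus; congr Vpi; apply: val_inj.
Qed.

(** One space Z presents f and contains the standard rows of both decompositions, transported to f
    by y for the second. It reduces to both totals, which agree by uniqueness of the total. *)
Theorem V_balg_inj (Mn : nmodType) (gam : U -> Mn) us us' :
  (forall t, \sum_(i <- sd t true) gam (vx t true i) =
             \sum_(i <- sd t false) gam (vx t false i)) ->
  \sum_(u <- us) @vcl K S u = \sum_(u <- us') @vcl K S u ->
  \sum_(u <- us) gam u = \sum_(u <- us') gam u.
Proof.
move=> gamE; case: (pselect (exists u0 : U, True)) => [[u0 _]|nU]; last first.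
  have E (s : seq U) : s = [::] by case: s => // u s; case: nU; exists u.
  by rewrite (E us) (E us').
pose f := diag K us u0 (size us); pose f' := diag K us' u0 (size us').
have ff : f ** f = f := diag_idem _ _ _ _; have ff' : f' ** f' = f' :=
  diag_idem _ _ _ _.
have VE s : \sum_(u <- s) @vcl K S u = Vpi (mkidem (diag_idem K s u0 (size s))).
  by rewrite Vdiag (big_nth u0) big_mkord.
rewrite !VE => /VpiP /(mvn_norm ff ff')[x [y [exy eyx ex xf [fy ye]]]].
pose r (s : seq U) (z : MM) := [seq (nth u0 s k, drow K s u0 k ** z) |
  k <- iota 0 (size s)].
have rP s z p : p \in r s z -> exists2 k, (k < size s)%N & p = (nth u0 s k,
  drow K s u0 k ** z).
  by move=> /mapP[k]; rewrite mem_iota => /= ks ->; exists k.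
have dE s k : (k < size s)%N -> drow K s u0 k ** diag K s u0 (size s) = drow K s
  u0 k.
  exact: drow_diag.
have [p|p|n [Z [sZ dZ vZ pZ Zr]]] := @init_exists f (r us f ++ r us' y) ff.
- rewrite mem_cat => /orP[] /rP[k ks ->] /=; by rewrite nmulA mV_drow.
- rewrite mem_cat => /orP[] /rP[k ks ->] /=; rewrite -nmulA ?ff//.
  by rewrite ye.
have R1 : red mV mX gam Z (\sum_(u <- us) gam u).
  apply: (@red_standard K S Mn gam n Z f f f us u0) => // k ks.
  apply: (Zr (_, _)); rewrite mem_cat; apply/orP; left.
  by apply/mapP; exists k => //; rewrite mem_iota.
have R2 : red mV mX gam Z (\sum_(u <- us') gam u).
  apply: (@red_standard K S Mn gam n Z f x y us' u0) => // k ks.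
  apply: (Zr (_, _)); rewrite mem_cat; apply/orP; right.
  by apply/mapP; exists k => //; rewrite mem_iota.
exact: (red_unique (@mVM K S) gamE dZ sZ R1 R2).
Qed.
End VA2.

(** * The two algebras of a weighted graph *)

Section Weights.
Variable E : wgraph.
Implicit Types (v : vertex E) (e : edge E).

Lemma wts_sorted v : sorted ltn (wts v).
Proof.
rewrite ltn_sorted_uniq_leq sort_uniq undup_uniq /=.
exact: (sort_sorted leq_total).
Qed.
Lemma mem_wts v n : (n \in wts v) = (n \in [seq wt e | e <- out v]).
Proof. by rewrite mem_sort mem_undup. Qed.
Lemma wts_gt0 v n : n \in wts v -> (0 < n)%N.
Proof. by rewrite mem_wts => /mapP[e _ ->]; apply: wt_gt0. Qed.
Lemma wti0 v : wti v 0 = 0%N. Proof. by []. Qed.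
Lemma wti_sorted v : sorted ltn (0%N :: wts v).
Proof.
have := wts_sorted v; rewrite /=; case h: (wts v) => [//|n s] /= ->.
by rewrite andbT; apply: (@wts_gt0 v); rewrite h inE eqxx.
Qed.
Lemma wti_lt v i j : (j <= nwts v)%N -> (i < j)%N -> (wti v i < wti v j)%N.
Proof.
move=> jn ij; rewrite /wti.
apply: (sorted_ltn_nth ltn_trans 0%N (wti_sorted v)) => //; rewrite inE /=.
exact: leq_trans ij (leqW jn).
Qed.
Lemma wti_le v i j : (j <= nwts v)%N -> (i <= j)%N -> (wti v i <= wti v j)%N.
Proof.
by move=> jn; rewrite leq_eqVlt => /orP[/eqP->//|/(wti_lt jn)/ltnW].
Qed.
Definition widx e := (index (wt e) (wts (src e))).+1.
Lemma wt_mem e : wt e \in wts (src e).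
Proof. by rewrite mem_wts; apply/mapP; exists e => //; rewrite in_out. Qed.
Lemma widx_range e : (0 < widx e <= nwts (src e))%N.
Proof. by rewrite /widx /= index_mem wt_mem. Qed.
Lemma wti_widx e : wti (src e) (widx e) = wt e.
Proof. by rewrite /wti /widx /= nth_index// wt_mem. Qed.
Lemma wt_le_wti v e i : (0 < i <= nwts v)%N -> src e = v ->
  (wt e <= wti v i)%N = ((wt e <= wti v i.-1) || (wt e == wti v i))%N.
Proof.
case: i => // i /andP[_ iv] ev; rewrite /=.
have er := widx_range e; rewrite ev in er.
have ee := wti_widx e; rewrite ev in ee; rewrite -ee.
case: (ltngtP (widx e) i.+1) => [h|h|->].
- rewrite ltnS in h; rewrite (wti_le _ (leqW h))// (wti_le _ h)//.
  exact: ltnW.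
- have [_ en] := andP er; have h1 := wti_lt en h.
  rewrite leqNgt h1 gtn_eqF// orbF; apply/esym/negbTE; rewrite -ltnNge.
  exact: wti_lt en (ltnW h).
- by rewrite leqnn eqxx orbT.
Qed.
Lemma wt_eq_wti v e i : (0 < i <= nwts v)%N -> src e = v ->
  (wt e == wti v i) = (widx e == i).
Proof.
move=> /andP[i0 iv] ev; have := widx_range e; have := wti_widx e;
  rewrite ev => ee /andP[e0 en].
rewrite -ee; case: (ltngtP (widx e) i) => [h|h|->]; last by rewrite eqxx.
  by rewrite ltn_eqF// wti_lt.
by rewrite gtn_eqF// wti_lt.
Qed.
Lemma wti_exists v i : (0 < i <= nwts v)%N -> exists2 e,
  e \in out v & wt e = wti v i.
Proof.
case: i => // i /andP[_ iv].
have : wti v i.+1 \in wts v by rewrite /wti /= mem_nth.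
by rewrite mem_wts => /mapP[e ev ->]; exists e.
Qed.
Lemma vwt_wti v : vwt v = wti v (nwts v).
Proof.
apply/eqP; rewrite eqn_leq; apply/andP; split.
  apply/bigmax_leqP_seq => e; rewrite in_out => /eqP ev _.
  have := wti_widx e; rewrite ev => <-; have /andP[_] := widx_range e;
    rewrite ev => h.
  exact: wti_le.
case h: (nwts v) => [|n]; first by rewrite wti0.
have [|e ev <-] := @wti_exists v n.+1; first by rewrite h leqnn.
by apply: vwt_ge; apply/eqP; rewrite -in_out.
Qed.
End Weights.

(** * The idempotents of L attached to the generators q_i^v *)

Section Lside.
Variables (K : fieldType) (E : wgraph).
Local Notation L := (wLPA K E).
Local Notation ML := (matInf L).
Implicit Types (v : vertex E) (e f : edge E).

Definition gV v : L := algpi (@LRel K E) (tvertex K v).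
Definition gE e i : L := algpi (@LRel K E) (tedge K e i).
Definition gG e i : L := algpi (@LRel K E) (tghost K e i).
Lemma LR t u : @LRel K E t u -> algpi (@LRel K E) t = algpi (@LRel K E) u.
Proof. by move=> h; apply/algpiP; apply: AC_rel. Qed.
Lemma gVV u v : gV u ** gV v = if u == v then gV u else 0.
Proof. by rewrite -algpiM (LR (LR_vertex _ _ _)); case: eqP. Qed.
Lemma gVid v : gV v ** gV v = gV v. Proof. by rewrite gVV eqxx. Qed.
Lemma gE_out e i : (wt e <= i)%N -> gE e i = 0.
Proof. by move=> h; rewrite /gE /tedge insubF// ltnNge h. Qed.
Lemma gG_out e i : (wt e <= i)%N -> gG e i = 0.
Proof. by move=> h; rewrite /gG /tghost insubF// ltnNge h. Qed.
Lemma gVE e i : gV (src e) ** gE e i = gE e i.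
Proof.
case: (ltnP i (wt e)) => h; last by rewrite gE_out// nmul0r.
by rewrite -algpiM; apply: LR; apply: (LR_srcE K (Ordinal h)).
Qed.
Lemma gEV e i : gE e i ** gV (rng e) = gE e i.
Proof.
case: (ltnP i (wt e)) => h; last by rewrite gE_out// nmul0l.
by rewrite -algpiM; apply: LR; apply: (LR_rngE K (Ordinal h)).
Qed.
Lemma gVG e i : gV (rng e) ** gG e i = gG e i.
Proof.
case: (ltnP i (wt e)) => h; last by rewrite gG_out// nmul0r.
by rewrite -algpiM; apply: LR; apply: (LR_rngG K (Ordinal h)).
Qed.
Lemma gGV e i : gG e i ** gV (src e) = gG e i.
Proof.
case: (ltnP i (wt e)) => h; last by rewrite gG_out// nmul0l.
by rewrite -algpiM; apply: LR; apply: (LR_srcG K (Ordinal h)).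
Qed.
Lemma g_sum v i j : (i < vwt v)%N -> (j < vwt v)%N ->
  \sum_(e <- out v) gE e i ** gG e j = if i == j then gV v else 0.
Proof.
move=> hi hj; have := LR (LR_sum K (Ordinal hi) (Ordinal hj)).
rewrite algpi_sum -val_eqE /= => S; transitivity (algpi (@LRel K E) (if i == j
  then tvertex K v else AZero)).
  by rewrite -S; apply: eq_bigr => e _; rewrite algpiM.
by case: ifP.
Qed.
Lemma g_dual e f : src e = src f ->
  \sum_(i < vwt (src e)) gG e i ** gE f i = if e == f then gV (rng e) else 0.
Proof.
move=> ef; have := LR (LR_dual K (erefl (src e)) (esym ef)).
rewrite algpi_sum => S; transitivity (algpi (@LRel K E) (if e == f then tvertex
  K (rng e) else AZero)).
  by rewrite -S; apply: eq_bigr => i _; rewrite algpiM.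
by case: ifP.
Qed.

Lemma L_ind (P : L -> Prop) : (forall v, P (gV v)) ->
  (forall e i, P (gE e i)) -> (forall e i, P (gG e i)) -> P 0 ->
  (forall x y, P x -> P y -> P (x + y)) -> (forall a x, P x -> P (a *: x)) ->
  (forall x y, P x -> P y -> P (x ** y)) -> forall x, P x.
Proof.
move=> PV PE PG P0 PD PZ PM x; have [t ->] := algpi_surj x.
elim: t => [[v|e i|e i]||t IHt u IHu|a t IHt|t IHt u IHu].
- exact: PV.
- by have := PE e i; rewrite /gE /tedge valK.
- by have := PG e i; rewrite /gG /tghost valK.
- exact: P0.
- by rewrite algpiD; apply: PD.
- by rewrite algpiZ; apply: PZ.
- by rewrite algpiM; apply: PM.
Qed.

Definition colE e : ML := \sum_(k < wt e) munit k 0 (gE e k).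
Definition rowE e : ML := \sum_(k < wt e) munit 0 k (gG e k).
Definition usum v n : ML := \sum_(k < n) munit k k (gV v).
(* The projection onto the complement, in the first w_i(v) copies of v, of the
   ranges of the edges of weight at most w_i(v). *)
Definition epsq v i : ML := usum v (wti v i) -
  \sum_(e <- out v | (wt e <= wti v i)%N) colE e ** rowE e.

Lemma colE_wide e n : (wt e <= n)%N -> colE e = \sum_(k < n) munit k 0 (gE e k).
Proof.
move=> en; rewrite -(big_mkord xpredT (fun k => munit k 0 (gE e k))).
rewrite (big_cat_nat (n := wt e))//= big_mkord [X in _ + X]big1_seq ?addr0//.
by move=> k /andP[_]; rewrite mem_index_iota => /andP[h _];
  rewrite gE_out// linear0.
Qed.
Lemma rowE_wide e n : (wt e <= n)%N -> rowE e = \sum_(k < n) munit 0 k (gG e k).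
Proof.
move=> en; rewrite -(big_mkord xpredT (fun k => munit 0 k (gG e k))).
rewrite (big_cat_nat (n := wt e))//= big_mkord [X in _ + X]big1_seq ?addr0//.
by move=> k /andP[_]; rewrite mem_index_iota => /andP[h _];
  rewrite gG_out// linear0.
Qed.
Lemma row_col n (x y : nat -> L) :
  (\sum_(k < n) munit 0 k (x k)) ** (\sum_(k < n) munit k 0 (y k)) =
  munit 0 0 (\sum_(k < n) x k ** y k).
Proof.
rewrite nmul_suml linear_sum; apply: eq_bigr => k _.
rewrite nmul_sumr (bigD1 k)//= munitM eqxx big1 ?addr0// => j jk.
by rewrite munitM -val_eqE /= in jk *; rewrite eq_sym (negbTE jk).
Qed.
Lemma rowcolE e f : src e = src f ->
  rowE e ** colE f = if e == f then munit 0 0 (gV (rng e)) else 0.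
Proof.
move=> ef; rewrite (@rowE_wide e (vwt (src e))); last exact: vwt_ge.
rewrite (@colE_wide f (vwt (src e))); last by rewrite ef; apply: vwt_ge.
by rewrite (row_col _ (gG e) (gE f)) g_dual//; case: ifP => //; rewrite linear0.
Qed.
Lemma colE_rng e : colE e ** munit 0 0 (gV (rng e)) = colE e.
Proof. by rewrite nmul_suml; apply: eq_bigr => k _; rewrite munitM eqxx gEV.
  Qed.
Lemma rowE_rng e : munit 0 0 (gV (rng e)) ** rowE e = rowE e.
Proof. by rewrite nmul_sumr; apply: eq_bigr => k _; rewrite munitM eqxx gVG.
  Qed.
Lemma usum_munitl v n k j x : usum v n ** munit k j x =
  if (k < n)%N then munit k j (gV v ** x) else 0.
Proof.
rewrite nmul_suml (eq_bigr (fun i : 'I_n => if (i : nat) == k then munit i j (gV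
  v ** x) else 0)).
  by rewrite -big_mkcond /= (big_ord1_eq _ (fun i => munit i j (gV v ** x))).
by move=> i _; rewrite munitM; case: eqP => [->|].
Qed.
Lemma usum_munitr v n k j x : munit j k x ** usum v n =
  if (k < n)%N then munit j k (x ** gV v) else 0.
Proof.
rewrite nmul_sumr (eq_bigr (fun i : 'I_n => if (i : nat) == k then munit j i (x
  ** gV v) else 0)).
  by rewrite -big_mkcond /= (big_ord1_eq _ (fun i => munit j i (x ** gV v))).
by move=> i _; rewrite munitM eq_sym; case: eqP => [->|].
Qed.
Lemma usum_colE e n : (wt e <= n)%N -> usum (src e) n ** colE e = colE e.
Proof.
move=> en; rewrite nmul_sumr; apply: eq_bigr => k _.
by rewrite usum_munitl gVE (leq_trans (ltn_ord k) en).
Qed.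
Lemma rowE_usum e n : (wt e <= n)%N -> rowE e ** usum (src e) n = rowE e.
Proof.
move=> en; rewrite nmul_suml; apply: eq_bigr => k _.
by rewrite usum_munitr gGV (leq_trans (ltn_ord k) en).
Qed.
Lemma usum_idem v n : usum v n ** usum v n = usum v n.
Proof.
by rewrite {2}/usum nmul_sumr; apply: eq_bigr => k _;
  rewrite usum_munitl gVid ltn_ord.
Qed.

Lemma rowE_epsq e i : (wt e <= wti (src e) i)%N -> rowE e ** epsq (src e) i = 0.
Proof.
move=> h; rewrite nmulBr rowE_usum// nmul_sumr -big_filter.
set s := [seq _ <- _ | _]; have es : e \in s by rewrite mem_filter h in_out
  eqxx.
have us : uniq s by rewrite filter_uniq// fset_uniq.
rewrite (bigD1_seq e)//= nmulA rowcolE// eqxx rowE_rng big1_seq ?addr0 ?subrr//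
  => f.
case/andP => fe; rewrite mem_filter in_out => /andP[_ /eqP fv].
by rewrite nmulA rowcolE// eq_sym (negbTE fe) nmul0l.
Qed.
Lemma epsq_colE e i : (wt e <= wti (src e) i)%N -> epsq (src e) i ** colE e = 0.
Proof.
move=> h; rewrite nmulBl usum_colE// nmul_suml -big_filter.
set s := [seq _ <- _ | _]; have es : e \in s by rewrite mem_filter h in_out
  eqxx.
have us : uniq s by rewrite filter_uniq// fset_uniq.
rewrite (bigD1_seq e)//= -nmulA rowcolE// eqxx colE_rng big1_seq ?addr0 ?subrr//
  => f.
case/andP => fe; rewrite mem_filter in_out => /andP[_ /eqP fv].
by rewrite -nmulA rowcolE// (negbTE fe) nmul0r.
Qed.
Lemma usum_epsq v i : usum v (wti v i) ** epsq v i = epsq v i.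
Proof.
rewrite nmulBr usum_idem nmul_sumr; congr (_ - _).
rewrite big_seq_cond [RHS]big_seq_cond; apply: eq_bigr => e /andP[].
by rewrite in_out => /eqP <- h; rewrite nmulA usum_colE.
Qed.
Lemma epsq_usum v i : epsq v i ** usum v (wti v i) = epsq v i.
Proof.
rewrite nmulBl usum_idem nmul_suml; congr (_ - _).
rewrite big_seq_cond [RHS]big_seq_cond; apply: eq_bigr => e /andP[].
by rewrite in_out => /eqP <- h; rewrite -nmulA rowE_usum.
Qed.
Lemma epsq_idem v i : epsq v i ** epsq v i = epsq v i.
Proof.
rewrite {2}/epsq nmulBr epsq_usum nmul_sumr big_seq_cond big1 ?subr0// =>
  e /andP[].
by rewrite in_out => /eqP <- h; rewrite nmulA epsq_colE// nmul0l.
Qed.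
Lemma epsq0 v : epsq v 0 = 0.
Proof.
rewrite /epsq wti0 /usum big_ord0 big_pred0 ?subr0// => e.
by rewrite leqNgt wt_gt0.
Qed.
(** For i = k_v all edges at v are included, and relation (iii) says that the e e^* sum to the
    identity of w(v) copies of v. *)
Lemma epsq_last v : epsq v (nwts v) = 0.
Proof.
rewrite /epsq -vwt_wti; apply/eqP; rewrite subr_eq0; apply/eqP.
rewrite [RHS](_ : _ = \sum_(e <- out v) \sum_(k < vwt v) \sum_(l < vwt v)
   munit k l (gE e k ** gG e l)); last first.
  rewrite big_seq_cond [RHS]big_seq_cond; apply: eq_big => [e|e /andP[ev _]].
    by case: (boolP (e \in out v)) => //=; rewrite in_out => /eqP/vwt_ge ->.
  have ew : (wt e <= vwt v)%N by apply: vwt_ge; apply/eqP; rewrite -in_out.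
  rewrite (colE_wide ew) (rowE_wide ew) nmul_suml; apply: eq_bigr => k _.
  by rewrite nmul_sumr; apply: eq_bigr => l _; rewrite munitM eqxx.
rewrite exchange_big; apply: eq_bigr => k _; rewrite exchange_big (bigD1 k)//=.
rewrite -linear_sum g_sum// eqxx big1 ?addr0// => l lk.
by rewrite -linear_sum g_sum// eq_sym val_eqE (negbTE lk) linear0.
Qed.

(** The idempotent common to both sides of the i-th relation of M at v: written here through the
    left side, in [etas_edges] through the right side. *)
Definition etas v i : ML :=
  epsq v i.-1 + \sum_(k <- iota (wti v i.-1) (wti v i - wti v i.-1)) munit k k
    (gV v).
Lemma etas_edges v i : (0 < i <= nwts v)%N ->
  etas v i = epsq v i + \sum_(e <- out v | wt e == wti v i) colE e ** rowE e.
Proof.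
move=> hi; rewrite /etas /epsq addrAC; have /andP[i0 iv] := hi.
have il : (i.-1 < i)%N by case: (i) i0.
have -> : usum v (wti v i.-1) + \sum_(k <- iota (wti v i.-1) (wti v i - wti v
  i.-1)) munit k k (gV v) =
    usum v (wti v i).
  rewrite /usum -!(big_mkord xpredT (fun k => munit k k (gV v))).
  by rewrite [RHS](big_cat_nat (n := wti v i.-1))//= ltnW// wti_lt.
rewrite -addrA; congr (_ + _).
have -> : \sum_(e <- out v | (wt e <= wti v i)%N) colE e ** rowE e =
    \sum_(e <- out v | (wt e <= wti v i.-1)%N) colE e ** rowE e +
    \sum_(e <- out v | wt e == wti v i) colE e ** rowE e.
  rewrite [LHS]big_mkcond [X in _ = X + _]big_mkcond [X in _ = _ + X]big_mkcond
    -big_split.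
  rewrite big_seq_cond [RHS]big_seq_cond; apply: eq_bigr => e /andP[].
  rewrite in_out => /eqP ev _ /=; rewrite (wt_le_wti hi ev).
  case: (boolP (wt e <= wti v i.-1)%N) => /= h; last by rewrite add0r.
  by rewrite ltn_eqF ?addr0// (leq_ltn_trans h)// wti_lt.
by rewrite opprD subrK.
Qed.
End Lside.

HB.instance Definition _ (E : wgraph) := gen_eqMixin (MGens E).
HB.instance Definition _ (E : wgraph) := gen_choiceMixin (MGens E).

(** * The system of inverse matrices of a weighted graph *)

Section GraphSystem.
Variable E : wgraph.
Implicit Types (v : vertex E) (e : edge E).

(* [qv v i] is the generator q_{i+1}^v (junk value [MVertex v] out of range). *)
Definition qv v i : MGens E := if insub i is Some j then MQ v j else MVertex v.
Definition glab := option (nat + edge E).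
(* The two sides of the i-th relation at v: [None] labels q_{i-1}^v, resp.
   q_i^v, [inl k] a copy of v and [inr e] the range of e. *)
Definition gsd (t : vertex E * nat) (d : bool) : seq glab :=
  let: (v, i) := t in
  if (0 < i <= nwts v)%N then
    if d then (if (1 < i)%N then [:: None] else [::]) ++
       [seq Some (inl k) | k <- iota (wti v i.-1) (wti v i - wti v i.-1)]
    else (if (i < nwts v)%N then [:: None] else [::]) ++
       [seq Some (inr e) | e <- out v & wt e == wti v i]
  else [::].
Definition gvx (t : vertex E * nat) (d : bool) (l : glab) : MGens E :=
  let: (v, i) := t in
  match l with
  | None => if d then qv v i.-2 else qv v i.-1
  | Some (inl k) => MVertex v
  | Some (inr e) => MVertex (rng e)
  end.
Lemma gsd_uniq t d : uniq (gsd t d).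
Proof.
case: t => v i; rewrite /gsd; case: ifP => // _.
have N0 (f : nat + edge E -> glab) (s : seq (nat + edge E)) : None \notin [seq
  Some x | x <- s].
  by apply/mapP => -[].
case: d; rewrite cat_uniq; apply/and3P; split; try by case: ifP.
- by apply/hasPn => _ /mapP[k _ ->]; case: ifP.
- by rewrite map_inj_uniq ?iota_uniq// => k k' [].
- by apply/hasPn => _ /mapP[k _ ->]; case: ifP.
- by rewrite map_inj_uniq ?filter_uniq ?fset_uniq// => k k' [].
Qed.
(** Some edge has weight w_i(v), and w_{i-1}(v) < w_i(v) leaves at least one copy of v. *)
Lemma gsd_ne t d l : l \in gsd t d -> exists l', l' \in gsd t (~~ d).
Proof.
case: t => v i; rewrite /gsd; case: ifP => // hi _; have /andP[i0 iv] := hi.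
case: d => /=.
  have [e ev ew] := wti_exists hi; exists (Some (inr e)); rewrite mem_cat.
  by apply/orP; right; rewrite map_f// mem_filter ew eqxx.
exists (Some (inl (wti v i.-1))); rewrite mem_cat; apply/orP; right.
rewrite map_f// mem_iota leqnn /= subnKC; first by rewrite wti_lt//;
  case: (i) i0.
by rewrite wti_le// leq_pred.
Qed.
Definition gsys : bsys := BSys gvx gsd_uniq gsd_ne.

Lemma side_true (N : nmodType) (f : MGens E -> N) v i : (0 < i <= nwts v)%N ->
  \sum_(l <- gsd (v, i) true) f (gvx (v, i) true l) =
  moneval f (mq v i.-1) + f (MVertex v) *+ (wti v i - wti v i.-1).
Proof.
move=> hi; rewrite /gsd hi big_cat big_map /=; congr (_ + _); last first.
  by rewrite big_const_seq count_predT size_iota iter_addr_0.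
case: i hi => [|[|i]] //= hi; first by rewrite big_nil.
rewrite big_seq1 /qv; case: insubP => //.
by case/negP; case: (nwts v) hi.
Qed.
Lemma side_false (N : nmodType) (f : MGens E -> N) v i : (0 < i <= nwts v)%N ->
  \sum_(l <- gsd (v, i) false) f (gvx (v, i) false l) =
  moneval f (mq v i) + \sum_(e <- out v | wt e == wti v i) f (MVertex (rng e)).
Proof.
move=> hi; rewrite /gsd hi big_cat big_map big_filter /=; congr (_ + _).
case: i hi => [|i] //= hi.
case: ifP => h.
  rewrite big_seq1 /qv; case: insubP => //.
  by case/negP; case: (nwts v) h.
rewrite big_nil insubF//; move: h; case: (nwts v) hi => // n hi h.
Qed.
Lemma MRel_sides (N : nmodType) (f : MGens E -> N) :
  (forall t, \sum_(l <- gsd t true) f (gvx t true l) = \sum_(l <- gsd t false) f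
    (gvx t false l)) ->
  forall t u, MRel t u -> moneval f t = moneval f u.
Proof.
move=> h t u [v i hi]; have := h (v, i); rewrite side_true// side_false//=.
by rewrite moneval_iter moneval_sum.
Qed.
Lemma sides_mongen t : \sum_(l <- gsd t true) mongen (@MRel E) (gvx t true l) =
  \sum_(l <- gsd t false) mongen (@MRel E) (gvx t false l).
Proof.
case: t => v i; case: (boolP (0 < i <= nwts v)%N) => hi; last first.
  by rewrite /gsd (negbTE hi) !big_nil.
rewrite side_true// side_false//.
have /monpiP := MC_rel (MR_rel hi); rewrite !monpiE /=.
by rewrite moneval_iter moneval_sum.
Qed.
End GraphSystem.

Section OrthogonalSum.
Variables (K : comPzRingType) (A : nuAlgType K) (J : eqType).
Variables (g g' c : J -> matInf A).
Hypothesis cc : forall j, c j ** c j = c j.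

(** The [g j ** g' j] are orthogonal idempotents, and g j, g' j make each equivalent to c j. *)
Lemma Vorth (s : seq J) : uniq s ->
  (forall j k, j \in s -> k \in s -> g' j ** g k = if j == k then c j else 0) ->
  (forall j, j \in s -> g j ** c j = g j) -> (forall j, j \in s ->
    c j ** g' j = g' j) ->
  forall h : (\sum_(j <- s) g j ** g' j) ** (\sum_(j <- s) g j ** g' j) =
    \sum_(j <- s) g j ** g' j,
  Vpi (mkidem h) = \sum_(j <- s) Vpi (mkidem (cc j)).
Proof.
elim: s => [|j s IH] us gg gc cg h.
  by rewrite [RHS]big_nil; apply: Vpi_eq0; rewrite /= big_nil.
have hj : j \in j :: s by rewrite inE eqxx.
have hk k : k \in s -> k \in j :: s by rewrite inE orbC => ->.
move: us => /= /andP[js us].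
have ne k : k \in s -> (j == k) = false.
  by move=> ks; apply/negP => /eqP E; rewrite E ks in js.
have idem1 (k : J) : k \in j :: s -> (g k ** g' k) ** (g k ** g' k) = g k ** g'
  k.
  by move=> kk; rewrite -nmulA (nmulA (g' k)) gg// eqxx cg.
have o1 : (g j ** g' j) ** (\sum_(k <- s) g k ** g' k) = 0.
  rewrite nmul_sumr big1_seq// => k /andP[_ ks].
  by rewrite -nmulA (nmulA (g' j)) (gg _ _ hj (hk _ ks)) ne// nmul0l nmul0r.
have o2 : (\sum_(k <- s) g k ** g' k) ** (g j ** g' j) = 0.
  rewrite nmul_suml big1_seq// => k /andP[_ ks].
  by rewrite -nmulA (nmulA (g' k)) (gg _ _ (hk _ ks) hj) eq_sym ne// nmul0l
    nmul0r.
have hs : (\sum_(k <- s) g k ** g' k) ** (\sum_(k <- s) g k ** g' k) = \sum_(k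
  <- s) g k ** g' k.
  move: h; rewrite big_cons nmulDl !nmulDr o1 o2 addr0 add0r idem1//.
  by move=> /addrI.
rewrite [RHS]big_cons -(IH us _ _ _ hs); last 3 first.
- by move=> k k' /hk ? /hk ?; apply: gg.
- by move=> k /hk; apply: gc.
- by move=> k /hk; apply: cg.
rewrite (VpiD (e := mkidem (idem1 _ hj)) (f := mkidem hs)) //= ?big_cons//.
congr (_ + _); apply/VpiP => /=; exists (g j), (g' j); split=> //.
by rewrite gg// eqxx.
Qed.
Lemma orth_sum_idem (s : seq J) : uniq s ->
  (forall j k, j \in s -> k \in s -> g' j ** g k = if j == k then c j else 0) ->
  (forall j, j \in s -> g j ** c j = g j) ->
  forall k, k \in s -> (\sum_(j <- s) g j ** g' j) ** g k = g k.
Proof.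
move=> us gg gc k ks; rewrite nmul_suml (bigD1_seq k)//= -nmulA gg// eqxx gc//.
rewrite big1_seq ?addr0// => j /andP[jk js].
by rewrite -nmulA gg// (negbTE jk) nmul0r.
Qed.
Lemma orth_sum_idem2 (s : seq J) : uniq s ->
  (forall j k, j \in s -> k \in s -> g' j ** g k = if j == k then c j else 0) ->
  (forall j, j \in s -> g j ** c j = g j) ->
  (\sum_(j <- s) g j ** g' j) ** (\sum_(j <- s) g j ** g' j) = \sum_(j <- s) g j
    ** g' j.
Proof.
move=> us gg gc; rewrite [LHS]nmul_sumr.
by apply: eq_big_seq => k ks; rewrite nmulA orth_sum_idem.
Qed.
End OrthogonalSum.

(** * The homomorphism from M to V(L) *)

Section Lframes.
Variables (K : fieldType) (E : wgraph).
Local Notation L := (wLPA K E).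
Local Notation ML := (matInf L).
Implicit Types (v : vertex E) (e : edge E).

Definition eU (u : MGens E) : ML :=
  match u with MVertex v => munit 0 0 (gV K v) | MQ v j => epsq K v j.+1 end.
Lemma eU_idem u : eU u ** eU u = eU u.
Proof.
case: u => [v|v j] /=; first by rewrite munitM eqxx gVid.
exact: epsq_idem.
Qed.
Lemma eU_qv v i : (i.+1 < nwts v)%N -> eU (qv v i) = epsq K v i.+1.
Proof.
move=> h; rewrite /qv; case: insubP => [j _ <-//|].
by case/negP; case: (nwts v) h.
Qed.
(** [gl] embeds the summand labelled l into w_i(v) copies of v and [gr] projects back; on either
    side of t the products [gl ** gr] sum to [etas]. *)
Definition gl (t : vertex E * nat) (d : bool) (l : glab E) : ML :=
  let: (v, i) := t in
  match l with
  | None => if d then epsq K v i.-1 else epsq K v i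
  | Some (inl k) => munit k 0 (gV K v)
  | Some (inr e) => colE K e
  end.
Definition gr (t : vertex E * nat) (d : bool) (l : glab E) : ML :=
  let: (v, i) := t in
  match l with
  | None => if d then epsq K v i.-1 else epsq K v i
  | Some (inl k) => munit 0 k (gV K v)
  | Some (inr e) => rowE K e
  end.

Lemma gsd_trueP v i l : l \in gsd (v, i) true -> (0 < i <= nwts v)%N /\
  ((l = None /\ (1 < i)%N) \/ (exists2 k, l = Some (inl k) & (wti v i.-1 <= k <
    wti v i)%N)).
Proof.
rewrite /gsd; case: ifP => // hi h; split=> //; move: h.
rewrite mem_cat => /orP[|/mapP[k]].
  by case: ifP => // h; rewrite inE => /eqP->; left.
rewrite mem_iota subnKC; first by move=> hk ->; right; exists k.
by have /andP[_ iv] := hi; rewrite wti_le// leq_pred.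
Qed.
Lemma gsd_falseP v i l : l \in gsd (v, i) false -> (0 < i <= nwts v)%N /\
  ((l = None /\ (i < nwts v)%N) \/ (exists e, [/\ l = Some (inr e),
    src e = v & wt e = wti v i])).
Proof.
rewrite /gsd; case: ifP => // hi h; split=> //; move: h.
rewrite mem_cat => /orP[|/mapP[e]].
  by case: ifP => // h; rewrite inE => /eqP->; left.
by rewrite mem_filter in_out => /andP[/eqP ew /eqP ev] ->; right; exists e.
Qed.
Lemma epsq_munit v i k : (wti v i <= k)%N ->
  epsq K v i ** munit k 0 (gV K v) = 0 /\ munit 0 k (gV K v) ** epsq K v i = 0.
Proof.
move=> h; split.
  by rewrite -epsq_usum -nmulA usum_munitl ltnNge h nmul0r.
by rewrite -usum_epsq nmulA usum_munitr ltnNge h nmul0l.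
Qed.
Lemma gr_gl t d l l' : l \in gsd t d -> l' \in gsd t d ->
  gr t d l ** gl t d l' = if l == l' then eU (gvx t d l) else 0.
Proof.
case: t => v i; case: d.
  move=> /gsd_trueP[hi [[-> i1]|[k -> hk]]] /gsd_trueP[_ [[-> _]|[k' -> hk']]].
  - rewrite eqxx /= epsq_idem eU_qv; last by case: i hi i1 =>
      [|[|i]] //= /andP[].
    by case: i i1 hi => [|[|i]].
  - by have [/= -> _] := epsq_munit (andP hk').1.
  - by have [_ /= ->] := epsq_munit (andP hk).1.
  - rewrite /= munitM gVid; case: eqVneq => [->|ne]; first by rewrite eqxx.
    by case: eqP => // -[kk]; rewrite kk eqxx in ne.
move=> /gsd_falseP[hi [[-> i1]|[e [-> ev ew]]]] /gsd_falseP[_ [[-> _]|[f [->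
  fv fw]]]].
- rewrite eqxx /= epsq_idem eU_qv; last by case: i hi i1.
  by case: i hi {i1}.
- by rewrite /= -fv epsq_colE// fv fw.
- by rewrite /= -ev rowE_epsq// ev ew.
- by rewrite /= rowcolE ?ev ?fv.
Qed.
Lemma gl_eU t d l : l \in gsd t d -> gl t d l ** eU (gvx t d l) = gl t d l.
Proof.
case: t => v i; case: d.
  move=> /gsd_trueP[hi [[-> i1]|[k -> hk]]] /=;
    last by rewrite munitM eqxx gVid.
  rewrite eU_qv; last by case: i hi i1 => [|[|i]] //= /andP[].
  by case: i i1 hi => [|[|i]] //= _ _; rewrite epsq_idem.
move=> /gsd_falseP[hi [[-> i1]|[e [-> ev ew]]]] /=; last exact: colE_rng.
rewrite eU_qv; last by case: i hi i1.
by case: i hi {i1} => //= i _; rewrite epsq_idem.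
Qed.
Lemma eU_gr t d l : l \in gsd t d -> eU (gvx t d l) ** gr t d l = gr t d l.
Proof.
case: t => v i; case: d.
  move=> /gsd_trueP[hi [[-> i1]|[k -> hk]]] /=;
    last by rewrite munitM eqxx gVid.
  rewrite eU_qv; last by case: i hi i1 => [|[|i]] //= /andP[].
  by case: i i1 hi => [|[|i]] //= _ _; rewrite epsq_idem.
move=> /gsd_falseP[hi [[-> i1]|[e [-> ev ew]]]] /=; last exact: rowE_rng.
rewrite eU_qv; last by case: i hi i1.
by case: i hi {i1} => //= i _; rewrite epsq_idem.
Qed.
Lemma gl_gr_sum v i d : (0 < i <= nwts v)%N ->
  \sum_(l <- gsd (v, i) d) gl (v, i) d l ** gr (v, i) d l = etas K v i.
Proof.
move=> hi; case: d; last rewrite etas_edges//;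
  rewrite /gsd hi big_cat big_map ?big_filter.
  congr (_ + _); last by apply: eq_bigr => k _; rewrite /= munitM eqxx gVid.
  case: ifP => h; first by rewrite big_seq1 /= epsq_idem.
  by rewrite big_nil; case: i hi h => [|[|i]] //; rewrite epsq0.
congr (_ + _); case: ifP => h; first by rewrite big_seq1 /= epsq_idem.
rewrite big_nil; have /andP[_ iv] := hi.
have -> : i = nwts v by apply/eqP; rewrite eqn_leq iv leqNgt h.
by rewrite epsq_last.
Qed.
Lemma etas_idem v i : (0 < i <= nwts v)%N -> etas K v i ** etas K v i = etas K v
  i.
Proof.
move=> hi; rewrite -(gl_gr_sum true hi).
by apply: (orth_sum_idem2 (c := fun l => eU (gvx (v,
  i) true l)) (gsd_uniq _ _)) => [j k|j];
  [apply: gr_gl|apply: gl_eU].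
Qed.
Lemma etas_gl v i d l : l \in gsd (v, i) d -> etas K v i ** gl (v,
  i) d l = gl (v, i) d l.
Proof.
move=> hl; have hi : (0 < i <= nwts v)%N.
  by case: (d) hl => [/gsd_trueP[]|/gsd_falseP[]].
rewrite -(gl_gr_sum d hi).
by apply: (orth_sum_idem (c := fun l => eU (gvx (v, i) d l)) (gsd_uniq _ _)) =>
  // [j k|j];
  [apply: gr_gl|apply: gl_eU].
Qed.

Lemma gr_etas v i d l : l \in gsd (v, i) d -> gr (v,
  i) d l ** etas K v i = gr (v, i) d l.
Proof.
move=> hl; have hi : (0 < i <= nwts v)%N.
  by case: (d) hl => [/gsd_trueP[]|/gsd_falseP[]].
rewrite -(gl_gr_sum d hi) nmul_sumr (bigD1_seq l) ?gsd_uniq// nmulA gr_gl// eqxx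
  eU_gr//.
rewrite big1_seq => [|j /andP[jl hj]]; first exact: addr0.
by rewrite nmulA gr_gl// eq_sym (negbTE jl) nmul0l.
Qed.

Definition vU (u : MGens E) : Vmon L := Vpi (mkidem (eU_idem u)).
Lemma vU_sides t : \sum_(l <- gsd t true) vU (gvx t true l) = \sum_(l <- gsd t
  false) vU (gvx t false l).
Proof.
case: t => v i; case: (boolP (0 < i <= nwts v)%N) => hi; last first.
  by rewrite /gsd (negbTE hi) !big_nil.
have S d : \sum_(l <- gsd (v, i) d) vU (gvx (v,
  i) d l) = Vpi (mkidem (etas_idem hi)).
  have h := etas_idem hi; rewrite -{1 2 3}(gl_gr_sum d hi) in h.
  rewrite -(Vorth (g := gl (v, i) d) (g' := gr (v, i) d) (c := fun l =>
    eU (gvx (v, i) d l)) _ (gsd_uniq _ _) _ _ _ h).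
  - by congr Vpi; apply: val_inj; rewrite /= gl_gr_sum.
  - by move=> j k; apply: gr_gl.
  - by move=> j; apply: gl_eU.
  - by move=> j; apply: eU_gr.
by rewrite !S.
Qed.
Definition mu : {additive wmon E -> Vmon L} := monlift (MRel_sides vU_sides).
Lemma mu_gen u : mu (mongen _ u) = vU u.
Proof. exact: monlift_gen. Qed.
End Lframes.

(** * Copies of the edges of the graph inside A *)

Section Aside.
Variables (K : fieldType) (E : wgraph).
Local Notation S := (gsys E).
Local Notation A := (balg K S).
Local Notation MA := (matInf A).
Local Notation bV := (@bV K S).
Local Notation bX := (@bX K S).
Local Notation sd := (@gsd E).
Local Notation vx := (@gvx E).
Implicit Types (v : vertex E) (e f : edge E).

Definition m00 (x : A) : MA := munit 0 0 x.
Definition bv v : A := bV (MVertex v).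
Definition uA v n : MA := \sum_(k < n) munit k k (bv v).

(** The frame of side true, given the column C of q_{i-1}^v; no edge label occurs there, whence the
    value 0. The frame of the other side is obtained from it by the matrix X, see [cb]. *)
Definition ca (C : MA) v (l : glab E) : MA :=
  match l with None => C | Some (inl k) => munit k 0 (bv v) | Some (inr _) =>
    0 end.
Definition ra (R : MA) v (l : glab E) : MA :=
  match l with None => R | Some (inl k) => munit 0 k (bv v) | Some (inr _) =>
    0 end.
Definition cb C v i l : MA := \sum_(l' <- sd (v,
  i) true) ca C v l' ** m00 (bX (v, i) true l' l).
Definition rb R v i l : MA := \sum_(l' <- sd (v, i) true) m00 (bX (v,
  i) false l l') ** ra R v l'.
(* The embedding of q_i^v into w_i(v) copies of v, and a retraction. *)
Fixpoint CA v i : MA := if i is i'.+1 then cb (CA v i') v i None else 0.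
Fixpoint RA v i : MA := if i is i'.+1 then rb (RA v i') v i None else 0.
Definition cav v i l := ca (CA v i.-1) v l.
Definition rav v i l := ra (RA v i.-1) v l.
Definition cbv v i l := cb (CA v i.-1) v i l.
Definition rbv v i l := rb (RA v i.-1) v i l.
Lemma CAS v i : CA v i.+1 = cbv v i.+1 None. Proof. by []. Qed.
Lemma RAS v i : RA v i.+1 = rbv v i.+1 None. Proof. by []. Qed.

Lemma CAE v i : CA v i.+1 = \sum_(l <- sd (v, i.+1) true) ca (CA v i) v l ** m00
  (bX (v, i.+1) true l None).
Proof. by []. Qed.
Lemma RAE v i : RA v i.+1 = \sum_(l <- sd (v, i.+1) true) m00 (bX (v,
  i.+1) false None l) ** ra (RA v i) v l.
Proof. by []. Qed.

Lemma uA_munitl v n k j x : uA v n ** munit k j x =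
  if (k < n)%N then munit k j (bv v ** x) else 0.
Proof.
rewrite nmul_suml (eq_bigr (fun i : 'I_n => if (i : nat) == k then munit i j (bv
  v ** x) else 0)).
  by rewrite -big_mkcond /= (big_ord1_eq _ (fun i => munit i j (bv v ** x))).
by move=> i _; rewrite munitM; case: eqP => [->|].
Qed.
Lemma uA_munitr v n k j x : munit j k x ** uA v n =
  if (k < n)%N then munit j k (x ** bv v) else 0.
Proof.
rewrite nmul_sumr (eq_bigr (fun i : 'I_n => if (i : nat) == k then munit j i (x
  ** bv v) else 0)).
  by rewrite -big_mkcond /= (big_ord1_eq _ (fun i => munit j i (x ** bv v))).
by move=> i _; rewrite munitM eq_sym; case: eqP => [->|].
Qed.
Lemma uAM v n m : (m <= n)%N -> uA v n ** uA v m = uA v m /\ uA v m ** uA v n =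
  uA v m.
Proof.
move=> mn; split.
  by rewrite {2}/uA nmul_sumr; apply: eq_bigr => k _;
    rewrite uA_munitl (leq_trans (ltn_ord k) mn) bVid.
by rewrite {1}/uA nmul_suml; apply: eq_bigr => k _;
    rewrite uA_munitr (leq_trans (ltn_ord k) mn) bVid.
Qed.

Lemma cb_bad C v i l : l \notin sd (v, i) false -> cb C v i l = 0.
Proof.
move=> h; rewrite /cb big1// => l' _; rewrite /m00 bX_bad ?linear0 ?nmul0r//.
by rewrite negb_and h orbT.
Qed.
Lemma rb_bad R v i l : l \notin sd (v, i) false -> rb R v i l = 0.
Proof.
move=> h; rewrite /rb big1// => l' _; rewrite /m00 bX_bad ?linear0 ?nmul0l//.
by rewrite negb_and h.
Qed.
Lemma CA_supp v i : (i <= nwts v)%N -> uA v (wti v i) ** CA v i = CA v i /\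
  RA v i ** uA v (wti v i) = RA v i.
Proof.
elim: i => [|i IH] iv; first by rewrite nmul0r nmul0l.
have [h1 h2] := IH (ltnW iv); have lw : (wti v i <= wti v i.+1)%N by rewrite
  wti_le.
have [u1 u2] := uAM v lw.
rewrite CAE RAE; split; [rewrite nmul_sumr|rewrite nmul_suml];
  apply: eq_big_seq => l /gsd_trueP[_].
  case=> [[-> _]|[k -> /andP[_ hk]]] /=; first by rewrite -{1}h1 !nmulA u1 h1.
  by rewrite nmulA uA_munitl hk bVid.
case=> [[-> _]|[k -> /andP[_ hk]]] /=; first by rewrite -{1}h2 -!nmulA u2 h2.
by rewrite -nmulA uA_munitr hk bVid.
Qed.
Lemma cbv_vx v i l : cbv v i l ** m00 (bV (vx (v, i) false l)) = cbv v i l.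
Proof.
rewrite nmul_suml; apply: eq_bigr => l' _; rewrite -nmulA munit00M.
by have -> := @bXV K S (v, i) true l' l.
Qed.
Lemma rbv_vx v i l : m00 (bV (vx (v, i) false l)) ** rbv v i l = rbv v i l.
Proof.
rewrite nmul_sumr; apply: eq_bigr => l' _; rewrite nmulA munit00M.
by have -> := @bVX K S (v, i) false l l'.
Qed.
Lemma cav_vx v i l : l \in sd (v, i) true -> cav v i l ** m00 (bV (vx (v,
  i) true l)) = cav v i l.
Proof.
move=> /gsd_trueP[_ [[-> i1]|[k -> _]]]; last by rewrite /cav /= munitM eqxx
  bVid.
by case: i i1 => [|[|i]] // _; rewrite /cav [_.-1]/= CAS;
  apply: (cbv_vx v i.+1 None).
Qed.

(** Duality of the frames on side true. The inverse matrices carry it to side false, and q_i^v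
    carries it on to the next index, where the new copies of v lie outside the support of q_i^v. *)
Definition orthA v i := forall l l', l \in sd (v, i) true -> l' \in sd (v,
  i) true ->
  rav v i l ** cav v i l' = if l == l' then m00 (bV (vx (v, i) true l)) else 0.
Definition orthB v i := forall l l', l \in sd (v, i) false -> l' \in sd (v,
  i) false ->
  rbv v i l ** cbv v i l' = if l == l' then m00 (bV (vx (v, i) false l)) else 0.

Lemma rav_cbv v i : orthA v i -> forall l l', l \in sd (v, i) true ->
  rav v i l ** cbv v i l' = m00 (bX (v, i) true l l').
Proof.
move=> h l l' hl; rewrite nmul_sumr (bigD1_seq l) ?gsd_uniq//=.
rewrite nmulA [X in X ** _]h// eqxx munit00M (@bVX K S (v, i) true l l').
rewrite big1_seq ?addr0// => l2 /andP[ne hl2].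
by rewrite nmulA [X in X ** _]h// eq_sym (negbTE ne) nmul0l.
Qed.
Lemma rbv_cav v i : orthA v i -> forall l l', l' \in sd (v, i) true ->
  rbv v i l ** cav v i l' = m00 (bX (v, i) false l l').
Proof.
move=> h l l' hl; rewrite nmul_suml (bigD1_seq l') ?gsd_uniq//=.
rewrite -nmulA [X in _ ** X]h// eqxx munit00M (@bXV K S (v, i) false l l').
rewrite big1_seq ?addr0// => l2 /andP[ne hl2].
by rewrite -nmulA [X in _ ** X]h// (negbTE ne) nmul0r.
Qed.
Lemma orthAB v i : orthA v i -> orthB v i.
Proof.
move=> h l l' hl hl'; rewrite nmul_suml.
rewrite (eq_big_seq (fun l2 => m00 (bX (v, i) false l l2 ** bX (v,
  i) true l2 l'))).
  rewrite -linear_sum (@bXX K S (v, i) false l l' hl hl').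
  by case: ifP => // _; rewrite linear0.
by move=> l2 hl2; rewrite -nmulA rav_cbv// munit00M.
Qed.
Lemma orthBA v i : orthB v i -> orthA v i.+1.
Proof.
move=> h l l' /gsd_trueP[hi [[-> i1]|[k -> hk]]] /gsd_trueP[_ [[-> _]|[k' ->
  hk']]].
- rewrite eqxx; case: i i1 h hi => // i _ h /andP[_ hi]; apply: h.
    by rewrite /gsd /= (ltnW hi) hi.
  by rewrite /gsd /= (ltnW hi) hi.
- rewrite /rav /cav /= -(CA_supp (ltnW (andP hi).2)).2 -nmulA uA_munitl.
  by case/andP: hk' => hk' _; rewrite ltnNge hk' nmul0r.
- rewrite /rav /cav /= -(CA_supp (ltnW (andP hi).2)).1 nmulA uA_munitr.
  by case/andP: hk => hk _; rewrite ltnNge hk nmul0l.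
- rewrite /rav /cav /= munitM bVid.
  by case: (eqVneq k k') => [->|ne]; [rewrite eqxx|case: eqP => // -[kk];
    rewrite kk eqxx in ne].
Qed.
Lemma orthA_all v i : orthA v i.
Proof.
elim: i => [|i IH]; first by move=> l l' /gsd_trueP[].
exact: orthBA (orthAB IH).
Qed.
Lemma orthB_all v i : orthB v i. Proof. exact: orthAB (@orthA_all v i). Qed.

(** The two inverse matrices cancel in the middle, which leaves the frame sum of side true. *)
Lemma cb_rb_sum v i : (0 < i <= nwts v)%N ->
  \sum_(l <- sd (v, i) false) cbv v i l ** rbv v i l =
  CA v i.-1 ** RA v i.-1 + \sum_(k <- iota (wti v i.-1) (wti v i - wti v i.-1))
    munit k k (bv v).
Proof.
move=> hi; transitivity (\sum_(l <- sd (v, i) true) cav v i l ** rav v i l);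
  last first.
  rewrite /gsd hi big_cat big_map; congr (_ + _).
    case: ifP => h; first by rewrite big_seq1.
    by rewrite big_nil; case: i hi h => [|[|i]] //= _ _; rewrite nmul0l.
  by apply: eq_bigr => k _; rewrite /cav /rav /= munitM eqxx bVid.
transitivity (\sum_(l1 <- sd (v, i) true) \sum_(l2 <- sd (v, i) true)
   cav v i l1 ** m00 (\sum_(l <- sd (v, i) false) bX (v, i) true l1 l ** bX (v,
     i) false l l2) ** rav v i l2).
  transitivity (\sum_(l <- sd (v, i) false) \sum_(l1 <- sd (v,
    i) true) \sum_(l2 <- sd (v, i) true)
     cav v i l1 ** m00 (bX (v, i) true l1 l ** bX (v,
       i) false l l2) ** rav v i l2).
    apply: eq_bigr => l _; rewrite nmul_suml; apply: eq_bigr => l1 _.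
    rewrite nmul_sumr; apply: eq_bigr => l2 _.
    by rewrite /m00 -munit00M !nmulA.
  rewrite exchange_big; apply: eq_bigr => l1 _; rewrite exchange_big;
    apply: eq_bigr => l2 _.
  by rewrite /m00 linear_sum nmul_sumr nmul_suml.
apply: eq_big_seq => l1 hl1; rewrite (bigD1_seq l1) ?gsd_uniq//= [X in _ +
  X]big1_seq ?addr0.
  by rewrite (@bXX K S (v, i) true l1 l1 hl1 hl1) eqxx cav_vx.
move=> l2 /andP[ne hl2]; rewrite (@bXX K S (v,
  i) true l1 l2 hl1 hl2) eq_sym (negbTE ne).
by rewrite /m00 linear0 nmul0r nmul0l.
Qed.

Definition colA e : MA := cbv (src e) (widx e) (Some (inr e)).
Definition rowA e : MA := rbv (src e) (widx e) (Some (inr e)).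
Lemma edge_sd e : Some (inr e) \in sd (src e, widx e) false.
Proof.
rewrite /gsd widx_range mem_cat; apply/orP; right.
by rewrite map_f// mem_filter in_out wti_widx !eqxx.
Qed.
Lemma colA_vx e : colA e ** m00 (bv (rng e)) = colA e.
Proof. exact: cbv_vx. Qed.
Lemma rowA_vx e : m00 (bv (rng e)) ** rowA e = rowA e.
Proof. exact: (rbv_vx (src e) (widx e) (Some (inr e))). Qed.
Lemma cbv_supp v i l : (0 < i <= nwts v)%N -> uA v (wti v i) ** cbv v i l = cbv
  v i l.
Proof.
move=> /andP[i0 iv]; have [h1 _] := CA_supp (leq_trans (leq_pred i) iv).
have lw : (wti v i.-1 <= wti v i)%N by rewrite wti_le// leq_pred.
have [u1 _] := uAM v lw.
rewrite nmul_sumr; apply: eq_big_seq => l' /gsd_trueP[_].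
case=> [[-> _]|[k -> /andP[_ hk]]] /=; first by rewrite -{1}h1 !nmulA u1 h1.
by rewrite nmulA uA_munitl hk bVid.
Qed.
Lemma rbv_supp v i l : (0 < i <= nwts v)%N -> rbv v i l ** uA v (wti v i) = rbv
  v i l.
Proof.
move=> /andP[i0 iv]; have [_ h2] := CA_supp (leq_trans (leq_pred i) iv).
have lw : (wti v i.-1 <= wti v i)%N by rewrite wti_le// leq_pred.
have [_ u2] := uAM v lw.
rewrite nmul_suml; apply: eq_big_seq => l' /gsd_trueP[_].
case=> [[-> _]|[k -> /andP[_ hk]]] /=; first by rewrite -{1}h2 -!nmulA u2 h2.
by rewrite -nmulA uA_munitr hk bVid.
Qed.
Lemma colA_supp e : uA (src e) (wt e) ** colA e = colA e.
Proof. by rewrite -(wti_widx e); apply: cbv_supp; apply: widx_range. Qed.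
Lemma rowA_supp e : rowA e ** uA (src e) (wt e) = rowA e.
Proof. by rewrite -(wti_widx e); apply: rbv_supp; apply: widx_range. Qed.

(* The telescoping sum of the relations cb_rb_sum. *)
Lemma frameA v i : (i <= nwts v)%N ->
  CA v i ** RA v i + \sum_(e <- out v | (wt e <= wti v i)%N) colA e ** rowA e =
    uA v (wti v i).
Proof.
elim: i => [|i IH] iv.
  rewrite nmul0l add0r wti0 /uA big_ord0 big_pred0// => e.
  by rewrite leqNgt wt_gt0.
have hi : (0 < i.+1 <= nwts v)%N by [].
have := cb_rb_sum hi; rewrite {1}/gsd hi big_cat big_map big_filter /=.
rewrite (_ : \sum_(l <- _) _ = CA v i.+1 ** RA v i.+1); last first.
  case: ifP => h; first by rewrite big_seq1.
  have nl : None \notin sd (v, i.+1) false.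
    by rewrite /gsd hi mem_cat h /=; apply/mapP => -[].
  by rewrite big_nil CAS /cbv (cb_bad _ nl) nmul0l.
rewrite (_ : \sum_(e <- _ | _) _ = \sum_(e <- out v |
  wt e == wti v i.+1) colA e ** rowA e); last first.
  rewrite big_seq_cond [RHS]big_seq_cond; apply: eq_bigr => e /andP[].
  rewrite in_out => /eqP ev; rewrite (wt_eq_wti hi ev) /colA /rowA ev =>
    /eqP ->.
  by [].
move=> F.
have -> : \sum_(e <- out v | (wt e <= wti v i.+1)%N) colA e ** rowA e =
    \sum_(e <- out v | wt e == wti v i.+1) colA e ** rowA e +
    \sum_(e <- out v | (wt e <= wti v i)%N) colA e ** rowA e.
  rewrite [LHS]big_mkcond [X in _ = X + _]big_mkcond [X in _ = _ + X]big_mkcond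
    -big_split.
  rewrite big_seq_cond [RHS]big_seq_cond; apply: eq_bigr => e /andP[].
  rewrite in_out => /eqP ev _ /=; rewrite (wt_le_wti hi ev) /=.
  case: (boolP (wt e <= wti v i)%N) => /= h; last by rewrite addr0.
  by rewrite ltn_eqF ?add0r// (leq_ltn_trans h)// wti_lt.
rewrite addrA F -addrA [X in _ + X]addrC addrA IH ?(ltnW iv)//.
rewrite /uA -!(big_mkord xpredT (fun k => munit k k (bv v))).
by rewrite [RHS](big_cat_nat (n := wti v i))//= ltnW// wti_lt.
Qed.
Lemma CA_last v i : (nwts v <= i)%N -> CA v i = 0.
Proof.
case: i => // i h; rewrite CAS /cbv cb_bad//; apply/negP => /gsd_falseP[_].
by case=> [[_]|[e []]] //; rewrite ltnNge h.
Qed.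
Lemma frameA_last v : \sum_(e <- out v) colA e ** rowA e = uA v (vwt v).
Proof.
have := frameA (leqnn (nwts v)); rewrite CA_last// nmul0l add0r -vwt_wti => <-.
rewrite big_seq_cond [RHS]big_seq_cond; apply: eq_bigl => e.
by case: (boolP (e \in out v)) => //=; rewrite in_out => /eqP/vwt_ge ->.
Qed.

(** At i = widx e, the edge and q_i are different labels of one dual frame. Afterwards q_i is built
    from q_{i-1}, treated by induction, and from copies of v beyond the support of e. *)
Lemma rowA_CA e i : (widx e <= i <= nwts (src e))%N ->
  rowA e ** CA (src e) i = 0 /\
  RA (src e) i ** colA e = 0.
Proof.
have /andP[w0 wn] := widx_range e.
elim: i => [|i IH] /andP[ei iv]; first by move: w0; rewrite ltnNge ei.
case: (ltngtP (widx e) i.+1) ei => // [ei _|ei _]; last first.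
  case: (boolP (None \in sd (src e, i.+1) false)) => h; last first.
    by rewrite CAS RAS /cbv /rbv cb_bad// rb_bad// nmul0l nmul0r.
  have he := edge_sd e; rewrite ei in he.
  rewrite CAS RAS /colA /rowA ei.
  by rewrite (orthB_all he h) (orthB_all h he).
rewrite ltnS in ei; have [h1 h2] : rowA e ** CA (src e) i = 0 /\ RA (src e) i **
  colA e = 0.
  by apply: IH; rewrite ei ltnW.
have we : (wt e <= wti (src e) i)%N.
  by rewrite -(wti_widx e) wti_le// ltnW.
rewrite CAE RAE; split; [rewrite nmul_sumr|rewrite nmul_suml];
  rewrite big1_seq// => l /andP[_ /gsd_trueP[_]].
  case=> [[-> _]|[k -> /andP[hk _]]] /=; first by rewrite nmulA h1 nmul0l.
  by rewrite nmulA -rowA_supp -[rowA e ** _ ** _]nmulA uA_munitl ltnNge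
    (leq_trans we hk) nmul0r nmul0l.
case=> [[-> _]|[k -> /andP[hk _]]] /=; first by rewrite -nmulA h2 nmul0r.
by rewrite -nmulA -colA_supp [munit 0 k _ ** _]nmulA uA_munitr ltnNge (leq_trans
  we hk) nmul0l nmul0r.
Qed.
(** For equal weights this is duality on one side. For different weights the heavier edge is built
    from a q and from copies of v that are all orthogonal to the lighter one. *)
Lemma rowcolA e f : src e = src f ->
  rowA e ** colA f = if e == f then m00 (bv (rng e)) else 0.
Proof.
move=> ef; have := widx_range f; rewrite -ef => /andP[f0 fn].
have /andP[e0 en] := widx_range e.
case: (ltngtP (widx e) (widx f)) => h.
- have -> : (e == f) = false by apply/eqP => eqef; rewrite eqef ltnn in h.
  have h' : (widx e <= (widx f).-1 <= nwts (src e))%N.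
    by rewrite (leq_trans (leq_pred _) fn) andbT; case: (widx f) h.
  have [h1 _] := rowA_CA h'.
  have we : (wt e <= wti (src e) (widx f).-1)%N.
    by rewrite -{1}(wti_widx e); case/andP: h' => *; apply: wti_le.
  rewrite [colA f]/colA -ef nmul_sumr big1_seq// => l /andP[_ /gsd_trueP[_]].
  case=> [[-> _]|[k -> /andP[hk _]]] /=; first by rewrite nmulA h1 nmul0l.
  by rewrite nmulA -rowA_supp -[rowA e ** _ ** _]nmulA uA_munitl ltnNge
    (leq_trans we hk) nmul0r nmul0l.
- have -> : (e == f) = false by apply/eqP => eqef; rewrite eqef ltnn in h.
  have h' : (widx f <= (widx e).-1 <= nwts (src f))%N.
    by rewrite -ef (leq_trans (leq_pred _) en) andbT; case: (widx e) h.
  have [_ h1] := rowA_CA h'.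
  have we : (wt f <= wti (src f) (widx e).-1)%N.
    by rewrite -{1}(wti_widx f); case/andP: h' => *; apply: wti_le.
  rewrite [rowA e]/rowA ef nmul_suml big1_seq// => l /andP[_ /gsd_trueP[_]].
  case=> [[-> _]|[k -> /andP[hk _]]] /=; first by rewrite -nmulA h1 nmul0r.
  by rewrite -nmulA -colA_supp [munit 0 k _ ** _]nmulA uA_munitr ltnNge
    (leq_trans we hk) nmul0l nmul0r.
- have he := edge_sd e; have hf := edge_sd f; rewrite -ef -h in hf.
  by rewrite /rowA /colA -ef -h (orthB_all he hf).
Qed.
End Aside.

(** * The homomorphism from L to A and its image *)

Section Iota.
Variables (K : fieldType) (E : wgraph).
Local Notation S := (gsys E).
Local Notation A := (balg K S).
Local Notation MA := (matInf A).
Local Notation L := (wLPA K E).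
Local Notation bV := (@bV K S).
Local Notation bX := (@bX K S).
Local Notation bv := (@bv K E).
Local Notation m00 := (@m00 K E).
Local Notation sd := (@gsd E).
Local Notation vx := (@gvx E).
Local Notation colA := (@colA K E).
Local Notation rowA := (@rowA K E).
Local Notation CA := (@CA K E).
Local Notation RA := (@RA K E).
Local Notation uA := (@uA K E).
Local Notation gV := (@gV K E).
Local Notation gE := (@gE K E).
Local Notation gG := (@gG K E).
Implicit Types (v : vertex E) (e f : edge E).

Lemma uA_mulE v n (M : MA) i j : (uA v n ** M) i j = if (i < n)%N then bv v ** M
  i j else 0.
Proof.
rewrite nmul_suml mat_sum (eq_bigr (fun k : 'I_n =>
  if (k : nat) == i then bv v ** M i j else 0)).
  by rewrite -big_mkcond /= (big_ord1_eq _ (fun _ => bv v ** M i j)).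
by move=> k _; rewrite munit_mulE eq_sym; case: eqP => // ->.
Qed.
Lemma mul_uAE v n (M : MA) i j : (M ** uA v n) i j = if (j < n)%N then M i j **
  bv v else 0.
Proof.
rewrite nmul_sumr mat_sum (eq_bigr (fun k : 'I_n =>
  if (k : nat) == j then M i j ** bv v else 0)).
  by rewrite -big_mkcond /= (big_ord1_eq _ (fun _ => M i j ** bv v)).
by move=> k _; rewrite mul_munitE eq_sym; case: eqP => // ->.
Qed.
Lemma uA_entry v n i j : uA v n i j = if (i < n)%N && (i == j) then bv v else 0.
Proof.
rewrite mat_sum (eq_bigr (fun k : 'I_n => if (k : nat) == i then
   if i == j then bv v else 0 else 0)).
  rewrite -big_mkcond /= (big_ord1_eq _ (fun _ => if i == j then bv v else 0)).
  by case: (i < n)%N.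
by move=> k _; rewrite munitE eq_sym; case: eqP => // ->; rewrite eq_sym.
Qed.
Definition col_entry e i : A := colA e i 0%N.
Definition row_entry e i : A := rowA e 0%N i.
Lemma col_entry_out e i : (wt e <= i)%N -> col_entry e i = 0.
Proof. by move=> h; rewrite /col_entry -colA_supp uA_mulE ltnNge h. Qed.
Lemma row_entry_out e i : (wt e <= i)%N -> row_entry e i = 0.
Proof. by move=> h; rewrite /row_entry -rowA_supp mul_uAE ltnNge h. Qed.
Lemma bv_col_entry e i : bv (src e) ** col_entry e i = col_entry e i.
Proof.
by rewrite /col_entry -colA_supp uA_mulE; case: ifP => _;
  rewrite ?nmul0r// nmulA bVid.
Qed.
Lemma row_entry_bv e i : row_entry e i ** bv (src e) = row_entry e i.
Proof.
by rewrite /row_entry -rowA_supp mul_uAE; case: ifP => _;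
  rewrite ?nmul0l// -nmulA bVid.
Qed.
Lemma col_entry_bv e i : col_entry e i ** bv (rng e) = col_entry e i.
Proof. by rewrite /col_entry -colA_vx mul_munitE eqxx -nmulA bVid. Qed.
Lemma bv_row_entry e i : bv (rng e) ** row_entry e i = row_entry e i.
Proof. by rewrite /row_entry -rowA_vx munit_mulE eqxx nmulA bVid. Qed.
Lemma colA_corner e : corner (wt e) 1 (colA e).
Proof.
move=> i j h; rewrite -colA_vx mul_munitE; case: j h => [|j] //.
by rewrite orbF => h; have := col_entry_out h; rewrite /col_entry => ->;
  rewrite nmul0l.
Qed.
Lemma rowA_corner e : corner 1 (wt e) (rowA e).
Proof.
move=> i j h; rewrite -rowA_vx munit_mulE; case: i h => [|i] // h.
by have := row_entry_out h; rewrite /row_entry => ->; rewrite nmul0r.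
Qed.

Definition igen (x : LGen E) : A :=
  match x with LVertex v => bv v | LEdge e i => col_entry e i | LGhost e i =>
    row_entry e i end.
Lemma igen_edge e i : algeval igen (tedge K e i) = col_entry e i.
Proof.
rewrite /tedge; case: insubP => [j _ <-//|]; rewrite -leqNgt => h.
by rewrite col_entry_out.
Qed.
Lemma igen_ghost e i : algeval igen (tghost K e i) = row_entry e i.
Proof.
rewrite /tghost; case: insubP => [j _ <-//|]; rewrite -leqNgt => h.
by rewrite row_entry_out.
Qed.
(** Relation (iii) is the telescoped frame equation [frameA_last], relation (iv) is [rowcolA]. *)
Lemma igen_rel t u : LRel t u -> algeval igen t = algeval igen u.
Proof.
case=> {t u}.
- by move=> u v /=; rewrite bVV; case: (eqVneq u v) => [->|ne]; rewrite ?eqxx//;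
    case: eqP => // -[E']; rewrite E' eqxx in ne.
- by move=> e i; rewrite [LHS]/= igen_edge bv_col_entry.
- by move=> e i; rewrite [LHS]/= igen_edge col_entry_bv.
- by move=> e i; rewrite [LHS]/= igen_ghost bv_row_entry.
- by move=> e i; rewrite [LHS]/= igen_ghost row_entry_bv.
- move=> v i j; rewrite algeval_sum (eq_bigr (fun e => (colA e ** rowA e) i j));
    last first.
    by move=> e _; rewrite [LHS]/= igen_edge igen_ghost (matMEl _ (@colA_corner
      e)) big_ord1.
  by rewrite -mat_sum frameA_last uA_entry ltn_ord /= val_eqE; case: ifP.
- move=> v e f ev fv; have ef : src e = src f by rewrite ev fv.
  transitivity ((rowA e ** colA f) 0%N 0%N); last first.
    by rewrite rowcolA//; case: ifP.
  have we : (wt e <= vwt v)%N by apply: vwt_ge.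
  rewrite (matMEl _ (corner_widen (leqnn 1) we (@rowA_corner e))).
  by rewrite algeval_sum; apply: eq_bigr => i _;
    rewrite [LHS]/= igen_edge igen_ghost.
Qed.
Definition iota_hom : nuHom L A := alglift igen_rel.
Local Notation iota := iota_hom.
Lemma iotaV v : iota (gV v) = bv v. Proof. exact: (alglift_pi igen_rel). Qed.
Lemma iotaE e i : iota (gE e i) = col_entry e i.
Proof. by rewrite -igen_edge; apply: (alglift_pi igen_rel). Qed.
Lemma iotaG e i : iota (gG e i) = row_entry e i.
Proof. by rewrite -igen_ghost; apply: (alglift_pi igen_rel). Qed.

Local Notation im := (map_matInf iota).
Lemma im_colE e : im (colE K e) = colA e.
Proof.
rewrite map_matInf_sum [RHS](mat_munits (@colA_corner e));
  apply: eq_bigr => k _.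
by rewrite big_ord1 map_munit iotaE.
Qed.
Lemma im_rowE e : im (rowE K e) = rowA e.
Proof.
rewrite map_matInf_sum [RHS](mat_munits (@rowA_corner e)) big_ord1;
  apply: eq_bigr => k _.
by rewrite map_munit iotaG.
Qed.
Lemma im_epsq v i : (i <= nwts v)%N -> im (epsq K v i) = CA v i ** RA v i.
Proof.
move=> iv; rewrite map_matInfB; apply/eqP; rewrite subr_eq; apply/eqP.
rewrite !map_matInf_sum; transitivity (uA v (wti v i)).
  by apply: eq_bigr => k _; rewrite map_munit iotaV.
rewrite -(frameA K iv); congr (_ + _); apply: eq_bigr => e _.
by rewrite map_matInfM im_colE im_rowE.
Qed.

Lemma nwts_pred v (j : 'I_(nwts v).-1) : (j.+1 < nwts v)%N.
Proof. by have := ltn_ord j; case: (nwts v) j => [[]|]. Qed.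
Lemma None_sd v i : (0 < i)%N -> (i < nwts v)%N -> None \in sd (v, i) false.
Proof. by move=> i0 h; rewrite /gsd i0 (ltnW h) h. Qed.
Lemma qvE v (j : 'I_(nwts v).-1) : qv v j = MQ v j.
Proof. by rewrite /qv valK. Qed.
Definition Cu (u : MGens E) : MA := match u with MVertex v => m00 (bv v) |
  MQ v j => CA v j.+1 end.
Definition Ru (u : MGens E) : MA := match u with MVertex v => m00 (bv v) |
  MQ v j => RA v j.+1 end.
Lemma RuCu u : Ru u ** Cu u = m00 (bV u).
Proof.
case: u => [v|v j] /=; first by rewrite munit00M bVid.
have h : None \in sd (v, j.+1) false by apply: None_sd; rewrite ?nwts_pred.
have := @orthB_all K E v j.+1 _ _ h h; rewrite eqxx /= qvE.
exact.
Qed.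
Lemma CuV u : Cu u ** m00 (bV u) = Cu u.
Proof.
case: u => [v|v j] /=; first by rewrite munit00M bVid.
by have := @cbv_vx K E v j.+1 None; rewrite /= qvE.
Qed.
Lemma VRu u : m00 (bV u) ** Ru u = Ru u.
Proof.
case: u => [v|v j] /=; first by rewrite munit00M bVid.
by have := @rbv_vx K E v j.+1 None; rewrite /= qvE.
Qed.
Lemma CuRu u : Cu u ** Ru u = im (eU K u).
Proof.
case: u => [v|v j] /=; first by rewrite munit00M map_munit iotaV bVid.
by rewrite im_epsq// ltnW// nwts_pred.
Qed.
Lemma Cu_qv v i : (i.+1 < nwts v)%N -> Cu (qv v i) = CA v i.+1 /\ Ru (qv v i) =
  RA v i.+1.
Proof.
move=> h; rewrite /qv; case: insubP => [j _ <-//|].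
by case/negP; case: (nwts v) h.
Qed.

Theorem Vmap_vU u : Vmap iota (vU K u) = @vcl K S u.
Proof.
rewrite [LHS]Vmap_pi; apply/VpiP; exists (Cu u), (Ru u); split.
  by rewrite CuRu.
by rewrite RuCu.
Qed.

Definition in_image (M : MA) := exists N, M = im N.
Lemma in_image0 : in_image 0. Proof. by exists 0; rewrite map_matInf0. Qed.
Lemma in_imageD M N : in_image M -> in_image N -> in_image (M + N).
Proof. by move=> [M' ->] [N' ->]; exists (M' + N'); rewrite map_matInfD. Qed.
Lemma in_imageM M N : in_image M -> in_image N -> in_image (M ** N).
Proof. by move=> [M' ->] [N' ->]; exists (M' ** N'); rewrite map_matInfM. Qed.
Lemma in_imageZ a M : in_image M -> in_image (a *: M).
Proof.
by move=> [M' ->]; exists (a *: M'); apply: matInf_ext => i j;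
  rewrite map_matInfE !matZ map_matInfE linearZ.
Qed.
Lemma in_image_sum J (r : seq J) (P : pred J) (F : J -> MA) :
  (forall j, P j -> in_image (F j)) -> in_image (\sum_(j <- r | P j) F j).
Proof. by move=> h; apply: (big_ind in_image in_image0 in_imageD). Qed.

Definition cside t d l : MA := let: (v, i) := t in if d then @cav K E v i l else
  @cbv K E v i l.
Definition rside t d l : MA := let: (v, i) := t in if d then @rav K E v i l else
  @rbv K E v i l.
Lemma m00X t d l l' : l \in sd t d -> l' \in sd t (~~ d) ->
  m00 (bX t d l l') = rside t d l ** cside t (~~ d) l'.
Proof.
case: t => v i; case: d => /= hl hl'.
  by rewrite rav_cbv//; apply: orthA_all.
by rewrite rbv_cav//; apply: orthA_all.
Qed.
Lemma CuMV v : Cu (MVertex v) = munit 0 0 (bv v). Proof. by []. Qed.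
Lemma RuMV v : Ru (MVertex v) = munit 0 0 (bv v). Proof. by []. Qed.
Lemma csideT v i k : cside (v, i) true (Some (inl k)) = munit k 0 (bv v). Proof.
  by []. Qed.
Lemma rsideT v i k : rside (v, i) true (Some (inl k)) = munit 0 k (bv v). Proof.
  by []. Qed.
Lemma csideN v i : cside (v, i) true None = CA v i.-1. Proof. by []. Qed.
Lemma rsideN v i : rside (v, i) true None = RA v i.-1. Proof. by []. Qed.
Lemma csideNF v i : cside (v, i.+1) false None = CA v i.+1. Proof. by []. Qed.
Lemma rsideNF v i : rside (v, i.+1) false None = RA v i.+1. Proof. by []. Qed.
Lemma cside_edge e : cside (src e, widx e) false (Some (inr e)) = colA e. Proof.
  by []. Qed.
Lemma rside_edge e : rside (src e, widx e) false (Some (inr e)) = rowA e. Proof.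
  by []. Qed.
Lemma vx_inl v i d k : vx (v, i) d (Some (inl k)) = MVertex v. Proof. by [].
  Qed.
Lemma vx_inr v i d e : vx (v, i) d (Some (inr e)) = MVertex (rng e). Proof.
  by []. Qed.
Lemma vx_NT v i : vx (v, i) true None = qv v i.-2. Proof. by []. Qed.
Lemma vx_NF v i : vx (v, i) false None = qv v i.-1. Proof. by []. Qed.
Lemma in_image_side t d l : l \in sd t d ->
  in_image (Cu (vx t d l) ** rside t d l) /\ in_image (cside t d l ** Ru (vx t d
    l)).
Proof.
case: t => v i; case: d.
  move=> /gsd_trueP[hi [[-> i1]|[k -> hk]]]; last first.
    rewrite csideT rsideT vx_inl CuMV RuMV !munitM !eqxx bVid.
    split; [exists (munit 0 k (gV v))|exists (munit k 0 (gV v))];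
      rewrite map_munit iotaV; exact: erefl.
  case: i hi i1 => [|[|i]] // hi _.
  have h : (i.+1 < nwts v)%N by case/andP: hi.
  have [c r] := Cu_qv h.
  rewrite csideN rsideN vx_NT [i.+2.-2]/= c r.
  by split; exists (epsq K v i.+1); rewrite im_epsq// ltnW.
move=> /gsd_falseP[hi [[-> i1]|[e [-> ev ew]]]].
  case: i hi i1 => [|i] // hi h.
  have [c r] := Cu_qv h.
  rewrite csideNF rsideNF vx_NF [i.+1.-1]/= c r.
  by split; exists (epsq K v i.+1); rewrite im_epsq// ltnW.
have wi : widx e = i by apply/eqP; rewrite -(wt_eq_wti hi ev) ew.
rewrite -ev -wi cside_edge rside_edge vx_inr CuMV RuMV; split.
  by exists (rowE K e); rewrite im_rowE; apply: rowA_vx.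
by exists (colE K e); rewrite im_colE; apply: colA_vx.
Qed.

Lemma CuV_if u w : Cu u ** m00 (bV w) = if u == w then Cu u else 0.
Proof.
case: eqP => [<-|/eqP ne]; first exact: CuV.
by rewrite -[Cu u]CuV -nmulA munit00M bVV (negbTE ne) /m00 linear0 nmul0r.
Qed.
Lemma VRu_if u w : m00 (bV w) ** Ru u = if w == u then Ru u else 0.
Proof.
case: eqP => [->|/eqP ne]; first exact: VRu.
by rewrite -[Ru u]VRu nmulA munit00M bVV (negbTE ne) /m00 linear0 nmul0l.
Qed.
(** A letter of A is a row frame times a column frame ([m00X]), and both factors enter the image
    once multiplied by Cu and Ru. Products are separated by inserting [Ru w ** Cu w], the vertex
    w. *)
Lemma in_image_corner x u u' : in_image (Cu u ** m00 x ** Ru u').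
Proof.
elim/balg_ind: x u u'.
- move=> u u1 u2; rewrite CuV_if; case: eqP => [->|_]; last by rewrite nmul0l;
    apply: in_image0.
  rewrite -[Cu u]CuV -nmulA VRu_if; case: eqP => [<-|_]; last by rewrite nmul0r;
    apply: in_image0.
  by rewrite CuRu; exists (eU K u).
- move=> t d l l' u u'.
  case: (boolP ((l \in sd t d) && (l' \in sd t (~~ d)))) => [/andP[hl hl']|bad];
    last first.
    rewrite [bX t d l l'](@bX_bad K S t d l l' bad) /m00 linear0 nmul0r nmul0l;
      exact: in_image0.
  rewrite -(@bVX K S t d l l') /m00 -munit00M nmulA CuV_if.
  case: eqP => [->|_]; last by rewrite !nmul0l; apply: in_image0.
  rewrite -(@bXV K S t d l l') -munit00M -!nmulA VRu_if.
  case: eqP => [<-|_]; last by rewrite !nmul0r; apply: in_image0.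
  rewrite [munit 0 0 (bX t d l l')](m00X hl hl') -[_ ** _ ** Ru _]nmulA nmulA.
  by apply: in_imageM; [have [] := in_image_side hl|have [] :=
    in_image_side hl'].
- by move=> u u'; rewrite /m00 linear0 nmul0r nmul0l; apply: in_image0.
- by move=> x y hx hy u u'; rewrite /m00 linearD nmulDr nmulDl;
    apply: in_imageD; [apply: hx|apply: hy].
- by move=> a x hx u u'; rewrite /m00 linearZ /= nmulZr nmulZl;
    apply: in_imageZ; apply: hx.
- move=> x y hx hy u u'; have [s [_ sy _]] := @local_unit K S y.
  have -> : Cu u ** m00 (x ** y) ** Ru u' =
     \sum_(w <- s) (Cu u ** m00 x ** Ru w) ** (Cu w ** m00 y ** Ru u').
    rewrite -{1}sy /bone /vone nmul_suml nmul_sumr /m00 linear_sum nmul_sumr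
      nmul_suml.
    apply: eq_bigr => w _; transitivity (Cu u ** m00 (x ** (bV w ** y)) ** Ru
      u'); first by [].
    rewrite /m00 -(munit00M x) -(munit00M _ y) -!nmulA; congr (_ ** (_ ** _)).
    by rewrite [Ru w ** _]nmulA RuCu nmulA.
  by apply: in_image_sum => w _; apply: in_imageM; [apply: hx|apply: hy].
Qed.

Lemma L_unit (x : L) : has_unit gV x.
Proof.
elim/L_ind: x.
- by move=> v; apply: (has_unit_gen (@gVV K E)); apply: gVid.
- by move=> e i; apply: (has_unit_gen (@gVV K E)); [apply: gVE|apply: gEV].
- by move=> e i; apply: (has_unit_gen (@gVV K E)); [apply: gVG|apply: gGV].
- exact: has_unit0.
- by move=> x y; apply: (has_unitD (@gVV K E)).
- by move=> a x; apply: has_unitZ.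
- by move=> x y; apply: (has_unitM (@gVV K E)).
Qed.

Lemma iota_corner (a b : L) (y : A) : exists c, iota a ** y ** iota b = iota c.
Proof.
have [s [_ _ as_]] := L_unit a; have [s' [_ sb _]] := L_unit b.
have P v v' : exists c, bv v ** y ** bv v' = iota c.
  have [N hN] := in_image_corner y (MVertex v) (MVertex v').
  exists (N 0%N 0%N); rewrite -map_matInfE -hN CuMV RuMV /m00 !munit00M
    munit00E.
  by [].
have [c hc] : {c : vertex E -> vertex E -> L & forall v v',
  bv v ** y ** bv v' = iota (c v v')}.
  apply: cid; have /choice[c hc] := fun p : vertex E * vertex E => P p.1 p.2.
  by exists (fun v v' => c (v, v')) => v v'; have := hc (v, v').
exists (\sum_(v <- s) \sum_(v' <- s') a ** c v v' ** b).
have unitE s0 : iota (vone gV s0) = \sum_(v <- s0) bv v.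
  by rewrite /vone raddf_sum; apply: eq_bigr => v _; apply: iotaV.
rewrite -{1}as_ -{1}sb !nuhomM !unitE nmul_sumr !nmul_suml raddf_sum.
apply: eq_bigr => v _; rewrite raddf_sum nmul_sumr.
apply: eq_bigr => v' _; transitivity (iota (a ** c v v' ** b)); last by [].
by rewrite !(nuhomM iota) -hc !nmulA.
Qed.
End Iota.

(** * Injectivity of V(L) -> V(A) *)

Section Blocks.
Variables (K : comPzRingType) (U : choiceType) (A : nuAlgType K).
Local Notation GG := (U -> matInf A).

(** U may be infinite, so its vertices need not fit into one finitely supported matrix; blocks act
    on families of matrices instead. *)
Definition blk_fun (u u' : U) (M : matInf A) (f : GG) : GG :=
  fun w => if w == u then M ** f u' else 0.
Lemma blk_lin u u' M : blk_fun u u' M \in @is_lin K GG.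
Proof.
rewrite inE => a f g; apply/funext => w.
have E (x y : GG) : (a *: x + y) w = a *: x w + y w by [].
rewrite E /blk_fun; case: ifP => _; last by rewrite scaler0 addr0.
by rewrite [(a *: f + g) u'](_ : _ = a *: f u' + g u')// nmulDr nmulZr.
Qed.
Definition blk u u' M : lendo GG := Lendo (blk_lin u u' M).
Lemma blkE u u' M f w : blk u u' M f w = if w == u then M ** f u' else 0.
Proof. by []. Qed.
Lemma blkM u u' w M N : blk u u' M ** blk u' w N = blk u w (M ** N).
Proof.
apply: lendo_ext => f; apply/funext => x; rewrite lendoM !blkE eqxx nmulA.
exact: erefl.
Qed.
Lemma blkM_ne u u' v w M N : u' != v -> blk u u' M ** blk v w N = 0.
Proof.
move=> ne; apply: lendo_ext => f; apply/funext => x;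
  rewrite lendoM !blkE (negbTE ne) nmul0r.
by case: ifP.
Qed.
Lemma blk0 u u' : blk u u' 0 = 0.
Proof.
apply: lendo_ext => f; apply/funext => x; rewrite blkE nmul0l.
by case: ifP.
Qed.
Lemma blkD u u' M N : blk u u' (M + N) = blk u u' M + blk u u' N.
Proof.
apply: lendo_ext => f; apply/funext => x; rewrite [RHS](_ : _ = blk u u' M f x +
  blk u u' N f x)//.
by rewrite !blkE nmulDl; case: ifP => //; rewrite addr0.
Qed.
Lemma blk_sum u u' J (s : seq J) (P : pred J) (F : J -> matInf A) :
  blk u u' (\sum_(j <- s | P j) F j) = \sum_(j <- s | P j) blk u u' (F j).
Proof. exact: (big_morph _ (blkD u u') (blk0 u u')). Qed.
End Blocks.

(* The representation kappa of A by matrices over L has kappa (iota l) acting as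
   the left multiplication by l. *)
Section Kappa.
Variables (K : fieldType) (E : wgraph).
Local Notation S := (gsys E).
Local Notation A := (balg K S).
Local Notation MA := (matInf A).
Local Notation L := (wLPA K E).
Local Notation ML := (matInf L).
Local Notation bV := (@bV K S).
Local Notation bX := (@bX K S).
Local Notation m00 := (@m00 K E).
Local Notation sd := (@gsd E).
Local Notation vx := (@gvx E).
Local Notation gV := (@gV K E).
Local Notation gE := (@gE K E).
Local Notation gG := (@gG K E).
Local Notation gl := (@gl K E).
Local Notation gr := (@gr K E).
Local Notation cav := (@cav K E).
Local Notation rav := (@rav K E).
Local Notation cbv := (@cbv K E).
Local Notation rbv := (@rbv K E).
Local Notation iota := (@iota_hom K E).
Local Notation blk := (@blk K (MGens E) L).
Implicit Types (v : vertex E) (e f : edge E).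

Definition kV u := blk u u (eU K u).
Definition kX t d l l' := if (l \in sd t d) && (l' \in sd t (~~ d)) then
  blk (vx t d l) (vx t (~~ d) l') (gr t d l ** gl t (~~ d) l') else 0.
Lemma kVV u u' : kV u ** kV u' = if u == u' then kV u else 0.
Proof.
case: eqP => [->|/eqP ne]; last by rewrite blkM_ne.
by rewrite blkM eU_idem.
Qed.
Lemma kVX t d l l' : kV (vx t d l) ** kX t d l l' = kX t d l l'.
Proof.
rewrite /kX; case: ifP => [/andP[hl hl']|_]; last exact: nmul0r.
by rewrite blkM nmulA eU_gr.
Qed.
Lemma kXV t d l l' : kX t d l l' ** kV (vx t (~~ d) l') = kX t d l l'.
Proof.
rewrite /kX; case: ifP => [/andP[hl hl']|_]; last exact: nmul0l.
by rewrite blkM -nmulA gl_eU.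
Qed.
Lemma kX_bad t d l l' : ~~ ((l \in sd t d) && (l' \in sd t (~~ d))) ->
  kX t d l l' = 0.
Proof. by rewrite /kX => /negbTE ->. Qed.
Lemma sd_range v i d l : l \in sd (v, i) d -> (0 < i <= nwts v)%N.
Proof. by case: d => [/gsd_trueP[]|/gsd_falseP[]]. Qed.
Lemma kXX t d l l' : l \in sd t d -> l' \in sd t d ->
  \sum_(j <- sd t (~~ d)) kX t d l j ** kX t (~~ d) j l' = if l == l' then kV
    (vx t d l) else 0.
Proof.
move=> hl hl'; transitivity (blk (vx t d l) (vx t d l')
   (gr t d l ** (\sum_(j <- sd t (~~ d)) gl t (~~ d) j ** gr t (~~ d) j) ** gl t
     d l')).
  rewrite nmul_sumr nmul_suml blk_sum; apply: eq_big_seq => j hj.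
  by rewrite /kX hl hj negbK hl' !andbT blkM !nmulA.
case: t hl hl' => v i hl hl'; rewrite gl_gr_sum ?(sd_range hl)// gr_etas//
  gr_gl//.
by case: eqP => [->|_] //; rewrite blk0.
Qed.
Definition kappa_hom : nuHom A (lendo (MGens E -> ML)) :=
  @blift K S _ kV kX kVV kVX kXV kX_bad kXX.
Local Notation kappa := kappa_hom.
Lemma kappaV u : kappa (bV u) = kV u. Proof. exact: (@blift_V K S _ kV kX kVV
  kVX kXV kX_bad kXX). Qed.
Lemma kappaX t d l l' : kappa (bX t d l l') = kX t d l l'.
Proof. exact: (@blift_X K S _ kV kX kVV kVX kXV kX_bad kXX). Qed.

(** The k-th entry of a column of A must act through the k-th row of the corresponding frame of L.
    The induction on i passes through side false ([kcolB]), where q_i^v arises. *)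
Definition kcol v i := forall l k, l \in sd (v, i) true ->
  kappa ((cav v i l) k 0%N) =
  blk (MVertex v) (vx (v, i) true l) (munit 0 k (gV v) ** gl (v, i) true l).
Definition krow v i := forall l k, l \in sd (v, i) true ->
  kappa ((rav v i l) 0%N k) =
  blk (vx (v, i) true l) (MVertex v) (gr (v, i) true l ** munit k 0 (gV v)).
Lemma kcolB v i : kcol v i -> forall l k, l \in sd (v, i) false ->
  kappa ((cbv v i l) k 0%N) =
  blk (MVertex v) (vx (v, i) false l) (munit 0 k (gV v) ** gl (v, i) false l).
Proof.
move=> h l k hl; rewrite mat_sum raddf_sum -(etas_gl K hl) -(gl_gr_sum K true
  (sd_range hl)).
rewrite nmul_suml nmul_sumr blk_sum; apply: eq_big_seq => l' hl'.
transitivity (kappa ((cav v i l' ** m00 (bX (v, i) true l' l)) k 0%N));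
  first by [].
rewrite mul_munitE eqxx nuhomM (h l' k hl') kappaX /kX hl hl' [if true && true
  then _ else _]/=.
by rewrite blkM !nmulA.
Qed.
Lemma krowB v i : krow v i -> forall l k, l \in sd (v, i) false ->
  kappa ((rbv v i l) 0%N k) =
  blk (vx (v, i) false l) (MVertex v) (gr (v, i) false l ** munit k 0 (gV v)).
Proof.
move=> h l k hl; rewrite mat_sum raddf_sum -(gr_etas K hl) -(gl_gr_sum K true
  (sd_range hl)).
rewrite nmul_sumr nmul_suml blk_sum; apply: eq_big_seq => l' hl'.
transitivity (kappa ((m00 (bX (v, i) false l l') ** rav v i l') 0%N k));
  first by [].
rewrite munit_mulE eqxx nuhomM (h l' k hl') kappaX /kX hl hl' [if true && true
  then _ else _]/=.
by rewrite blkM !nmulA.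
Qed.
Lemma kcol_all v i : kcol v i.
Proof.
elim: i => [|i IH] l k; first by move=> /gsd_trueP[].
move=> /gsd_trueP[hi [[-> i1]|[k' -> hk]]]; last first.
  rewrite /cav [ca _ _ _]/= munitE andbT; transitivity (blk (MVertex v) (MVertex
    v) (munit 0 k (gV v) ** munit k' 0 (gV v))); last by [].
  rewrite munitM; case: eqP => _; last by rewrite raddf0 blk0.
  by rewrite gVid kappaV.
have hN : None \in sd (v, i) false by apply: None_sd => //; case/andP: hi.
case: i IH i1 hi hN => // i IH _ hi hN.
exact: (kcolB IH k hN).
Qed.
Lemma krow_all v i : krow v i.
Proof.
elim: i => [|i IH] l k; first by move=> /gsd_trueP[].
move=> /gsd_trueP[hi [[-> i1]|[k' -> hk]]]; last first.
  rewrite /rav [ra _ _ _]/= munitE; transitivity (blk (MVertex v) (MVertex v)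
    (munit 0 k' (gV v) ** munit k 0 (gV v))); last by [].
  rewrite munitM (eq_sym k') eqxx andTb; case: eqP => _;
    last by rewrite raddf0 blk0.
  by rewrite gVid kappaV.
have hN : None \in sd (v, i) false by apply: None_sd => //; case/andP: hi.
case: i IH i1 hi hN => // i IH _ hi hN.
exact: (krowB IH k hN).
Qed.
Lemma kappa_iotaE e k : kappa (iota (gE e k)) =
  blk (MVertex (src e)) (MVertex (rng e)) (munit 0 0 (gE e k)).
Proof.
rewrite iotaE; transitivity (blk (MVertex (src e)) (MVertex (rng e)) (munit 0 k
  (gV (src e)) ** colE K e)).
  exact: (kcolB (@kcol_all _ _) k (edge_sd e)).
congr blk; case: (ltnP k (wt e)) => h; last first.
  rewrite gE_out// linear0 nmul_sumr big1// => j _; rewrite munitM;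
    case: eqP => // kj.
  by rewrite kj leqNgt ltn_ord in h.
rewrite nmul_sumr (bigD1 (Ordinal h))//= munitM eqxx gVE big1 ?addr0// => j jk.
by rewrite munitM eq_sym; rewrite -val_eqE /= in jk; rewrite (negbTE jk).
Qed.
Lemma kappa_iotaG e k : kappa (iota (gG e k)) =
  blk (MVertex (rng e)) (MVertex (src e)) (munit 0 0 (gG e k)).
Proof.
rewrite iotaG; transitivity (blk (MVertex (rng e)) (MVertex (src e)) (rowE K e
  ** munit k 0 (gV (src e)))).
  exact: (krowB (@krow_all _ _) k (edge_sd e)).
congr blk; case: (ltnP k (wt e)) => h; last first.
  rewrite gG_out// linear0 nmul_suml big1// => j _; rewrite munitM;
    case: eqP => // kj.
  by rewrite -kj leqNgt ltn_ord in h.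
rewrite nmul_suml (bigD1 (Ordinal h))//= munitM eqxx gGV big1 ?addr0// => j jk.
by rewrite munitM; rewrite -val_eqE /= in jk; rewrite (negbTE jk).
Qed.

(** A copy of L in the representation: m is cut into the pieces v m, each placed at (0, 0) of its
    vertex. *)
Definition ksig (m : L) (u : MGens E) : ML :=
  match u with MVertex v => munit 0 0 (gV v ** m) | MQ _ _ => 0 end.
Lemma blk_ksig v w x m : gV v ** x = x -> x ** gV w = x ->
  blk (MVertex v) (MVertex w) (munit 0 0 x) (ksig m) = ksig (x ** m).
Proof.
move=> vx xw; apply/funext => u; rewrite blkE [ksig m _]/= munit00M nmulA xw.
case: u => [u|u j]; last by case: eqP.
rewrite [ksig _ _]/= -{2}vx !nmulA gVV (inj_eq (f := @MVertex E));
  last by move=> ? ? [].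
by case: eqP => [->|_]; rewrite ?vx// !nmul0l linear0.
Qed.
Lemma kappa_iota (l m : L) : kappa (iota l) (ksig m) = ksig (l ** m).
Proof.
elim/L_ind: l m.
- move=> v m; rewrite iotaV kappaV.
  transitivity (blk (MVertex v) (MVertex v) (munit 0 0 (gV v)) (ksig m));
    first by [].
  by rewrite blk_ksig ?gVid.
- by move=> e i m; rewrite kappa_iotaE blk_ksig ?gVE ?gEV.
- by move=> e i m; rewrite kappa_iotaG blk_ksig ?gVG ?gGV.
- move=> m; rewrite !raddf0 nmul0l; apply/funext => -[v|v j] //.
  by rewrite [RHS]/= nmul0r linear0.
- move=> x y hx hy m; rewrite !raddfD lendoD hx hy; apply/funext => -[v|v j];
    last exact: addr0.
  by rewrite [RHS]/= nmulDl nmulDr linearD.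
- move=> a x hx m; rewrite !linearZ lendoZ hx; apply/funext => -[v|v j];
    last exact: scaler0.
  by rewrite [RHS]/= nmulZl nmulZr linearZ.
- by move=> x y hx hy m; rewrite !nuhomM lendoM hy hx nmulA.
Qed.
Lemma iota_inj : injective iota.
Proof.
move=> x y xy; apply/eqP; rewrite -subr_eq0; apply/eqP.
have : iota (x - y) = 0 by rewrite raddfB /= xy subrr.
move: (x - y) => z z0; have [s [_ sz zs]] := L_unit z.
have P v : gV v ** z = 0.
  have := kappa_iota z (vone gV s); rewrite z0 raddf0 zs =>
    /(congr1 (fun g : MGens E -> ML => g (MVertex v) 0%N 0%N)).
  by rewrite [ksig _ _]/= munit00E => <-.
by rewrite -sz nmul_suml big1// => v _; rewrite P.
Qed.

Lemma im_inj : injective (map_matInf iota).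
Proof.
move=> M N h; apply: matInf_ext => i j; apply: iota_inj.
by rewrite -!map_matInfE h.
Qed.
Lemma im_entries (M : MA) : (forall i j, exists x, M i j = iota x) -> exists N,
  M = map_matInf iota N.
Proof.
move=> h; have [n cM] := matInf_corner M.
have /choice[x hx] := fun p : nat * nat => h p.1 p.2.
exists (\sum_(i < n) \sum_(j < n) munit i j (x (i : nat, j : nat))).
rewrite map_matInf_sum {1}(mat_munits cM); apply: eq_bigr => i _;
  rewrite map_matInf_sum; apply: eq_bigr => j _.
by rewrite map_munit -hx.
Qed.
Lemma im_sandwich (M N : ML) (Y : MA) : exists Z,
  map_matInf iota M ** Y ** map_matInf iota N = map_matInf iota Z.
Proof.
have [m cM] := matInf_corner M; have [n cN] := matInf_corner N.
have cM' : corner m m (map_matInf iota M) by move=> i j h;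
  rewrite map_matInfE cM// raddf0.
have cN' : corner n n (map_matInf iota N) by move=> i j h;
  rewrite map_matInfE cN// raddf0.
apply: im_entries => i j.
rewrite (matMEr _ cN').
have : forall l, exists x, (map_matInf iota M ** Y) i l ** iota (N l j) = iota
  x.
  move=> l; rewrite (matMEl _ cM') nmul_suml.
  have /choice[x hx] : forall k, exists x, iota (M i k) ** Y k l ** iota (N l j)
    = iota x.
    by move=> k; apply: iota_corner.
  exists (\sum_(k < m) x k); rewrite raddf_sum; apply: eq_bigr => k _ /=.
  exact: hx.
move=> /choice[x hx]; exists (\sum_(l < n) x l); rewrite raddf_sum;
  apply: eq_bigr => l _.
exact: hx.
Qed.
(** Normalised to x = e x f and y = f y e, the matrices of an equivalence over A have entries in the
    image of L, because that image is a corner. *)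
Lemma Vmap_iota_inj : injective (Vmap iota).
Proof.
move=> a b; have [e ->] := Vpi_surj a; have [f ->] := Vpi_surj b.
rewrite [Vmap iota (Vpi e)]Vmap_pi [Vmap iota (Vpi f)]Vmap_pi => /VpiP.
have ie : map_matInf iota e ** map_matInf iota e = map_matInf iota e by rewrite
  -map_matInfM idemE.
have if_ : map_matInf iota f ** map_matInf iota f = map_matInf iota f by rewrite
  -map_matInfM idemE.
move=> /(mvn_norm ie if_)[x [y [exy fyx ex xf [fy ye]]]].
have [x' hx] := im_sandwich e f x; rewrite ex xf in hx.
have [y' hy] := im_sandwich f e y; rewrite fy ye in hy.
apply/VpiP; exists x', y'; split; apply: im_inj.
  by rewrite exy hx hy -map_matInfM.
by rewrite fyx hx hy -map_matInfM.
Qed.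
End Kappa.

(** * The isomorphism and its naturality *)

Lemma presMon_sum (X : Type) (r : monTerm X -> monTerm X ->
  Prop) (x : presMon r) :
  exists us, x = \sum_(u <- us) mongen r u.
Proof.
have [t ->] := monpi_surj x; elim: t => [y||t [us hus] u [us' hus']].
- by exists [:: y]; rewrite big_seq1.
- by exists [::]; rewrite big_nil.
- by exists (us ++ us'); rewrite big_cat monpiD hus hus'.
Qed.

Lemma bij_isomorphism (U V : nmodType) (f : {additive U -> V}) : injective f ->
  (forall y, exists x, f x = y) -> @isomorphism AbMon U V f.
Proof.
move=> fi fs; have /choice[g gK] := fs.
have ga : nmod_morphism g.
  by split=> [|x y]; apply: fi; rewrite gK ?raddf0// raddfD /= !gK.
pose gA := GRing.isNmodMorphism.Build _ _ g ga.
pose ga' : {additive V -> U} := HB.pack g gA.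
exists ga'; split; apply: additive_ext => x; last exact: gK.
by apply: fi; apply: gK.
Qed.

Section Iso.
Variables (K : fieldType) (E : wgraph).
Local Notation S := (gsys E).
Local Notation iota := (@iota_hom K E).
Local Notation mu := (@mu K E).

Lemma iota_mu us : Vmap iota (mu (\sum_(u <- us) mongen (@MRel E) u)) = \sum_(u
  <- us) @vcl K S u.
Proof.
rewrite !raddf_sum; apply: eq_bigr => u _ /=.
rewrite [mu _]mu_gen; exact: Vmap_vU.
Qed.
Lemma mu_surj y : exists x, mu x = y.
Proof.
have [us hus] := V_balg_gen (Vmap iota y).
exists (\sum_(u <- us) mongen (@MRel E) u); apply: Vmap_iota_inj.
by rewrite iota_mu hus.
Qed.
(** The invariant of V(A) is used with the universal target: gam sends a vertex of A to the
    generator of M which it is. *)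
Lemma mu_inj : injective mu.
Proof.
move=> x y; have [us ->] := presMon_sum x; have [us' ->] := presMon_sum y.
move=> /(congr1 (Vmap iota)); rewrite !iota_mu.
apply: (@V_balg_inj K S _ (mongen (@MRel E))).
exact: sides_mongen.
Qed.
End Iso.

Section Naturality.
Variables (K : fieldType) (E F : wgraph) (f : complete_hom E F).
Local Notation Lf := (Lmap K f).

Lemma LmapV v : Lf (gV K v) = gV K (hv f v).
Proof. exact: (alglift_pi (@Lmap_rel K E F f)). Qed.
Lemma LmapE e i : Lf (gE K e i) = gE K (he f e) i.
Proof. by rewrite [LHS](alglift_pi (@Lmap_rel K E F f)) Lmap_edge. Qed.
Lemma LmapG e i : Lf (gG K e i) = gG K (he f e) i.
Proof. by rewrite [LHS](alglift_pi (@Lmap_rel K E F f)) Lmap_ghost. Qed.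

Lemma map_epsq v i : out v != fset0 -> map_matInf Lf (epsq K v i) = epsq K (hv f
  v) i.
Proof.
move=> v0; have wE : wti (hv f v) i = wti v i by rewrite /wti wts_hom.
rewrite map_matInfB !map_matInf_sum [RHS]/epsq wE; congr (_ - _).
  by apply: eq_bigr => k _; rewrite map_munit LmapV.
rewrite -[RHS]big_filter.
have p := perm_filter (fun e => (wt e <= wti v i)%N) (out_hom f v0).
rewrite (perm_big _ p) filter_map big_map big_filter.
apply: eq_big => [e|e _] /=; first by rewrite he_wt.
rewrite map_matInfM !map_matInf_sum; congr (_ ** _).
  by rewrite /colE he_wt; apply: eq_bigr => k _; rewrite map_munit LmapE.
by rewrite /rowE he_wt; apply: eq_bigr => k _; rewrite map_munit LmapG.
Qed.
Lemma mu_nat x : Vmap Lf (mu K E x) = mu K F (Mmap f x).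
Proof.
have [us ->] := presMon_sum x; rewrite !raddf_sum; apply: eq_bigr => u _.
transitivity (Vmap Lf (vU K u)); first by congr (Vmap _ _); apply: mu_gen.
transitivity (mu K F (Mmap_gen f u)); last by congr (mu _ _ _);
  apply/esym/monlift_gen.
rewrite [LHS]Vmap_pi; case: u => [v|v j].
  transitivity (vU K (MVertex (hv f v))); last by rewrite -mu_gen.
  by congr Vpi; apply: val_inj; rewrite /= map_munit LmapV.
have v0 : out v != fset0 by apply: (@out_nwts _ v j.+1);
  rewrite /= ltnW// nwts_pred.
have h : (j < (nwts (hv f v)).-1)%N by rewrite /nwts wts_hom.
transitivity (vU K (MQ (hv f v) (Ordinal h))).
  by congr Vpi; apply: val_inj; rewrite /= map_epsq.
by rewrite -mu_gen [Mmap_gen _ _]/= (insubT (fun i =>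
  i < (nwts (hv f v)).-1)%N h).
Qed.
End Naturality.

Theorem VL_iso_M (K : fieldType) :
  nat_isomorphic (comp_functor (Vfunctor K) (Lfunctor K)) Mfunctor.
Proof.
have I (E : wgraph) : @isomorphism AbMon (wmon E) (Vmon (wLPA K E)) (mu K E).
  by apply: bij_isomorphism; [apply: mu_inj|apply: mu_surj].
(* The transformation goes from V(L) to M, so eta is the inverse of [mu]; its naturality follows
   from that of [mu]. *)
pose eta E := projT1 (cid (I E)); have etaP E := projT2 (cid (I E));
  rewrite -/(eta _) in etaP.
exists eta; split=> [E|E F f].
  by exists (mu K E); have [] := etaP E.
apply: additive_ext => a; have [x <-] := mu_surj a.
have e1 G y : eta G (mu K G y) = y.
  by have [h _] := etaP G; apply: (congr1 (fun h : {additive wmon G ->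
    wmon G} => h y) h).
transitivity (Mmap f x); first by congr (Mmap f _); apply: e1.
transitivity (eta F (Vmap (Lmap K f) (mu K E x))); last by [].
by rewrite mu_nat; apply/esym/e1.
Qed.

(** * Heredity *)

Section Complement.
Variables (K : fieldType) (V : lmodType K).
Implicit Types (C I : set V).

Definition subspace C := forall a x y, C x -> C y -> C (a *: x + y).
Lemma subspace0 C x : subspace C -> C x -> C 0.
Proof. by move=> sC Cx; have := sC (-1) x x Cx Cx; rewrite scaleN1r addNr. Qed.
Lemma subspaceZ C a x : subspace C -> C x -> C (a *: x).
Proof. by move=> sC Cx; have := sC a x 0 Cx (subspace0 sC Cx); rewrite addr0.
  Qed.
Lemma subspaceB C x y : subspace C -> C x -> C y -> C (x - y).
Proof. by move=> sC Cx Cy; rewrite addrC -scaleN1r; apply: sC. Qed.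

Lemma complement_exists I : subspace I -> I 0 -> exists C, [/\ subspace C, C 0,
  (forall x, C x -> I x -> x = 0) & forall x, exists2 i, I i & C (x - i)].
Proof.
move=> sI I0; pose P C := subspace C /\ (forall x, C x -> I x -> x = 0).
have [|C [[sC CI] Cmax]] := @Zorn_bigcup V P.
  move=> F FP tF; split.
    move=> a x y [X FX Xx] [Y FY Yy]; have [XY|YX] := tF X Y FX FY.
      by exists Y => //; apply: (FP Y FY).1 => //; apply: XY.
    by exists X => //; apply: (FP X FX).1 => //; apply: YX.
  by move=> x [X FX Xx]; apply: (FP X FX).2.
have max x : (exists2 i, I i & C (x - i)) \/ ~ (exists2 i,
  I i & C (x - i)) by exact: EM.
(* The empty set also satisfies P, so 0 in C has to come from maximality. *)
have C0 : C 0.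
  apply: contrapT => nC0; have Ce x : ~ C x by move=> Cx; apply: nC0;
    apply: subspace0 Cx.
  apply: (Cmax [set 0]); first by split=> [x /Ce|/(_ 0 erefl)].
  by split=> // a x y -> ->; rewrite scaler0 addr0.
exists C; split=> // x; case: (max x) => // nx; exfalso.
pose C' := [set y | exists a, C (y - a *: x)].
have CC' : C `<=` C' by move=> y Cy; exists 0; rewrite scale0r subr0.
have C'x : C' x by exists 1; rewrite scale1r subrr.
apply: (Cmax C').
  by split=> // /(_ _ C'x) Cx; apply: nx; exists 0; rewrite ?subr0.
split=> [b y z [a ay] [c cz]|y [a ay] Iy].
  exists (b * a + c); rewrite scalerDl -scalerA opprD addrACA -scalerBr.
  exact: sC.
case: (eqVneq a 0) => [a0|an]; first by apply: CI => //; move: ay;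
  rewrite a0 scale0r subr0.
case: nx; exists (a^-1 *: y); first exact: subspaceZ.
have := subspaceZ (- a^-1) sC ay.
by rewrite scalerBr !scaleNr scalerA mulVf// scale1r opprK addrC.
Qed.

Lemma retraction_exists I : subspace I -> I 0 -> exists p : {linear V -> V},
  (forall x, I (p x)) /\ (forall x, I x -> p x = x).
Proof.
move=> sI I0; have [C [sC C0 CI CD]] := complement_exists sI I0.
have /choice[p pP] : forall x, exists i, I i /\ C (x - i) by move=> x;
  have [i] := CD x; exists i.
have puniq x i : I i -> C (x - i) -> p x = i.
  move=> Ii Ci; have [Ip Cp] := pP x; apply/eqP; rewrite -subr_eq0; apply/eqP.
  apply: CI; last exact: subspaceB.
  have -> : p x - i = (x - i) - (x - p x) by rewrite opprB [RHS]addrC addrA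
    subrK.
  exact: subspaceB.
have lp : linear p.
  move=> a x y; have [Ix Cx] := pP x; have [Iy Cy] := pP y; apply: puniq;
    first exact: sI.
  by rewrite opprD addrACA -scalerBr; apply: sC.
pose pL := GRing.isLinear.Build _ _ _ _ p lp.
pose q : {linear V -> V} := HB.pack p pL.
exists q; split=> x; first by have [] := pP x.
by move=> Ix; apply: puniq => //; rewrite subrr.
Qed.
End Complement.

Lemma section_exists (K : fieldType) (V W : lmodType K) (g : {linear V -> W}) :
  (forall y, exists x, g x = y) -> exists s : {linear W -> V}, forall y,
    g (s y) = y.
Proof.
move=> gs; pose Kr := [set x | g x = 0].
have sK : subspace Kr by move=> a x y gx gy; rewrite /Kr /= linearP gx gy
  scaler0 addr0.
have [p [pK pid]] := retraction_exists sK (raddf0 g).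
have /choice[r rK] := gs.
pose s y := r y - p (r y).
have p0 x y : g x = g y -> x - p x = y - p y.
  move=> gxy; have : Kr (x - y) by rewrite /Kr /= raddfB /= gxy subrr.
  move=> /pid; rewrite raddfB /= => h; apply/eqP.
  by rewrite subr_eq -addrA (addrC (- p y)) h addrC subrK.
have ls : linear s.
  move=> a x y; rewrite /s scalerBr addrACA -opprD -linearP; apply: p0.
  by rewrite linearP !rK.
pose sL := GRing.isLinear.Build _ _ _ _ s ls.
pose q : {linear W -> V} := HB.pack s sL.
by exists q => y; rewrite /= /s raddfB /= rK pK subr0.
Qed.

(** * First-order deformations of a representation of L *)

Section SquareZero.
Variables (K : fieldType) (E : wgraph) (B : nuAlgType K).
Local Notation L := (wLPA K E).
Local Notation gV := (@gV K E).
Local Notation gE := (@gE K E).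
Local Notation gG := (@gG K E).
Variables (rho : nuHom L B) (d : edge E -> nat -> B).
Hypothesis d_out : forall e i, (wt e <= i)%N -> d e i = 0.
Hypothesis src_d : forall e i, rho (gV (src e)) ** d e i = d e i.
Hypothesis d_rng : forall e i, d e i ** rho (gV (rng e)) = d e i.
Variable N : B -> Prop.
Hypothesis N0 : N 0.
Hypothesis ND : forall x y, N x -> N y -> N (x + y).
Hypothesis NN : forall x, N x -> N (- x).
Hypothesis NMl : forall l x, N x -> N (rho l ** x).
Hypothesis NMr : forall l x, N x -> N (x ** rho l).
Hypothesis NN0 : forall x y, N x -> N y -> x ** y = 0.
Hypothesis Nd : forall e i, N (d e i).
Implicit Types (v : vertex E) (e f : edge E).

Lemma Nsum J (r : seq J) (P : pred J) (F : J -> B) :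
  (forall j, P j -> N (F j)) -> N (\sum_(j <- r | P j) F j).
Proof. by move=> h; apply: (big_ind N). Qed.

(** This and the next three lemmas are X X^* = 1 and X^* X = 1 applied to a vector F from either
    side. *)
Lemma sum_EG v i (F : nat -> B) : (i < vwt v)%N -> rho (gV v) ** F i = F i ->
  \sum_(e <- out v) rho (gE e i) ** \sum_(k < vwt v) rho (gG e k) ** F k = F i.
Proof.
move=> hi Fi; transitivity (\sum_(k < vwt v) rho (\sum_(e <- out v) gE e i ** gG
  e k) ** F k).
  under eq_bigr do rewrite nmul_sumr.
  rewrite exchange_big; apply: eq_bigr => k _; rewrite raddf_sum nmul_suml.
  by apply: eq_bigr => e _; rewrite /= nuhomM nmulA.
rewrite (bigD1 (Ordinal hi))//= g_sum// eqxx Fi big1 ?addr0// => k ki.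
by rewrite g_sum// eq_sym -[Ordinal hi]/(Ordinal hi) -val_eqE /= in ki *;
  rewrite (negbTE ki) raddf0 nmul0l.
Qed.
Lemma sum_EG' v i (F : nat -> B) : (i < vwt v)%N -> F i ** rho (gV v) = F i ->
  \sum_(e <- out v) (\sum_(k < vwt v) F k ** rho (gE e k)) ** rho (gG e i) = F
    i.
Proof.
move=> hi Fi; transitivity (\sum_(k < vwt v) F k ** rho (\sum_(e <- out v) gE e
  k ** gG e i)).
  under eq_bigr do rewrite nmul_suml.
  rewrite exchange_big; apply: eq_bigr => k _; rewrite raddf_sum nmul_sumr.
  by apply: eq_bigr => e _; rewrite /= nuhomM nmulA.
rewrite (bigD1 (Ordinal hi))//= g_sum// eqxx Fi big1 ?addr0// => k ki.
by rewrite g_sum// -val_eqE /= in ki *; rewrite (negbTE ki) raddf0 nmul0r.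
Qed.
Lemma sum_GE e (F : edge E -> B) : rho (gV (rng e)) ** F e = F e ->
  \sum_(k < vwt (src e)) rho (gG e k) ** \sum_(f <- out (src e)) rho (gE f k) **
    F f = F e.
Proof.
move=> Fe; transitivity (\sum_(f <- out (src e)) rho (\sum_(k < vwt (src e)) gG
  e k ** gE f k) ** F f).
  under eq_bigr do rewrite nmul_sumr.
  rewrite exchange_big; apply: eq_bigr => f _; rewrite raddf_sum nmul_suml.
  by apply: eq_bigr => k _; rewrite /= nuhomM nmulA.
have eo : e \in out (src e) by rewrite in_out.
rewrite (bigD1_seq e) ?fset_uniq//= g_dual// eqxx Fe big1_seq ?addr0// =>
  f /andP[fe].
by rewrite in_out => /eqP fs; rewrite g_dual// eq_sym (negbTE fe) raddf0 nmul0l.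
Qed.
Lemma sum_GE' e (F : edge E -> B) : F e ** rho (gV (rng e)) = F e ->
  \sum_(k < vwt (src e)) (\sum_(f <- out (src e)) F f ** rho (gG f k)) ** rho
    (gE e k) = F e.
Proof.
move=> Fe; transitivity (\sum_(f <- out (src e)) F f ** rho (\sum_(k < vwt (src
  e)) gG f k ** gE e k)).
  under eq_bigr do rewrite nmul_suml.
  rewrite exchange_big; apply: eq_bigr => f _; rewrite raddf_sum nmul_sumr.
  by apply: eq_bigr => k _; rewrite /= nuhomM nmulA.
have eo : e \in out (src e) by rewrite in_out.
rewrite (bigD1_seq e) ?fset_uniq//= g_dual// eqxx Fe big1_seq ?addr0// =>
  f /andP[fe].
by rewrite in_out => /eqP fs; have := @g_dual K E f e fs; rewrite fs => ->;
  rewrite (negbTE fe) raddf0 nmul0r.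
Qed.

(* Entry (e, i) of X^* F X^*, where X is the matrix (e_i). *)
Definition GFG (F : edge E -> nat -> B) e i : B :=
  \sum_(k < vwt (src e)) rho (gG e k) ** \sum_(f <- out (src e)) F f k ** rho
    (gG f i).
Definition dE_defect e i : B :=
  if (wt e <= i)%N && (i < vwt (src e))%N then GFG d e i else 0.
(* X beta X for the defect beta: subtracting it from d makes the entries of
   X^* d X^* in the positions (e, i) with i >= w(e) vanish. *)
Definition dE e i : B := d e i -
  \sum_(f <- out (src e)) rho (gE f i) ** \sum_(k < vwt (src e)) dE_defect f k
    ** rho (gE e k).
Definition dG e i : B := - GFG dE e i.

Lemma N_GFG F e i : (forall f k, N (F f k)) -> N (GFG F e i).
Proof. by move=> NF; apply: Nsum => k _; apply: NMl; apply: Nsum => f _;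
  apply: NMr. Qed.
Lemma N_defect e i : N (dE_defect e i).
Proof. by rewrite /dE_defect; case: ifP => // _; apply: N_GFG. Qed.
Lemma N_dE e i : N (dE e i).
Proof.
apply: ND => //; apply: NN; apply: Nsum => f _; apply: NMl; apply: Nsum => k _.
by apply: NMr; apply: N_defect.
Qed.
Lemma N_dG e i : N (dG e i).
Proof. by apply: NN; apply: N_GFG; apply: N_dE. Qed.

Lemma src_dE e i : rho (gV (src e)) ** dE e i = dE e i.
Proof.
rewrite nmulBr src_d nmul_sumr; congr (_ - _); apply: eq_big_seq => f.
by rewrite in_out => /eqP fs; rewrite nmulA -nuhomM -fs gVE.
Qed.
Lemma dE_rng e i : dE e i ** rho (gV (rng e)) = dE e i.
Proof.
rewrite nmulBl d_rng nmul_suml; congr (_ - _); apply: eq_bigr => f _.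
rewrite -nmulA nmul_suml; congr (_ ** _); apply: eq_bigr => k _.
by rewrite -nmulA -nuhomM gEV.
Qed.
(** A nonzero summand of the correction would require wt e <= i < wt f <= k < wt e. *)
Lemma dE_out e i : (wt e <= i)%N -> dE e i = 0.
Proof.
move=> wi; rewrite /dE d_out// sub0r big1 ?oppr0// => f _.
case: (ltnP i (wt f)) => fi; last by rewrite gE_out// raddf0 nmul0l.
rewrite big1 ?nmul0r// => k _; rewrite /dE_defect.
case: (ltnP k (wt e)) => ek; last by rewrite gE_out// raddf0 nmul0r.
by rewrite [(wt f <= k)%N]leqNgt (ltn_trans ek (leq_ltn_trans wi fi)) nmul0l.
Qed.
Lemma rng_GFG F e i : rho (gV (rng e)) ** GFG F e i = GFG F e i.
Proof. by rewrite nmul_sumr; apply: eq_bigr => k _; rewrite nmulA -nuhomM gVG.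
  Qed.
Lemma GFG_src F e i : GFG F e i ** rho (gV (src e)) = GFG F e i.
Proof.
rewrite nmul_suml; apply: eq_bigr => k _; rewrite -nmulA nmul_suml;
  congr (_ ** _).
apply: eq_big_seq => f; rewrite in_out => /eqP fs.
by rewrite -nmulA -nuhomM; have := gGV K f i; rewrite fs => ->.
Qed.
(** X^* X beta X X^* = beta, so the correction subtracts exactly the unwanted entry of X^* d X^*. *)
Lemma dG_out e i : (wt e <= i)%N -> dG e i = 0.
Proof.
move=> wi; rewrite /dG; apply/eqP; rewrite oppr_eq0; apply/eqP.
case: (ltnP i (vwt (src e))) => vi; last first.
  rewrite /GFG big1// => k _; rewrite big1_seq ?nmul0r// => f /andP[_].
  rewrite in_out => /eqP fs; rewrite gG_out ?raddf0 ?nmul0r//.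
  by apply: leq_trans vi; apply: vwt_ge.
have dd : dE_defect e i = GFG d e i by rewrite /dE_defect wi vi.
have rd : rho (gV (rng e)) ** dE_defect e i = dE_defect e i by rewrite dd
  rng_GFG.
have dr : dE_defect e i ** rho (gV (src e)) = dE_defect e i by rewrite dd
  GFG_src.
rewrite /GFG.
transitivity (GFG d e i - \sum_(k < vwt (src e)) rho (gG e k) ** \sum_(f <- out
  (src e))
   (\sum_(g <- out (src e)) rho (gE g k) ** \sum_(l < vwt (src e)) dE_defect g l
     ** rho (gE f l)) ** rho (gG f i)).
  rewrite -sumrB; apply: eq_bigr => k _; rewrite -nmulBr -sumrB; congr (_ ** _).
  by apply: eq_big_seq => f; rewrite in_out => /eqP fs; rewrite -nmulBl /dE fs.
rewrite -dd; apply/eqP; rewrite subr_eq0; apply/eqP.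
transitivity (\sum_(k < vwt (src e)) rho (gG e k) ** \sum_(g <- out (src e))
   rho (gE g k) ** \sum_(f <- out (src e)) (\sum_(l < vwt (src e)) dE_defect g l
     ** rho (gE f l)) ** rho (gG f i)).
  rewrite (sum_GE (F := fun g => \sum_(f <- out (src e)) (\sum_(l < vwt (src e))
    dE_defect g l ** rho (gE f l)) ** rho (gG f i))).
    by rewrite (sum_EG' (F := fun l => dE_defect e l)).
  by rewrite (sum_EG' (F := fun l => dE_defect e l)).
apply: eq_bigr => k _; congr (_ ** _); under eq_bigr do rewrite nmul_sumr.
rewrite exchange_big; apply: eq_bigr => f _; rewrite nmul_suml.
by apply: eq_bigr => g _; rewrite nmulA.
Qed.

Definition psi_gen (x : LGen E) : B :=
  match x with
  | LVertex v => rho (gV v)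
  | LEdge e i => rho (gE e i) + dE e i
  | LGhost e i => rho (gG e i) + dG e i
  end.
Lemma psi_edge e i : algeval psi_gen (tedge K e i) = rho (gE e i) + dE e i.
Proof.
rewrite /tedge; case: insubP => [j _ <-//|]; rewrite -leqNgt => h.
by rewrite gE_out// dE_out// raddf0 addr0.
Qed.
Lemma psi_ghost e i : algeval psi_gen (tghost K e i) = rho (gG e i) + dG e i.
Proof.
rewrite /tghost; case: insubP => [j _ <-//|]; rewrite -leqNgt => h.
by rewrite gG_out// dG_out// raddf0 addr0.
Qed.
(** To first order the relations become X dG + dE X^* = 0 and X^* dE + dG X = 0, which hold for dG =
    - X^* dE X^*; products of two deformation terms vanish by [NN0]. *)
Lemma psi_rel t u : LRel t u -> algeval psi_gen t = algeval psi_gen u.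
Proof.
case=> {t u}.
- by move=> u v /=; rewrite -nuhomM gVV; case: eqP => // _; rewrite raddf0.
- by move=> e i; rewrite [LHS]/= psi_edge nmulDr src_dE -nuhomM gVE.
- by move=> e i; rewrite [LHS]/= psi_edge nmulDl dE_rng -nuhomM gEV.
- by move=> e i; rewrite [LHS]/= psi_ghost nmulDr -nuhomM gVG /dG nmulNr
    rng_GFG.
- by move=> e i; rewrite [LHS]/= psi_ghost nmulDl -nuhomM gGV /dG nmulNl
    GFG_src.
- move=> v i j; rewrite algeval_sum.
  transitivity (rho (if i == j then gV v else 0)); last by case: ifP => // _;
    rewrite raddf0.
  rewrite -val_eqE /= -g_sum// raddf_sum.
  transitivity (\sum_(e <- out v) rho (gE e i ** gG e j) +
     (\sum_(e <- out v) rho (gE e i) ** dG e j + \sum_(e <- out v) dE e i ** rho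
       (gG e j))).
    rewrite -!big_split; apply: eq_bigr => e _.
    rewrite [LHS]/= psi_edge psi_ghost /= nuhomM;
      have := NN0 (N_dE e i) (N_dG e j).
    by move: (dE e i) (dG e j) => x y xy; rewrite nmulDl !nmulDr xy addr0 addrA.
  rewrite [X in _ + X = _](_ : _ = 0) ?addr0//.
  rewrite -[X in _ + X](sum_EG (F := fun k => \sum_(f <- out v) dE f k ** rho
    (gG f j)) (ltn_ord i)); last first.
    rewrite nmul_sumr; apply: eq_big_seq => f; rewrite in_out => /eqP fs.
    by rewrite nmulA; have := src_dE f i; rewrite fs => ->.
  rewrite -big_split big1_seq// => e /andP[_]; rewrite in_out => /eqP ev /=.
  by rewrite /dG /GFG ev nmulNr addNr.
- move=> v e f ev fv; rewrite algeval_sum.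
  transitivity (rho (if e == f then gV (rng e) else 0));
    last by case: ifP => // _; rewrite raddf0.
  rewrite -g_dual ?ev// raddf_sum.
  transitivity (\sum_(k < vwt v) rho (gG e k ** gE f k) +
     (\sum_(k < vwt v) rho (gG e k) ** dE f k + \sum_(k < vwt v) dG e k ** rho
       (gE f k))).
    rewrite -!big_split; apply: eq_bigr => k _.
    rewrite [LHS]/= psi_edge psi_ghost /= nuhomM;
      have := NN0 (N_dG e k) (N_dE f k).
    by move: (dG e k) (dE f k) => x y xy; rewrite nmulDl !nmulDr xy addr0 addrA.
  rewrite [X in _ + X = _](_ : _ = 0) ?addr0//.
  transitivity (\sum_(k < vwt v) rho (gG e k) ** dE f k - \sum_(i < vwt v)
     (\sum_(g <- out v) (\sum_(k < vwt v) rho (gG e k) ** dE g k) ** rho (gG g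
       i)) ** rho (gE f i)).
    congr (_ + _); rewrite -sumrN; apply: eq_bigr => i _; rewrite -nmulNl;
      congr (_ ** _).
    rewrite /dG /GFG ev; congr (- _); under eq_bigr do rewrite nmul_sumr.
    rewrite exchange_big; apply: eq_bigr => g _; rewrite nmul_suml.
    by apply: eq_bigr => k _; rewrite nmulA.
  have := @sum_GE' f (fun g => \sum_(k < vwt v) rho (gG e k) ** dE g k).
  rewrite fv => ->; first exact: subrr.
  by rewrite nmul_suml; apply: eq_bigr => k _; rewrite -nmulA dE_rng.
Qed.
Definition psi : nuHom L B := alglift psi_rel.
Lemma psiV v : psi (gV v) = rho (gV v). Proof. exact: (alglift_pi psi_rel). Qed.
Lemma psiE e i : psi (gE e i) = rho (gE e i) + dE e i.
Proof. by rewrite -psi_edge; apply: (alglift_pi psi_rel). Qed.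
Lemma psiG e i : psi (gG e i) = rho (gG e i) + dG e i.
Proof. by rewrite -psi_ghost; apply: (alglift_pi psi_rel). Qed.
End SquareZero.

(** * Extension of the defect derivation *)

Section ExtendDerivation.
Variables (K : fieldType) (E : wgraph) (W : lmodType K).
Local Notation L := (wLPA K E).
Local Notation gV := (@gV K E).
Local Notation gE := (@gE K E).
Local Notation gG := (@gG K E).
Variables (act : nuHom L (lendo W)) (s : {linear L -> W}).
Hypothesis s_vertex : forall v x, s (gV v ** x) = act (gV v) (s x).
Variables (I : L -> Prop) (p : {linear L -> L}).
Hypothesis I_mul : forall l x, I x -> I (l ** x).
Hypothesis p_I : forall x, I (p x).
Hypothesis p_id : forall x, I x -> p x = x.
Variable Kr : W -> Prop.
Hypothesis Kr0 : Kr 0.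
Hypothesis KrD : forall x y, Kr x -> Kr y -> Kr (x + y).
Hypothesis KrN : forall x, Kr x -> Kr (- x).
Hypothesis Kr_act : forall l x, Kr x -> Kr (act l x).
Definition defect l x : W := act l (s x) - s (l ** x).
Hypothesis Kr_defect : forall l x, I x -> Kr (defect l x).
Implicit Types (v : vertex E) (e f : edge E) (l x y : L).

Lemma defectM l l' x : defect (l ** l') x = act l (defect l' x) + defect l (l'
  ** x).
Proof.
by rewrite /defect nuhomM lendoM lendo_rB nmulA addrA subrK.
Qed.
Lemma defectDl l l' x : defect (l + l') x = defect l x + defect l' x.
Proof. by rewrite /defect raddfD lendoD nmulDl raddfD opprD addrACA. Qed.
Lemma defectZl a l x : defect (a *: l) x = a *: defect l x.
Proof. by rewrite /defect linearZ lendoZ nmulZl linearZ scalerBr. Qed.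
Lemma defect0l x : defect 0 x = 0.
Proof. by rewrite /defect raddf0 lendo0 nmul0l raddf0 subrr. Qed.
Lemma defect_vertex v x : defect (gV v) x = 0.
Proof. by rewrite /defect s_vertex subrr. Qed.
Lemma defectDr l a x y : defect l (a *: x + y) = a *: defect l x + defect l y.
Proof.
rewrite /defect nmulDr nmulZr !(linearP s) lendo_rD lendo_rZ.
by rewrite scalerBr opprD addrACA.
Qed.
Lemma defect0r l : defect l 0 = 0.
Proof. by rewrite /defect nmul0r raddf0 lendo_r0 subrr. Qed.

(** A derivation D becomes a homomorphism through the triangular operators (m, x) |-> (l m + D_l x,
    l x); [rho] is the case D = 0, to be deformed. *)
Definition rho_fun l (z : W * L) : W * L := (act l z.1, l ** z.2).
Lemma rho_lin l : rho_fun l \in @is_lin K (W * L)%type.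
Proof.
rewrite inE => a x y; rewrite /rho_fun; congr (_, _).
  by rewrite /= lendo_rD lendo_rZ.
by rewrite /= nmulDr nmulZr.
Qed.
Definition rho_op l : lendo (W * L)%type := Lendo (rho_lin l).
Lemma rho_op_linear : linear rho_op.
Proof.
move=> a l l'; apply: lendo_ext => z; rewrite lendoD lendoZ; congr (_, _).
  by rewrite /= linearP.
by rewrite /= nmulDl nmulZl.
Qed.
HB.instance Definition _ := GRing.isLinear.Build K L (lendo (W * L)%type) *:%R
  rho_op rho_op_linear.
Lemma rho_opM : {morph (rho_op : {linear L -> lendo (W * L)%type}) : x y / x **
  y}.
Proof.
move=> x y; apply: lendo_ext => z; congr (_, _).
  by rewrite /= nuhomM.
by rewrite /= nmulA.
Qed.
Definition rho : nuHom L (lendo (W * L)%type) := NUHom rho_opM.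
Lemma rhoE l m x : rho l (m, x) = (act l m, l ** x). Proof. by []. Qed.

(** The retraction p extends the defect from I to L; the factor [gV (rng e)] in front of it makes
    [d_op_rng] hold. *)
Definition d_fun e i (z : W * L) : W * L := (defect (gE e i) (p (gV (rng e) **
  z.2)), 0).
Lemma d_lin e i : d_fun e i \in @is_lin K (W * L)%type.
Proof.
rewrite inE => a x y; rewrite /d_fun; congr (_, _);
  last by rewrite /= scaler0 addr0.
by rewrite [(_ + _).2]/= nmulDr nmulZr linearP defectDr.
Qed.
Definition d_op e i : lendo (W * L)%type := Lendo (d_lin e i).
Lemma d_opE e i m x : d_op e i (m, x) = (defect (gE e i) (p (gV (rng e) ** x)),
  0).
Proof. by []. Qed.
Lemma d_op_out e i : (wt e <= i)%N -> d_op e i = 0.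
Proof. by move=> h; apply: lendo_ext => -[m x]; rewrite d_opE gE_out// defect0l.
  Qed.
Lemma src_d_op e i : rho (gV (src e)) ** d_op e i = d_op e i.
Proof.
apply: lendo_ext => -[m x]; rewrite lendoM d_opE rhoE nmul0r; congr (_, _).
set y := p _; have := defectM (gV (src e)) (gE e i) y.
by rewrite gVE defect_vertex addr0.
Qed.
Lemma d_op_rng e i : d_op e i ** rho (gV (rng e)) = d_op e i.
Proof. by apply: lendo_ext => -[m x]; rewrite lendoM rhoE !d_opE nmulA gVid.
  Qed.
(** The strictly triangular operators with values in Kr; any two have product 0. *)
Definition Nil (b : lendo (W * L)%type) := forall m x,
  [/\ Kr (b (m, x)).1, (b (m, x)).2 = 0 & b (m, 0) = 0].
Lemma Nil0 : Nil 0. Proof. by []. Qed.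
Lemma NilD b c : Nil b -> Nil c -> Nil (b + c).
Proof.
move=> hb hc m x; have [b1 b2 b3] := hb m x; have [c1 c2 c3] := hc m x.
rewrite !lendoD b3 c3 addr0; split=> //; first exact: KrD.
by rewrite /= b2 c2 addr0.
Qed.
Lemma NilN b : Nil b -> Nil (- b).
Proof.
move=> hb m x; have [b1 b2 b3] := hb m x.
rewrite -scaleN1r !lendoZ b3 scaler0; split=> //; first by rewrite scaleN1r;
  apply: KrN.
by rewrite /= b2 scaler0.
Qed.
Lemma NilMl l b : Nil b -> Nil (rho l ** b).
Proof.
move=> hb m x; have [b1 b2 b3] := hb m x; rewrite !lendoM b3 lendo_r0;
  split=> //=.
  exact: Kr_act.
by rewrite b2 nmul0r.
Qed.
Lemma NilMr l b : Nil b -> Nil (b ** rho l).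
Proof.
move=> hb m x; rewrite !lendoM !rhoE nmul0r.
by have [b1 b2 _] := hb (act l m) (l ** x); have [_ _ b3] := hb (act l m) 0;
  split.
Qed.
Lemma NilNil b c : Nil b -> Nil c -> b ** c = 0.
Proof.
move=> hb hc; apply: lendo_ext => -[m x]; rewrite lendoM.
have [_ c2 _] := hc m x; rewrite [c _]surjective_pairing c2.
by have [_ _] := hb (c (m, x)).1 0.
Qed.
Lemma Nil_d e i : Nil (d_op e i).
Proof.
move=> m x; rewrite !d_opE; split=> //=; first exact: Kr_defect.
by rewrite nmul0r raddf0 defect0r.
Qed.
Definition ext_hom : nuHom L (lendo (W * L)%type) :=
  psi d_op_out src_d_op d_op_rng Nil0 NilD NilN NilMl NilMr NilNil Nil_d.

Lemma ext_Kr l m x : Kr (act l m - (ext_hom l (m, x)).1) /\ (ext_hom l (m,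
  x)).2 = l ** x.
Proof.
have triv b : Nil b -> forall l m x, Kr (act l m - ((rho l + b) (m, x)).1) /\
   ((rho l + b) (m, x)).2 = l ** x.
  move=> hb l' m' x'; have [b1 b2 _] := hb m' x'; rewrite lendoD /= b2 addr0;
    split=> //.
  by rewrite opprD addrA subrr add0r; apply: KrN.
elim/L_ind: l m x.
- move=> v m x; rewrite [ext_hom _]psiV -[rho _]addr0; exact: triv Nil0 _ _ _.
- move=> e i m x; rewrite [ext_hom _]psiE; apply: triv.
  by apply: N_dE; [apply: Nil0|apply: NilD|apply: NilN|apply: NilMl|apply:
    NilMr|apply: Nil_d].
- move=> e i m x; rewrite [ext_hom _]psiG; apply: triv.
  by apply: N_dG; [apply: Nil0|apply: NilD|apply: NilN|apply: NilMl|apply: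
    NilMr|apply: Nil_d].
- by move=> m x; rewrite !raddf0 !lendo0 nmul0l addr0.
- move=> l l' hl hl' m x; have [h1 h2] := hl m x; have [h1' h2'] := hl' m x.
  rewrite (raddfD act) (raddfD ext_hom) !lendoD nmulDl /= h2 h2'; split=> //.
  by rewrite opprD addrACA; apply: KrD.
- move=> a l hl m x; have [_ h2] := hl m x; have [h1 _] := hl (a *: m) (a *: x).
  rewrite (linearZZ act) (linearZZ ext_hom) !lendoZ nmulZl -h2; split=> //;
    move: h1.
  by rewrite (_ : (_ *: m, _) = a *: (m, x))// !lendo_rZ.
- move=> l l' hl hl' m x; have [h1' h2'] := hl' m x; rewrite !nuhomM !lendoM.
  have [h1 h2] := hl (ext_hom l' (m, x)).1 (ext_hom l' (m, x)).2.
  rewrite -surjective_pairing in h1 h2; rewrite h2 h2' nmulA; split=> //.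
  rewrite [X in Kr X](_ : _ = act l (act l' m - (ext_hom l' (m,
    x)).1) + (act l (ext_hom l' (m, x)).1 - (ext_hom l (ext_hom l' (m, x))).1)).
    by apply: KrD => //; apply: Kr_act.
  by rewrite lendo_rB addrA subrK.
Qed.
(** On I the deformation d is an honest derivation. Applied to X X^* = 1 it shows that d X^* is
    minus X times the defect of X^*, and X^* X = 1 removes the factor X. *)
Lemma GFG_d e i m x : I x -> (i < vwt (src e))%N ->
  GFG rho d_op e i (m, x) = (- defect (gG e i) x, 0).
Proof.
move=> Ix hi.
transitivity (\sum_(k < vwt (src e)) (act (gG e k) (\sum_(f <- out (src e))
  defect (gE f k) (gG f i ** x)), 0 : L)).
  rewrite lendo_sum; apply: eq_bigr => k _; rewrite lendoM lendo_sum.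
  rewrite (eq_bigr (fun f => (defect (gE f k) (gG f i ** x), 0))); last first.
    by move=> f _; rewrite lendoM rhoE d_opE nmulA gVG p_id//; apply: I_mul.
  rewrite (_ : \sum_(f <- _) _ = (\sum_(f <- out (src e)) defect (gE f k) (gG f
    i ** x), 0)).
    by rewrite rhoE nmul0r.
  by elim/big_rec2: _ => [//|f y1 y2 _ ->]; congr (_, _); rewrite /= addr0.
transitivity (\sum_(k < vwt (src e)) act (gG e k) (\sum_(f <- out (src e))
  defect (gE f k) (gG f i ** x)), 0 : L).
  by elim/big_rec2: _ => [//|f y1 y2 _ ->]; congr (_, _); rewrite /= addr0.
congr (_, _).
transitivity (- \sum_(f <- out (src e)) act (\sum_(k < vwt (src e)) gG e k ** gE
  f k) (defect (gG f i) x)).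
  transitivity (\sum_(k < vwt (src e)) - \sum_(f <- out (src e)) act (gG e k **
    gE f k) (defect (gG f i) x)).
    apply: eq_bigr => k _; pose b := \sum_(f <- out (src e)) act (gE f k)
      (defect (gG f i) x).
    have ab : \sum_(f <- out (src e)) defect (gE f k) (gG f i ** x) + b = 0.
      rewrite -big_split; transitivity (defect (\sum_(f <- out (src e)) gE f k
        ** gG f i) x).
        rewrite (big_morph (fun l => defect l x) (fun l l' =>
          defectDl l l' x) (defect0l x)).
        by apply: eq_bigr => f _; rewrite defectM addrC.
      by rewrite g_sum//; case: ifP => _; rewrite ?defect_vertex ?defect0l.
    rewrite (_ : \sum_(f <- _) _ = - b); last by apply/eqP;
      rewrite -addr_eq0 ab.
    rewrite lendo_rN lendo_rsum; congr (- _).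
    by apply: eq_bigr => f _; rewrite nuhomM lendoM.
  rewrite sumrN exchange_big; congr (- _); apply: eq_bigr => f _.
  by rewrite raddf_sum lendo_sum.
congr (- _).
rewrite (bigD1_seq e) ?fset_uniq ?in_out//= g_dual// eqxx big1_seq ?addr0.
  by have := defectM (gV (rng e)) (gG e i) x; rewrite gVG defect_vertex addr0 =>
    <-.
move=> f /andP[fe]; rewrite in_out => /eqP fs.
by rewrite g_dual// eq_sym (negbTE fe) raddf0 lendo0.
Qed.
(** In the corrected positions e_i^* is 0 and so is its defect; thus on I nothing is corrected and
    the extension restricts to the given derivation. *)
Lemma dE_defect_I e i m x : I x -> dE_defect rho d_op e i (m, x) = 0.
Proof.
move=> Ix; rewrite /dE_defect; case: ifP => [/andP[wi vi]|//].
by rewrite GFG_d// gG_out// defect0l oppr0.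
Qed.
Lemma dE_I e i m x : I x -> dE rho d_op e i (m, x) = (defect (gE e i) x, 0).
Proof.
move=> Ix; rewrite (_ : dE rho d_op e i (m, x) = d_op e i (m, x)).
  rewrite d_opE p_id; last exact: I_mul.
  by have := defectM (gE e i) (gV (rng e)) x; rewrite gEV defect_vertex lendo_r0
    add0r => <-.
rewrite /dE lendoD -[RHS]addr0; congr (_ + _).
rewrite -scaleN1r lendoZ lendo_sum big1 ?scaler0// => f _.
rewrite lendoM lendo_sum big1 ?lendo_r0// => k _.
by rewrite lendoM rhoE dE_defect_I//; apply: I_mul.
Qed.
Lemma dG_I e i m x : I x -> dG rho d_op e i (m, x) = (defect (gG e i) x, 0).
Proof.
move=> Ix; case: (ltnP i (wt e)) => wi; last first.
  have -> : dG rho d_op e i = 0 by apply: dG_out.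
  by rewrite gG_out// defect0l.
have vi : (i < vwt (src e))%N by apply: leq_trans wi _; apply: vwt_ge.
rewrite /dG -scaleN1r lendoZ (_ : GFG rho (dE rho d_op) e i (m,
  x) = GFG rho d_op e i (m, x)).
  by rewrite GFG_d// scaleN1r; congr (_, _); [apply: opprK|apply: oppr0].
rewrite !lendo_sum; apply: eq_bigr => k _; rewrite !lendoM !lendo_sum;
  congr (_ _).
apply: eq_bigr => f _; rewrite !lendoM rhoE dE_I; last exact: I_mul.
by rewrite d_opE nmulA gVG p_id//; apply: I_mul.
Qed.
Lemma ext_I l m x : I x -> ext_hom l (m, x) = (act l m + defect l x, l ** x).
Proof.
elim/L_ind: l m x.
- by move=> v m x Ix; rewrite [ext_hom _]psiV rhoE defect_vertex addr0.
- move=> e i m x Ix; rewrite [ext_hom _]psiE lendoD dE_I// rhoE; congr (_, _).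
  exact: addr0.
- move=> e i m x Ix; rewrite [ext_hom _]psiG lendoD dG_I// rhoE; congr (_, _).
  exact: addr0.
- by move=> m x _; rewrite !raddf0 !lendo0 nmul0l defect0l addr0.
- move=> l l' hl hl' m x Ix; rewrite (raddfD ext_hom) (raddfD act) !lendoD hl//
    hl'//.
  by rewrite defectDl nmulDl addrACA.
- move=> a l hl m x Ix; rewrite (linearZZ ext_hom) (linearZZ act) !lendoZ hl//.
  by rewrite defectZl nmulZl -scalerDr.
- move=> l l' hl hl' m x Ix; rewrite !nuhomM !lendoM hl'// hl;
    last exact: I_mul.
  by rewrite defectM lendo_rD; congr (_, _); [apply/esym/addrA|apply: nmulA].
Qed.

Variable one : L.
Hypothesis mul_one : forall x, x ** one = x.
(** With D the extended derivation this is s(x) + D_x(1). For x in I one has D_{lx}(1) = l D_x(1) +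
    l s(x) - s(lx), which makes the sum L-linear on I. *)
Definition split_map x : W := s x + (ext_hom x (0, one)).1.
Lemma split_mapD x y : split_map (x + y) = split_map x + split_map y.
Proof. by rewrite /split_map (raddfD s) (raddfD ext_hom) lendoD addrACA. Qed.
Lemma split_mapM l x : I x -> split_map (l ** x) = act l (split_map x).
Proof.
move=> Ix; rewrite /split_map nuhomM lendoM.
have -> : ext_hom x (0, one) = ((ext_hom x (0, one)).1, x).
  by have [_ h] := ext_Kr x 0 one; rewrite mul_one in h;
    rewrite {1}[ext_hom x _]surjective_pairing h.
rewrite ext_I// lendo_rD; rewrite [_.1]/= /defect.
by rewrite addrA [s _ + _]addrC -addrA (addrC (s _)) subrK addrC.
Qed.
Lemma split_map_Kr x : Kr (split_map x - s x).
Proof.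
rewrite /split_map addrAC subrr add0r.
by have [h _] := ext_Kr x 0 one; have := KrN h; rewrite lendo_r0 sub0r opprK.
Qed.
End ExtendDerivation.

(* The ring R is a copy of L_K(E, w), or of its converse: this treats left and
   right ideals at once. *)
Section Hereditary.
Variables (K : fieldType) (E : wgraph) (finE : finite_wgraph E).
Local Notation L := (wLPA K E).
Local Notation gV := (@gV K E).
Local Notation one := (wLPA_one K E).
Variables (R : pzRingType) (j : L -> R) (j' : R -> L).
Hypothesis jK : cancel j j'.
Hypothesis j'K : cancel j' j.
Hypothesis jD : forall x y, j (x + y) = j x + j y.
Hypothesis jM : forall x y, j (x ** y) = j x * j y.
Hypothesis j1 : j one = 1.

Lemma one_mul x : one ** x = x. Proof. exact: (wLPA_oneP K finE).1. Qed.
Lemma mul_one x : x ** one = x. Proof. exact: (wLPA_oneP K finE).2. Qed.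
Lemma j'D a b : j' (a + b) = j' a + j' b.
Proof. by rewrite -{1}(j'K a) -{1}(j'K b) -jD jK. Qed.
Lemma j'M a b : j' (a * b) = j' a ** j' b.
Proof. by rewrite -{1}(j'K a) -{1}(j'K b) -jM jK. Qed.
Lemma j_sum J (r : seq J) (F : J -> L) : j (\sum_(i <- r) F i) = \sum_(i <- r) j
  (F i).
Proof.
have j0 : j 0 = 0 by apply: (addrI (j 0)); rewrite -jD !addr0.
exact: (big_morph j jD j0).
Qed.

Definition restr (M : lmodType R) : Type := M.
HB.instance Definition _ M := GRing.Zmodule.on (restr M).
Section Restriction.
Variable M : lmodType R.
Definition restr_scale (a : K) (m : restr M) : restr M :=
  j (a *: one) *: (m : M).
Lemma restr_scaleA a b m : restr_scale a (restr_scale b m) = restr_scale (a * b)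
  m.
Proof. by rewrite /restr_scale scalerA -jM nmulZl nmulZr one_mul scalerA. Qed.
Lemma restr_scale1 : left_id 1 restr_scale.
Proof. by move=> m; rewrite /restr_scale scale1r j1 scale1r. Qed.
Lemma restr_scaleDr : right_distributive restr_scale +%R.
Proof. by move=> a m n; apply: scalerDr. Qed.
Lemma restr_scaleDl m : {morph restr_scale^~ m : a b / a + b}.
Proof. by move=> a b; rewrite /restr_scale scalerDl jD [LHS]scalerDl. Qed.
HB.instance Definition _ := GRing.Zmodule_isLmodule.Build K (restr M)
  restr_scaleA restr_scale1 restr_scaleDr restr_scaleDl.

Definition act_fun (l : L) (m : restr M) : restr M := j l *: (m : M).
Lemma act_lin l : act_fun l \in @is_lin K (restr M).
Proof.
rewrite inE => a m n; rewrite /act_fun [LHS]scalerDr; congr (_ + _).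
rewrite [a *: m](_ : _ = j (a *: one) *: (m : M))// [RHS](_ : _ = j (a *: one)
  *: (j l *: (m : M)))//.
by rewrite !scalerA -!jM nmulZr nmulZl one_mul mul_one.
Qed.
Definition act_op l : lendo (restr M) := Lendo (act_lin l).
Lemma act_opE l m : act_op l m = j l *: (m : M). Proof. by []. Qed.
Lemma act_op_linear : linear act_op.
Proof.
move=> a l l'; apply: lendo_ext => m; rewrite lendoD lendoZ !act_opE jD
  [LHS]scalerDl.
congr (_ + _); rewrite [RHS](_ : _ = j (a *: one) *: (j l *: (m : M)))// scalerA
  -jM.
by rewrite nmulZl one_mul.
Qed.
HB.instance Definition _ := GRing.isLinear.Build K L (lendo (restr M)) *:%R
  act_op act_op_linear.
Lemma act_opM : {morph (act_op : {linear L -> lendo (restr M)}) : x y / x ** y}.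
Proof.
move=> x y; apply: lendo_ext => m; transitivity (j (x ** y) *: (m : M));
  first by [].
by rewrite jM -scalerA.
Qed.
Definition act : nuHom L (lendo (restr M)) := NUHom act_opM.
Lemma actE l m : act l m = j l *: (m : M). Proof. by []. Qed.
End Restriction.

Lemma restr_linear (M N : lmodType R) (g : {linear M -> N}) :
  linear (g : restr M -> restr N).
Proof.
move=> a x y; rewrite raddfD; congr (_ + _).
by transitivity (g (j (a *: one) *: (x : M))); [|rewrite linearZ].
Qed.

Theorem hereditary_of_iso : left_hereditary R.
Proof.
move=> I M N g f gs.
pose gK : {linear restr M -> restr N} :=
  HB.pack (g : restr M -> restr N) (GRing.isLinear.Build _ _ _ _ (g : restr M ->
    restr N) (restr_linear g)).
have gKE x : gK x = g x by [].
have g_act l (m : restr M) : g (act M l m) = j l *: (g m : N) by rewrite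
  -linearZ.
have [sig sigK] : exists s : {linear restr N -> restr M}, forall y,
  gK (s y) = y.
  exact: section_exists.
pose I' x := (j x : R^o) \in I.
have ImulR (a x : R) : (x : R^o) \in I -> (a * x : R^o) \in I by move=> xI;
  apply: (@rpredZ _ _ I a (x : R^o)).
have I_mul l x : I' x -> I' (l ** x) by move=> xI; rewrite /I' jM; apply: ImulR.
have sI : subspace I'.
  move=> a x y xI yI; rewrite /I' jD; apply: (rpredD (S := I)) => //.
  by rewrite -[a *: x](_ : (a *: one) ** x = _);
    [apply: I_mul|rewrite nmulZl one_mul].
have I0 : I' 0.
  by rewrite /I' (_ : j 0 = 0); [apply: (rpred0 I)|apply: (addrI (j 0));
    rewrite -jD !addr0].
have [p [pI pid]] := retraction_exists sI I0.
(* The retraction p extends f linearly over K from I to all of L. *)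
pose F x : restr N := f (@LeftIdeal R I (j (p x)) (pI x)).
have F_of x (u : left_ideal I) : I' x -> j x = val u -> F x = f u.
  by move=> xI xu; congr (f _); apply: val_inj; rewrite /= pid.
have F_lin : linear F.
  move=> a x y; pose u : left_ideal I := j (a *: one) *: LeftIdeal (pI x) +
    LeftIdeal (pI y).
  transitivity (f u : restr N); last by rewrite raddfD /= linearZ.
  congr (f _); apply: val_inj.
  rewrite /= linearP jD; congr (_ + _); rewrite -[a *: p x](_ : (a *: one) ** p
    x = _) ?jM//.
  by rewrite nmulZl one_mul.
have F_mul l x : I' x -> F (l ** x) = j l *: (F x : N).
  move=> xI; pose u : left_ideal I := LeftIdeal xI.
  rewrite (F_of _ (j l *: u)); [|exact: I_mul|exact: jM].
  by rewrite (F_of x u)// linearZ.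
pose s0 : {linear L -> restr M} := sig \o (HB.pack F (GRing.isLinear.Build _ _ _
  _ F F_lin) : {linear L -> restr N}).
have s0E x : s0 x = sig (F x) by [].
clearbody s0; pose vs := fset_set [set: vertex E].
have inV v : v \in vs by rewrite in_fset_set ?inE//; exact: finE.1.
(* Summing v s0(v x) over the finitely many vertices v makes the lift commute with vertices, so that
   the defect vanishes on them. *)
pose s x := \sum_(v <- vs) act M (gV v) (s0 (gV v ** x)).
have s_lin : linear s.
  move=> a x y; rewrite scaler_sumr -big_split; apply: eq_bigr => v _.
  by rewrite nmulDr nmulZr linearP lendo_rD lendo_rZ.
pose sL : {linear L -> restr M} := HB.pack s (GRing.isLinear.Build _ _ _ _ s
  s_lin).
have s_vertex v x : sL (gV v ** x) = act M (gV v) (sL x).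
  transitivity (act M (gV v) (s0 (gV v ** x))).
    rewrite [LHS](bigD1_seq v) ?fset_uniq//= nmulA gVid big1 ?addr0// => w wv.
    by rewrite nmulA gVV (negbTE wv) nmul0l raddf0;
      exact: (lendo_r0 (act M (gV w))).
  transitivity (\sum_(w <- vs) act M (gV v ** gV w) (s0 (gV w ** x)));
    last first.
    by rewrite lendo_rsum; apply: eq_bigr => w _; rewrite nuhomM lendoM.
  rewrite (bigD1_seq v) ?fset_uniq// gVid big1; first by rewrite [RHS]addr0.
  move=> w wv.
  by rewrite gVV eq_sym (negbTE wv) raddf0 lendo0.
have gs_F x : I' x -> g (sL x) = F x.
  move=> xI; rewrite raddf_sum.
  transitivity (\sum_(v <- vs) j (gV v) *: (F x : N)).
    apply: eq_bigr => v _; rewrite [LHS]g_act s0E; have := sigK (F (gV v ** x));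
      rewrite gKE => ->.
    by rewrite F_mul// scalerA -jM gVid.
  rewrite -scaler_suml -j_sum; transitivity (j (wLPA_one K E) *: (F x : N));
    first by [].
  by rewrite j1; apply: scale1r.
have Kr_act l (x : restr M) : g x = 0 -> g (act M l x) = 0 by move=> gx;
  rewrite g_act gx scaler0.
have Kr_defect l x : I' x -> g (defect (act M) sL l x) = 0.
  move=> xI; rewrite /defect raddfB /= [X in X - _]g_act !gs_F//;
    last exact: I_mul.
  by rewrite F_mul// subrr.
have KrD (x y : restr M) : g x = 0 -> g y = 0 -> g (x + y) = 0 by move=> gx gy;
  rewrite raddfD /= gx gy addr0.
have KrN (x : restr M) : g x = 0 -> g (- x) = 0 by move=> gx;
  rewrite raddfN /= gx oppr0.
have Kr0 : g (0 : restr M) = 0 by apply: raddf0.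
pose T := split_map s_vertex pI (Kr := fun m : restr M =>
  g m = 0) Kr0 KrD KrN Kr_act Kr_defect one.
have TD x y : T (x + y) = T x + T y by exact: split_mapD.
have TM l x : I' x -> T (l ** x) = act M l (T x) by move=> xI;
  exact: (@split_mapM _ _ _ _ _ s_vertex _ _ I_mul pI pid (fun m : restr M =>
    g m = 0) _ _ _ _ _ _ mul_one).
have Tg x : g (T x) = g (sL x).
  by apply/eqP; rewrite -subr_eq0 -raddfB; apply/eqP;
    exact: (@split_map_Kr _ _ _ _ _ s_vertex _ _ pI (fun m : restr M =>
    g m = 0)).
clearbody T; pose h (u : left_ideal I) : M := T (j' (val u)).
have uI (u : left_ideal I) : I' (j' (val u)) by rewrite /I' j'K; apply: valP.
have h_lin : linear h.
  move=> a u u'.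
  have -> : h (a *: u + u') = T (j' a ** j' (val u) + j' (val u')).
    by rewrite -j'M -j'D.
  by rewrite TD TM// actE j'K.
pose hL : {linear left_ideal I -> M} := HB.pack h (GRing.isLinear.Build _ _ _ _
  h h_lin).
exists hL => u.
transitivity (g (T (j' (val u)))); first by [].
by rewrite Tg gs_F//; apply: F_of => //; rewrite j'K.
Qed.
End Hereditary.

(** * The involution exchanging e_i and e_i^* *)

Section OppositeAlgebra.
Variables (K : comPzRingType) (A : nuAlgType K).
Definition oppAlg : Type := A.
HB.instance Definition _ := GRing.Lmodule.on oppAlg.
Definition opp_mul (x y : oppAlg) : oppAlg := (y : A) ** (x : A).
Lemma opp_mulA : associative opp_mul.
Proof. by move=> x y z; rewrite /opp_mul nmulA. Qed.
Lemma opp_mulDl : left_distributive opp_mul +%R.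
Proof. by move=> x y z; apply: nmulDr. Qed.
Lemma opp_mulDr : right_distributive opp_mul +%R.
Proof. by move=> x y z; apply: nmulDl. Qed.
Lemma opp_mulZl (a : K) x y : opp_mul (a *: x) y = a *: opp_mul x y.
Proof. exact: nmulZr. Qed.
Lemma opp_mulZr (a : K) x y : opp_mul x (a *: y) = a *: opp_mul x y.
Proof. exact: nmulZl. Qed.
HB.instance Definition _ := Lmodule_isNUAlgebra.Build K oppAlg
  opp_mulA opp_mulDl opp_mulDr opp_mulZl opp_mulZr.
Lemma opp_mulE (x y : oppAlg) : x ** y = (y : A) ** (x : A) :> A. Proof. by [].
  Qed.
End OppositeAlgebra.

Section Involution.
Variables (K : fieldType) (E : wgraph).
Local Notation L := (wLPA K E).
Local Notation gV := (@gV K E).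
Local Notation gE := (@gE K E).
Local Notation gG := (@gG K E).

Definition star_gen (x : LGen E) : oppAlg L :=
  match x with LVertex v => gV v | LEdge e i => gG e i | LGhost e i =>
    gE e i end.
Lemma star_edge e i : algeval star_gen (tedge K e i) = gG e i.
Proof.
rewrite /tedge; case: insubP => [j _ <-//|]; rewrite -leqNgt => h.
by rewrite gG_out.
Qed.
Lemma star_ghost e i : algeval star_gen (tghost K e i) = gE e i.
Proof.
rewrite /tghost; case: insubP => [j _ <-//|]; rewrite -leqNgt => h.
by rewrite gE_out.
Qed.
(** Reversing products maps (iii) to itself with i and j exchanged, and (iv) to itself with e and f
    exchanged. *)
Lemma star_rel t u : LRel t u -> algeval star_gen t = algeval star_gen u.
Proof.
case=> {t u}.
- by move=> u v; rewrite [LHS]gVV eq_sym; case: eqP => [->|].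
- by move=> e i; rewrite [LHS]/= star_edge [LHS]opp_mulE gGV.
- by move=> e i; rewrite [LHS]/= star_edge [LHS]opp_mulE gVG.
- by move=> e i; rewrite [LHS]/= star_ghost [LHS]opp_mulE gEV.
- by move=> e i; rewrite [LHS]/= star_ghost [LHS]opp_mulE gVE.
- move=> v i j; rewrite algeval_sum; transitivity (\sum_(e <- out v) gE e j **
    gG e i).
    by apply: eq_bigr => e _; rewrite [LHS]/= star_edge star_ghost.
  by rewrite g_sum// eq_sym val_eqE; case: ifP.
- move=> v e f ev fv; rewrite algeval_sum; transitivity (\sum_(i < vwt (src f))
    gG f i ** gE e i).
    by rewrite fv; apply: eq_bigr => i _; rewrite [LHS]/= star_edge star_ghost.
  by rewrite g_dual ?ev// eq_sym; case: eqP => [->|].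
Qed.
Definition star_hom : nuHom L (oppAlg L) := alglift star_rel.
Definition star (x : L) : L := star_hom x.
Lemma starV v : star (gV v) = gV v. Proof. exact: (alglift_pi star_rel). Qed.
Lemma starE e i : star (gE e i) = gG e i.
Proof. by rewrite -star_edge; apply: (alglift_pi star_rel). Qed.
Lemma starG e i : star (gG e i) = gE e i.
Proof. by rewrite -star_ghost; apply: (alglift_pi star_rel). Qed.
Lemma starD x y : star (x + y) = star x + star y. Proof. exact: raddfD. Qed.
Lemma starZ a x : star (a *: x) = a *: star x. Proof.
  exact: (linearZZ star_hom). Qed.
Lemma starM x y : star (x ** y) = star y ** star x. Proof.
  exact: (nuhomM star_hom). Qed.
Lemma star0 : star 0 = 0. Proof. exact: (raddf0 star_hom). Qed.
Lemma starK : involutive star.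
Proof.
move=> x; elim/L_ind: x.
- by move=> v; rewrite !starV.
- by move=> e i; rewrite starE starG.
- by move=> e i; rewrite starG starE.
- by rewrite !star0.
- by move=> x y hx hy; rewrite !starD hx hy.
- by move=> a x hx; rewrite !starZ hx.
- by move=> x y hx hy; rewrite !starM hx hy.
Qed.
End Involution.

Theorem theorem14 (K : fieldType) :
  nat_isomorphic (comp_functor (Vfunctor K) (Lfunctor K)) Mfunctor /\
  (forall (E : wgraph) (finE : finite_wgraph E),
     left_hereditary (wLPA_ring K finE) /\
     right_hereditary (wLPA_ring K finE)).
Proof.
split; first exact: VL_iso_M.
move=> E finE; split.
  by apply: (@hereditary_of_iso K E finE (wLPA_ring K finE) id id).
(* The involution identifies L with its converse ring, which turns right ideals into left ideals. *)
apply: (@hereditary_of_iso K E finE (wLPA_ring K finE)^c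
  (@star K E) (@star K E)).
- exact: starK.
- exact: starK.
- by move=> x y; apply: starD.
- by move=> x y; apply: starM.
- transitivity (\sum_(v <- fset_set [set: vertex E]) @gV K E v); last by [].
  rewrite (big_morph _ (@starD K E) (@star0 K E)).
  by apply: eq_bigr => v _; apply: starV.
Qed.
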